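(* For a sequence $(\mathcal C_n)_{n\ge 1}$ of (distributions of) random compositions, with $\mathcal C_n$ a random composition of $n$, the following two conditions are equivalent: (i) $(\mathcal C_n)$ is both uniform-consistent and right-consistent. (ii) $(\mathcal C_n)$ can be derived by uniform sampling from $S\cap[0,1]$ for some self-similar random closed subset $S$ of $\mathbb R_+=[0,\infty[$. When these conditions hold, a strong right-consistent version of $(\mathcal C_n)$ can be constructed as follows: independently of $S$, let $\epsilon_1<\epsilon_2<\cdots$ be the atoms of a homogeneous Poisson point process on $\mathbb R_+$, and let the binary representation of $\mathcal C_n$ be the first $n$ digits of the sequence $(\xi_j)_{j\ge1}$ defined by $\xi_1=1$ and, for $j>1$, $$\xi_j=1\big([\epsilon_{j-1},\epsilon_j]\cap S\neq\emptyset\big),$$ where $1(\cdot)$ denotes the indicator of an event.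
   Context: A composition of $n$ is a sequence $\lambda=(\lambda_1,\dots,\lambda_\ell)$ of positive integers (parts) with sum $n$. In balls-in-boxes form it is a row of $n$ identical balls, in places $1,\dots,n$ from left to right, distributed in $\ell$ consecutive boxes, the $i$th box from the left containing $\lambda_i$ balls. In binary form it is the string of $n$ binary digits whose $j$th digit is $1$ if the $j$th ball is the leftmost ball of its box and $0$ otherwise (so the first digit is always $1$). A random composition of $n$ is a random variable with values in the set of compositions of $n$. Given random variables $Y_n\in\{1,\dots,n\}$, with $Y_n$ independent of $\mathcal C_n$, let $\mathcal C_n^-$ be the composition of $n-1$ obtained from $\mathcal C_n$ by deleting the ball in place $Y_n$ (a box which becomes empty disappears). $(\mathcal C_n)$ is $(Y_n)$-consistent if $\mathcal C_n^-$ has the same distribution as $\mathcal C_{n-1}$ for every $n\ge2$; it is uniform-consistent if this holds with $Y_n$ uniformly distributed on $\{1,\dots,n\}$, and right-consistent if this holds with $Y_n\equiv n$. These properties only concern the marginal distributions of the $\mathcal C_n$. A strong right-consistent version of $(\mathcal C_n)$ is a realisation, on one probability space, of random compositions with the given marginal distributions such that almost surely, for every $n\geq 2$, $\mathcal C_{n-1}$ is obtained from $\mathcal C_n$ by deleting its last (rightmost) ball. Uniform sampling from a random closed set $Z\subset[0,1]$: let $U_1,U_2,\dots$ be independent uniform $[0,1]$ variables independent of $Z$; let $U_i\sim U_j$ for $i\ne j$ iff $U_i,U_j$ fall in the same interval component of $[0,1]\setminus Z$ (so a $U_i\in Z$ forms a singleton class); $\mathcal C_n$ is the sequence of sizes of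 the equivalence classes among $U_1,\dots,U_n$, listed from left to right. The sequence $(\mathcal C_n)$ is derived by uniform sampling from $Z$ if, for each $n$, $\mathcal C_n$ has the distribution of the composition so constructed. (Convention: $1$ is included in $Z$ only if $1$ is not an isolated point of $Z$; this does not affect the composition.) A random closed subset $S\subset\mathbb R_+$ is self-similar if $S$ has the same distribution as $cS$ for all $c>0$. *)

(* Defs.v *)
From HB Require Import structures.
From mathcomp Require Import all_boot all_order all_algebra finmap.
From mathcomp Require Import all_classical all_reals all_analysis.

Set Implicit Arguments.
Unset Strict Implicit.
Unset Printing Implicit Defensive.

Import Order.TTheory GRing.Theory Num.Theory.
Import numFieldNormedType.Exports.

Local Open Scope classical_set_scope.
Local Open Scope ring_scope.

Definition is_composition (n : nat) (s : seq nat) : bool :=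
  (0%N \notin s) && (sumn s == n).

(* [composition 0] has the empty composition as its only element. *)
Record composition (n : nat) := Composition {
  parts :> seq nat;
  compositionP : is_composition n parts }.

HB.instance Definition _ n := [isSub for @parts n].
HB.instance Definition _ n := [Countable of composition n by <:].

Lemma trivial_is_composition n : is_composition n [seq m <- [:: n] | m != 0%N].
Proof. by case: n => [|n]; rewrite /is_composition//= addn0 eqxx. Qed.

HB.instance Definition _ n :=
  isPointed.Build (composition n) (Composition (trivial_is_composition n)).

HB.instance Definition _ n := @isMeasurable.Build default_measure_display
  (composition n) discrete_measurable discrete_measurable0
  discrete_measurableC discrete_measurableU.

Definition binary (s : seq nat) : bitseq :=
  flatten [seq true :: nseq m.-1 false | m <- s].

(* Deletes the ball that has exactly [y] balls on its left, i.e., the ball in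
   place [y.+1] when places are numbered from 1. *)
Fixpoint delete_seq (y : nat) (s : seq nat) : seq nat :=
  if s is m :: s' then
    if (y < m)%N then (if m == 1%N then s' else m.-1 :: s')
    else m :: delete_seq (y - m) s'
  else [::].

Lemma delete_is_composition n (c : composition n.+1) (y : 'I_n.+1) :
  is_composition n (delete_seq y c).
Proof.
suff H s : 0%N \notin s -> forall k, (k < sumn s)%N ->
    (0%N \notin delete_seq k s) /\ (sumn (delete_seq k s)).+1 = sumn s.
  have /andP[c0 /eqP cn] := compositionP c.
  have [|d0] := H _ c0 y; first by rewrite cn.
  by rewrite cn => -[/eqP]; rewrite /is_composition d0.
elim: s => [//|m s IH]; rewrite inE negb_or eq_sym -lt0n => /andP[m0 s0] k /=.
case: ifPn => [km _|]; last first.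
  rewrite -leqNgt => mk ks; have [|H0 H1] := IH s0 (k - m)%N.
    by rewrite ltn_subLR.
  by rewrite inE negb_or eq_sym -lt0n m0 H0/= -addnS H1.
case: ifPn => [/eqP ->|m1]; first by rewrite s0 add1n.
rewrite inE negb_or s0 andbT /= -addSn prednK// eq_sym -lt0n; split => //.
by case: m m0 m1 {km} => [|[]].
Qed.

Definition delete_ball n (c : composition n.+1) (y : 'I_n.+1) : composition n :=
  Composition (delete_is_composition c y).

HB.instance Definition _ n := isPointed.Build 'I_n.+1 ord0.

HB.instance Definition _ n := @isMeasurable.Build default_measure_display
  'I_n.+1 discrete_measurable discrete_measurable0
  discrete_measurableC discrete_measurableU.

Section uniform_place.
Context (R : realType) (n : nat).

Definition uniform_place : set 'I_n.+1 -> \bar R :=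
  mscale (n.+1%:R^-1)%:nng (@counting _ R).

HB.instance Definition _ := Measure.on uniform_place.

Lemma uniform_place_setT : uniform_place [set: 'I_n.+1] = 1%E.
Proof.
rewrite /uniform_place /mscale/= /counting asboolT; last exact: finite_finset.
suff -> : #|` fset_set [set: 'I_n.+1]| = n.+1 :> nat by rewrite -EFinM mulVf.
by apply: card_fset_set; apply: card_esym; exact: card_II.
Qed.

HB.instance Definition _ := @Measure_isProbability.Build _ _ R
  uniform_place uniform_place_setT.

End uniform_place.
Arguments uniform_place : clear implicits.

Section consistency.
Context (R : realType).
Implicit Types C : forall n, probability (composition n) R.

(* [Y n] is the law of the place of the ball deleted from a composition of
   [n.+1], places being numbered from 0; the product law makes this place
   independent of the composition. *)
Definition consistent C (Y : forall n, probability 'I_n.+1 R) :=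
  forall n, (0 < n)%N -> forall A : set (composition n),
    pushforward (C n.+1 \x Y n)%E (fun cy => delete_ball cy.1 cy.2) A = C n A.

Definition uniform_consistent C :=
  consistent C (fun n => uniform_place R n).

Definition right_consistent C :=
  consistent C (fun n => \d_(ord_max : 'I_n.+1)).

Definition strong_right_version C d (Omega : measurableType d)
    (P : probability Omega R) (X : forall n, Omega -> composition n) :=
  [/\ forall n, measurable_fun setT (X n),
      forall n, (0 < n)%N -> forall A, pushforward P (X n) A = C n A &
      {ae P, forall w, forall n, (0 < n)%N ->
        X n w = delete_ball (X n.+1 w) ord_max}].

End consistency.

Section probability.
Context (R : realType) d (Omega : measurableType d) (P : probability Omega R).

Definition same_law d' (Omega' : measurableType d') (P' : probability Omega' R)
    dT (T : measurableType dT) (X : {RV P >-> T}) (X' : {RV P' >-> T}) :=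
  forall A, measurable A -> distribution P X A = distribution P' X' A.

Definition independent_systems (F G : set (set Omega)) :=
  forall A B, F A -> G B -> P (A `&` B) = (P A * P B)%E.

Definition sigma_rvs dT (T : measurableType dT) (X : nat -> {RV P >-> T}) :=
  <<s \bigcup_i g_sigma_algebra_preimage (X i) >>.

Definition independent_of_seq dT (T : measurableType dT)
    dT' (T' : measurableType dT') (X : {RV P >-> T})
    (Y : nat -> {RV P >-> T'}) :=
  independent_systems (g_sigma_algebra_preimage X) (sigma_rvs Y).

Definition mutually_independent dT (T : measurableType dT)
    (X : nat -> {RV P >-> T}) :=
  forall (J : {fset nat}) (A : nat -> set T), (forall i, measurable (A i)) ->
    P (\bigcap_(i in [set` J]) (X i @^-1` A i)) =
    (\big[*%E/1%E]_(i <- J) P (X i @^-1` A i))%E.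

End probability.

Definition closed_subset (R : realType) (D : set R) :=
  {F : set R | closed F /\ F `<=` D}.

Definition cset (R : realType) (D : set R) (F : closed_subset D) : set R :=
  sval F.
Coercion cset : closed_subset >-> set.

HB.instance Definition _ (R : realType) (D : set R) :=
  gen_eqMixin (closed_subset D).
HB.instance Definition _ (R : realType) (D : set R) :=
  gen_choiceMixin (closed_subset D).
HB.instance Definition _ (R : realType) (D : set R) :=
  isPointed.Build (closed_subset D)
    (exist _ set0 (conj closed0 (@sub0set _ D))).

(* The events [F `&` K !=set0], K compact, generate the Borel sigma-algebra of the
   Fell topology on closed sets. *)
Definition hitting (R : realType) (D : set R) : set (set (closed_subset D)) :=
  [set [set F : closed_subset D | F `&` K !=set0] | K in @compact R].

HB.instance Definition _ (R : realType) (D : set R) :=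
  Measurable.copy (closed_subset D) (g_sigma_algebraType (@hitting R D)).

Section closed_subset_maps.
Context (R : realType).
Local Notation halfline := `[0%R : R, +oo[%classic.
Local Notation unit_itv := `[0%R : R, 1%R]%classic.

Lemma scale_subproof (c : {posnum R}) (F : closed_subset halfline) :
  closed ( *%R c%:num @` F) /\ *%R c%:num @` F `<=` halfline.
Proof.
case: F => F [cF F0] /=; split; last first.
  by move=> _ [x /F0 + <-]; rewrite /= !in_itv/= !andbT => x0; exact: mulr_ge0.
suff -> : *%R c%:num @` F = ( *%R c%:num^-1) @^-1` F.
  by apply: preimage_closed => // x _; exact: mulrl_continuous.
apply/seteqP; split=> [_ [x Fx <-]|x Fx] /=; first by rewrite mulKf.
by exists (c%:num^-1 * x) => //; rewrite mulVKf.
Qed.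

Definition scale (c : {posnum R}) (F : closed_subset halfline) :
    closed_subset halfline :=
  exist _ ( *%R c%:num @` F) (scale_subproof c F).

Lemma measurable_scale c : measurable_fun setT (scale c).
Proof.
apply: (measurability (@hitting R halfline)) => //.
move=> _ [_ [K cK <-] <-]; rewrite setTI; apply: sub_sigma_algebra.
exists ( *%R c%:num^-1 @` K).
  apply: continuous_compact => //; apply: continuous_subspaceT => x.
  exact: mulrl_continuous.
apply/seteqP; split=> F [x /= [Fx]].
  move=> [y Ky yx]; exists (c%:num * x); split; first by exists x.
  by rewrite -yx mulVKf.
move: Fx => [y Fy <-] Ky; exists y; split => //.
by exists (c%:num * y) => //; rewrite mulKf.
Qed.

HB.instance Definition _ c :=
  isMeasurableFun.Build _ _ _ _ (scale c) (measurable_scale c).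

Lemma restrict01_subproof (D : set R) (F : closed_subset D) :
  closed (F `&` unit_itv) /\ F `&` unit_itv `<=` unit_itv.
Proof.
split; last exact: subIsetr.
by apply: closedI; [case: F => F []|exact: interval_closed].
Qed.

Definition restrict01 (D : set R) (F : closed_subset D) :
    closed_subset unit_itv :=
  exist _ (F `&` unit_itv) (restrict01_subproof F).

Lemma measurable_restrict01 D : measurable_fun setT (@restrict01 D).
Proof.
apply: (measurability (@hitting R unit_itv)) => //.
move=> _ [_ [K cK <-] <-]; rewrite setTI; apply: sub_sigma_algebra.
exists (unit_itv `&` K); last by apply/seteqP; split=> F; rewrite /= setIA.
by rewrite setIC; apply: compact_closedI => //; exact: interval_closed.
Qed.

HB.instance Definition _ D :=
  isMeasurableFun.Build _ _ _ _ (@restrict01 D) (@measurable_restrict01 D).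

End closed_subset_maps.

Section sampling.
Context (R : realType) (Z : set R) (n : nat) (u : nat -> R).

(* Two points in the same interval component of the complement of [Z]; a point
   of [Z] has an empty component there, hence a singleton class. *)
Definition same_class : rel 'I_n := fun i j => (i == j) ||
  `[< connected_component (`[0, 1] `\` Z) (u i) (u j) >].

Definition sample_classes : {set {set 'I_n}} :=
  equivalence_partition same_class [set: 'I_n]%SET.

(* The default value 1 of the minimum is harmless for points of [0,1]; a point
   outside [0,1] (a null event under uniform sampling) is a singleton class. *)
Definition leftmost (B : {set 'I_n}) : R := \big[Num.min/1]_(i in B) u i.

(* Two distinct classes with the same leftmost point are both singletons, so
   that the result does not depend on how ties are broken. *)
Definition sample_sizes : seq nat :=
  [seq #|B : {set 'I_n}| |
    B <- sort (fun B B' => leftmost B <= leftmost B') (enum sample_classes)].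

Lemma sample_is_composition : is_composition n sample_sizes.
Proof.
have eqr : {in [set: 'I_n]%SET & &, equivalence_rel same_class}.
  move=> i j k _ _ _; rewrite /same_class eqxx; split=> // /orP[/eqP->//|].
  move=> /asboolP ij; apply/idP/idP => /orP[/eqP <-|/asboolP jk].
  - by apply/orP; right; apply/asboolP/connected_component_sym.
  - apply/orP; right; apply/asboolP; apply: connected_component_trans jk.
    exact: connected_component_sym.
  - by apply/orP; right; apply/asboolP.
  - by apply/orP; right; apply/asboolP; apply: connected_component_trans jk.
have parT := equivalence_partitionP eqr.
apply/andP; split.
  apply/negP => /mapP[B]; rewrite mem_sort mem_enum => PB /esym/eqP.
  rewrite cards_eq0 => /eqP B0; move: parT => /and3P[_ _ /negP]; apply.
  by rewrite -B0.
rewrite sumnE big_map (perm_big (enum sample_classes))/=; last first.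
  by rewrite perm_sort.
by rewrite big_enum/= -(card_partition parT) cardsT card_ord.
Qed.

Definition sample_composition : composition n :=
  Composition sample_is_composition.

End sampling.

Section derived.
Context (R : realType) (C : forall n, probability (composition n) R).

Definition uniform_sample d (Omega : measurableType d)
    (P : probability Omega R) (Z : {RV P >-> closed_subset `[0%R : R, 1%R]})
    (U : nat -> {RV P >-> R}) :=
  [/\ forall i A, measurable A ->
        distribution P (U i) A = uniform_prob (@ltr01 R) A,
      mutually_independent U &
      independent_of_seq Z U].

(* The given probability space need not carry a uniform sample, hence the copy
   [Z'] of [Z]; the property only depends on the law of [Z]. *)
Definition derived_from d (Omega : measurableType d) (P : probability Omega R)
    (Z : {RV P >-> closed_subset `[0%R : R, 1%R]}) :=
  exists d' (Omega' : measurableType d') (P' : probability Omega' R)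
    (Z' : {RV P' >-> closed_subset `[0%R : R, 1%R]}) (U : nat -> {RV P' >-> R}),
    [/\ same_law Z' Z, uniform_sample Z' U &
        forall n, (0 < n)%N -> forall A,
          pushforward P'
            (fun w => sample_composition (cset (Z' w)) n (fun i => U i w)) A = C n A].

End derived.

Section self_similar.
Context (R : realType) d (Omega : measurableType d) (P : probability Omega R).
Implicit Types (S : {RV P >-> closed_subset `[0%R : R, +oo[})
               (eps : nat -> {RV P >-> R}).

Definition self_similar S :=
  forall c : {posnum R}, same_law S (scale c \o S : {RV P >-> _}).

(* [eps] enumerates in increasing order the atoms of a Poisson point process on
   the half-line with intensity [rate] times the Lebesgue measure.  The argument
   [0%N] of [poisson_prob] is a dummy. *)
Definition poisson_atoms (rate : R) eps :=
  {ae P, forall w, 0 <= eps 0%N w /\ forall j, eps j w < eps j.+1 w} /\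
  forall m (B : 'I_m -> set R) (k : 'I_m -> nat),
    (forall i, [/\ measurable (B i), B i `<=` `[0, +oo[ &
                   (lebesgue_measure (B i) < +oo)%E]) ->
    trivIset setT B ->
    P [set w | forall i, ([set j | B i (eps j w)] #= `I_(k i))%card] =
    (\big[*%E/1%E]_(i < m)
      poisson_prob (rate * fine (lebesgue_measure (B i))) 0%N [set k i])%E.

(* Digits and atoms are numbered from 0: [eps k] is the (k+1)-st atom, and
   digit [k.+1] is the (k+2)-nd. *)
Definition digit S eps (w : Omega) (j : nat) : bool :=
  if j is k.+1 then `[< cset (S w) `&` `[eps k w, eps k.+1 w] !=set0 >] else true.

Definition poisson_construction (rate : R) S eps
    (X : forall n, Omega -> composition n) :=
  [/\ poisson_atoms rate eps, independent_of_seq S eps &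
      forall n w, binary (X n w) = mkseq (digit S eps w) n].

End self_similar.

(* Main.v *)
(* The law of a composition of [n] is determined by the probabilities that, for
   every pair of a list [D], two places lie in the same box.  For a sample from Z
   this means that Z avoids the closed gaps of D between ranked sample points.
   Cutting [0, 1] into K cells, the probability is the limit as K grows of an average,
   over the n-subsets A of {0, ..., K-1}, of the probability that Z avoids the
   gaps between the cells of A.  If S is self-similar, the mesh 1 / K may be
   replaced by 1, and this probability becomes a function of A only; both
   consistencies, and the law of the Poisson construction (whose atoms, given
   their number in [0, t], also form a uniform sample), then follow by counting
   subsets and letting t grow.

   Conversely, right-consistency provides an infinite sequence of digits; let
   D_c be the set of the positions of its ones, divided by c.  Averaging over
   geometrically growing c and passing to the limit along an ultrafilter yields
   a limit of the laws of D_c which is invariant under rational dilations.  The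
   limiting probabilities of hitting finitely many rational intervals are those
   of a sequence of random bits, and the complement of the union of those which
   are not hit is a self-similar random closed set S.  By uniform consistency C_n is
   the restriction of C_c to a uniform n-subset of its places, so the
   probability that D has unbroken pairs under C_n lies between the
   probabilities that S avoids the closed, resp. open, gaps of a sample.  These
   agree, as almost surely no sample point is a point of S isolated on
   one side. *)
Require Import Defs.
From HB Require Import structures.
From mathcomp Require Import all_boot all_order all_algebra finmap.
From mathcomp Require Import all_classical all_reals all_analysis.
From mathcomp Require Import measurable_realfun zify ring lra.

Set Implicit Arguments.
Unset Strict Implicit.
Unset Printing Implicit Defensive.

Import Order.TTheory GRing.Theory Num.Theory.
Import numFieldNormedType.Exports.

Local Open Scope classical_set_scope.
Local Open Scope ring_scope.

(** * Real-valued probabilities *)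

Section real_probability.
Context d (T : measurableType d) (R : realType) (P : probability T R).
Implicit Types A B N : set T.

(** Deleting a ball acts on lists of pairs only by renumbering places, and concatenating two lists
    intersects their events. Both consistencies thus become identities between numbers indexed by
    finite subsets.

    In the converse, a subsequential limit of the laws of D_c need not be invariant. The mean over
    c, c l, ..., c l^(N-1) changes by at most 1/N when c is replaced by l c; such means are nested
    for l = 1, ..., N, so invariance is built into the limit and uniform consistency is left to
    identify the samples. The ultrafilter gives one limit functional, additive on finite sums, for
    all events at once. Countable additivity is recovered by reading the rational hitting bits off
    nested intervals of [0, 1]. The limiting set function and the random set are then compared by
    two inequalities, one for compact sets and one for open sets. These suffice twice: real
    dilations are approximated by rational ones through thickenings, and the hulls of grid cells are
    compact while their inner gaps are open. *)

Definition pr A : R := fine (P A).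

Lemma prE A : measurable A -> P A = (pr A)%:E.
Proof. by move=> mA; rewrite fineK// fin_num_measure. Qed.

Lemma pr_ge0 A : 0 <= pr A.
Proof. exact: fine_ge0. Qed.

Lemma pr_mono A B : measurable A -> measurable B -> A `<=` B -> pr A <= pr B.
Proof.
by move=> mA mB AB; rewrite -lee_fin -!prE//; apply: le_measure; rewrite ?inE.
Qed.

Lemma pr_setT : pr setT = 1.
Proof. by rewrite /pr probability_setT. Qed.

Lemma pr_set0 : pr set0 = 0.
Proof. by rewrite /pr measure0. Qed.

Lemma prU A B : measurable A -> measurable B -> A `&` B = set0 ->
  pr (A `|` B) = pr A + pr B.
Proof.
move=> mA mB AB; apply: EFin_inj; rewrite EFinD -!prE//.
  by rewrite measureU.
exact: measurableU.
Qed.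

Lemma pr_split A B : measurable A -> measurable B ->
  pr A = pr (A `&` B) + pr (A `&` ~` B).
Proof.
move=> mA mB; rewrite -prU//.
- by rewrite -setIUr setUv setIT.
- exact: measurableI.
- by apply: measurableI => //; exact: measurableC.
- by rewrite setIACA setICr setI0.
Qed.

Lemma pr_setC A : measurable A -> pr (~` A) = 1 - pr A.
Proof.
by move=> mA; rewrite -pr_setT (@pr_split setT A)// !setTI addrC addKr.
Qed.

Lemma pr_le1 A : measurable A -> pr A <= 1.
Proof. by move=> mA; rewrite -pr_setT; exact: pr_mono. Qed.

Lemma prI1 A N : measurable A -> measurable N -> pr N = 1 ->
  pr (A `&` N) = pr A.
Proof.
move=> mA mN N1; rewrite [RHS](@pr_split A N)// [X in _ + X](_ : _ = 0) ?addr0//.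
have mNC : measurable (~` N) by exact: measurableC.
apply/eqP; rewrite eq_le pr_ge0 andbT (_ : 0 = pr (~` N)); last first.
  by rewrite pr_setC// N1 subrr.
by apply: pr_mono => //; exact: measurableI.
Qed.

Lemma pr_sum_seq (I : eqType) (s : seq I) (A : I -> set T) : uniq s ->
  (forall i, i \in s -> measurable (A i)) ->
  (forall i j w, i \in s -> j \in s -> A i w -> A j w -> i = j) ->
  pr [set w | exists2 i, i \in s & A i w] = \sum_(i <- s) pr (A i).
Proof.
elim: s => [|i s IH] /=.
  move=> _ _ _; rewrite big_nil -pr_set0; congr pr.
  by apply/seteqP; split=> w // -[].
move=> /andP[is_ us] mA dA; rewrite big_cons -IH//; first last.
- by move=> a b w sa sb; apply: dA; rewrite inE ?sa ?sb orbT.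
- by move=> a sa; apply: mA; rewrite inE sa orbT.
rewrite -prU.
- congr pr; apply/seteqP; split=> w /=.
    move=> [j]; rewrite inE => /orP[/eqP->|js Aj]; first by left.
    by right; exists j.
  move=> [Ai|[j js Aj]]; first by exists i; rewrite ?mem_head.
  by exists j; rewrite // inE js orbT.
- by apply: mA; rewrite mem_head.
- rewrite (_ : [set w | _] = \bigcup_(j in [set` s]) A j); last first.
    by apply/seteqP; split=> w [j js Aj]; exists j.
  by apply: fin_bigcup_measurable => // j /= js; apply: mA; rewrite inE js orbT.
- apply/seteqP; split=> w //= -[Ai [j js Aj]].
  have ij : i = j by apply: dA Aj; rewrite ?inE ?eqxx ?js ?orbT.
  by rewrite ij js in is_.
Qed.

Lemma measurable_exists_fin (I : finType) (Q : pred I) (A : I -> set T) :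
  (forall i, Q i -> measurable (A i)) ->
  measurable [set w | exists2 i, Q i & A i w].
Proof.
move=> mA; rewrite (_ : [set w | _] = \bigcup_(j in [set` Q]) A j); last first.
  by apply/seteqP; split=> w [j js Aj]; exists j.
by apply: fin_bigcup_measurable => // j /= js; exact: mA.
Qed.

Lemma pr_sum_fin (I : finType) (Q : pred I) (A : I -> set T) :
  (forall i, Q i -> measurable (A i)) ->
  (forall i j w, Q i -> Q j -> A i w -> A j w -> i = j) ->
  pr [set w | exists2 i, Q i & A i w] = \sum_(i | Q i) pr (A i).
Proof.
move=> mA dA; rewrite -big_filter -pr_sum_seq; last 3 first.
- by rewrite filter_uniq// index_enum_uniq.
- by move=> i; rewrite mem_filter => /andP[Qi _]; exact: mA.
- by move=> i j w; rewrite !mem_filter => /andP[Qi _] /andP[Qj _]; exact: dA.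
congr pr; apply/seteqP; split=> w /= [i Qi Ai]; exists i => //.
  by rewrite mem_filter Qi mem_index_enum.
by move: Qi; rewrite mem_filter => /andP[].
Qed.

(** The event [E n] that [A m] and [B] agree for all m from n on increases with n, and the union
    contains [N], so its probability tends to 1. Off [E n] the probabilities of [A n] and [B] differ
    by at most 1 - [pr (E n)]. Convergence can thus be checked outcome by outcome. *)
Lemma pr_event_cvg (A : nat -> set T) B N :
  (forall n, measurable (A n)) -> measurable B -> measurable N -> pr N = 1 ->
  (forall w, N w -> exists n0, forall n, (n0 <= n)%N -> (A n w <-> B w)) ->
  pr (A n) @[n --> \oo] --> pr B.
Proof.
move=> mA mB mN N1 AB.
pose D n := (A n `&` ~` B) `|` (B `&` ~` A n).
have mD n : measurable (D n).
  by apply: measurableU; apply: measurableI => //; exact: measurableC.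
pose E n := \bigcap_(m in [set m | (n <= m)%N]) ~` D m.
have mE n : measurable (E n).
  apply: bigcap_measurable => [|m _]; first by exists n => /=.
  exact: measurableC.
have EDN w n : E n w -> forall m, (n <= m)%N -> A m w <-> B w.
  move=> Enw m nm; have := Enw m nm; rewrite /D /= => /not_orP[H1 H2].
  split=> H; apply: contrapT => H'; [exact: H1|exact: H2].
have UE : pr (\bigcup_n E n) = 1.
  apply/eqP; rewrite eq_le pr_le1/=; last exact: bigcup_measurable.
  rewrite -N1; apply: pr_mono => //; first exact: bigcup_measurable.
  move=> w /AB[n0 H]; exists n0 => // m /= nm.
  by move=> [] [H1 H2]; apply: H2; apply/(H m nm).
have cE : pr (E n) @[n --> \oo] --> (1 : R).
  have := nondecreasing_cvg_mu (mu := P) mE (bigcup_measurable _).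
  rewrite -UE => /(_ (fun k _ => mE k)) H.
  apply/fine_cvg; rewrite -prE; last exact: bigcup_measurable.
  apply: H => n m nm; apply/subsetPset => w Ew k mk; apply: Ew.
  exact: leq_trans mk.
apply/cvgrPdist_le => e e0; move/cvgrPdist_le : cE => /(_ e e0).
apply: filterS => n; rewrite ger0_norm ?subr_ge0 ?pr_le1// => H.
have mEC := measurableC (mE n).
suff K X Y : measurable X -> measurable Y -> X `&` E n `<=` Y -> pr X - pr Y <= e.
  rewrite ler_norml; apply/andP; split.
    by rewrite lerNl opprB; apply: K => // w [Bw En]; apply/(EDN w n En n (leqnn n)).
  by apply: K => // w [Bw En]; apply/(EDN w n En n (leqnn n)).
move=> mX mY XY; rewrite (le_trans _ H)// -pr_setC// lerBlDr.
rewrite (@pr_split X (E n))// addrC lerD//.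
  by apply: pr_mono => //; exact: measurableI.
by apply: pr_mono => //; exact: measurableI.
Qed.

Lemma measurable_forall (I : countType) (A : I -> set T) :
  (forall i, measurable (A i)) -> measurable [set w | forall i, A i w].
Proof.
move=> mA; rewrite (_ : [set w | _] = ~` \bigcup_(i in [set: I]) ~` A i).
  apply: measurableC; apply: countable_bigcupT_measurable.
    exact: countableP.
  by move=> i; exact: measurableC.
apply/seteqP; split=> w H; first by move=> [i _]; apply; exact: H.
by move=> i; apply: contrapT => Aiw; apply: H; exists i.
Qed.

Lemma measurable_exists (I : countType) (A : I -> set T) :
  (forall i, measurable (A i)) -> measurable [set w | exists i, A i w].
Proof.
move=> mA; rewrite (_ : [set w | _] = \bigcup_(i in [set: I]) A i).
  by apply: countable_bigcupT_measurable => //; exact: countableP.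
by apply/seteqP; split=> w [i]; [exists i|move=> _; exists i].
Qed.

Lemma pr1_forall (I : countType) (A : I -> set T) :
  (forall i, measurable (A i)) -> (forall i, pr (A i) = 1) ->
  pr [set w | forall i, A i w] = 1.
Proof.
move=> mA A1.
pose B k := if choice.unpickle k is Some i then A i else setT.
have mB k : measurable (B k) by rewrite /B; case: choice.unpickle.
have B1 k : pr (B k) = 1.
  by rewrite /B; case: choice.unpickle => [i|]; [exact: A1|exact: pr_setT].
have : P.-negligible (\bigcup_k ~` B k).
  apply: negligible_bigcup => k; apply/negligibleP; first exact: measurableC.
  by have := prE (measurableC (mB k)); rewrite pr_setC// B1 subrr.
have mU : measurable (\bigcup_k ~` B k).
  by apply: bigcupT_measurable => k; exact: measurableC.
move=> /(negligibleP P mU) PU.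
rewrite (_ : [set w | _] = ~` \bigcup_k ~` B k).
  by rewrite pr_setC// /pr PU subr0.
apply/seteqP; split=> w H.
  by move=> [k _]; apply; rewrite /B; case: choice.unpickle.
move=> i; apply: contrapT => Aiw; apply: H.
by exists (choice.pickle i) => //; rewrite /B choice.pickleK.
Qed.

Lemma measurable_bool_set (f : T -> bool) : measurable_fun setT f ->
  measurable [set w | f w].
Proof.
move=> mf; rewrite (_ : [set w | f w] = setT `&` f @^-1` [set true]).
  exact: mf.
by rewrite setTI; apply/seteqP; split=> w.
Qed.

End real_probability.

(** The preimage is a finite union of fibres of [b]. Composition-valued maps, whose target carries
    the discrete sigma-algebra, are treated in this way: finitely many measurable bits are listed
    that determine the value. *)
Lemma measurable_factor d (T : measurableType d) (F : finType) (U : Type)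
    (b : T -> F) (X : T -> U) (A : set U) :
  (forall x, measurable [set w | b w = x]) ->
  (forall w w', b w = b w' -> X w = X w') -> measurable (X @^-1` A).
Proof.
move=> mb bX.
pose Q x := `[< exists2 w, b w = x & A (X w) >].
rewrite (_ : X @^-1` A = [set w | exists2 x, Q x & b w = x]); last first.
  apply/seteqP; split=> w /=.
    by move=> AX; exists (b w) => //; apply/asboolP; exists w.
  by move=> [x] /asboolP[w' <- AX] e; rewrite /= (bX _ _ e).
by apply: (measurable_exists_fin (Q := Q) (A := fun x => [set w | b w = x])).
Qed.

(** * Compositions and their digits *)

Lemma size_binary s : 0%N \notin s -> size (binary s) = sumn s.
Proof.
elim: s => [//|m s IH]; rewrite inE negb_or eq_sym -lt0n => /andP[m0 s0].
by rewrite /binary/= size_cat size_nseq -/(binary s) IH// -addSn prednK.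
Qed.

Lemma binary_cons m s : binary (m :: s) = true :: nseq m.-1 false ++ binary s.
Proof. by []. Qed.

Lemma find_binary s : find id (binary s) = 0%N.
Proof. by case: s. Qed.

Lemma binary_inj s s' : 0%N \notin s -> 0%N \notin s' ->
  binary s = binary s' -> s = s'.
Proof.
elim: s s' => [|m s IH] [|m' s'] //.
rewrite !inE !negb_or => /andP[m0 s0] /andP[m0' s0'] [E].
(* The zeros before the next one count the remaining balls of the first box. *)
have find_gap k (t : seq nat) : find id (nseq k false ++ binary t) = k.
  rewrite find_cat has_nseq andbF size_nseq find_binary addn0//.
have mm' : m.-1 = m'.-1 by rewrite -(find_gap m.-1 s) E find_gap.
have -> : m = m' by lia.
congr cons; apply: IH => //; move: E; rewrite mm' => /eqP.
by rewrite eqseq_cat// eqxx => /eqP.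
Qed.

Section composition_binary.
Variable n : nat.
Implicit Types c : composition n.

Lemma composition_parts_gt0 c : 0%N \notin (c : seq nat).
Proof. by case: c => s /= /andP[]. Qed.

Lemma composition_sum c : sumn c = n.
Proof. by case: c => s /= /andP[_ /eqP]. Qed.

Lemma size_composition_binary c : size (binary c) = n.
Proof. by rewrite size_binary ?composition_sum// composition_parts_gt0. Qed.

Lemma composition_binary_inj : injective (fun c => binary c).
Proof.
move=> c c' /binary_inj H; apply: val_inj; apply: H; exact: composition_parts_gt0.
Qed.

Lemma nth_composition_binary0 c : (0 < n)%N -> nth false (binary c) 0 = true.
Proof. by case: c => -[|m s] //= /andP[_ /eqP <-]. Qed.

End composition_binary.

(** Deleting a ball replaces its digit and the next one by their disjunction: the next ball opens a
    box afterwards if it did so before, or if it takes over from a deleted ball that did. The last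
    ball leaves no trace, hence the empty value on a single digit. *)
Fixpoint remove_digit (y : nat) (b : bitseq) : bitseq :=
  if b is x :: b' then
    if y is y'.+1 then x :: remove_digit y' b'
    else if b' is x' :: b'' then (x || x') :: b'' else [::]
  else [::].

Lemma remove_digit_cat y b1 b2 :
  remove_digit (size b1 + y) (b1 ++ b2) = b1 ++ remove_digit y b2.
Proof. by elim: b1 => //= x b1 ->. Qed.

Lemma remove_digit_nseq y k b : (y < k.+1)%N ->
  remove_digit y (nseq k.+1 false ++ b) = nseq k false ++ b.
Proof.
elim: k y => [|k IH] [|y]//=; first by case: b.
by move=> yk; congr cons; exact: IH.
Qed.

Lemma binary_delete_seq y s : 0%N \notin s -> (y < sumn s)%N ->
  binary (delete_seq y s) = remove_digit y (binary s).
Proof.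
elim: s y => [//|m s IH] y; rewrite inE negb_or => /andP[m0 s0] /=.
have {}m0 : (0 < m)%N by lia.
case: ifPn => [ym _|]; last first.
  rewrite -leqNgt => my ys; rewrite binary_cons IH//; last by lia.
  rewrite -cat_cons -remove_digit_cat; congr remove_digit.
  by rewrite /= size_nseq; lia.
case: m m0 ym => [//|[|k]] _ /=.
  by rewrite ltnS leqn0 => /eqP -> /=; case: s {IH s0}.
move=> yk; rewrite binary_cons /=; case: y yk => [//|y yk] /=.
congr cons; symmetry; exact: (remove_digit_nseq (k := k) (y := y) (binary s) yk).
Qed.

Lemma nth_remove_digit y b l : (l < (size b).-1)%N ->
  nth false (remove_digit y b) l =
  if (l < y)%N then nth false b l
  else if l == y then nth false b y || nth false b y.+1 else nth false b l.+1.
Proof.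
elim: b y l => [//|x b IH] [|y] [|l] //=; case: b IH => [//|x' b] IH //= lb.
by rewrite IH.
Qed.

Lemma remove_last_digit b : (0 < size b)%N ->
  remove_digit (size b).-1 b = take (size b).-1 b.
Proof.
by elim: b => [//|x [//|x' b] IH] _ /=; rewrite -[in RHS]IH.
Qed.

(* A pair [(i, j)] stands for the event that the places [i] and [j] are in the
   same box. *)
Definition unbroken n (D : seq (nat * nat)) : set (composition n) :=
  [set c | forall p, p \in D -> forall l, (p.1 < l <= p.2)%N ->
    ~~ nth false (binary c) l].

Arguments unbroken : clear implicits.

Definition places_below n (D : seq (nat * nat)) :=
  all (fun p => p.1 < p.2 < n)%N D.

Definition map_places (f : nat -> nat) (D : seq (nat * nat)) :=
  [seq (f p.1, f p.2) | p <- D].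

Lemma map_places_id f D n : (forall i, (i < n)%N -> f i = i) ->
  places_below n D -> map_places f D = D.
Proof.
move=> fi /allP Dn; rewrite /map_places -[RHS]map_id; apply/eq_in_map.
by move=> [i j] /Dn /= ij; rewrite !fi//; lia.
Qed.

(** Boxes are intervals of places, so deleting a ball neither splits nor merges the boxes of the
    other balls; [bump y] sends each surviving ball back to its former place. *)
Lemma unbroken_delete n D (c : composition n.+1) (y : 'I_n.+1) :
  places_below n D ->
  unbroken n D (delete_ball c y) <-> unbroken n.+1 (map_places (bump y) D) c.
Proof.
move=> /allP Dn.
have E : binary (delete_ball c y) = remove_digit y (binary c).
  rewrite binary_delete_seq ?composition_parts_gt0//.
  by rewrite composition_sum.
have nE l : (l < n)%N -> nth false (binary (delete_ball c y)) l =
    if (l < y)%N then nth false (binary c) l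
    else if l == y then nth false (binary c) y || nth false (binary c) y.+1
    else nth false (binary c) l.+1.
  by move=> ln; rewrite E nth_remove_digit// size_composition_binary.
split=> H.
- move=> _ /mapP[[i j] pD ->] l /= il; have /= ij := Dn _ pD.
  have HH k : (i < k <= j)%N ->
      ~~ nth false (binary (delete_ball c y)) k by exact: (H _ pD).
  move: il; rewrite /bump => il.
  have [ly|yl|ly] := ltngtP l y.
  + have K : (i < l <= j)%N by lia.
    by move: (HH _ K); rewrite nE ?ly//; lia.
  + have [ly|ly] := eqVneq l y.+1; rewrite ?ly.
      have K : (i < y <= j)%N by lia.
      move: (HH _ K); rewrite nE ?ltnn ?eqxx ?negb_or; last by lia.
      by case/andP.
    have K : (i < l.-1 <= j)%N by lia.
    move: (HH _ K); rewrite nE; last by lia.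
    have -> : (l.-1 < y)%N = false by lia.
    have -> : (l.-1 == y) = false by lia.
    by rewrite prednK//; lia.
  + have K : (i < y <= j)%N by lia.
    move: (HH _ K); rewrite ly nE ?ltnn ?eqxx ?negb_or; last by lia.
    by case/andP.
- move=> [i j] pD l /= il; have /= ij := Dn _ pD.
  have HH := H (bump y i, bump y j) (map_f _ pD); rewrite /bump /= in HH.
  rewrite nE; last by lia.
  have [ly|yl|ly] := ltngtP l y.
  + by apply: HH; lia.
  + by apply: HH; lia.
  + by rewrite negb_or; apply/andP; split; apply: HH; lia.
Qed.

Lemma unbroken_cat n D D' : unbroken n (D ++ D') = unbroken n D `&` unbroken n D'.
Proof.
apply/seteqP; split=> c H.
  by split=> p pD; apply: H; rewrite mem_cat pD ?orbT.
by move=> p; rewrite mem_cat => /orP[]; [apply: H.1|apply: H.2].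
Qed.

(** The pair (l-1, l) reads off the digit at l, and the digit at 0 is always one, so singletons
    belong to the sigma-algebra; there are countably many compositions. *)
Lemma sigma_unbroken n :
  <<s [set A | exists2 D, places_below n D & A = unbroken n D] >> =
  [set: set (composition n)].
Proof.
set G := [set A | _]; apply/seteqP; split=> // A _.
have mI (F : nat -> set (composition n)) :
    (forall i, <<s G >> (F i)) -> <<s G >> (\bigcap_i F i).
  move=> mF; rewrite -[X in <<s G >> X]setCK setC_bigcap.
  apply: sigma_algebraC; apply: sigma_algebra_bigcup => i.
  exact: sigma_algebraC.
have mT : <<s G >> setT.
  rewrite -[X in <<s G >> X]setC0; apply: sigma_algebraC; apply: (@sigma_algebra0 _ setT G).
have m1 c : <<s G >> [set c].
  pose F l := [set c' : composition n | (0 < l < n)%N ->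
    nth false (binary c') l = nth false (binary c) l].
  rewrite (_ : [set c] = \bigcap_l F l); last first.
    apply/seteqP; split=> [_ -> //|c' H].
    apply: composition_binary_inj; apply: (@eq_from_nth _ false).
      by rewrite !size_composition_binary.
    rewrite size_composition_binary => -[|l] ln.
      by rewrite !nth_composition_binary0.
    exact: H.
  apply: mI => l.
  have [ln|ln] := boolP (0 < l < n)%N; last first.
    rewrite (_ : F l = setT)//; apply/seteqP; split=> c' // _.
    by rewrite /F /= (negbTE ln).
  have mu : <<s G >> (unbroken n [:: (l.-1, l)]).
    by apply: sub_sigma_algebra; exists [:: (l.-1, l)] => //=; rewrite andbT; lia.
  have uE c' : unbroken n [:: (l.-1, l)] c' <-> ~~ nth false (binary c') l.
    split; first by move=> H; apply: (H (l.-1, l)); rewrite ?mem_head//=; lia.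
    move=> H p; rewrite inE => /eqP -> k /= kl.
    by have -> : k = l by lia.
  case E : (nth false (binary c) l).
    rewrite (_ : F l = ~` unbroken n [:: (l.-1, l)]).
      exact: sigma_algebraC.
    apply/seteqP; split=> c'; rewrite /F /=.
      by move=> H /uE; rewrite (H ln) E.
    move=> H _; rewrite E; case E' : (nth false (binary c') l) => //.
    by case: H; apply/uE; rewrite E'.
  rewrite (_ : F l = unbroken n [:: (l.-1, l)])//.
  apply/seteqP; split=> c'; rewrite /F /=.
    by move=> H; apply/uE; rewrite (H ln) E.
  by move=> /uE H _; rewrite E; apply/negbTE.
rewrite (_ : A = \bigcup_(k in @setT nat)
    [set c : composition n | choice.pickle c = k /\ A c]); last first.
  apply/seteqP; split=> [c Ac|c [k _ [_ //]]].
  by exists (choice.pickle c).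
apply: sigma_algebra_bigcup => k.
have [[c [ck Ac]]|nc] := pselect (exists c : composition n, choice.pickle c = k /\ A c).
  rewrite (_ : [set c | _] = [set c])//; apply/seteqP; split=> c' /=.
    by move=> [ck' _]; apply: (pcan_inj (@choice.pickleK _)); rewrite ck ck'.
  by move=> ->.
rewrite (_ : [set c | _] = set0); first exact: (@sigma_algebra0 _ setT G).
by apply/seteqP; split=> c //= H; apply: nc; exists c.
Qed.

(** The generators of [sigma_unbroken] form a pi-system, by concatenation of lists, and the empty
    list gives the whole space. *)
Lemma composition_law_unique (R : realType) n
    (m1 m2 : probability (composition n) R) :
  (forall D, places_below n D -> m1 (unbroken n D) = m2 (unbroken n D)) ->
  forall A, m1 A = m2 A.
Proof.
move=> H A.
have U0 : unbroken n [::] = setT by apply/seteqP; split.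
pose G := [set A | exists2 D, places_below n D & A = unbroken n D].
apply: (measure_unique G (fun=> setT)) => //.
- by rewrite sigma_unbroken; apply/seteqP; split.
- move=> _ _ [D Dn ->] [D' Dn' ->]; exists (D ++ D').
    by rewrite /places_below all_cat; apply/andP; split.
  by rewrite unbroken_cat.
- by move=> _; exists [::].
- by apply: bigcup_const; exists 0%N.
- by move=> _ [D Dn ->]; exact: H.
- by move=> k; rewrite -ge0_fin_numE// fin_num_measure.
Qed.

Lemma composition_rv_law d (T : measurableType d) (R : realType)
    (P : probability T R) n (X : T -> composition n)
    (m : probability (composition n) R) :
  (forall A, measurable (X @^-1` A)) ->
  (forall D, places_below n D ->
    P (X @^-1` unbroken n D) = m (unbroken n D)) ->
  forall A, P (X @^-1` A) = m A.
Proof.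
move=> mX XD A.
have mfX : measurable_fun setT X by move=> _ B _; rewrite setTI.
pose X' : {mfun T >-> composition n} := mfun_Sub (mem_set mfX).
exact: (@composition_law_unique R n (distribution P X') m).
Qed.

(** * Compositions obtained by sampling *)

Definition gaps (R : numDomainType) (x : nat -> R) (D : seq (nat * nat)) : set R :=
  [set t | exists2 p, p \in D & x p.1 <= t <= x p.2].

(** With [ss] the classes in order and [e] the relation of lying in one class, this reads the digits
    of a composition off consecutive ranked points. *)
Lemma nth_binary_blocks (T : eqType) (x0 : T) (e : rel T) (ss : seq (seq T)) :
  (forall s, s \in ss -> s != [::]) ->
  (forall s, s \in ss -> forall x y, x \in s -> y \in s -> e x y) ->
  pairwise (fun s t => all (fun x => all (fun y => ~~ e x y) t) s) ss ->
  forall l, (0 < l < size (flatten ss))%N ->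
    nth false (binary (map size ss)) l =
    ~~ e (nth x0 (flatten ss) l.-1) (nth x0 (flatten ss) l).
Proof.
elim: ss => [|s ss IH] ne es /=; first by move=> _ l; rewrite ltn0 andbF.
move=> /andP[/allP ss1 ss2] l; rewrite size_cat => /andP[l0 ls].
have s0 : (0 < size s)%N.
  by have := ne s (mem_head _ _); case: s {ss1 ls es ne IH}.
have {}IH := IH (fun t ts => ne t (mem_behead (s := s :: ss) ts))
  (fun t ts => es t (mem_behead (s := s :: ss) ts)) ss2.
rewrite binary_cons -cat_cons !nth_cat /= size_nseq prednK//.
have [ll|sl] := ltnP l (size s).
  rewrite (_ : (l.-1 < size s)%N) ?(leq_ltn_trans (leq_pred _) ll)//.
  rewrite (es s (mem_head _ _)) ?mem_nth//=; last by lia.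
  by case: l l0 ll {ls} => [//|l] _ ll /=; rewrite nth_nseq if_same.
have [E|ne_sl] := eqVneq l (size s).
  rewrite E subnn ltn_predL s0 in ls *.
  case: ss ss1 ss2 IH ls ne {es} => [|t ss] ss1 ss2 IH ls ne.
    by move: ls; rewrite addn0 ltnn.
  have t0 : (0 < size t)%N.
    by have := ne t (mem_behead (s := s :: t :: ss) (mem_head _ _)); case: (t).
  have /allP := ss1 t (mem_head _ _) => /(_ (nth x0 s (size s).-1)).
  rewrite mem_nth ?ltn_predL// => /(_ isT)/allP/(_ (nth x0 (flatten (t :: ss)) 0)).
  by rewrite /= nth_cat t0 mem_nth// => /(_ isT) ->.
rewrite (_ : (l.-1 < size s)%N = false); last by lia.
rewrite IH; last by lia.
by rewrite (_ : (l - size s).-1 = l.-1 - size s)%N//; lia.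
Qed.

Lemma sorted_flatten (T : eqType) (r : rel T) (ss : seq (seq T)) :
  transitive r -> (forall s, s \in ss -> sorted r s) ->
  pairwise (fun s t => all (fun x => all (fun y => r x y) t) s) ss ->
  sorted r (flatten ss).
Proof.
move=> tr; rewrite sorted_pairwise// => sr pr_ss.
have {}sr s : s \in ss -> pairwise r s by move=> /sr; rewrite sorted_pairwise.
elim: ss sr pr_ss => [//|s ss IH] sr /= /andP[/allP H1 H2].
rewrite pairwise_cat sr ?mem_head//= IH//; last first.
  by move=> t ts; apply: sr; rewrite inE ts orbT.
rewrite andbT; apply/allrelP => x y xs /flattenP[t ts yt].
by have /allP/(_ _ xs)/allP/(_ _ yt) := H1 _ ts.
Qed.

Lemma miss_gaps_chain (R : realType) (F : set R) (x : nat -> R) a b : (a < b)%N ->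
  (forall k l, (k < l <= b)%N -> x k < x l) ->
  F `&` `[x a, x b] = set0 <->
  (forall l, (a < l <= b)%N -> F `&` `[x l.-1, x l] = set0).
Proof.
move=> ab xlt; have xle k l : (k <= l <= b)%N -> x k <= x l.
  rewrite leq_eqVlt => /andP[/orP[/eqP -> //|kl] lb].
  by rewrite ltW// xlt// kl.
split=> [H l lab|].
  apply/seteqP; split=> // t [Ft] /=; rewrite in_itv/= => /andP[t1 t2].
  have : (F `&` `[x a, x b]) t; last by rewrite H.
  split=> //=; rewrite in_itv /= (le_trans _ t1) ?(le_trans t2)//=; apply: xle; lia.
elim: b ab {xlt} xle => [//|b IH] ab xle H.
apply/seteqP; split=> // t [Ft] /=; rewrite in_itv/= => /andP[t1 t2].
have [tb|tb] := leP t (x b).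
  have [E|nab] := eqVneq a b.
    have : (F `&` `[x b.+1.-1, x b.+1]) t; last by rewrite (H b.+1)//; lia.
    by split=> //=; rewrite in_itv /= t2 andbT -E.
  have : (F `&` `[x a, x b]) t; last first.
    rewrite IH//; first by lia.
      by move=> k l kl; apply: xle; lia.
    by move=> l lab; apply: H; lia.
  by split=> //=; rewrite in_itv /= t1.
have : (F `&` `[x b.+1.-1, x b.+1]) t; last by rewrite (H b.+1)//; lia.
by split=> //=; rewrite in_itv /= (ltW tb).
Qed.

Lemma sorted_points_lt (R : realType) n (u : nat -> R) k l :
  (forall i j, (i < n)%N -> (j < n)%N -> u i = u j -> i = j) -> (k < l < n)%N ->
  nth 0 (sort <=%R [seq u i | i <- iota 0 n]) k <
  nth 0 (sort <=%R [seq u i | i <- iota 0 n]) l.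
Proof.
move=> uinj /andP[kl ln]; rewrite lt_neqAle; apply/andP; split; last first.
  have := @sort_le_sorted _ _ [seq u i | i <- iota 0 n].
  rewrite sorted_pairwise; last exact: le_trans.
  move=> /(pairwiseP 0); apply; rewrite ?inE ?size_sort ?size_map ?size_iota//.
  exact: ltn_trans ln.
have uxs : uniq (sort <=%R [seq u i | i <- iota 0 n]).
  rewrite sort_uniq map_inj_in_uniq ?iota_uniq// => i j.
  by rewrite !mem_iota !add0n /=; exact: uinj.
rewrite nth_uniq ?size_sort ?size_map ?size_iota//; first by lia.
by lia.
Qed.

Section sample_digits.
Context (R : realType) (Z : set R) (n : nat) (u : nat -> R).

(** Connected sets of reals are intervals: a component containing both points contains the segment
    between them, and a segment that avoids Z is itself a connected set inside the component. *)
Lemma connected_component_gap (x y : R) : x <= y ->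
  connected_component (`[0, 1] `\` Z) x y <->
  [/\ 0 <= x, y <= 1 & Z `&` `[x, y] = set0].
Proof.
move=> xy; split.
  move=> cxy.
  have cyx := connected_component_sym cxy.
  have Ax : (`[0, 1] `\` Z) x by exact: connected_component_sub cyx.
  have Ay : (`[0, 1] `\` Z) y by exact: connected_component_sub cxy.
  have /connected_intervalP Ic := component_connected (A := `[0, 1] `\` Z) (x := x).
  have cxx := connected_component_refl Ax.
  move: Ax Ay => [+ _] [+ _]; rewrite /= !in_itv/= => /andP[x0 _] /andP[_ y1].
  split=> //; apply/seteqP; split=> // t [Zt] /=; rewrite in_itv /= => xty.
  by have /connected_component_sub[_] := Ic x y cxx cxy t xty.
move=> [x0 y1 Zxy]; apply: (connected_component_max (B := `[x, y])).
- by rewrite /= in_itv /= lexx.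
- move=> t /= txy; split; last first.
    by move=> Zt; have : (Z `&` `[x, y]) t by []; rewrite Zxy.
  move: txy; rewrite !in_itv /= => /andP[xt ty].
  by rewrite (le_trans x0 xt) (le_trans ty y1).
- by apply/connected_intervalP/interval_is_interval.
- by rewrite /= in_itv /= xy lexx.
Qed.

Lemma same_classC (i j : 'I_n) : same_class Z u i j = same_class Z u j i.
Proof.
rewrite /same_class eq_sym; congr orb; apply/asboolP/asboolP;
  exact: connected_component_sym.
Qed.

Lemma same_class_equivalence :
  {in [set: 'I_n]%SET & &, equivalence_rel (@same_class R Z n u)}.
Proof.
move=> i j k _ _ _; rewrite /same_class eqxx; split=> // /orP[/eqP->//|].
move=> /asboolP ij; apply/idP/idP => /orP[/eqP <-|/asboolP jk].
- by apply/orP; right; apply/asboolP/connected_component_sym.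
- apply/orP; right; apply/asboolP; apply: connected_component_trans jk.
  exact: connected_component_sym.
- by apply/orP; right; apply/asboolP.
- by apply/orP; right; apply/asboolP; apply: connected_component_trans jk.
Qed.

Hypothesis u01 : forall i, (i < n)%N -> 0 <= u i <= 1.
Hypothesis uinj : forall i j, (i < n)%N -> (j < n)%N -> u i = u j -> i = j.

Let leu : rel 'I_n := fun i j => u i <= u j.

Let leu_trans : transitive leu.
Proof. by move=> j i k; exact: le_trans. Qed.

Let leu_total : total leu.
Proof. by move=> i j; exact: le_total. Qed.

Let leu_anti : antisymmetric leu.
Proof.
by move=> i j; rewrite /leu => /le_anti H; apply/ord_inj/uinj.
Qed.

Let same_class_gap (i j : 'I_n) : u i < u j ->
  same_class Z u i j <-> Z `&` `[u i, u j] = set0.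
Proof.
move=> uij; have /andP[i0 i1] := u01 (ltn_ord i).
have /andP[j0 j1] := u01 (ltn_ord j).
rewrite /same_class; have -> /= : (i == j) = false.
  by apply/eqP => ij; rewrite ij ltxx in uij.
split.
  by move=> /asboolP /(connected_component_gap (ltW uij)) [].
by move=> H; apply/asboolP/(connected_component_gap (ltW uij)).
Qed.

Let classes : seq {set 'I_n} :=
  sort (fun B B' => leftmost u B <= leftmost u B') (enum (@sample_classes R Z n u)).

Let mem_classes B : (B \in classes) = (B \in @sample_classes R Z n u).
Proof. by rewrite mem_sort mem_enum. Qed.

Let partition_classes : finset.partition (@sample_classes R Z n u) [set: 'I_n].
Proof. exact: equivalence_partitionP same_class_equivalence. Qed.

Let classes_same B i j : B \in classes -> i \in B -> j \in B = same_class Z u i j.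
Proof.
rewrite mem_classes => /imsetP[k _ ->]; rewrite !inE /= => ki.
have inT x : x \in [set: 'I_n]%SET by rewrite inE.
have [_ H] := @same_class_equivalence k i j (inT _) (inT _) (inT _).
exact: H.
Qed.

Let classes_ne0 B : B \in classes -> B != finset.set0.
Proof.
rewrite mem_classes; move: partition_classes => /and3P[_ _ B0] PB.
by apply: contraNneq B0 => <-.
Qed.

Let classes_disjoint B B' i : B \in classes -> B' \in classes ->
  i \in B -> i \in B' -> B = B'.
Proof.
move=> BC BC' iB iB'; apply/setP => j.
by rewrite (classes_same _ BC iB) (classes_same _ BC' iB').
Qed.

Let leftmost_attained B : B \in classes ->
  exists2 i, i \in B & leftmost u B = u i.
Proof.
move=> /classes_ne0/finset.set0Pn[i iB].
have [k|k kB E] := @eq_bigmin _ _ _ 1 i (mem B) (fun k : 'I_n => u k) iB.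
  by move=> _; have /andP[] := u01 (ltn_ord k).
by exists k.
Qed.

(** The sort compares leftmost points only. Suppose a point j of the later class lay to the left of
    a point i of the earlier one. The leftmost point k of the earlier class is at most j, so j lies
    between k and i, in a segment that misses Z, hence in the same class. *)
Let classes_ordered :
  pairwise (fun B B' : {set 'I_n} => [forall i in B, forall j in B', leu i j && ~~ same_class Z u i j])
    classes.
Proof.
have lm_trans : transitive (fun B B' : {set 'I_n} => leftmost u B <= leftmost u B').
  by move=> B2 B1 B3; exact: le_trans.
have lm_total : total (fun B B' : {set 'I_n} => leftmost u B <= leftmost u B').
  by move=> B1 B2; exact: le_total.
have := sort_sorted lm_total (enum (@sample_classes R Z n u)).
rewrite -/classes (sorted_pairwise lm_trans) => pw.
have uc : uniq classes by rewrite sort_uniq enum_uniq.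
move: uc pw; rewrite uniq_pairwise => pu pw.
have /andP := conj pu pw; rewrite -pairwise_relI.
apply: (sub_in_pairwise (P := mem classes)); last by apply/allP.
move=> B B' BC BC' /= /andP[BB' lBB'].
apply/forall_inP => i iB; apply/forall_inP => j jB'.
have ns : ~~ same_class Z u i j.
  apply: contraNN BB'; rewrite -(classes_same _ BC iB) => jB.
  by apply/eqP; exact: classes_disjoint jB jB'.
rewrite ns andbT; apply: contraT; rewrite /leu -ltNge => uji.
have [k kB kE] := leftmost_attained BC.
have kj : u k <= u j by rewrite -kE (le_trans lBB')// bigmin_le_cond.
have sik : same_class Z u k i by rewrite -(classes_same _ BC kB).
move: kj; rewrite le_eqVlt => /orP[/eqP kj|kj].
  have kj' : k = j by apply/ord_inj/uinj.
  by move: ns; rewrite same_classC -kj' sik.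
move: sik => /(same_class_gap (lt_trans kj uji)) Zki.
have : same_class Z u k j.
  apply/(same_class_gap kj); apply/seteqP; split=> // t [Zt] /=.
  rewrite in_itv/= => /andP[kt tj].
  have : (Z `&` `[u k, u i]) t.
    by split=> //=; rewrite in_itv /= kt (le_trans tj (ltW uji)).
  by rewrite Zki.
rewrite -(classes_same _ BC kB) => jB; move: ns.
by rewrite -(classes_same _ BC iB) jB.
Qed.

Let blocks : seq (seq 'I_n) := [seq sort leu (enum B) | B : {set 'I_n} <- classes].

Let ranks := sort leu (enum 'I_n).

(** Both sides are sorted lists of the same points, and since there are no ties the sorted
    arrangement is unique. *)
Let flatten_blocks : flatten blocks = ranks.
Proof.
apply: (sorted_eq leu_trans leu_anti).
- apply: sorted_flatten => //.
    by move=> s /mapP[B _ ->]; exact: sort_sorted.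
  rewrite pairwise_map; apply: sub_pairwise classes_ordered => B B' /= /forall_inP H.
  apply/allP => i; rewrite mem_sort mem_enum => iB.
  apply/allP => j; rewrite mem_sort mem_enum => jB.
  by have /forall_inP/(_ _ jB)/andP[] := H _ iB.
- exact: sort_sorted.
- rewrite perm_sym perm_sort; apply: uniq_perm.
  + exact: enum_uniq.
  + have : pairwise (fun s t : seq 'I_n => ~~ has (mem s) t) blocks.
      rewrite pairwise_map; apply: sub_pairwise classes_ordered => B B' /= /forall_inP H.
      apply/hasPn => j; rewrite mem_sort mem_enum => jB; apply/negP.
      rewrite /= mem_sort mem_enum => jB'.
      have /forall_inP/(_ _ jB)/andP[_] := H _ jB'.
      by rewrite /same_class eqxx.
    have : all uniq blocks.
      by apply/allP => s /mapP[B _ ->]; rewrite sort_uniq enum_uniq.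
    elim: (blocks) => [//|s ss IH] /= /andP[us uss] /andP[/allP H1 H2].
    rewrite cat_uniq us IH// andbT /=; apply/hasPn => j /flattenP[t ts jt].
    by have /hasPn/(_ _ jt) := H1 _ ts.
  + move=> i; rewrite mem_enum inE; apply/esym/flattenP.
    have : i \in finset.cover (@sample_classes R Z n u).
      by move: partition_classes => /and3P[/eqP -> _ _]; rewrite inE.
    move=> /bigcupP[B BC iB]; exists (sort leu (enum B)).
      by apply/mapP; exists B; rewrite ?mem_classes.
    by rewrite mem_sort mem_enum.
Qed.

Let sizes_blocks : @sample_sizes R Z n u = map size blocks.
Proof.
rewrite /sample_sizes /blocks -map_comp; apply: eq_map => B /=.
by rewrite size_sort cardE.
Qed.

Let size_ranks : size ranks = n.
Proof. by rewrite size_sort -cardE card_ord. Qed.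

Let xs := sort <=%R [seq u i | i <- iota 0 n].

Let xsE l (i0 : 'I_n) : (l < n)%N -> nth 0 xs l = u (nth i0 ranks l).
Proof.
move=> ln; have -> : xs = [seq u (nat_of_ord i) | i <- ranks].
  rewrite /xs -val_enum_ord -map_comp sort_map.
  by congr map.
by rewrite (nth_map i0) ?size_ranks.
Qed.

Let sample_digit l : (0 < l < n)%N ->
  nth false (binary (@sample_composition R Z n u)) l = false <->
  Z `&` `[nth 0 xs l.-1, nth 0 xs l] = set0.
Proof.
move=> ln; have i0 : 'I_n by apply: (@Ordinal n 0); lia.
have lt_l : nth 0 xs l.-1 < nth 0 xs l by apply: sorted_points_lt => //; lia.
rewrite /= sizes_blocks (@nth_binary_blocks _ i0 (@same_class R Z n u)); first last.
- by rewrite flatten_blocks size_ranks.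
- rewrite pairwise_map; apply: sub_pairwise classes_ordered => B B' /= /forall_inP H.
  apply/allP => i; rewrite mem_sort mem_enum => iB.
  apply/allP => j; rewrite mem_sort mem_enum => jB.
  by have /forall_inP/(_ _ jB)/andP[] := H _ iB.
- move=> s /mapP[B BC ->] i j; rewrite !mem_sort !mem_enum => iB jB.
  by rewrite -(classes_same _ BC iB).
- move=> s /mapP[B BC ->]; rewrite -size_eq0 size_sort -cardE cards_eq0.
  exact: classes_ne0.
rewrite flatten_blocks !(xsE i0) in lt_l *; [|lia..].
rewrite -(same_class_gap lt_l).
by split=> [/negbFE//|->].
Qed.

(** [sample_digit] deals with neighbouring ranks; [miss_gaps_chain] glues them into the whole gap of
    a pair. *)
Lemma sample_unbroken D : places_below n D ->
  unbroken n D (@sample_composition R Z n u) <->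
  Z `&` gaps (nth 0 (sort <=%R [seq u i | i <- iota 0 n])) D = set0.
Proof.
move=> /allP Dn; rewrite -/xs; split=> H.
  apply/seteqP; split=> // t [Zt [[a b] pD /= xt]].
  have /= abn := Dn _ pD.
  have : (Z `&` `[nth 0 xs a, nth 0 xs b]) t by split=> //=; rewrite in_itv.
  suff -> : Z `&` `[nth 0 xs a, nth 0 xs b] = set0 by [].
  have ab : (a < b)%N by lia.
  have xlt k l : (k < l <= b)%N -> nth 0 xs k < nth 0 xs l.
    by move=> kl; apply: sorted_points_lt => //; lia.
  apply/(miss_gaps_chain Z ab xlt) => l lp; apply/sample_digit; first by lia.
  by apply/negbTE/(H _ pD).
move=> [a b] pD l /= lp; have /= abn := Dn _ pD.
apply/negbT/sample_digit; first by lia.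
have : Z `&` `[nth 0 xs a, nth 0 xs b] = set0.
  apply/seteqP; split=> // t [Zt xt].
  have : (Z `&` gaps (nth 0 xs) D) t; last by rewrite H.
  by split=> //; exists (a, b) => //; move: xt; rewrite /= in_itv.
have ab : (a < b)%N by lia.
have xlt k m : (k < m <= b)%N -> nth 0 xs k < nth 0 xs m.
  by move=> km; apply: sorted_points_lt => //; lia.
by move=> /(miss_gaps_chain Z ab xlt); apply.
Qed.

End sample_digits.

(** Finitely many comparisons determine the composition, which is what makes it measurable. The
    comparisons with 1 account for the default value in [leftmost]. *)
Lemma sample_composition_ext (R : realType) (n : nat) (Z Z' : set R)
    (u u' : nat -> R) :
  (forall i j : 'I_n, same_class Z u i j = same_class Z' u' i j) ->
  (forall i j : 'I_n, (u i <= u j) = (u' i <= u' j)) ->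
  (forall i : 'I_n, (u i <= 1) = (u' i <= 1)) ->
  (forall i : 'I_n, (1 <= u i) = (1 <= u' i)) ->
  sample_composition Z n u = sample_composition Z' n u'.
Proof.
move=> same le le1 ge1; apply: val_inj => /=; rewrite /sample_sizes.
have -> : @sample_classes R Z n u = @sample_classes R Z' n u'.
  rewrite /sample_classes; congr equivalence_partition.
  by apply/funext => i; apply/funext => j; exact: same.
congr map; congr sort; apply/funext => B; apply/funext => B'.
have leftmost_le (v : nat -> R) (A : {set 'I_n}) y : (leftmost v A <= y) =
    (1 <= y) || [exists i in A, v i <= y].
  apply/idP/orP => [|[y1|/exists_inP[i iA iy]]].
  - move=> Ay; have [|y1] := leP 1 y; [by left|right].
    apply: contraLR Ay => /exists_inPn H; rewrite -ltNge.
    apply: lt_bigmin => // i iA; rewrite ltNge; exact: H.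
  - by rewrite (le_trans _ y1)//; exact: bigmin_le_id.
  - by rewrite (le_trans _ iy)//; exact: bigmin_le_cond.
have le_leftmost (v : nat -> R) (A : {set 'I_n}) y : (y <= leftmost v A) =
    (y <= 1) && [forall i in A, y <= v i].
  apply/idP/andP => [yA|[y1 /forall_inP H]]; last exact: le_bigmin.
  split; first by rewrite (le_trans yA)//; exact: bigmin_le_id.
  by apply/forall_inP => i iA; rewrite (le_trans yA)//; exact: bigmin_le_cond.
rewrite !leftmost_le !le_leftmost !lexx /=; congr orb.
  by apply: eq_forallb_in => i _; exact: ge1.
apply: eq_existsb_in => i _; rewrite !le_leftmost le1; congr andb.
by apply: eq_forallb_in => j _; exact: le.
Qed.

(** * Closed sets missing a set *)

Section compact_separation.
Context (R : realType).
Implicit Types F K G : set R.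

(** Around each point of K a ball of some radius r misses F. One half of r is spent on moving the
    centre, the other bounds the distance to F; compactness makes the second half uniform. *)
Lemma compact_closed_separated K F : compact K -> closed F -> F `&` K = set0 ->
  exists2 e : R, 0 < e & forall x y, K x -> F y -> e <= `|x - y|.
Proof.
move=> cK cF FK.
have H : \forall e \near (0 : R)^'+, K `<=` [set x | forall y, F y -> e <= `|x - y|].
  apply: (compact_near_coveringP K).1 cK _ (0^'+) _ _ _ => x Kx.
  have Fx : nbhs x (~` F).
    by apply: open_nbhs_nbhs; split; [exact: closed_openC|
      move=> ?; have : (F `&` K) x by []; rewrite FK].
  move: Fx => /nbhs_ballP[r /= r0 Fx].
  near=> x' e => /= y Fy; rewrite leNgt; apply/negP => x'y.
  apply: (Fx y) => //; rewrite /ball /=.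
  rewrite (_ : x - y = (x - x') + (x' - y)); last by rewrite addrA subrK.
  rewrite (le_lt_trans (ler_normD _ _))// (splitr r) ltrD//.
    near: x'; apply/nbhs_ballP; exists (r / 2) => /=; first by rewrite divr_gt0.
    by move=> z.
  rewrite (lt_le_trans x'y)//; near: e.
  by apply: nbhs_right_le; rewrite divr_gt0.
have [e [e0 He]] : exists e, 0 < e /\ K `<=` [set x | forall y, F y -> e <= `|x - y|].
  near (0 : R)^'+ => e; exists e; split; first by near: e; exact: nbhs_right_gt.
  by near: e.
by exists e => // x y Kx Fy; exact: He.
Unshelve. all: by end_near. Qed.

End compact_separation.

Section miss_events.
Context (R : realType) (D : set R).
Implicit Types (F : closed_subset D) (I K : set R).

Definition misses (I : set R) : set (closed_subset D) :=
  [set F | cset F `&` I = set0].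

Lemma cset_closed F : closed F.
Proof. by case: F => F []. Qed.

Lemma measurable_misses_compact K : compact K -> measurable (misses K).
Proof.
move=> cK; rewrite (_ : misses K = ~` [set F : closed_subset D | F `&` K !=set0]).
  by apply: measurableC; apply: sub_sigma_algebra; exists K.
by apply/seteqP; split=> F; [move=> /nonemptyPn|move=> H; apply/nonemptyPn].
Qed.

Lemma missesU I J : misses (I `|` J) = misses I `&` misses J.
Proof.
apply/seteqP; split=> F; rewrite /misses /= setIUr.
  by rewrite setU_eq0.
by move=> [-> ->]; rewrite setU0.
Qed.

Lemma misses_subset I J : I `<=` J -> misses J `<=` misses I.
Proof. by move=> IJ F; exact: subsetI_eq0. Qed.

Lemma misses_bigcup T (A : set T) (I : T -> set R) :
  misses (\bigcup_(i in A) I i) = \bigcap_(i in A) misses (I i).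
Proof.
apply/seteqP; split=> F.
  by move=> H i Ai; apply: misses_subset H; exact: bigcup_sup.
move=> H; apply/seteqP; split=> // t [Ft [i Ai It]].
by have : (F `&` I i) t by []; rewrite (H i Ai).
Qed.

(** An open set is the countable union of the rational segments that it contains, and these are
    compact. *)
Lemma measurable_misses_open I : open I -> measurable (misses I).
Proof.
move=> oI.
pose J (pq : rat * rat) : set R := `[ratr pq.1, ratr pq.2]%classic.
rewrite (_ : I = \bigcup_(pq in [set pq | J pq `<=` I]) J pq); last first.
  apply/seteqP; split=> [x Ix|x [pq H]]; last exact: H.
  have /nbhs_ballP[e /= e0 He] : nbhs x I by exact: open_nbhs_nbhs.
  have [p] := @rat_in_itvoo R (x - e) x ltac:(by rewrite ltrBlDr ltrDl).
  rewrite in_itv/= => /andP[p1 p2].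
  have [q] := @rat_in_itvoo R x (x + e) ltac:(by rewrite ltrDl).
  rewrite in_itv/= => /andP[q1 q2].
  exists (p, q); last by rewrite /J /= in_itv /= (ltW p2) (ltW q1).
  move=> y; rewrite /J /= in_itv /= => /andP[py yq]; apply: He.
  rewrite /ball /= ltr_distlC; apply/andP; split.
    by rewrite (lt_le_trans p1).
  by rewrite (le_lt_trans yq).
rewrite misses_bigcup bigcap_mkcond.
rewrite -[X in measurable X]setCK setC_bigcap; apply: measurableC.
apply: countable_bigcupT_measurable; first exact: countableP.
move=> pq; apply: measurableC; case: ifPn => _ //.
by apply: measurable_misses_compact; exact: segment_compact.
Qed.

Lemma setI_closed_misses : setI_closed [set misses K | K in @compact R].
Proof.
move=> _ _ [K cK <-] [K' cK' <-]; exists (K `|` K'); last exact: missesU.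
exact: compactU.
Qed.

Lemma measurable_closed_subsetE :
  measurable = <<s [set misses K | K in @compact R] >> :> set (set (closed_subset D)).
Proof.
apply/seteqP; split.
  apply: smallest_sub; first exact: smallest_sigma_algebra.
  move=> _ [K cK <-]; rewrite -[X in <<s _ >> X]setCK; apply: sigma_algebraC.
  apply: sub_sigma_algebra; exists K => //.
  by apply/seteqP; split=> F; [move=> /nonemptyPn|move=> H; apply/nonemptyPn].
apply: smallest_sub; first exact: sigma_algebra_measurable.
by move=> _ [K cK <-]; exact: measurable_misses_compact.
Qed.

(** Unlike hitting events, missing events are stable under intersection, because missing two compact
    sets is missing their union; the laws are therefore compared on a pi-system. *)
Lemma closed_subset_law d d' (T : measurableType d) (T' : measurableType d')
    (P : probability T R) (P' : probability T' R)
    (X : {RV P >-> closed_subset D}) (X' : {RV P' >-> closed_subset D}) :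
  (forall K, compact K -> P (X @^-1` misses K) = P' (X' @^-1` misses K)) ->
  same_law X X'.
Proof.
move=> H A mA.
apply: (measure_unique [set misses K | K in @compact R] (fun=> setT)) => //.
- exact: measurable_closed_subsetE.
- exact: setI_closed_misses.
- move=> _; exists set0; first exact: compact0.
  by apply/seteqP; split=> // F _; rewrite /misses /= setI0.
- by apply: bigcup_const; exists 0%N.
- by move=> _ [K cK <-]; exact: H.
- by move=> k; rewrite -ge0_fin_numE// fin_num_measure.
Qed.

(** A closed set that avoids a segment avoids a slightly larger one. With rational endpoints there
    are countably many candidates, so that missing a segment with random endpoints becomes an
    event. *)
Lemma misses_itvP F (a b : R) : a <= b -> misses `[a, b] F <->
  exists p q : rat, [/\ ratr p < a, b < ratr q & misses `[ratr p, ratr q] F].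
Proof.
move=> ab; split; last first.
  move=> [p [q [pa bq]]]; apply: misses_subset => x /=.
  by rewrite !in_itv /= => /andP[ax xb]; rewrite (le_trans (ltW pa) ax) (le_trans xb (ltW bq)).
move=> Fab; have Fab0 : F `&` `[a, b] = set0 by [].
have [e e0 He] := compact_closed_separated (@segment_compact R a b) (@cset_closed F) Fab.
have [p] := @rat_in_itvoo R (a - e) a ltac:(by rewrite ltrBlDr ltrDl).
rewrite in_itv/= => /andP[p1 p2].
have [q] := @rat_in_itvoo R b (b + e) ltac:(by rewrite ltrDl).
rewrite in_itv/= => /andP[q1 q2].
exists p, q; split=> //; apply/seteqP; split=> // x [Fx] /=.
rewrite in_itv /= => /andP[px xq].
have [xa|ax] := ltP x a.
  have := He a x _ Fx; rewrite /= in_itv /= lexx ab => /(_ isT).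
  rewrite ger0_norm; last by rewrite subr_ge0 ltW.
  rewrite leNgt => /negP; apply.
  by rewrite ltrBlDr -ltrBlDl (lt_le_trans p1).
have [bx|xb] := ltP b x.
  have := He b x _ Fx; rewrite /= in_itv /= lexx ab => /(_ isT).
  rewrite ler0_norm; last by rewrite subr_le0 ltW.
  rewrite opprB leNgt => /negP; apply.
  by rewrite ltrBlDl (le_lt_trans xq).
have : (F `&` `[a, b]) x by split=> //=; rewrite in_itv /= ax xb.
by rewrite Fab0.
Qed.

Lemma measurable_misses_itv d (T : measurableType d) (X : T -> closed_subset D)
    (a b : T -> R) :
  measurable_fun setT X -> measurable_fun setT a -> measurable_fun setT b ->
  measurable [set w | a w <= b w /\ misses `[a w, b w] (X w)].
Proof.
move=> mX ma mb.
rewrite (_ : [set w | _] = [set w | a w <= b w] `&`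
    \bigcup_(pq in @setT (rat * rat)) ([set w | ratr pq.1 < a w] `&`
       [set w | b w < ratr pq.2] `&` X @^-1` misses `[ratr pq.1, ratr pq.2])); last first.
  apply/seteqP; split=> w /= [ab H]; split=> //.
    by move: H => /(misses_itvP _ ab)[p [q [pa bq H]]]; exists (p, q).
  by apply/(misses_itvP _ ab); move: H => [[p q] _ [[pa bq] H]]; exists p, q.
have mle (f g : T -> R) : measurable_fun setT f -> measurable_fun setT g ->
    measurable [set w | f w <= g w].
  by move=> mf mg; rewrite -[X in measurable X]setTI; exact: measurable_fun_le.
have mlt (f g : T -> R) : measurable_fun setT f -> measurable_fun setT g ->
    measurable [set w | f w < g w].
  move=> mf mg; rewrite (_ : [set w | _] = ~` [set w | g w <= f w]).
    by apply: measurableC; exact: mle.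
  by apply/seteqP; split=> w /=; rewrite ltNge => /negP.
apply: measurableI; first exact: mle.
apply: countable_bigcupT_measurable; first exact: countableP.
move=> pq; apply: measurableI; first by apply: measurableI; apply: mlt.
rewrite -[X in measurable X]setTI; apply: mX => //.
by apply: measurable_misses_compact; exact: segment_compact.
Qed.

End miss_events.

(** * Sums over subsets *)

Section subsets.
Variable K : nat.
Implicit Types A B : {set 'I_K}.

Definition vals A : seq nat := [seq nat_of_ord i | i <- enum A].

Lemma size_vals A : size (vals A) = #|A|.
Proof. by rewrite size_map -cardE. Qed.

Lemma mem_vals A (i : 'I_K) : (nat_of_ord i \in vals A) = (i \in A).
Proof. by rewrite mem_map ?mem_enum//; exact: ord_inj. Qed.

Lemma vals_lt A k : k \in vals A -> (k < K)%N.
Proof. by move=> /mapP[i _ ->]. Qed.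

Lemma nth_vals_lt A i : (i < #|A|)%N -> (nth 0 (vals A) i < K)%N.
Proof. by move=> iA; apply: (@vals_lt A); rewrite mem_nth// size_vals. Qed.

Lemma sorted_vals A : sorted ltn (vals A).
Proof.
have : subseq (vals A) (iota 0 K).
  rewrite -val_enum_ord; apply: map_subseq.
  by rewrite /(enum A) enumT; exact: filter_subseq.
move=> /(subseq_sorted ltn_trans); apply; exact: iota_ltn_sorted.
Qed.

Lemma nth_vals_mono A i j : (i < j < #|A|)%N ->
  (nth 0 (vals A) i < nth 0 (vals A) j)%N.
Proof.
move=> ij; have := sorted_vals A; rewrite sorted_pairwise; last exact: ltn_trans.
by move=> /(pairwiseP 0%N); apply; rewrite ?inE ?size_vals; lia.
Qed.

Lemma vals_unique A s : sorted ltn s -> (forall k, k \in s = (k \in vals A)) ->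
  s = vals A.
Proof.
by move=> ss H; apply: (irr_sorted_eq ltn_trans ltnn) => //; exact: sorted_vals.
Qed.

End subsets.

Lemma vals_setD1 K (A : {set 'I_K}) (k : 'I_K) i : k \in A ->
  nth 0 (vals (A :\ k)%SET) i = nth 0 (vals A) (bump (index k (enum A)) i).
Proof.
move=> kA; set y := index k (enum A).
have yA : (y < size (vals A))%N by rewrite size_map index_mem mem_enum.
have ny : nth 0 (vals A) y = k.
  by rewrite (nth_map k) ?nth_index ?mem_enum// -(size_map (@nat_of_ord K)).
rewrite -(@vals_unique _ _ (take y (vals A) ++ drop y.+1 (vals A))).
- rewrite nth_cat size_take yA /bump; case: ltnP => iy.
    by rewrite nth_take.
  by rewrite nth_drop add1n addSn subnKC.
- apply: (subseq_sorted ltn_trans) (sorted_vals A).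
  rewrite -[X in subseq _ X](cat_take_drop y) cat_subseq//.
  by rewrite (drop_nth 0%N yA) subseq_cons.
- have := sorted_uniq ltn_trans ltnn (sorted_vals A).
  rewrite -{1}[vals A](cat_take_drop y) (drop_nth 0%N yA) ny => u_A j.
  have -> : (j \in vals (A :\ k)%SET) = (j != k :> nat) && (j \in vals A).
    apply/idP/andP.
      move=> jA; have jK := vals_lt jA; move: jA.
      by rewrite -[j]/(nat_of_ord (Ordinal jK)) !mem_vals !inE => /andP[].
    move=> [jk jA]; have jK := vals_lt jA; move: jk jA.
    rewrite -[j]/(nat_of_ord (Ordinal jK)) !mem_vals !inE => jk ->.
    by rewrite andbT.
  rewrite -{3}[vals A](cat_take_drop y) (drop_nth 0%N yA) ny.
  rewrite !mem_cat inE; move: u_A; rewrite cat_uniq /= negb_or.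
  have [->|jk] := eqVneq j k => //=.
  by move=> /and3P[_ /andP[/negbTE -> _] /andP[/negbTE -> _]].
Qed.

Section subset_sums.
Context (R : realType).
Implicit Types (v : (nat -> nat) -> R).

Definition vsum v n K : R :=
  \sum_(A : {set 'I_K} | #|A| == n) v (nth 0 (vals A)).

(** A subset enters through its increasing enumeration, which [nth] continues by 0. Comparing sums
    over subsets of different sizes requires that [v] ignore this padding. *)
Definition local v n := forall a b, (forall i, (i < n)%N -> a i = b i) -> v a = v b.

(** Double counting of the pairs formed by an (n+1)-subset and one of its elements: [bump y] skips
    the element of rank y, and each n-subset is reached from the K - n elements outside it. *)
Lemma vsum_remove v n K : local v n ->
  \sum_(y < n.+1) vsum (fun a => v (fun i => a (bump y i))) n.+1 K =
  (K - n)%:R * vsum v n K.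
Proof.
move=> lv; rewrite /vsum exchange_big /=.
transitivity (\sum_(A : {set 'I_K} | #|A| == n.+1)
    \sum_(k in A) v (nth 0 (vals (A :\ k)%SET))).
  apply: eq_bigr => A /eqP An.
  rewrite [RHS]big_enum_val /= [RHS](reindex (cast_ord (esym An))) /=; last first.
    by exists (cast_ord An) => y _; rewrite ?cast_ordK ?cast_ordKV.
  apply: eq_bigr => y _; apply: lv => i _.
  rewrite vals_setD1 ?enum_valP//; congr (nth _ _ (bump _ _)).
  rewrite /enum_val index_uniq ?enum_uniq//.
  by rewrite -cardE.
rewrite (exchange_big_dep xpredT)//= big_distrr /=.
under [LHS]eq_bigr => k _.
  rewrite (reindex_onto (fun B => k |: B) (fun A => A :\ k))/=; last first.
    by move=> A /andP[_ kA]; rewrite finset.setD1K.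
  rewrite (eq_bigl (fun B : {set 'I_K} => (#|B| == n) && (k \notin B))); last first.
    move=> B; rewrite setU11 andbT.
    have [kB|kB] := boolP (k \in B); rewrite ?andbF ?andbT.
      apply/negbTE/negP => /andP[_ /eqP E].
      by move: kB; rewrite -E !inE eqxx.
    by rewrite cardsU1 kB setU1K// eqxx andbT add1n eqSS.
  rewrite (eq_bigr (fun B => v (nth 0 (vals B)))); last first.
    by move=> B /andP[_ kB]; rewrite setU1K.
  over.
rewrite /= (exchange_big_dep (fun B : {set 'I_K} => #|B| == n)) /=; last first.
  by move=> k B _ /andP[].
apply: eq_bigr => B Bn.
rewrite (eq_bigl (mem (~: B)%SET)); last by move=> k; rewrite /= inE Bn.
by rewrite sumr_const cardsCs finset.setCK card_ord (eqP Bn) mulr_natl.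
Qed.

Lemma vals_bump K (y : 'I_K.+1) (A : {set 'I_K}) :
  vals [set lift y i | i in A]%SET = [seq bump y i | i <- vals A].
Proof.
symmetry; apply: vals_unique.
  apply: (homo_sorted (e := ltn)); last exact: sorted_vals.
  by move=> i j /=; rewrite /bump; lia.
move=> k; apply/mapP/idP.
  move=> [i iA ->]; have iK := vals_lt iA.
  rewrite -[bump y i]/(nat_of_ord (lift y (Ordinal iK))) mem_vals imset_f//.
  by rewrite -mem_vals.
move=> kA; have kK := vals_lt kA; move: kA.
rewrite -[k]/(nat_of_ord (Ordinal kK)) mem_vals => /imsetP[i iA ->].
by exists (nat_of_ord i); rewrite // (@mem_vals K).
Qed.

Lemma vals_lift K (A : {set 'I_K}) :
  vals [set lift ord_max i | i in A]%SET = vals A.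
Proof.
rewrite vals_bump -[RHS]map_id; apply/eq_in_map => i /vals_lt iK.
by rewrite /bump /= leqNgt iK.
Qed.

(** Double counting of the pairs formed by an n-subset of K + 1 places and a place y outside it:
    removing y renumbers the other places, and [bump y] undoes this. Each subset leaves K + 1 - n
    choices of y. *)
Lemma vsum_insert v n K : local v n ->
  \sum_(y < K.+1) \sum_(B : {set 'I_K} | #|B| == n)
    v (fun i => bump y (nth 0 (vals B) i)) = (K.+1 - n)%:R * vsum v n K.+1.
Proof.
move=> lv; rewrite /vsum.
transitivity (\sum_(y < K.+1) \sum_(A : {set 'I_K.+1} | (#|A| == n) && (y \notin A))
    v (nth 0 (vals A))).
  apply: eq_bigr => y _.
  rewrite [RHS](reindex_onto (fun B : {set 'I_K} => [set lift y i | i in B]%SET)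
    (fun A => [set i | lift y i \in A]%SET)) /=; last first.
    move=> A /andP[_ yA]; apply/setP => i; apply/imsetP/idP.
      by move=> [j]; rewrite inE => jA ->.
    move=> iA; have [j jE|E] := unliftP y i.
      by exists j; rewrite // inE -jE.
    by rewrite -E iA in yA.
  apply: eq_big => [B|B /eqP Bn].
    rewrite card_imset; last exact: lift_inj.
    rewrite (_ : y \notin _); last first.
      by apply/imsetP => -[j _ /eqP]; rewrite (negbTE (neq_lift y j)).
    rewrite andbT (_ : (_ == B) = true) ?andbT//.
    apply/eqP/setP => i; rewrite inE; apply/imsetP/idP => [[j jB /lift_inj ->//]|iB].
    by exists i.
  by apply: lv => i ni; rewrite vals_bump (nth_map 0) ?size_vals ?Bn.
rewrite (exchange_big_dep (fun A : {set 'I_K.+1} => #|A| == n)) /=; last first.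
  by move=> y A _ /andP[].
rewrite big_distrr /=; apply: eq_bigr => A An.
rewrite (eq_bigl (mem (~: A)%SET)); last by move=> y; rewrite /= inE An.
by rewrite sumr_const cardsCs finset.setCK card_ord (eqP An) mulr_natl.
Qed.

Lemma vals_lift_max K (A : {set 'I_K}) :
  vals (ord_max |: [set lift ord_max i | i in A])%SET = rcons (vals A) K.
Proof.
symmetry; apply: vals_unique.
  have := sorted_vals A; rewrite !sorted_pairwise; try exact: ltn_trans.
  rewrite -cats1 pairwise_cat => ->; rewrite /= !andbT.
  by apply/allrelP => i j iA; rewrite inE => /eqP ->; exact: vals_lt iA.
move=> k; rewrite mem_rcons inE; apply/idP/idP.
  move=> /orP[/eqP ->|kA].
    by rewrite -[K]/(nat_of_ord (@ord_max K)) mem_vals setU11.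
  have kK := vals_lt kA.
  have -> : k = lift ord_max (Ordinal kK) by rewrite lift_max.
  rewrite mem_vals !inE imset_f ?orbT//.
  by rewrite -mem_vals.
move=> kA; have kK := vals_lt kA; move: kA.
rewrite -[k]/(nat_of_ord (Ordinal kK)) mem_vals !inE => /orP[/eqP -> /=|].
  by rewrite eqxx.
by move=> /imsetP[i iA ->]; rewrite lift_max mem_vals iA orbT.
Qed.

(** The (n+1)-subsets are sorted by their largest element b: the other n elements form a subset of
    the places below b, and [v] does not see b. *)
Lemma vsum_last v n K : local v n -> vsum v n.+1 K = \sum_(b < K) vsum v n b.
Proof.
move=> lv; elim: K => [|K IH].
  rewrite big_ord0 /vsum big_pred0// => A.
  apply/negbTE; rewrite neq_ltn ltnS.
  by rewrite (leq_trans (max_card _))// card_ord.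
rewrite big_ord_recr /= -IH {1}/vsum (bigID (fun A : {set 'I_K.+1} => ord_max \in A)) /=.
rewrite addrC; congr +%R.
- rewrite (reindex_onto (fun B : {set 'I_K} => [set lift ord_max i | i in B]%SET)
    (fun A => [set i | lift ord_max i \in A]%SET)) /=; last first.
    move=> A /andP[_ mA]; apply/setP => i; apply/imsetP/idP.
      by move=> [j]; rewrite inE => jA ->.
    move=> iA; have [j jE|E] := unliftP ord_max i.
      by exists j; rewrite // inE -jE.
    by rewrite -E iA in mA.
  apply: eq_big => [B|B _]; last by rewrite vals_lift.
  rewrite card_imset; last exact: lift_inj.
  rewrite (_ : ord_max \notin _); last first.
    apply/imsetP => -[j _ /(congr1 (@nat_of_ord _))]; rewrite lift_max /=.
    by have := ltn_ord j; rewrite /=; lia.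
  rewrite andbT (_ : (_ == B) = true) ?andbT//.
  apply/eqP/setP => i; rewrite inE; apply/imsetP/idP => [[j jB /lift_inj ->//]|iB].
  by exists i.
- rewrite (reindex_onto (fun B : {set 'I_K} => ord_max |: [set lift ord_max i | i in B])%SET
    (fun A => [set i | lift ord_max i \in A]%SET)) /=; last first.
    move=> A /andP[_ mA]; apply/setP => i; rewrite !inE.
    apply/orP/idP => [[/eqP -> //|/imsetP[j]]|iA].
      by rewrite inE => jA ->.
    have [j jE|E] := unliftP ord_max i; last by left; apply/eqP.
    by right; apply/imsetP; exists j; rewrite // inE -jE.
  have nm (B : {set 'I_K}) : ord_max \notin [set lift ord_max i | i in B]%SET.
    apply/imsetP => -[j _ /(congr1 (@nat_of_ord _))]; rewrite lift_max /=.
    by have := ltn_ord j; rewrite /=; lia.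
  rewrite (eq_bigl (fun B : {set 'I_K} => #|B| == n)); last first.
    move=> B; rewrite cardsU1 nm card_imset; last exact: lift_inj.
    rewrite setU11 add1n eqSS andbT (_ : (_ == B) = true) ?andbT//.
    apply/eqP/setP => i; rewrite !inE; apply/orP/idP => [[/eqP|]|iB].
    - move=> /(congr1 (@nat_of_ord _)); rewrite lift_max /=.
      by have := ltn_ord i; rewrite /=; lia.
    - by move=> /imsetP[j jB /lift_inj ->].
    - by right; apply/imsetP; exists i.
  apply: eq_bigr => B /eqP Bn; apply: lv => i iN.
  by rewrite vals_lift_max nth_rcons size_vals Bn iN.
Qed.

Lemma vsum1 n K : vsum (fun=> 1) n K = 'C(K, n)%:R.
Proof.
rewrite /vsum sumr_const -[in RHS](card_ord K) -cardsT -cards_draws.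
congr (_%:R); apply: eq_card => A; rewrite !inE.
by rewrite finset.subsetT.
Qed.

Lemma bin_sum_ord n K : 'C(K, n.+1)%:R = \sum_(b < K) 'C(b, n)%:R :> R.
Proof. by rewrite -vsum1 vsum_last//; apply: eq_bigr => b _; rewrite vsum1. Qed.

(** A linear lower bound is all that the Cesaro argument needs to know about the growth of the
    denominator. *)
Lemma leq_sub_bin n K : (K - n <= 'C(K, n.+1))%N.
Proof.
elim: K => [//|K IH]; rewrite binS.
have [nK|Kn] := leqP n K; last by rewrite (_ : K.+1 - n = 0)%N//; lia.
have : (0 < 'C(K, n))%N by rewrite bin_gt0.
lia.
Qed.

Lemma inv_nat_cvg0 : (k%:R^-1 : R) @[k --> \oo] --> (0 : R).
Proof.
apply/cvgrPdist_le => e e0; near=> k.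
have k0 : (0 : R) < k%:R by rewrite ltr0n; near: k; exact: nbhs_infty_gt.
rewrite sub0r normrN ger0_norm ?invr_ge0 ?ler0n//.
rewrite -[e]invrK lef_pV2 ?posrE ?invr_gt0//.
by near: k; exact: nbhs_infty_ger.
Unshelve. all: by end_near. Qed.

(* The Stolz-Cesaro theorem for the weights [b |-> 'C(b, n)]. *)
Lemma cesaro_bin n (s : nat -> R) (L : R) :
  s b / 'C(b, n)%:R @[b --> \oo] --> L ->
  (\sum_(b < K) s b) / 'C(K, n.+1)%:R @[K --> \oo] --> L.
Proof.
move=> /cvgrPdist_le sL; apply/cvgrPdist_le => e e0.
have e20 : 0 < e / 2 by rewrite divr_gt0.
have [b0 _ Hb0] := sL _ e20.
pose b1 := maxn b0 n.
have Hb b : (b1 <= b)%N -> `|L * 'C(b, n)%:R - s b| <= e / 2 * 'C(b, n)%:R.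
  rewrite geq_max => /andP[b0b nb].
  have C0 : (0 : R) < 'C(b, n)%:R by rewrite ltr0n bin_gt0.
  rewrite -ler_pdivrMr// -[X in _ / X](gtr0_norm C0) -normf_div mulrBl mulfK ?gt_eqF//.
  exact: Hb0.
pose M := \sum_(b < b1) `|L * 'C(b, n)%:R - s b|.
have M0 : 0 <= M by apply: sumr_ge0.
near=> K.
have Kn : (n < K)%N by near: K; exact: nbhs_infty_gt.
have b1K : (b1 <= K)%N by near: K; exact: nbhs_infty_ge.
have C0 : (0 : R) < 'C(K, n.+1)%:R by rewrite ltr0n bin_gt0.
rewrite -[X in `|X - _|](mulfK (lt0r_neq0 C0)) -mulrBl normf_div (gtr0_norm C0).
rewrite ler_pdivrMr//.
have step1 : `|L * 'C(K, n.+1)%:R - \sum_(b < K) s b| <=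
    M + e / 2 * 'C(K, n.+1)%:R.
  rewrite bin_sum_ord !mulr_sumr -sumrB (le_trans (ler_norm_sum _ _ _))//.
  rewrite -(subnKC b1K) big_split_ord /= lerD//.
  rewrite big_split_ord /=; apply: (@le_trans _ _
     (\sum_(b < K - b1) e / 2 * 'C(b1 + b, n)%:R)).
    by apply: ler_sum => b _; apply: Hb; rewrite leq_addr.
  by rewrite lerDr; apply: sumr_ge0 => b _; rewrite mulr_ge0 ?ler0n// ltW.
rewrite (le_trans step1)// [X in _ <= X * _](splitr e) mulrDl lerD2r.
rewrite mulrC -ler_pdivrMr//.
apply: (@le_trans _ _ (K - n)%:R); last by rewrite ler_nat leq_sub_bin.
rewrite natrB; last exact: ltnW.
by rewrite lerBrDr; near: K; exact: nbhs_infty_ger.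
Unshelve. all: by end_near. Qed.

Lemma ffact_ratio_cvg1 n : (K ^_ n)%:R / K%:R ^+ n @[K --> \oo] --> (1 : R).
Proof.
elim: n => [|n IH].
  apply: cvg_near_cst; near=> K.
  by rewrite ffactn0 expr0 divr1.
have H : 1 - n%:R * K%:R^-1 @[K --> \oo] --> (1 - n%:R * 0 : R).
  by apply: cvgB; [exact: cvg_cst|apply: cvgMr; exact: inv_nat_cvg0].
rewrite mulr0 subr0 in H.
have H2 := cvgM IH H; rewrite mulr1 in H2.
apply: (cvg_trans _ (H2 _)); apply: near_eq_cvg.
near=> K.
have Kn : (n < K)%N by near: K; exact: nbhs_infty_gt.
rewrite ffactnSr exprSr natrM natrB; last exact: ltnW.
have K0 : K%:R != 0 :> R by rewrite pnatr_eq0; lia.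
have Y0 : (K%:R : R) ^+ n != 0 by rewrite expf_neq0.
rewrite /=; move: Y0; set Y := K%:R ^+ n => Y0.
by field; rewrite K0 Y0.
Unshelve. all: by end_near. Qed.

End subset_sums.

(** * Grid approximation of gaps *)

Section bands.
Context (R : realType).
Implicit Types (f g : nat -> R) (D : seq (nat * nat)) (a : nat -> nat).

Definition bands f g D : set R :=
  [set t | exists2 p, p \in D & f p.1 <= t <= g p.2].

Definition open_bands f g D : set R :=
  [set t | exists2 p, p \in D & f p.1 < t < g p.2].

(* For points lying in the cells [a i] of a grid of step [d], [hull] and [inner]
   approximate the union of the gaps listed in [D] from outside and inside. *)
Definition hull (d : R) a := bands (fun i => (a i)%:R * d) (fun i => (a i).+1%:R * d).
Definition inner (d : R) a := open_bands (fun i => (a i).+1%:R * d) (fun i => (a i)%:R * d).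

Definition cell (d : R) (k : nat) : set R := `[k%:R * d, k.+1%:R * d[%classic.

Lemma compact_bands f g D : compact (bands f g D).
Proof.
elim: D => [|p D IH].
  rewrite (_ : bands f g [::] = set0); first exact: compact0.
  by apply/seteqP; split=> // t [].
rewrite (_ : bands f g (p :: D) = `[f p.1, g p.2]%classic `|` bands f g D).
  by apply: compactU => //; exact: segment_compact.
apply/seteqP; split=> t.
  move=> [q]; rewrite inE => /orP[/eqP ->|qD] ft; first by left; rewrite /= in_itv.
  by right; exists q.
move=> [|[q qD ft]]; last by exists q; rewrite // inE qD orbT.
by rewrite /= in_itv /= => ft; exists p; rewrite ?mem_head.
Qed.

Lemma open_open_bands f g D : open (open_bands f g D).
Proof.
rewrite (_ : open_bands f g D = \bigcup_(p in [set` D]) `]f p.1, g p.2[%classic).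
  by apply: bigcup_open => p _; exact: interval_open.
by apply/seteqP; split=> t [p pD ft]; exists p => //; move: ft; rewrite /= in_itv.
Qed.

Lemma cell_inj d k l t : 0 < d -> cell d k t -> cell d l t -> k = l.
Proof.
move=> d0; rewrite /cell /= !in_itv /= => /andP[k1 k2] /andP[l1 l2].
have := le_lt_trans k1 l2; have := le_lt_trans l1 k2.
rewrite !ltr_pM2r// !ltr_nat; lia.
Qed.

Lemma cell_truncn d t : 0 < d -> 0 <= t -> cell d (Num.truncn (t / d)) t.
Proof.
move=> d0 t0; rewrite /cell /= in_itv /= -ler_pdivlMr// -ltr_pdivrMr//.
by apply/andP; split; [rewrite truncn_le// divr_ge0// ltW|exact: truncnS_gt].
Qed.

Lemma cell_truncnE d k t : 0 < d -> cell d k t -> Num.truncn (t / d) = k.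
Proof.
move=> d0 kt; apply: (cell_inj d0 _ kt); apply: cell_truncn => //.
move: kt; rewrite /cell /= in_itv /= => /andP[+ _]; apply: le_trans.
by rewrite mulr_ge0// ltW.
Qed.

Lemma cell_measurable d k : measurable (cell d k).
Proof. exact: measurable_itv. Qed.

Lemma min_gap n (u : nat -> R) :
  (forall i j, (i < n)%N -> (j < n)%N -> u i = u j -> i = j) ->
  exists2 e : R, 0 < e & forall i j, (i < n)%N -> (j < n)%N -> i != j ->
    e <= `|u i - u j|.
Proof.
move=> uinj.
exists (\big[Num.min/1]_(p : 'I_n * 'I_n | p.1 != p.2) `|u p.1 - u p.2|).
  apply: lt_bigmin => // -[i j] /= ij; rewrite normr_gt0 subr_eq0.
  by apply: contraNneq ij => /uinj ij; apply/eqP/ord_inj/ij.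
move=> i j ni nj ij.
apply: (@bigmin_le_cond _ _ _ _ (Ordinal ni, Ordinal nj) _
  (fun p : 'I_n * 'I_n => `|u p.1 - u p.2|)) => /=.
by rewrite -val_eqE.
Qed.

Section approximation.
Variables (F : set R) (cF : closed F) (n : nat) (x : nat -> R).
Variables (D : seq (nat * nat)) (Dn : places_below n D).

Lemma gaps_sub_hull d a : (forall i, (i < n)%N -> cell d (a i) (x i)) ->
  gaps x D `<=` hull d a D.
Proof.
move=> ax t [p pD /andP[pt tp]]; exists p => //.
have /andP[p12 p2] := allP Dn p pD; have p1 := ltn_trans p12 p2.
have := ax _ p1; have := ax _ p2; rewrite /cell /= !in_itv /=.
move=> /andP[_ h2] /andP[h1 _].
by rewrite (le_trans h1 pt) (le_trans tp (ltW h2)).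
Qed.

Lemma inner_sub_gaps d a : (forall i, (i < n)%N -> cell d (a i) (x i)) ->
  inner d a D `<=` open_bands x x D.
Proof.
move=> ax t [p pD /andP[pt tp]]; exists p => //.
have /andP[p12 p2] := allP Dn p pD; have p1 := ltn_trans p12 p2.
have := ax _ p1; have := ax _ p2; rewrite /cell /= !in_itv /=.
move=> /andP[h1 _] /andP[_ h2].
by rewrite (lt_trans h2 pt) (lt_le_trans tp h1).
Qed.

(** The closed set F is at a distance at least e from the compact union of the gaps, while every
    point of the hull is within the mesh d of that union. *)
Lemma miss_gaps_hull : F `&` gaps x D = set0 ->
  exists2 e : R, 0 < e & forall d a, 0 < d -> d < e ->
    (forall i, (i < n)%N -> cell d (a i) (x i)) ->
    (forall p, p \in D -> x p.1 <= x p.2) ->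
    F `&` hull d a D = set0.
Proof.
move=> FD.
have [e e0 He] := compact_closed_separated (@compact_bands x x D) cF FD.
exists e => // d a d0 de ax xx.
apply/seteqP; split=> // t [Ft [p pD /andP[pt tp]]].
have /andP[p12 p2] := allP Dn p pD; have p1 := ltn_trans p12 p2.
have := ax _ p1; have := ax _ p2; rewrite /cell /= !in_itv /=.
move=> /andP[h1 _] /andP[_ h2].
have pp := xx p pD.
have t1 : x p.1 - d < t.
  rewrite ltrBlDr (lt_le_trans h2)// -natr1 mulrDl mul1r lerD2r//.
have t2 : t <= x p.2 + d.
  by rewrite (le_trans tp)// -natr1 mulrDl mul1r lerD2r.
have [xt|tx] := leP (x p.1) t; last first.
  have := He (x p.1) t _ Ft; rewrite leNgt.
  rewrite gtr0_norm ?subr_gt0// => H.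
  have /negP := H ltac:(by exists p; rewrite // lexx pp); apply.
  by rewrite (lt_trans _ de)// ltrBlDr -ltrBlDl.
have [tx|xt'] := leP t (x p.2).
  have : (F `&` gaps x D) t by split=> //; exists p => //; rewrite xt tx.
  by rewrite FD.
have := He (x p.2) t _ Ft; rewrite leNgt.
rewrite ltr0_norm ?subr_lt0// opprB => H.
have /negP := H ltac:(by exists p; rewrite // lexx pp); apply.
by rewrite (le_lt_trans _ de)// lerBlDl.
Qed.

(** A point strictly inside a gap stays inside the inner gap as soon as the mesh is smaller than its
    distances to both ends. *)
Lemma hit_gaps_inner t : F t -> open_bands x x D t ->
  exists2 e : R, 0 < e & forall d a, 0 < d -> d < e ->
    (forall i, (i < n)%N -> cell d (a i) (x i)) -> inner d a D t.
Proof.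
move=> Ft [p pD /andP[pt tp]].
have /andP[p12 p2] := allP Dn p pD; have p1 := ltn_trans p12 p2.
exists (Num.min (t - x p.1) (x p.2 - t)).
  by rewrite lt_min !subr_gt0 pt tp.
move=> d a d0; rewrite lt_min => /andP[d1 d2] ax; exists p => //.
have := ax _ p1; have := ax _ p2; rewrite /cell /= !in_itv /=.
move=> /andP[_ h1] /andP[h2 _].
apply/andP; split.
  rewrite -natr1 mulrDl mul1r (@le_lt_trans _ _ (x p.1 + d)) ?lerD2r//.
  by rewrite -ltrBrDl.
move: h1; rewrite -natr1 mulrDl mul1r -ltrBlDr; apply: lt_trans.
by rewrite ltrBrDl -ltrBrDr.
Qed.

End approximation.

(** Truncation to the grid is nondecreasing, so when the points occupy distinct cells it commutes
    with sorting. *)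
Lemma sorted_cells K n (u : nat -> R) (f : {ffun 'I_n -> 'I_K}) d : 0 < d ->
  injective f -> (forall i : 'I_n, cell d (f i) (u i)) ->
  forall l, (l < n)%N ->
  cell d (nth 0%N (vals (f @: [set: 'I_n])%SET) l)
    (nth 0 (sort <=%R [seq u i | i <- iota 0 n]) l).
Proof.
move=> d0 finj fu l ln.
set xs := sort _ _.
have szx : size xs = n by rewrite size_sort size_map size_iota.
pose g t := Num.truncn (t / d).
have gE (i : 'I_n) : g (u i) = f i by exact: cell_truncnE.
have -> : vals (f @: [set: 'I_n])%SET = [seq g t | t <- xs].
  apply: (sorted_eq leq_trans anti_leq).
  - apply: (@sub_sorted _ ltn leq); last exact: sorted_vals.
    by move=> i j /ltnW.
  - apply: (@homo_sorted _ _ g <=%R leq); last exact: sort_le_sorted.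
    by move=> s t st; apply: le_truncn; rewrite ler_pM2r// invr_gt0.
  - rewrite perm_sym (perm_trans (perm_map g (permEl (perm_sort _ _))))//.
    rewrite -map_comp -val_enum_ord -map_comp; apply: uniq_perm.
    + rewrite (eq_map (g := fun i => nat_of_ord (f i))); last by move=> i; exact: gE.
      by rewrite map_inj_uniq ?enum_uniq// => i j /ord_inj/finj.
    + by apply: (sorted_uniq ltn_trans ltnn); exact: sorted_vals.
    + move=> k; apply/mapP/idP => [[i _ ->]|kf].
        by rewrite /= gE mem_vals imset_f.
      have kK := vals_lt kf; move: kf.
      rewrite -[k]/(nat_of_ord (Ordinal kK)) mem_vals => /imsetP[i _ ->].
      by exists i; rewrite ?mem_enum//= gE.
rewrite (nth_map 0) ?szx//; apply: cell_truncn => //.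
have /mapP[i] : nth 0 xs l \in [seq u i | i <- iota 0 n].
  by rewrite -(mem_sort <=%R) mem_nth// szx.
rewrite mem_iota add0n => /= ni ->.
have := fu (Ordinal ni); rewrite /cell /= in_itv /= => /andP[+ _].
by apply: le_trans; rewrite mulr_ge0// ltW.
Qed.

End bands.

(** Each n-subset is the image of exactly n! injections. *)
Lemma sum_injective_image (R : nmodType) (n K : nat) (G : {set 'I_K} -> R) :
  \sum_(f : {ffun 'I_n -> 'I_K} | injectiveb f) G (f @: [set: 'I_n])%SET =
  (\sum_(A : {set 'I_K} | #|A| == n) G A) *+ n`!.
Proof.
rewrite (partition_big (fun f : {ffun 'I_n -> 'I_K} => (f @: [set: 'I_n])%SET)
  (fun A => #|A| == n)) /=; last first.
  by move=> f /injectiveP finj; rewrite card_imset// cardsT card_ord.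
rewrite -sumrMnl; apply: eq_bigr => A /eqP An.
rewrite (eq_bigr (fun=> G A)); last by move=> f /andP[_ /eqP ->].
rewrite sumr_const; congr (_ *+ _).
have := card_inj_ffuns_on 'I_n (mem A).
rewrite card_ord An ffactnn => <-.
apply: eq_card => f; rewrite !inE andbC; apply/andP/andP => [[finj fA]|[finj fA]]; split=> //.
  by apply/ffun_onP => i; rewrite -(eqP fA) imset_f.
rewrite finset.eqEcard; apply/andP; split.
  by apply/fintype.subsetP => _ /imsetP[i _ ->]; exact: (forallP fA).
by rewrite An card_imset ?cardsT ?card_ord//; exact/injectiveP.
Qed.

(** * Sampling in cells *)

Section uniform01.
Context (R : realType).

Lemma uniform_prob01 (A : set R) : measurable A ->
  uniform_prob (@ltr01 R) A = lebesgue_measure (A `&` `[0, 1]).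
Proof.
move=> mA; transitivity (\int[uniform_prob (@ltr01 R)]_x (\1_A x)%:E)%E.
  by rewrite integral_indic// setIT.
rewrite integral_uniform//; last first.
  by apply/measurable_EFinP; exact: measurable_indic.
by rewrite subr0 invr1 mul1e integral_indic.
Qed.

Lemma uniform_prob_itv (a b : R) : 0 <= a -> a <= b -> b <= 1 ->
  uniform_prob (@ltr01 R) `[a, b[ = (b - a)%:E.
Proof.
move=> a0 ab b1; rewrite uniform_prob01// setIidl; last first.
  move=> x /=; rewrite !in_itv /= => /andP[ax xb].
  by rewrite (le_trans a0 ax) (le_trans (ltW xb)).
rewrite lebesgue_measure_itv /= lte_fin; case: ltgtP ab => // -> _.
by rewrite subrr.
Qed.

Lemma uniform_prob_cell K k : (k < K)%N ->
  uniform_prob (@ltr01 R) (cell K%:R^-1 k) = (K%:R^-1)%:E.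
Proof.
move=> kK; have K0 : 0 < K%:R :> R by rewrite ltr0n; lia.
rewrite uniform_prob_itv.
- by rewrite -mulrBl -natrB// subSnn mul1r.
- by rewrite mulr_ge0// invr_ge0 ltW.
- by rewrite ler_pM2r ?invr_gt0// ler_nat.
- by rewrite ler_pdivrMr// mul1r ler_nat.
Qed.

End uniform01.

Section iid_uniform_cells.
Context d (T : measurableType d) (R : realType) (P : probability T R).
Variable U : nat -> {RV P >-> R}.
Hypothesis Uunif : forall i A, measurable A ->
  distribution P (U i) A = uniform_prob (@ltr01 R) A.
Hypothesis Uindep : mutually_independent U.

Definition in_cells n K (f : 'I_n -> 'I_K) : set T :=
  [set w | forall i : 'I_n, cell K%:R^-1 (f i) (U i w)].

Lemma measurable_in_cells n K (f : 'I_n -> 'I_K) : measurable (in_cells f).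
Proof.
rewrite (_ : in_cells f =
    \bigcap_(i in [set: 'I_n]) (U i @^-1` cell K%:R^-1 (f i))); last first.
  by apply/seteqP; split=> w H i; [move=> _|]; exact: H.
apply: fin_bigcap_measurable; first exact: finite_finset.
move=> i _; rewrite -[X in measurable X]setTI.
by apply: measurable_funP => //; exact: cell_measurable.
Qed.

Lemma in_cellsE n K (f : 'I_n -> 'I_K) : exists2 A : nat -> set R,
  (forall i, measurable (A i)) /\ (forall i : 'I_n, A i = cell K%:R^-1 (f i)) &
  in_cells f = \bigcap_(i in [set` [fset i | i in iota 0 n]%fset]) (U i @^-1` A i).
Proof.
exists (fun i => if insub i is Some j then cell K%:R^-1 (f j) else setT).
  split=> [i|i]; first by case: insubP => [j _ _|_]; [exact: cell_measurable|].
  by rewrite valK.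
apply/seteqP; split=> w H i.
  rewrite /= !inE /= mem_iota add0n => /= ni.
  by rewrite insubT /=; exact: H.
have := H i; rewrite /= valK; apply.
by rewrite !inE /= mem_iota add0n ltn_ord.
Qed.

Lemma pr_in_cells n K (f : 'I_n -> 'I_K) : pr P (in_cells f) = K%:R^-1 ^+ n.
Proof.
have [A [mA Af] ->] := in_cellsE f.
rewrite /pr Uindep// -[RHS]/(fine (K%:R^-1 ^+ n)%:E); congr fine.
have -> : (\big[*%E/1%E]_(i <- [fset i | i in iota 0 n]%fset) P (U i @^-1` A i) =
    \big[*%E/1%E]_(i <- iota 0 n) P (U i @^-1` A i))%E.
  apply: perm_big; apply: uniq_perm; rewrite ?iota_uniq//.
  by move=> i; rewrite !inE.
rewrite -val_enum_ord big_map.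
rewrite (eq_bigr (fun=> (K%:R^-1)%:E)); last first.
  move=> i _; have := Uunif i (mA i); rewrite /distribution /pushforward => ->.
  by rewrite Af uniform_prob_cell.
by rewrite big_const_seq count_predT size_enum_ord; elim: n {f Af} => //= n ->; rewrite exprS.
Qed.

Definition good_points n : set T :=
  [set w | forall i j, (i < n)%N -> (j < n)%N ->
     0 <= U i w < 1 /\ (U i w = U j w -> i = j)].

Let mUpre i (A : set R) : measurable A -> measurable (U i @^-1` A).
Proof. by move=> mA; rewrite -[X in measurable X]setTI; apply: measurable_funP. Qed.

Let measurable_tie i j : measurable [set w | U i w = U j w].
Proof.
rewrite (_ : [set w | _] = [set w | U i w == U j w]); last first.
  by apply/seteqP; split=> w /= /eqP.
by apply: measurable_bool_set; apply: measurable_fun_eqr; exact: measurable_funP.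
Qed.

Let good (n : nat) (p : 'I_n * 'I_n) := (if p.1 == p.2 then setT
  else ~` [set w | U p.1 w = U p.2 w]) `&` (U p.1 @^-1` `[0, 1[).

Let measurable_good n p : measurable (@good n p).
Proof.
apply: measurableI; last exact: mUpre.
by case: ifPn => // _; apply: measurableC; exact: measurable_tie.
Qed.

Let good_pointsE n : good_points n = [set w | forall p, @good n p w].
Proof.
apply/seteqP; split=> w H.
  move=> [i j]; have [H1 H2] := H i j (ltn_ord i) (ltn_ord j).
  split; last by rewrite /= in_itv.
  by rewrite /=; case: eqVneq => // ij /= /H2 /ord_inj; exact/eqP.
move=> i j ni nj; have [H2 H1] := H (Ordinal ni, Ordinal nj).
split; first by move: H1; rewrite /= in_itv.
by move: H2; rewrite /= -val_eqE /=; case: eqVneq.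
Qed.

Lemma measurable_good_points n : measurable (good_points n).
Proof.
by rewrite good_pointsE; apply: measurable_forall => p; exact: measurable_good.
Qed.

Let pr_unit i : pr P (U i @^-1` `[0, 1[) = 1.
Proof.
rewrite /pr; have := Uunif i (measurable_itv `[0, 1[).
by rewrite /distribution /pushforward uniform_prob_itv// subr0 => ->.
Qed.

(** Tied points of [0, 1[ share a cell of every grid. For K cells this has probability K times K^-2,
    which tends to 0. *)
Let pr_tie i j : i != j -> pr P [set w | U i w = U j w] = 0.
Proof.
move=> ij; apply/eqP; rewrite eq_le pr_ge0 andbT.
have pr01 := pr_unit i.
have m01 := mUpre i (measurable_itv `[0, 1[).
rewrite -(prI1 (N := U i @^-1` `[0, 1[))//.
have bound K : (0 < K)%N -> pr P ([set w | U i w = U j w] `&` U i @^-1` `[0, 1[) <= K%:R^-1.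
  move=> K0; have K0' : 0 < K%:R^-1 :> R by rewrite invr_gt0 ltr0n.
  pose B (k : 'I_K) := (U i @^-1` cell K%:R^-1 k) `&` (U j @^-1` cell K%:R^-1 k).
  have mB k : measurable (B k) by apply: measurableI; apply: mUpre; exact: cell_measurable.
  have PB k : pr P (B k) = K%:R^-1 * K%:R^-1.
    have := Uindep [fset i; j]%fset (A := fun=> cell K%:R^-1 k) (fun=> cell_measurable _ _).
    rewrite big_fsetU1 ?inE//= big_seq_fset1.
    have := Uunif i (cell_measurable K%:R^-1 k).
    have := Uunif j (cell_measurable K%:R^-1 k).
    rewrite /distribution /pushforward uniform_prob_cell// => -> ->.
    rewrite /pr => H; rewrite -[RHS]/(fine (K%:R^-1 * K%:R^-1)%:E) EFinM -H.
    congr (fine (P _)); apply/seteqP; split=> w /=.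
      by move=> [Bi Bj] l /=; rewrite !inE => /orP[] /eqP ->.
    by move=> H'; split; apply: H'; rewrite /= !inE eqxx ?orbT.
  apply: (@le_trans _ _ (pr P [set w | exists2 k : 'I_K, true & B k w])).
    apply: pr_mono.
    - by apply: measurableI => //; exact: measurable_tie.
    - exact: (measurable_exists_fin (Q := fun=> true)).
    - move=> w [/= ij' ]; rewrite in_itv /= => /andP[u0 u1].
      have c := cell_truncn K0' u0.
      have kK : (Num.truncn (U i w / K%:R^-1) < K)%N.
        move: c; rewrite /cell /= in_itv /= => /andP[+ _].
        rewrite ler_pdivrMr ?ltr0n// => h.
        rewrite -(ltr_nat R) (le_lt_trans h)//.
        by rewrite -[ltRHS]mul1r ltr_pM2r ?ltr0n.
      by exists (Ordinal kK) => //; split=> //=; rewrite -ij'.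
  rewrite (pr_sum_fin _ (Q := fun=> true))//; last first.
    move=> k l w _ _ [k1 _] [l1 _]; apply: ord_inj; exact: (cell_inj K0' k1 l1).
  rewrite (eq_bigr (fun=> K%:R^-1 * K%:R^-1)); last by move=> k _; exact: PB.
  rewrite sumr_const card_ord -[X in X <= _]mulr_natl mulrA divff ?mul1r//.
  by rewrite pnatr_eq0 -lt0n.
apply: (closed_cvg (fun y => pr P ([set w | U i w = U j w] `&` U i @^-1` `[0, 1[) <= y) _ _ _ (@inv_nat_cvg0 R)).
  exact: closed_ge.
by exists 1%N => // K /= K0; exact: bound.
Qed.

Lemma pr_good_points n : pr P (good_points n) = 1.
Proof.
rewrite good_pointsE; apply: pr1_forall => p; first exact: measurable_good.
have m01 := mUpre p.1 (measurable_itv `[0, 1[).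
rewrite prI1//.
  by case: ifPn => // [_|ij]; [exact: pr_setT|rewrite pr_setC ?pr_tie ?subr0//].
by case: ifPn => // _; apply: measurableC; exact: measurable_tie.
Qed.

End iid_uniform_cells.

Section measurable_sample.
Context d (T : measurableType d) (R : realType) (D : set R).
Variables (Z : T -> closed_subset D) (U : nat -> T -> R).
Hypotheses (mZ : measurable_fun setT Z) (mU : forall i, measurable_fun setT (U i)).

(** The bits are those of [sample_composition_ext]; the relation of lying in one class becomes
    measurable once it says that a segment with random endpoints misses [Z]. *)
Lemma measurable_sample n (A : set (composition n)) :
  measurable [set w | A (sample_composition (cset (Z w)) n (fun i => U i w))].
Proof.
pose bits w (p : 'I_n * 'I_n) := (same_class (cset (Z w)) (fun i => U i w) p.1 p.2,
  U p.1 w <= U p.2 w, U p.1 w <= 1, 1 <= U p.1 w).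
have m_le (f g : T -> R) : measurable_fun setT f -> measurable_fun setT g ->
    measurable [set w | f w <= g w].
  by move=> mf mg; apply: measurable_bool_set; exact: measurable_fun_ler.
have m_eqb (f : T -> bool) x : measurable [set w | f w] ->
    measurable [set w | f w = x].
  case: x => // mf; rewrite (_ : [set w | _] = ~` [set w | f w]).
    exact: measurableC.
  by apply/seteqP; split=> w /=; [move=> ->|case: (f w)].
have m_same (i j : 'I_n) :
    measurable [set w | same_class (cset (Z w)) (fun i => U i w) i j].
  have [ij|ij] := eqVneq i j.
    rewrite (_ : [set w | _] = setT)//; apply/seteqP; split=> w // _.
    by rewrite /= /same_class ij eqxx.
  pose G (k l : 'I_n) := [set w | U k w <= U l w /\ misses `[U k w, U l w] (Z w)] `&`
    [set w | 0 <= U k w] `&` [set w | U l w <= 1].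
  have mG k l : measurable (G k l).
    apply: measurableI; last by apply: m_le => //; exact: measurable_cst.
    apply: measurableI; first exact: measurable_misses_itv.
    by apply: m_le => //; exact: measurable_cst.
  rewrite (_ : [set w | _] = G i j `|` G j i); first exact: measurableU.
  apply/seteqP; split=> w /=; rewrite /same_class (negbTE ij) /=.
    move=> /asboolP c; have [uij|/ltW uji] := leP (U i w) (U j w).
      by left; have [] := (connected_component_gap _ uij).1 c.
    right; have [] := (connected_component_gap _ uji).1 (connected_component_sym c).
    by [].
  move=> [] [[[uij v] u0] u1]; apply/asboolP.
    exact/(connected_component_gap _ uij).
  by apply: connected_component_sym; exact/(connected_component_gap _ uij).
apply: (@measurable_factor _ _ {ffun 'I_n * 'I_n -> bool * bool * bool * bool} _
  (fun w => [ffun p => bits w p])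
  (fun w => sample_composition (cset (Z w)) n (fun i => U i w))).
- move=> x.
  rewrite (_ : [set w | _] = [set w | forall p, bits w p = x p]); last first.
    apply/seteqP; split=> w /=; first by move=> <- p; rewrite ffunE.
    by move=> H; apply/ffunP => p; rewrite ffunE.
  apply: measurable_forall => p.
  case: (x p) => [[[x1 x2] x3] x4].
  rewrite [X in measurable X](_ : _ = [set w | same_class (cset (Z w)) (fun i => U i w) p.1 p.2 = x1]
     `&` [set w | (U p.1 w <= U p.2 w) = x2] `&` [set w | (U p.1 w <= 1) = x3]
     `&` [set w | (1 <= U p.1 w) = x4]); last first.
    apply/seteqP; split=> w /=; rewrite /bits; first by move=> [-> -> -> ->].
    by move=> [[[-> ->] ->] ->].
  by do 3?[apply: measurableI]; apply: m_eqb => //; apply: m_le => //;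
    exact: measurable_cst.
- move=> w w' bww'.
  have bE i j : bits w (i, j) = bits w' (i, j).
    by move/ffunP : bww' => /(_ (i, j)); rewrite !ffunE.
  by apply: sample_composition_ext => [i j|i j|i|i];
    [have [] := bE i j|have [] := bE i j|have [] := bE i i|have [] := bE i i].
Qed.

End measurable_sample.

(** * Grid approximation of sampled events *)

Section cells_cvg.
Context d (T : measurableType d) (R : realType) (P : probability T R).
Variable U : nat -> {RV P >-> R}.
Hypothesis Uunif : forall i A, measurable A ->
  distribution P (U i) A = uniform_prob (@ltr01 R) A.
Hypothesis Uindep : mutually_independent U.

Definition ranked n w := nth 0 (sort <=%R [seq U i w | i <- iota 0 n]).

(** Common scheme of the approximations from outside and from inside. On a fine grid the sample
    points occupy distinct cells, so exactly one injection [f] describes them, and [V] at the sorted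
    cells agrees with [B]. The factor K^-n is the probability of the cells, [v] that of [V] given
    the cells, and n! counts the injections with a given image. [G] carries an almost sure side
    condition. *)
Lemma cells_cvg n (V : nat -> (nat -> nat) -> set T) (B : set T)
    (v : nat -> (nat -> nat) -> R) (G : set T) :
  (forall K a, measurable (V K a)) -> measurable B -> measurable G -> pr P G = 1 ->
  (forall K (f : {ffun 'I_n -> 'I_K}), (0 < K)%N -> injective f ->
    pr P (in_cells U f `&` V K (nth 0%N (vals (f @: [set: 'I_n])%SET))) =
    K%:R^-1 ^+ n * v K (nth 0%N (vals (f @: [set: 'I_n])%SET))) ->
  (forall w, good_points U n w -> G w -> exists2 e : R, 0 < e &
    forall K a, (0 < K)%N -> K%:R^-1 < e ->
      (forall i, (i < n)%N -> cell K%:R^-1 (a i) (ranked n w i)) ->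
      V K a w <-> B w) ->
  (n`!%:R * K%:R^-1 ^+ n *
    \sum_(A : {set 'I_K} | #|A| == n) v K (nth 0%N (vals A)))
    @[K --> \oo] --> pr P B.
Proof.
move=> mV mB mG G1 PV VB.
pose TK K := [set w | exists2 f : {ffun 'I_n -> 'I_K}, injectiveb f &
  (in_cells U f `&` V K (nth 0%N (vals (f @: [set: 'I_n])%SET))) w].
have mI K (f : {ffun 'I_n -> 'I_K}) :
    measurable (in_cells U f `&` V K (nth 0%N (vals (f @: [set: 'I_n])%SET))).
  by apply: measurableI => //; exact: measurable_in_cells.
have cT : pr P (TK K) @[K --> \oo] --> pr P B.
  apply: (pr_event_cvg (N := good_points U n `&` G)) => //.
  - move=> K; apply: (measurable_exists_fin (Q := fun f : {ffun 'I_n -> 'I_K} => injectiveb f)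
      (A := fun f => in_cells U f `&` V K (nth 0%N (vals (f @: [set: 'I_n])%SET)))).
    by move=> f _; exact: mI.
  - by apply: measurableI => //; exact: measurable_good_points.
  - by rewrite prI1//; [exact: pr_good_points|exact: measurable_good_points].
  move=> w [gw Gw]; have [e e0 He] := VB w gw Gw.
  have uinj i j : (i < n)%N -> (j < n)%N -> U i w = U j w -> i = j.
    by move=> ni nj; have [] := gw i j ni nj.
  have [e' e'0 He'] := min_gap uinj.
  have me0 : 0 < Num.min e e' by rewrite lt_min e0 e'0.
  (* The mesh 1/K has to be below [e], as [VB] asks, and below the least distance [e'] between two
     sample points, so that their cells are distinct. *)
  exists (Num.truncn (Num.min e e')^-1).+1 => K eK.
  have K0 : (0 < K)%N by exact: leq_trans eK.
  have K0' : 0 < K%:R^-1 :> R by rewrite invr_gt0 ltr0n.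
  have : K%:R^-1 < Num.min e e'.
    rewrite -[ltRHS]invrK ltf_pV2 ?posrE ?invr_gt0 ?ltr0n//.
    by rewrite (lt_le_trans (truncnS_gt _))// ler_nat.
  rewrite lt_min => /andP[Ke Ke'].
  have kK (i : 'I_n) : (Num.truncn (U i w / K%:R^-1) < K)%N.
    have [/andP[u0 u1] _] := gw i i (ltn_ord i) (ltn_ord i).
    have := cell_truncn K0' u0.
    rewrite /cell /= in_itv /= => /andP[+ _].
    rewrite ler_pdivrMr ?ltr0n// => h.
    rewrite -(ltr_nat R) (le_lt_trans h)//.
    by rewrite -[ltRHS]mul1r ltr_pM2r ?ltr0n.
  pose f : {ffun 'I_n -> 'I_K} := [ffun i => Ordinal (kK i)].
  have fw : in_cells U f w.
    move=> i; rewrite ffunE /=; apply: cell_truncn => //.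
    by have [/andP[]] := gw i i (ltn_ord i) (ltn_ord i).
  have near_cells i j (k : nat) : (i < n)%N -> (j < n)%N ->
      cell K%:R^-1 k (U i w) -> cell K%:R^-1 k (U j w) -> i = j.
    move=> ni nj; rewrite /cell /= !in_itv /= => /andP[h1 h2] /andP[h3 h4].
    apply/eqP; apply: contraT => /(He' i j ni nj); rewrite leNgt => /negP; case.
    apply: lt_trans Ke'; rewrite ltr_norml; move: h2 h4; rewrite -natr1 mulrDl mul1r.
    by move=> h2 h4; apply/andP; split; lra.
  have finj : injective f.
    move=> i j fij; apply: ord_inj; apply: (near_cells _ _ (f i)) => //.
    by rewrite fij.
  have cellsE (g : {ffun 'I_n -> 'I_K}) : in_cells U g w -> g = f.
    move=> gw'; apply/ffunP => i; apply: ord_inj.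
    exact: (cell_inj K0' (gw' i) (fw i)).
  have sc := sorted_cells (u := fun i => U i w) K0' finj fw.
  split.
    move=> [g ginj [/cellsE ->]]; exact: (He _ _ K0 Ke sc).1.
  move=> Bw; exists f; first exact/injectiveP.
  by split=> //; exact: (He _ _ K0 Ke sc).2.
apply: cvg_trans cT; apply: near_eq_cvg; near=> K.
have K0 : (0 < K)%N by near: K; exact: nbhs_infty_gt.
have K0' : 0 < K%:R^-1 :> R by rewrite invr_gt0 ltr0n.
rewrite (pr_sum_fin _ (Q := fun f : {ffun 'I_n -> 'I_K} => injectiveb f))//; last first.
  move=> f g w _ _ [fw _] [gw _]; apply/ffunP => i; apply: ord_inj.
  exact: (cell_inj K0' (fw i) (gw i)).
rewrite (eq_bigr (fun f : {ffun 'I_n -> 'I_K} => K%:R^-1 ^+ n *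
   v K (nth 0%N (vals (f @: [set: 'I_n])%SET)))); last first.
  by move=> f /injectiveP finj; exact: PV.
rewrite -mulr_sumr (@sum_injective_image _ n K (fun A => v K (nth 0%N (vals A)))).
by rewrite -[X in _ * X = _]mulr_natl mulrCA mulrA.
Unshelve. all: by end_near. Qed.

End cells_cvg.

Lemma cvg_bigsum (R : realType) (I : Type) (r : seq I) (Q : pred I)
    (f : I -> nat -> R) (l : I -> R) :
  (forall i, Q i -> f i n @[n --> \oo] --> l i) ->
  \sum_(i <- r | Q i) f i n @[n --> \oo] --> \sum_(i <- r | Q i) l i.
Proof.
move=> fl; elim: r => [|i r IH].
  by rewrite big_nil; under eq_fun do rewrite big_nil; exact: cvg_cst.
rewrite big_cons; under eq_fun do rewrite big_cons.
by case: ifPn => // Qi; apply: cvgD => //; exact: fl.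
Qed.

Section sample_cells.
Context d (T : measurableType d) (R : realType) (P : probability T R).
Variables (Z : {RV P >-> closed_subset `[0%R : R, 1%R]}) (U : nat -> {RV P >-> R}).
Hypothesis sampleZU : uniform_sample Z U.

Lemma pr_cells_misses n K (f : 'I_n -> 'I_K) (I : set R) :
  measurable (misses I : set (closed_subset `[0%R : R, 1%R])) ->
  pr P (in_cells U f `&` Z @^-1` misses I) = K%:R^-1 ^+ n * pr P (Z @^-1` misses I).
Proof.
move=> mI; have [Uunif Uindep ZU] := sampleZU.
have mZI : measurable (Z @^-1` misses I) by exact: measurable_funPTI.
rewrite -(pr_in_cells Uunif Uindep f) mulrC.
apply: EFin_inj; rewrite EFinM -!prE//; last 2 first.
- exact: measurable_in_cells.
- by apply: measurableI => //; exact: measurable_in_cells.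
rewrite setIC; apply: ZU; first by exists (misses I) => //; rewrite setTI.
have [A [mA _] ->] := in_cellsE U f.
rewrite -[X in sigma_rvs U X]setCK.
have -> : ~` (\bigcap_(i in [set` [fset i | i in iota 0 n]%fset]) (U i @^-1` A i)) =
    \bigcup_i (if (i < n)%N then ~` (U i @^-1` A i) else set0).
  rewrite setC_bigcap bigcup_mkcond; apply: eq_bigcupr => i _.
  case: ifPn; case: ifPn => //.
    by rewrite inE /= !inE /= mem_iota => /negbTE ->.
  by move=> ni; rewrite notin_setE /= !inE /= mem_iota ni.
apply: sigma_algebraC; apply: sigma_algebra_bigcup => i.
case: ifPn => _; last exact: (@sigma_algebra0 _ setT).
apply: sigma_algebraC; apply: sub_sigma_algebra; exists i => //.
by exists (A i) => //; rewrite setTI.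
Qed.

Definition sampled_unbroken n D : set T :=
  [set w | unbroken n D (sample_composition (cset (Z w)) n (fun i => U i w))].

Lemma measurable_sampled_unbroken n D : measurable (sampled_unbroken n D).
Proof. by apply: measurable_sample => [|i]; exact: measurable_funP. Qed.

Lemma good_points_itv n w i : good_points U n w -> (i < n)%N -> 0 <= U i w <= 1.
Proof. by move=> gw ni; have [/andP[-> /ltW ->]] := gw i i ni ni. Qed.

Lemma good_points_inj n w i j : good_points U n w -> (i < n)%N -> (j < n)%N ->
  U i w = U j w -> i = j.
Proof. by move=> gw ni nj; have [] := gw i j ni nj. Qed.

Lemma sampled_unbrokenE n D w : places_below n D -> good_points U n w ->
  sampled_unbroken n D w <-> cset (Z w) `&` gaps (ranked U n w) D = set0.
Proof.
move=> Dn gw; apply: sample_unbroken => // [i|i j ni nj].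
  exact: good_points_itv.
exact: good_points_inj gw ni nj.
Qed.

Lemma ranked_lt n w p D : places_below n D -> good_points U n w -> p \in D ->
  ranked U n w p.1 < ranked U n w p.2.
Proof.
move=> Dn gw pD; apply: sorted_points_lt; last exact: (allP Dn p pD).
by move=> i j ni nj; exact: (good_points_inj gw ni nj).
Qed.

(** The hulls contain the gaps, so missing a hull entails missing the gaps; conversely, as [Z] is
    closed, missing the gaps entails missing every fine enough hull. *)
Lemma sample_hull_cvg n D : places_below n D ->
  (n`!%:R * K%:R^-1 ^+ n * \sum_(A : {set 'I_K} | #|A| == n)
    pr P (Z @^-1` misses (hull K%:R^-1 (nth 0%N (vals A)) D))) @[K --> \oo] -->
  pr P (sampled_unbroken n D).
Proof.
move=> Dn; have [Uunif Uindep _] := sampleZU.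
have mh e a : measurable (misses (D := `[0%R : R, 1%R]) (hull e a D)).
  by apply: measurable_misses_compact; exact: compact_bands.
apply: (cells_cvg Uunif Uindep (V := fun K a => Z @^-1` misses (hull K%:R^-1 a D))
  (B := sampled_unbroken n D)
  (v := fun K a => pr P (Z @^-1` misses (hull K%:R^-1 a D))) (G := setT)) => //.
- by move=> K a; exact: measurable_funPTI.
- exact: measurable_sampled_unbroken.
- exact: pr_setT.
- by move=> K f _ _; exact: pr_cells_misses.
move=> w gw _; have su := sampled_unbrokenE Dn gw.
have [Bw|nBw] := pselect (sampled_unbroken n D w).
  have [e e0 He] := miss_gaps_hull (@cset_closed _ _ (Z w)) Dn (su.1 Bw).
  exists e => // K a K0 Ke ax; split=> // _.
  apply: He => //; first by rewrite invr_gt0 ltr0n.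
  by move=> p pD; apply: ltW; exact: ranked_lt Dn gw pD.
exists 1 => // K a K0 _ ax; split=> // Vw.
apply: su.2; apply: subsetI_eq0 Vw => //.
exact: (gaps_sub_hull Dn).
Qed.

End sample_cells.

Lemma hull_unit (R : realType) n K (A : {set 'I_K}) D : #|A| = n ->
  places_below n D -> hull (K%:R^-1 : R) (nth 0%N (vals A)) D `<=` `[0, 1].
Proof.
move=> An Dn t [p pD /andP[p1 p2]]; have /andP[_ pn] := allP Dn p pD.
have aK : (nth 0%N (vals A) p.2 < K)%N by apply: nth_vals_lt; rewrite An.
have K0 : 0 < K%:R :> R by rewrite ltr0n (leq_ltn_trans _ aK).
rewrite /= in_itv /=; apply/andP; split.
  by rewrite (le_trans _ p1)// mulr_ge0// invr_ge0 ltW.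
by apply: (le_trans p2); rewrite ler_pdivrMr// mul1r ler_nat.
Qed.

(** * Self-similar sets *)

Section self_similar_hulls.
Context (R : realType) dS (TS : measurableType dS) (PS : probability TS R).
Variable S : {RV PS >-> closed_subset `[0%R : R, +oo[}.
Hypothesis ssS : self_similar S.
Implicit Types (D : seq (nat * nat)).

Definition vhull D (a : nat -> nat) : R := pr PS (S @^-1` misses (hull 1 a D)).

Lemma misses_scale (c : {posnum R}) (F : closed_subset `[0%R : R, +oo[) (I : set R) :
  misses I (scale c F) <-> misses [set t | I (c%:num * t)] F.
Proof.
split=> H; apply/seteqP; split=> // t.
  move=> [Ft It]; suff : (cset (scale c F) `&` I) (c%:num * t) by rewrite H.
  by split=> //; exists t.
move=> [[s Fs <-] It]; suff : (F `&` [set t | I (c%:num * t)]) s by rewrite H.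
by split.
Qed.

Lemma hull_scale (d : R) a D t : 0 < d -> hull d a D (d * t) <-> hull 1 a D t.
Proof.
move=> d0; split=> -[p pD pt]; exists p => //; move: pt;
  by rewrite !mulr1 -!(mulrC d) !ler_pM2l.
Qed.

(** Dilation by d carries the hull of mesh 1 to that of mesh d. Self-similarity of [S] enters the
    computations through this equality, which removes the grid size from the probabilities. *)
Lemma pr_misses_hull (d : R) a D : 0 < d ->
  pr PS (S @^-1` misses (hull d a D)) = vhull D a.
Proof.
move=> d0; have mh e : measurable (misses (D := `[0%R : R, +oo[) (hull e a D)).
  by apply: measurable_misses_compact; exact: compact_bands.
rewrite /pr; have := ssS (PosNum d0) (mh d).
rewrite /distribution /pushforward => ->; congr fine; congr (PS _).
apply/seteqP; split=> w /=; rewrite misses_scale /=; apply: subsetI_eq0 => // t;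
  by move/(hull_scale _ _ _ d0).
Qed.

Lemma vhull_local D n : places_below n D -> local (vhull D) n.
Proof.
move=> /allP Dn a b ab; rewrite /vhull; congr (pr _ (S @^-1` misses _)).
by apply/seteqP; split=> t [p pD pt]; exists p => //; move: pt;
  have /andP[p12 p2] := Dn p pD; rewrite !ab// (ltn_trans p12 p2).
Qed.

Lemma vhull_map f D a : vhull (map_places f D) a = vhull D (fun i => a (f i)).
Proof.
rewrite /vhull; congr (pr _ (S @^-1` misses _)); apply/seteqP; split=> t.
  by move=> [_ /mapP[p pD ->] pt]; exists p.
by move=> [p pD pt]; exists (f p.1, f p.2) => //; apply/mapP; exists p.
Qed.

Variable C : forall n : nat, probability (composition n) R.
Hypothesis CS : derived_from C (@restrict01 R _ \o S : {RV PS >-> _}).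

(** The normalisation n! K^-n of the sampling limit is replaced by the equivalent 1 / 'C(K, n), for
    which the counting identities over subsets are exact. *)
Lemma derived_cells n D : (0 < n)%N -> places_below n D ->
  vsum (vhull D) n K / 'C(K, n)%:R @[K --> \oo] --> pr (C n) (unbroken n D).
Proof.
move=> n0 Dn; have [d [T [P [Z [U [ZS [Uunif Uindep ZU] CE]]]]]] := CS.
have sampleZU : uniform_sample Z U by [].
have -> : pr (C n) (unbroken n D) = pr P (sampled_unbroken Z U n D) by rewrite /pr -CE.
have mh e a : measurable (misses (D := `[0%R : R, 1%R]) (hull e a D)).
  by apply: measurable_misses_compact; exact: compact_bands.
have H0 := sample_hull_cvg sampleZU Dn.
have H : (n`!%:R * K%:R^-1 ^+ n * \sum_(A : {set 'I_K} | #|A| == n)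
    vhull D (nth 0%N (vals A))) @[K --> \oo] --> pr P (sampled_unbroken Z U n D).
  apply: cvg_trans H0; apply: near_eq_cvg; near=> K; congr (_ * _).
  have K0' : 0 < K%:R^-1 :> R by rewrite invr_gt0 ltr0n; near: K; exact: nbhs_infty_gt.
  apply: eq_bigr => A /eqP An; set a := nth 0%N _.
  rewrite -(pr_misses_hull a D K0') /pr; congr fine; have := ZS _ (mh K%:R^-1 a).
  rewrite /distribution /pushforward => ->; congr (PS _).
  apply/seteqP; split=> w; rewrite /misses /= => Hw; last first.
    by rewrite -setIA; apply: subsetI_eq0 Hw => // t [].
  apply/seteqP; split=> // t [St ht].
  suff : (cset (S w) `&` `[0, 1]%classic `&` hull K%:R^-1 a D) t by rewrite Hw.
  by split=> //; split=> //; exact: hull_unit An Dn _ ht.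
have H2 := cvgM H (cvgV (oner_neq0 _) (@ffact_ratio_cvg1 R n)).
rewrite invr1 mulr1 in H2.
apply: (cvg_trans _ (H2 _ _)); apply: near_eq_cvg; near=> K.
have nK : (n <= K)%N by near: K; exact: nbhs_infty_ge.
have K0 : K%:R != 0 :> R by rewrite pnatr_eq0 -lt0n (leq_trans n0).
rewrite /= -bin_ffact natrM /vsum invf_div.
have Kn : K%:R ^+ n != 0 :> R by rewrite expf_neq0.
have C0 : 'C(K, n)%:R != 0 :> R by rewrite pnatr_eq0 -lt0n bin_gt0.
have F0 : n`!%:R != 0 :> R by rewrite pnatr_eq0 -lt0n fact_gt0.
rewrite exprVn; move: Kn; set X := K%:R ^+ n => Kn.
by field; rewrite Kn C0 F0.
Unshelve. all: by end_near. Qed.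

(** By [vsum_last], the averages for n + 1 are Cesaro means of those for n with weights 'C(b, n), so
    they have the same limit. *)
Lemma derived_unbroken_last n D : (0 < n)%N -> places_below n D ->
  pr (C n.+1) (unbroken n.+1 D) = pr (C n) (unbroken n D).
Proof.
move=> n0 Dn; have Dn1 : places_below n.+1 D.
  by apply/allP => p /(allP Dn) /andP[-> /= /ltnW].
have H := derived_cells (ltn0Sn n) Dn1.
have := cesaro_bin (derived_cells n0 Dn).
move=> H'; apply: (cvg_unique _ H); first exact: Rhausdorff.
apply: cvg_trans H'; apply: near_eq_cvg; near=> K.
by rewrite (vsum_last _ (vhull_local Dn)).
Unshelve. all: by end_near. Qed.

(** The identity already holds before the limit: it is [vsum_remove] combined with (n+1) 'C(K, n+1)
    = (K - n) 'C(K, n). *)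
Lemma derived_unbroken_remove n D : (0 < n)%N -> places_below n D ->
  \sum_(y < n.+1) pr (C n.+1) (unbroken n.+1 (map_places (bump y) D)) =
  n.+1%:R * pr (C n) (unbroken n D).
Proof.
move=> n0 Dn.
have Dy (y : 'I_n.+1) : places_below n.+1 (map_places (bump y) D).
  apply/allP => _ /mapP[p /(allP Dn) + ->] /=; rewrite /bump; lia.
have H : \sum_(y < n.+1) vsum (vhull (map_places (bump y) D)) n.+1 K / 'C(K, n.+1)%:R
    @[K --> \oo] --> \sum_(y < n.+1) pr (C n.+1) (unbroken n.+1 (map_places (bump y) D)).
  apply: cvg_bigsum => y _.
  exact: derived_cells.
have H' : n.+1%:R * (vsum (vhull D) n K / 'C(K, n)%:R)
    @[K --> \oo] --> n.+1%:R * pr (C n) (unbroken n D).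
  by apply: cvgMr; exact: derived_cells.
apply: (cvg_unique _ H); first exact: Rhausdorff.
apply: cvg_trans H'; apply: near_eq_cvg; near=> K.
have nK : (n < K)%N by near: K; exact: nbhs_infty_gt.
rewrite -mulr_suml.
have -> : \sum_(y < n.+1) vsum (vhull (map_places (bump y) D)) n.+1 K =
    (K - n)%:R * vsum (vhull D) n K.
  rewrite -(vsum_remove _ (vhull_local Dn)); apply: eq_bigr => y _.
  by apply: eq_bigr => A _; rewrite vhull_map.
have C0 : 'C(K, n)%:R != 0 :> R by rewrite pnatr_eq0 -lt0n bin_gt0 ltnW.
have C1 : 'C(K, n.+1)%:R != 0 :> R by rewrite pnatr_eq0 -lt0n bin_gt0.
have E : n.+1%:R * 'C(K, n.+1)%:R = (K - n)%:R * 'C(K, n)%:R :> R.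
  by rewrite -!natrM mul_bin_left.
apply: (mulIf C1); rewrite divfK// mulrAC E.
by field; rewrite C0.
Unshelve. all: by end_near. Qed.

End self_similar_hulls.

(** * Consistency *)

Section consistency_in_law.
Context (R : realType) (C : forall n, probability (composition n) R).

Let deleted n (cy : composition n.+1 * 'I_n.+1) := delete_ball cy.1 cy.2.

Lemma deleted_preimage n (A : set (composition n)) :
  @deleted n @^-1` A = [set cy | exists2 y : 'I_n.+1, true &
    ([set c | A (delete_ball c y)] `*` [set y]) cy].
Proof.
apply/seteqP; split=> -[c y] /=; first by move=> Acy; exists y.
by move=> [y' _ [/= Acy ->]].
Qed.

Lemma consistent_prE (Y : forall n, probability 'I_n.+1 R) n (A : set (composition n)) :
  pushforward (C n.+1 \x Y n)%E (fun cy => delete_ball cy.1 cy.2) A =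
  (\sum_(y < n.+1) pr (C n.+1) [set c | A (delete_ball c y)] * pr (Y n) [set y])%:E.
Proof.
rewrite /pushforward -/(@deleted n) deleted_preimage.
have mX (y : 'I_n.+1) : measurable ([set c | A (delete_ball c y)] `*` [set y]).
  exact: measurableX.
rewrite prE; last exact: (measurable_exists_fin (Q := fun=> true) (A := fun y =>
  [set c | A (delete_ball c y)] `*` [set y])).
rewrite (pr_sum_fin _ (Q := fun=> true))//; last first.
  by move=> y y' [c y0] _ _ [_ /= <-] [_ /= <-].
congr EFin; apply: eq_bigr => y _; apply: EFin_inj.
by rewrite EFinM -!prE//; exact: product_measure1E.
Qed.

Let right_sum n (A : set (composition n)) :
  \sum_(y < n.+1) pr (C n.+1) [set c | A (delete_ball c y)] *
    pr (\d_(ord_max : 'I_n.+1)) [set y] =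
  pr (C n.+1) [set c | A (delete_ball c ord_max)].
Proof.
rewrite (bigD1 ord_max)//= big1 ?addr0.
  by rewrite /pr /= /dirac indicE mem_set// mulr1.
move=> y yn; rewrite /pr /= /dirac indicE memNset ?mulr0//.
by move=> /= e; rewrite e eqxx in yn.
Qed.

Let uniform_sum n (A : set (composition n)) :
  \sum_(y < n.+1) pr (C n.+1) [set c | A (delete_ball c y)] *
    pr (uniform_place R n) [set y] =
  n.+1%:R^-1 * \sum_(y < n.+1) pr (C n.+1) [set c | A (delete_ball c y)].
Proof.
rewrite mulr_sumr; apply: eq_bigr => y _; rewrite mulrC; congr (_ * _).
rewrite /pr /= /uniform_place /mscale /= /counting asboolT; last first.
  exact: finite_set1.
by rewrite fset_set1 cardfs1 -EFinM mulr1.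
Qed.

Lemma right_consistentP : right_consistent C <->
  forall n, (0 < n)%N -> forall A : set (composition n),
    pr (C n.+1) [set c | A (delete_ball c ord_max)] = pr (C n) A.
Proof.
pose Y n : probability 'I_n.+1 R := \d_(ord_max : 'I_n.+1).
split=> H n n0 A.
  have := etrans (esym (consistent_prE Y A)) (H n n0 A).
  by rewrite right_sum prE// => -[].
by apply: (etrans (consistent_prE Y A)); rewrite right_sum H// prE.
Qed.

Lemma uniform_consistentP : uniform_consistent C <->
  forall n, (0 < n)%N -> forall A : set (composition n),
    \sum_(y < n.+1) pr (C n.+1) [set c | A (delete_ball c y)] =
    n.+1%:R * pr (C n) A.
Proof.
split=> H n n0 A.
  have := H n n0 A; rewrite consistent_prE uniform_sum prE// => -[<-].
  by rewrite mulVKf ?pnatr_eq0.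
by rewrite consistent_prE uniform_sum H// mulKf ?pnatr_eq0// prE.
Qed.

Let unbroken_deleted n D (y : 'I_n.+1) : places_below n D ->
  [set c | unbroken n D (delete_ball c y)] =
  unbroken n.+1 (map_places (bump y) D).
Proof. by move=> Dn; apply/seteqP; split=> c /(unbroken_delete _ _ Dn). Qed.

Let consistent_unbroken (Y : forall n, probability 'I_n.+1 R) :
  (forall n D, (0 < n)%N -> places_below n D ->
    \sum_(y < n.+1) pr (C n.+1) [set c | unbroken n D (delete_ball c y)] *
      pr (Y n) [set y] = pr (C n) (unbroken n D)) ->
  consistent C Y.
Proof.
move=> H n n0 A.
apply: (@composition_rv_law _ _ R (C n.+1 \x Y n)%E n
  (fun cy => delete_ball cy.1 cy.2) (C n)) => [B|D Dn].
  rewrite -/(@deleted n) deleted_preimage.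
  by apply: (measurable_exists_fin (Q := fun=> true) (A := fun y : 'I_n.+1 =>
    [set c | B (delete_ball c y)] `*` [set y])) => y _; exact: measurableX.
transitivity (pushforward (C n.+1 \x Y n)%E
    (fun cy => delete_ball cy.1 cy.2) (unbroken n D)); first by [].
by rewrite consistent_prE H// prE.
Qed.

Lemma unbroken_uniform_consistent :
  (forall n D, (0 < n)%N -> places_below n D ->
    \sum_(y < n.+1) pr (C n.+1) (unbroken n.+1 (map_places (bump y) D)) =
    n.+1%:R * pr (C n) (unbroken n D)) ->
  uniform_consistent C.
Proof.
move=> H; apply: consistent_unbroken => n D n0 Dn.
rewrite uniform_sum (eq_bigr (fun y : 'I_n.+1 =>
  pr (C n.+1) (unbroken n.+1 (map_places (bump y) D)))); last first.
  by move=> y _; rewrite unbroken_deleted.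
by rewrite H// mulKf ?pnatr_eq0.
Qed.

Lemma unbroken_right_consistent :
  (forall n D, (0 < n)%N -> places_below n D ->
    pr (C n.+1) (unbroken n.+1 D) = pr (C n) (unbroken n D)) ->
  right_consistent C.
Proof.
move=> H; apply: consistent_unbroken => n D n0 Dn.
rewrite right_sum unbroken_deleted// (map_places_id (n := n)) ?H// => i ni.
by rewrite /bump /= leqNgt ni.
Qed.

Lemma consistent_unbroken_remove : uniform_consistent C ->
  forall n D, (0 < n)%N -> places_below n D ->
    \sum_(y < n.+1) pr (C n.+1) (unbroken n.+1 (map_places (bump y) D)) =
    n.+1%:R * pr (C n) (unbroken n D).
Proof.
move=> /uniform_consistentP H n D n0 Dn; rewrite -H//.
by apply: eq_bigr => y _; rewrite unbroken_deleted.
Qed.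

Lemma consistent_unbroken_last : right_consistent C ->
  forall n D, (0 < n)%N -> places_below n D ->
    pr (C n.+1) (unbroken n.+1 D) = pr (C n) (unbroken n D).
Proof.
move=> /right_consistentP H n D n0 Dn; rewrite -[RHS]H// unbroken_deleted//.
rewrite (map_places_id (n := n))// => i ni.
by rewrite /bump /= leqNgt ni.
Qed.

Lemma consistent_unbroken_le : right_consistent C ->
  forall m n D, (0 < n <= m)%N -> places_below n D ->
    pr (C m) (unbroken m D) = pr (C n) (unbroken n D).
Proof.
move=> H m n D /andP[n0 nm] Dn; rewrite -(subnKC nm).
elim: (m - n)%N => [|k IH]; first by rewrite addn0.
rewrite addnS consistent_unbroken_last ?addn_gt0 ?n0//.
by apply/allP => p /(allP Dn) /andP[-> /= h]; rewrite ltn_addr.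
Qed.

(** Iterated uniform deletion: C_k is C_n seen on a uniform k-subset of places. The induction is on
    n - k; inserting one place into every k-subset of n places produces each k-subset of n + 1
    places equally often. *)
Lemma consistent_subsample : uniform_consistent C ->
  forall k n D, (0 < k <= n)%N -> places_below k D ->
    \sum_(A : {set 'I_n} | #|A| == k)
      pr (C n) (unbroken n (map_places (nth 0%N (vals A)) D)) =
    'C(n, k)%:R * pr (C k) (unbroken k D).
Proof.
move=> H k n D /andP[k0 kn] Dk; rewrite -(subnKC kn); move: (n - k)%N => j {n kn}.
elim: j => [|j IH].
  rewrite addn0 binn mul1r (big_pred1 [set: 'I_k]%SET).
    rewrite (map_places_id (n := k))// => i ik.
    by rewrite /vals enum_setT -enumT val_enum_ord nth_iota.
  move=> A; rewrite /=; apply/eqP/eqP => [Ak|->]; last by rewrite cardsT card_ord.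
  by apply/eqP; rewrite eqEcard finset.subsetT cardsT card_ord Ak /=.
set n := (k + j)%N in IH *; rewrite addnS -/n.
have n0 : (0 < n)%N by rewrite addn_gt0 k0.
pose v a := pr (C n.+1) (unbroken n.+1 (map_places a D)).
have lv : local v k.
  move=> a b ab; rewrite /v; congr (pr _ (unbroken _ _)).
  apply/eq_in_map => p pD; have /andP[p12 p2] := allP Dk p pD.
  by rewrite !ab// (ltn_trans p12 p2).
have nk : (k <= n)%N by rewrite leq_addr.
have nk0 : (n.+1 - k)%:R != 0 :> R by rewrite pnatr_eq0; lia.
(* After multiplication by n + 1 - k the left side is a sum over insertions, and on the right
   (n+1-k) 'C(n+1, k) = (n+1) 'C(n, k) brings in the induction hypothesis. *)
apply: (mulfI nk0); rewrite -/(vsum v k n.+1) -(vsum_insert _ lv).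
rewrite mulrA -natrM -mul_bin_down /= natrM -mulrA -IH mulr_sumr exchange_big /=.
apply: eq_bigr => B /eqP Bk; rewrite -(consistent_unbroken_remove H)//.
  apply: eq_bigr => y _; rewrite /v; congr (pr _ (unbroken _ _)).
  by rewrite /map_places -map_comp.
apply/allP => _ /mapP[p pD ->] /=; have /andP[p12 p2] := allP Dk p pD.
by rewrite nth_vals_mono ?Bk ?p12 ?p2// nth_vals_lt// Bk.
Qed.

End consistency_in_law.

(** * The Poisson construction *)

Section counting.

Lemma card_eq_count (A : set nat) n : (forall j, A j -> (j < n)%N) ->
  (A #= `I_(count (fun j => `[< A j >]) (iota 0 n)))%card.
Proof.
elim: n A => [|n IH] A An.
  by rewrite /= II0 card_eq0; apply/eqP/seteqP; split=> // j /An.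
rewrite -addn1 iotaD count_cat /= add0n addn0.
have [An'|An'] := pselect (A n); last first.
  rewrite asboolF// addn0; apply: IH => j Aj.
  have := An _ Aj; rewrite ltnS leq_eqVlt => /orP[/eqP jn|//].
  by move: Aj; rewrite jn.
rewrite asboolT// addn1; apply/eq_cardSP; exists n => //.
have -> : count (fun j => `[< A j >]) (iota 0 n) =
    count (fun j => `[< (A `\ n) j >]) (iota 0 n).
  apply: eq_in_count => j; rewrite mem_iota add0n /= => jn.
  by apply/asboolP/asboolP => [Aj|[]//]; split=> //= e; rewrite e ltnn in jn.
apply: IH => j [Aj /= jn]; have := An _ Aj.
by rewrite ltnS leq_eqVlt => /orP[/eqP|].
Qed.

(** A cardinality becomes a countable combination of conditions on single indices, the form required
    both for measurability and for passing to the limit. *)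
Lemma card_eq_countP (A : set nat) k : (A #= `I_k)%card <->
  exists n, (forall j, A j -> (j < n)%N) /\
    count (fun j => `[< A j >]) (iota 0 n) = k.
Proof.
split=> [Ak|[n [An <-]]]; last exact: card_eq_count.
have [n An] : exists n, forall j, A j -> (j < n)%N.
  have : finite_set A by apply/finite_setP; exists k.
  move=> /finite_fsetP[X ->]; exists (\max_(j <- X) j).+1 => j jX.
  by rewrite ltnS; apply: leq_bigmax_seq.
exists n; split=> //; apply/card_eq_II.
apply: (card_eq_trans _ Ak); rewrite card_eq_sym; exact: card_eq_count.
Qed.

End counting.

Section measurable_count.
Context d (T : measurableType d) (R : realType) (f : nat -> T -> R).
Hypothesis mf : forall j, measurable_fun setT (f j).

Lemma measurable_count (B : set R) k : measurable B ->
  measurable [set w | ([set j | B (f j w)] #= `I_k)%card].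
Proof.
move=> mB.
have mfB j : measurable [set w | B (f j w)].
  by rewrite -[X in measurable X]setTI; exact: mf.
rewrite (_ : [set w | _] = [set w | exists n,
    ((forall j, (n <= j)%N -> ~ B (f j w)) /\
     count (fun j => `[< B (f j w) >]) (iota 0 n) = k)]); last first.
  apply/seteqP; split=> w /=.
    move=> /card_eq_countP[n [Bn cn]]; exists n; split=> // j nj /Bn.
    by rewrite ltnNge nj.
  move=> [n [Bn cn]]; apply/card_eq_countP; exists n; split=> // j Bj.
  by rewrite ltnNge; apply/negP => /Bn.
apply: (measurable_exists (A := fun n => [set w |
    ((forall j, (n <= j)%N -> ~ B (f j w)) /\
     count (fun j => `[< B (f j w) >]) (iota 0 n) = k)])) => n.
apply: measurableI.
  apply: (measurable_forall (A := fun j => [set w | (n <= j)%N -> ~ B (f j w)])) => j.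
  have [nj|nj] := boolP (n <= j)%N.
    rewrite (_ : [set w | _] = ~` [set w | B (f j w)]); first exact: measurableC.
    by apply/seteqP; split=> w /=; [apply|].
  by rewrite (_ : [set w | _] = setT)//; apply/seteqP; split.
pose b w := [ffun i : 'I_n => `[< B (f i w) >]].
apply: (measurable_factor (b := b)
  (X := fun w => count (fun j => `[< B (f j w) >]) (iota 0 n)) [set k]).
- move=> x; rewrite (_ : [set w | _] =
     [set w | forall i : 'I_n, `[< B (f i w) >] = x i]); last first.
    apply/seteqP; split=> w /=; first by move=> <- i; rewrite ffunE.
    by move=> H; apply/ffunP => i; rewrite ffunE.
  apply: (measurable_forall (A := fun i : 'I_n => [set w | `[< B (f i w) >] = x i])) => i.
  case: (x i).
    rewrite (_ : [set w | _] = [set w | B (f i w)])//.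
    by apply/seteqP; split=> w /= /asboolP.
  rewrite (_ : [set w | _] = ~` [set w | B (f i w)]); first exact: measurableC.
  apply/seteqP; split=> w /=; last by move=> /asboolPn/negbTE.
  by move=> H; apply/asboolPn; rewrite H.
- move=> w w' bww'; apply: eq_in_count => j; rewrite mem_iota add0n => /= jn.
  by move/ffunP : bww' => /(_ (Ordinal jn)); rewrite !ffunE.
Qed.

End measurable_count.

Lemma lebesgue_cell (R : realType) (e : R) k : 0 < e ->
  lebesgue_measure (cell e k) = e%:E.
Proof.
move=> e0; rewrite /cell lebesgue_measure_itv /= lte_fin ltr_pM2r// ltr_nat ltnSn.
by rewrite -EFinB -mulrBl -natrB// subSnn mul1r.
Qed.

(** * Poisson weights *)

Section poisson_pmf.
Context (R : realType).

(** At x = 0 the formula gives the unit mass at 0, in agreement with [poisson_prob] at rate 0, so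
    that null sets need no separate treatment. *)
Definition poisson_weight (x : R) (k : nat) : R := x ^+ k * expR (- x) / k`!%:R.

Lemma poisson_weight_ge0 x k : 0 <= x -> 0 <= poisson_weight x k.
Proof. by move=> x0; rewrite !mulr_ge0// ?exprn_ge0// expR_ge0. Qed.

Lemma poisson_prob_weight x k : 0 <= x ->
  poisson_prob x 0%N [set k] = (poisson_weight x k)%:E.
Proof.
rewrite le_eqVlt => /orP[/eqP <-|x0].
  rewrite /poisson_prob ltxx /poisson_weight oppr0 expR0 mulr1 expr0n diracE.
  case: k => [|k] /=; first by rewrite mem_set// fact0 divr1.
  by rewrite memNset// mul0r.
rewrite /poisson_prob x0 esum_set1 ?lee_fin ?poisson_pmf_ge0//.
by rewrite /poisson_pmf x0 /poisson_weight mulrAC.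
Qed.

Lemma poisson_weightD x y k : \sum_(i < k.+1) poisson_weight x i * poisson_weight y (k - i) =
  poisson_weight (x + y) k.
Proof.
rewrite /poisson_weight [x + y]addrC exprDn opprD expRD !mulr_suml.
apply: eq_bigr => i _; have ik : (i <= k)%N by rewrite -ltnS ltn_ord.
have fi : i`!%:R != 0 :> R by rewrite pnatr_eq0 -lt0n fact_gt0.
have fki : (k - i)`!%:R != 0 :> R by rewrite pnatr_eq0 -lt0n fact_gt0.
have fk : k`!%:R = 'C(k, i)%:R * (i`!%:R * (k - i)`!%:R) :> R.
  by rewrite -!natrM bin_fact.
have Ck : 'C(k, i)%:R != 0 :> R by rewrite pnatr_eq0 -lt0n bin_gt0.
rewrite fk -[X in _ = X * _ / _]mulr_natl.
by field; rewrite fi fki Ck.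
Qed.

Lemma poisson_weight_sum x : series (poisson_weight x) n @[n --> \oo] --> (1 : R).
Proof.
rewrite (_ : 1 = expR (- x) * expR x); last by rewrite -expRD addNr expR0.
rewrite (_ : series _ = fun n => expR (- x) * series (exp_coeff x) n).
  by apply: cvgMr; exact: is_cvg_series_exp_coeff.
apply/funext => n; rewrite /series /= mulr_sumr; apply: eq_bigr => k _.
by rewrite /poisson_weight /exp_coeff /= mulrA [expR _ * _]mulrC.
Qed.

(** From x^(k+1) / (k+1)! <= e^x. As x grows, the bound makes a given number of points unlikely. *)
Lemma poisson_weight_le x k : 0 < x -> poisson_weight x k <= k.+1%:R / x.
Proof.
move=> x0; rewrite ler_pdivlMr// /poisson_weight.
have := expR_ge1Dxn k (ltW x0).
move=> H; have {}H : x ^+ k.+1 / k.+1`!%:R <= expR x by rewrite (le_trans _ H)// lerDr.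
have f0 : 0 < k`!%:R :> R by rewrite ltr0n fact_gt0.
rewrite expRN [leLHS](_ : _ = k.+1%:R * (x ^+ k.+1 / k.+1`!%:R) / expR x).
  by rewrite ler_pdivrMr ?expR_gt0// ler_pM2l// ltr0n.
rewrite exprSr factS natrM; have : expR x != 0 by rewrite gt_eqF ?expR_gt0.
set e := expR x => e0; field.
by rewrite e0 gt_eqF//= addrC natr1 pnatr_eq0.
Qed.

End poisson_pmf.

Section poisson_cells.
Context (R : realType) d (T : measurableType d) (P : probability T R).
Variables (rate : R) (eps : nat -> {RV P >-> R}).
Hypotheses (rate0 : 0 < rate) (epsP : poisson_atoms rate eps).

Definition increasing_atoms : set T :=
  [set w | 0 <= eps 0%N w /\ forall j, eps j w < eps j.+1 w].

Lemma measurable_increasing_atoms : measurable increasing_atoms.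
Proof.
apply: measurableI.
  apply: measurable_bool_set; apply: measurable_fun_ler.
    exact: measurable_cst.
  exact: measurable_funP.
apply: (measurable_forall (A := fun j => [set w | eps j w < eps j.+1 w])) => j.
by apply: measurable_bool_set; apply: measurable_fun_ltr; exact: measurable_funP.
Qed.

Lemma pr_increasing_atoms : pr P increasing_atoms = 1.
Proof.
have mi := measurable_increasing_atoms.
have [[N [mN PN NS]] _] := epsP.
suff : pr P (~` increasing_atoms) = 0.
  by rewrite pr_setC// => /eqP; rewrite subr_eq0 => /eqP.
apply/eqP; rewrite eq_le pr_ge0 andbT.
rewrite (_ : 0 = pr P N); last by rewrite /pr PN.
by apply: pr_mono => //; exact: measurableC.
Qed.

Lemma atoms_lt w i j : increasing_atoms w -> (i < j)%N -> eps i w < eps j w.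
Proof.
move=> [_ H]; elim: j => [//|j IH]; rewrite ltnS leq_eqVlt => /orP[/eqP ->//|/IH].
by move=> /lt_trans; apply.
Qed.

Lemma atoms_le w i j : increasing_atoms w -> (i <= j)%N -> eps i w <= eps j w.
Proof.
by move=> H; rewrite leq_eqVlt => /orP[/eqP ->//|/(atoms_lt H)/ltW].
Qed.

Lemma atoms_ge0 w i : increasing_atoms w -> 0 <= eps i w.
Proof. by move=> H; rewrite (le_trans H.1)// atoms_le. Qed.

(** The truth value of [k \in A] is read as the number of atoms, 1 or 0, in the cell k. *)
Definition occupied (e : R) K (A : {set 'I_K}) : set T :=
  [set w | forall k : 'I_K, ([set j | cell e k (eps j w)] #= `I_(k \in A))%card].

Definition number_below (t : R) m : set T :=
  [set w | (forall i, (i < m)%N -> eps i w < t) /\ t <= eps m w].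

Lemma measurable_occupied e K (A : {set 'I_K}) : measurable (occupied e A).
Proof.
apply: (measurable_forall (A := fun k : 'I_K =>
  [set w | ([set j | cell e k (eps j w)] #= `I_(k \in A))%card])) => k.
apply: measurable_count => //; exact: cell_measurable.
Qed.

Lemma measurable_number_below t m : measurable (number_below t m).
Proof.
apply: measurableI.
  apply: (measurable_forall (A := fun i => [set w | (i < m)%N -> eps i w < t])) => i.
  have [im|im] := boolP (i < m)%N.
    rewrite (_ : [set w | _] = [set w | eps i w < t]).
      apply: measurable_bool_set; apply: measurable_fun_ltr.
        exact: measurable_funP.
      exact: measurable_cst.
    by apply/seteqP; split=> w /=; [apply|].
  by rewrite (_ : [set w | _] = setT)//; apply/seteqP; split.
apply: measurable_bool_set; apply: measurable_fun_ler.
  exact: measurable_cst.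
exact: measurable_funP.
Qed.

Lemma pr_occupied e K (A : {set 'I_K}) : 0 < e ->
  pr P (occupied e A) = (rate * e) ^+ #|A| * expR (- (rate * e * K%:R)).
Proof.
move=> e0; have re0 : 0 < rate * e by rewrite mulr_gt0.
have [_ H] := epsP; have {H} := H K (fun k => cell e k) (fun k => nat_of_bool (k \in A)).
rewrite /pr /occupied => -> //.
- rewrite (eq_bigr (fun k : 'I_K =>
     ((rate * e) ^+ (k \in A) * expR (- (rate * e)))%:E)); last first.
    move=> k _; rewrite lebesgue_cell//= poisson_prob_weight ?mulr_ge0 1?ltW// /poisson_weight.
    by case: (k \in A); rewrite /= ?fact0 divr1.
  rewrite -[RHS]/(fine (_)%:E); congr fine.
  rewrite prodEFin; congr EFin.
  rewrite big_split /= prodr_const card_ord; congr (_ * _).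
    rewrite -prodr_const [RHS]big_mkcond /=.
    by apply: eq_bigr => k _; case: (k \in A).
  by rewrite -expRM_natl mulrN mulrC.
- move=> k; split; first exact: cell_measurable.
    move=> t; rewrite /cell /= !in_itv /= andbT => /andP[+ _]; apply: le_trans.
    by rewrite mulr_ge0// ltW.
  by rewrite lebesgue_cell// ltry.
- apply/trivIsetP => k l _ _ kl; apply/seteqP; split=> // t [kt lt_].
  by move: kl; rewrite -val_eqE /= (cell_inj e0 kt lt_) eqxx.
Qed.

(** Each of the K cells contains at most one atom, so the cell numbers of the atoms below K e are
    distinct; they increase with the atoms and run through A, hence they are its increasing
    enumeration. *)
Lemma occupied_cells e K (A : {set 'I_K}) w : 0 < e -> increasing_atoms w ->
  occupied e A w -> number_below (K%:R * e) #|A| w /\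
  forall i, (i < #|A|)%N -> cell e (nth 0%N (vals A) i) (eps i w).
Proof.
move=> e0 iw ow.
pose g j := Num.truncn (eps j w / e).
have gc j : cell e (g j) (eps j w) by apply: cell_truncn => //; exact: atoms_ge0.
have gK j : eps j w < K%:R * e -> (g j < K)%N.
  move=> jK; have := gc j; rewrite /cell /= in_itv /= => /andP[+ _].
  by move=> /le_lt_trans/(_ jK); rewrite ltr_pM2r// ltr_nat.
have one k : k \in A -> exists j, [set j | cell e k (eps j w)] = [set j].
  move=> kA; have := ow k; rewrite kA => /eq_cardSP[j jk].
  rewrite II0 card_eq0 => /eqP H; exists j; apply/seteqP; split=> i /=; last by move=> ->.
  move=> ik; apply: contrapT => ij.
  by have : ([set j | cell e k (eps j w)] `\ j) i by []; rewrite H.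
have none k : k \notin A -> forall j, ~ cell e k (eps j w).
  move=> kA; have := ow k; rewrite (negbTE kA) II0 card_eq0 => /eqP H j jk.
  by have : [set j | cell e k (eps j w)] j by []; rewrite H.
have gA j (jK : eps j w < K%:R * e) : Ordinal (gK j jK) \in A.
  by apply: contraT => /none/(_ j); case; exact: gc.
have ginj i j : eps i w < K%:R * e -> g i = g j -> i = j.
  move=> iK gij; have [l H] := one _ (gA i iK).
  have : [set j | cell e (Ordinal (gK i iK)) (eps j w)] i by exact: gc.
  have : [set j | cell e (Ordinal (gK i iK)) (eps j w)] j by rewrite /= gij; exact: gc.
  by rewrite H /= => -> ->.
have ltK i j : (i <= j)%N -> eps j w < K%:R * e -> eps i w < K%:R * e.
  by move=> ij; apply: le_lt_trans; exact: atoms_le.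
(* Pigeonhole: at most K atoms lie below K e. This excludes an infinite accumulation of atoms there
   and gives the first index m beyond K e. *)
have bound m : (forall i, (i < m)%N -> eps i w < K%:R * e) -> (m <= K)%N.
  move=> H; have -> : m = size [seq g i | i <- iota 0 m] by rewrite size_map size_iota.
  rewrite -(size_iota 0 K); apply: uniq_leq_size.
    rewrite map_inj_in_uniq ?iota_uniq// => i j; rewrite mem_iota add0n /= => im _.
    by apply: ginj; exact: H.
  move=> _ /mapP[i + ->]; rewrite !mem_iota !add0n /= => im.
  exact: (gK _ (H _ im)).
have [m [m1 m2]] : exists m, (forall i, (i < m)%N -> eps i w < K%:R * e) /\
    K%:R * e <= eps m w.
  have ex : exists m, K%:R * e <= eps m w.
    apply: contrapT => nex; have := bound K.+1; rewrite ltnn => H; suff: false by [].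
    by apply: H => i _; rewrite ltNge; apply/negP => h; apply: nex; exists i.
  exists (ex_minn ex); case: ex_minnP => m Km mmin; split=> // i im.
  by rewrite ltNge; apply/negP => /mmin; rewrite leqNgt im.
have valsE : [seq g i | i <- iota 0 m] = vals A.
  apply: vals_unique.
    apply: (@homo_sorted_in _ _ (fun i => (i < m)%N) g ltn ltn); last 2 first.
    - by apply/allP => i; rewrite mem_iota.
    - exact: iota_ltn_sorted.
    move=> i j im jm /= ij; rewrite ltn_neqAle; apply/andP; split.
      apply/eqP => /(ginj _ _ (m1 i im)) E; by rewrite E ltnn in ij.
    by apply: le_truncn; rewrite ler_pM2r ?invr_gt0// atoms_le// ltnW.
  move=> k; apply/mapP/idP.
    move=> [i]; rewrite mem_iota add0n /= => im ->.
    by rewrite -[g i]/(nat_of_ord (Ordinal (gK i (m1 i im)))) mem_vals; exact: gA.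
  move=> kA; have kK := vals_lt kA; move: kA.
  rewrite -[k]/(nat_of_ord (Ordinal kK)) mem_vals => /one[j H].
  have kj : cell e k (eps j w).
    by have : [set j] j by []; rewrite -H.
  have jK : eps j w < K%:R * e.
    move: kj; rewrite /cell /= in_itv /= => /andP[_ /lt_le_trans]; apply.
    by rewrite ler_pM2r// ler_nat.
  exists j; last exact: (cell_inj e0 kj (gc j)).
  rewrite mem_iota add0n /= ltnNge; apply/negP => mj.
  by have := lt_le_trans (ltK _ _ mj jK) m2; rewrite ltxx.
have mA : m = #|A| by rewrite -size_vals -valsE size_map size_iota.
rewrite -mA; split=> // i im.
by rewrite -valsE (nth_map 0%N) ?size_iota// nth_iota.
Qed.

End poisson_cells.

Section poisson_counts.
Context (R : realType) d (T : measurableType d) (P : probability T R).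
Variables (rate : R) (S : {RV P >-> closed_subset `[0%R : R, +oo[}).
Variable eps : nat -> {RV P >-> R}.
Hypotheses (rate0 : 0 < rate) (epsP : poisson_atoms rate eps).
Hypothesis Seps : independent_of_seq S eps.
Hypothesis ssS : self_similar S.

Lemma occupied_inj e K (A B : {set 'I_K}) w :
  occupied eps e A w -> occupied eps e B w -> A = B.
Proof.
move=> oA oB; apply/setP => k; have := oA k; have := oB k.
move=> /card_esym kB kA; have := card_eq_trans kB kA.
by move=> /card_eq_II; case: (k \in A); case: (k \in B).
Qed.

(** Independence of [S] speaks of the sigma-algebra generated by [eps], so measurability is
    established anew with the sample space carrying only that sigma-algebra. *)
Lemma occupied_sigma e K (A : {set 'I_K}) : sigma_rvs eps (occupied eps e A).
Proof.
pose G := \bigcup_i g_sigma_algebra_preimage (eps i).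
pose TG : measurableType _ := g_sigma_algebraType G.
have mf j : @measurable_fun _ _ TG R setT (eps j).
  move=> _ Y mY; apply: sub_sigma_algebra; exists j => //.
  by exists Y.
apply: (@measurable_forall _ TG 'I_K (fun k : 'I_K =>
  [set w | ([set j | cell e k (eps j w)] #= `I_(k \in A))%card])) => k.
apply: (@measurable_count _ TG R (fun j => eps j)) => //; exact: cell_measurable.
Qed.

Lemma pr_occupied_misses e K (A : {set 'I_K}) a D : 0 < e ->
  pr P (occupied eps e A `&` S @^-1` misses (hull e a D)) =
  (rate * e) ^+ #|A| * expR (- (rate * e * K%:R)) * vhull S D a.
Proof.
move=> e0; have mh : measurable (misses (D := `[0%R : R, +oo[) (hull e a D)).
  by apply: measurable_misses_compact; exact: compact_bands.
have mS : measurable (S @^-1` misses (hull e a D)) by exact: measurable_funPTI.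
have mO := measurable_occupied eps e A.
rewrite -(pr_occupied rate0 epsP)// -(pr_misses_hull ssS a D e0) mulrC.
apply: EFin_inj; rewrite EFinM -!prE//; last exact: measurableI.
rewrite setIC; apply: Seps; last exact: occupied_sigma.
by exists (misses (hull e a D)) => //; rewrite setTI.
Qed.

Definition misses_atoms D : set T :=
  [set w | cset (S w) `&` gaps (fun i => eps i w) D = set0].

Lemma misses_atomsE n D w : places_below n D -> increasing_atoms eps w ->
  misses_atoms D w <-> forall p, p \in D ->
    eps p.1 w <= eps p.2 w /\ misses `[eps p.1 w, eps p.2 w] (S w).
Proof.
move=> Dn iw; split.
  move=> H p pD; have /andP[p12 _] := allP Dn p pD.
  split; first by apply: atoms_le => //; exact: ltnW.
  apply: subsetI_eq0 H => // t; rewrite /= in_itv /= => pt.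
  by exists p.
move=> H; apply/seteqP; split=> // t [St [p pD pt]].
have [_ Hp] := H p pD; suff : (cset (S w) `&` `[eps p.1 w, eps p.2 w]) t by rewrite Hp.
by split=> //=; rewrite in_itv.
Qed.

Lemma measurable_misses_atoms n D : places_below n D ->
  measurable (misses_atoms D `&` increasing_atoms eps).
Proof.
move=> Dn; rewrite (_ : _ `&` _ = [set w | forall p : seq_sub D,
    eps (val p).1 w <= eps (val p).2 w /\
    misses `[eps (val p).1 w, eps (val p).2 w] (S w)] `&` increasing_atoms eps).
  apply: measurableI; last exact: measurable_increasing_atoms.
  apply: (measurable_forall (A := fun p : seq_sub D => [set w |
    eps (val p).1 w <= eps (val p).2 w /\
    misses `[eps (val p).1 w, eps (val p).2 w] (S w)])) => p.
  by apply: measurable_misses_itv; exact: measurable_funP.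
apply/seteqP; split=> w [H iw]; split=> //.
  move=> [p pD]; exact: (misses_atomsE Dn iw).1.
apply/(misses_atomsE Dn iw) => p pD; exact: (H (SeqSub pD)).
Qed.

(** Converse of [occupied_cells]: the m atoms below t are distinct, so every grid finer than their
    least gap separates them. *)
Lemma number_below_occupied t m w : 0 < t -> increasing_atoms eps w ->
  number_below eps t m w ->
  exists K0, forall K, (K0 <= K)%N -> (0 < K)%N /\
    exists2 A : {set 'I_K}, #|A| == m & occupied eps (t / K%:R) A w.
Proof.
move=> t0 iw [nb1 nb2].
have uinj i j : (i < m)%N -> (j < m)%N -> eps i w = eps j w -> i = j.
  move=> _ _ E; apply/eqP; case: ltngtP => // ij.
    by have := atoms_lt iw ij; rewrite E ltxx.
  by have := atoms_lt iw ij; rewrite E ltxx.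
have [e' e'0 He'] := min_gap uinj.
exists (Num.truncn (t / e')).+1 => K eK.
have K0 : (0 < K)%N by exact: leq_trans eK.
have K0' : 0 < K%:R :> R by rewrite ltr0n.
split=> //; set e := t / K%:R.
have e0 : 0 < e by rewrite divr_gt0.
have ee' : e < e'.
  rewrite /e ltr_pdivrMr// mulrC -ltr_pdivrMr//.
  by rewrite (lt_le_trans (truncnS_gt _))// ler_nat.
pose g i := Num.truncn (eps i w / e).
have gc i : cell e (g i) (eps i w) by apply: cell_truncn => //; exact: atoms_ge0.
have belowE j k : (k < K)%N -> cell e k (eps j w) -> (j < m)%N.
  move=> kK; rewrite /cell /= in_itv /= => /andP[_ h].
  rewrite ltnNge; apply/negP => /(atoms_le iw) mj.
  have := lt_le_trans h (_ : k.+1%:R * e <= t); rewrite ltNge (le_trans nb2 mj).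
  move=> /(_ _)/negP; apply => //.
  by rewrite /e mulrCA ger_pMr// ler_pdivrMr// mul1r ler_nat.
have gK (i : 'I_m) : (g i < K)%N.
  have := gc i; rewrite /cell /= in_itv /= => /andP[+ _].
  move=> /le_lt_trans/(_ (nb1 i (ltn_ord i))).
  by rewrite /e mulrCA gtr_pMr// ltr_pdivrMr// mul1r ltr_nat.
have one i j k : (i < m)%N -> (j < m)%N -> cell e k (eps i w) ->
    cell e k (eps j w) -> i = j.
  move=> ni nj; rewrite /cell /= !in_itv /= => /andP[h1 h2] /andP[h3 h4].
  apply/eqP; apply: contraT => /(He' i j ni nj); rewrite leNgt => /negP; case.
  apply: lt_trans ee'; rewrite ltr_norml; move: h2 h4; rewrite -natr1 mulrDl mul1r.
  by move=> h2 h4; apply/andP; split; lra.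
pose f (i : 'I_m) := Ordinal (gK i).
exists (f @: [set: 'I_m])%SET.
  rewrite card_imset ?cardsT ?card_ord// => i j fij; apply: ord_inj.
  by apply: (one _ _ (f i)) => //; [exact: gc|rewrite fij; exact: gc].
move=> k; have [|kA] := boolP (k \in _).
  move=> /imsetP[i _ ->]; rewrite (_ : [set j | _] = [set nat_of_ord i]); last first.
    apply/seteqP; split=> j /=; last by move=> ->; exact: gc.
    move=> H; apply/esym; exact: (one _ _ _ (ltn_ord i) (belowE _ _ (gK i) H) (gc i) H).
  by apply/eq_cardSP; exists (nat_of_ord i) => //; rewrite setDv II0 card_eq0.
rewrite II0 card_eq0; apply/eqP/seteqP; split=> // j /= H.
have jm := belowE j k (ltn_ord k) H.
move: kA => /negP; apply; apply/imsetP; exists (Ordinal jm) => //.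
by apply: ord_inj => /=; exact: (cell_inj e0 H (gc j)).
Qed.

(** Cut [0, t[ into K cells. All sets A of m cells are equally likely to be those occupied, with
    probability (rate t / K)^m e^(-rate t), so given their number the atoms look like a uniform
    m-subset, over which [vhull] averages to q in the limit. The remaining factor 'C(K, m) / K^m
    tends to 1 / m!. *)
Lemma pr_misses_number t m D q : 0 < t -> places_below m D ->
  (vsum (vhull S D) m K / 'C(K, m)%:R @[K --> \oo] --> q) ->
  pr P (misses_atoms D `&` increasing_atoms eps `&` number_below eps t m) =
  poisson_weight (rate * t) m * q.
Proof.
move=> t0 Dm vq.
pose V K (A : {set 'I_K}) := occupied eps (t / K%:R) A `&`
  S @^-1` misses (hull (t / K%:R) (nth 0%N (vals A)) D).
have mV K (A : {set 'I_K}) : measurable (V K A).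
  apply: measurableI; first exact: measurable_occupied.
  apply: measurable_funPTI; apply: measurable_misses_compact; exact: compact_bands.
pose TK K := [set w | exists2 A : {set 'I_K}, #|A| == m & V K A w].
have cT : pr P (TK K) @[K --> \oo] -->
    pr P (misses_atoms D `&` increasing_atoms eps `&` number_below eps t m).
  apply: (pr_event_cvg (N := increasing_atoms eps)).
  - move=> K; apply: (measurable_exists_fin (Q := fun A : {set 'I_K} => #|A| == m)
      (A := fun A => V K A)) => A _; exact: mV.
  - apply: measurableI; first exact: measurable_misses_atoms Dm.
    exact: measurable_number_below.
  - exact: measurable_increasing_atoms.
  - exact: pr_increasing_atoms epsP.
  move=> w iw.
  have fwd K : (0 < K)%N -> TK K w ->
      (misses_atoms D `&` increasing_atoms eps `&` number_below eps t m) w.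
    move=> K0 [A /eqP Am [oA vA]].
    have e0 : 0 < t / K%:R by rewrite divr_gt0// ltr0n.
    have [nb cl] := occupied_cells e0 iw oA.
    rewrite mulrCA divff ?pnatr_eq0 -?lt0n// mulr1 Am in nb; split=> //; split=> //.
    apply: subsetI_eq0 vA => //; apply: (gaps_sub_hull Dm).
    by move=> i im; apply: cl; rewrite Am.
  have [mw|nmw] := pselect ((misses_atoms D `&` number_below eps t m) w); last first.
    exists 1%N => K K0; split; first exact: fwd.
    by move=> [[? ?] ?]; case: nmw.
  have [md nb] := mw.
  have [K0 HK0] := number_below_occupied t0 iw nb.
  have [e e0 He] := miss_gaps_hull (@cset_closed _ _ (S w)) Dm md.
  exists (maxn K0 (Num.truncn (t / e)).+1) => K; rewrite geq_max => /andP[/HK0[K1 [A Am oA]] eK].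
  split; first exact: fwd.
  move=> _; exists A => //; split=> //.
  have te0 : 0 < t / K%:R by rewrite divr_gt0// ltr0n.
  have [_ cl] := occupied_cells te0 iw oA.
  apply: He => //.
  - rewrite ltr_pdivrMr ?ltr0n// mulrC -ltr_pdivrMr//.
    by rewrite (lt_le_trans (truncnS_gt _))// ler_nat.
  - by move=> i im; apply: cl; rewrite (eqP Am).
  - by move=> p /(allP Dm) /andP[p12 _]; apply: atoms_le => //; exact: ltnW.
apply: (cvg_unique _ cT); first exact: Rhausdorff.
have H2 := cvgM (cvg_cst (poisson_weight (rate * t) m)) (cvgM (@ffact_ratio_cvg1 R m) vq).
rewrite mul1r in H2.
apply: (cvg_trans _ (H2 _ _ _)); apply: near_eq_cvg; near=> K.
have nK : (m <= K)%N by near: K; exact: nbhs_infty_ge.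
have K0 : (0 < K)%N by near: K; exact: nbhs_infty_gt.
have K0' : K%:R != 0 :> R by rewrite pnatr_eq0 -lt0n.
rewrite (pr_sum_fin _ (Q := fun A : {set 'I_K} => #|A| == m))//; last first.
  by move=> A B w _ _ [oA _] [oB _]; exact: occupied_inj oA oB.
rewrite (eq_bigr (fun A : {set 'I_K} => (rate * (t / K%:R)) ^+ m * expR (- (rate * t)) *
   vhull S D (nth 0%N (vals A)))); last first.
  move=> A /eqP Am; rewrite /V pr_occupied_misses ?divr_gt0 ?ltr0n// Am.
  by rewrite -[rate * _ * _]mulrA divfK.
rewrite -mulr_sumr -/(vsum (vhull S D) m K) /= -bin_ffact natrM /poisson_weight.
have Kn : K%:R ^+ m != 0 :> R by rewrite expf_neq0.
have C0 : 'C(K, m)%:R != 0 :> R by rewrite pnatr_eq0 -lt0n bin_gt0.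
have F0 : m`!%:R != 0 :> R by rewrite pnatr_eq0 -lt0n fact_gt0.
rewrite (_ : (rate * (t / K%:R)) ^+ m = (rate * t) ^+ m / K%:R ^+ m); last first.
  by rewrite mulrA expr_div_n.
move: Kn; set X := K%:R ^+ m => Kn.
by field; rewrite Kn C0 F0.
Unshelve. all: by end_near. Qed.

(** The case of the empty list of pairs, for which nothing has to be missed and q = 1. *)
Lemma pr_number_below t m : 0 < t ->
  pr P (number_below eps t m) = poisson_weight (rate * t) m.
Proof.
move=> t0; have mi := measurable_increasing_atoms eps.
rewrite -(prI1 (measurable_number_below eps t m) mi (pr_increasing_atoms epsP)).
have -> : number_below eps t m `&` increasing_atoms eps =
    misses_atoms [::] `&` increasing_atoms eps `&` number_below eps t m.
  apply/seteqP; split=> w; first by move=> [? ?]; split=> //; split=> //; apply/seteqP; split=> // s [_ []].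
  by move=> [[_ ?] ?].
rewrite (@pr_misses_number t m [::] 1)// ?mulr1//.
have H : (fun _ : nat => 1 : R) @ \oo --> (1 : R) by exact: cvg_cst.
apply: cvg_trans H; apply: near_eq_cvg; near=> K.
have nK : (m <= K)%N by near: K; exact: nbhs_infty_ge.
have -> : vhull S [::] = fun=> 1.
  apply/funext => a; rewrite /vhull -(@pr_setT _ _ _ P); congr pr.
  by apply/seteqP; split=> w // _; apply/seteqP; split=> // s [_ []].
by rewrite vsum1 divff// pnatr_eq0 -lt0n bin_gt0.
Unshelve. all: by end_near. Qed.

Lemma number_below_inj t m m' w : increasing_atoms eps w ->
  number_below eps t m w -> number_below eps t m' w -> m = m'.
Proof.
move=> iw [h1 h2] [h1' h2']; apply/eqP; case: ltngtP => // mm'.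
  by have := le_lt_trans h2 (h1' _ mm'); rewrite ltxx.
by have := le_lt_trans h2' (h1 _ mm'); rewrite ltxx.
Qed.

Definition locally_finite_atoms t : set T :=
  [set w | exists m, (number_below eps t m `&` increasing_atoms eps) w].

Lemma measurable_locally_finite_atoms t : measurable (locally_finite_atoms t).
Proof.
apply: (measurable_exists (A := fun m => number_below eps t m `&` increasing_atoms eps)) => m.
apply: measurableI; first exact: measurable_number_below.
exact: measurable_increasing_atoms.
Qed.

(** The disjoint events of having exactly m atoms below t have the Poisson weights as probabilities,
    which sum to 1; so the sequence of atoms almost surely does not stay below t. *)
Lemma pr_locally_finite_atoms t : 0 < t -> pr P (locally_finite_atoms t) = 1.
Proof.
move=> t0; apply/eqP; rewrite eq_le pr_le1/=; last exact: measurable_locally_finite_atoms.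
have mi := measurable_increasing_atoms eps.
rewrite -(cvg_lim _ (poisson_weight_sum (rate * t))); last exact: Rhausdorff.
apply: limr_le; first by apply/cvg_ex; exists 1; exact: poisson_weight_sum.
apply: nearW => M; rewrite /series /= big_mkord.
rewrite (eq_bigr (fun m : 'I_M => pr P (number_below eps t m `&` increasing_atoms eps))); last first.
  move=> m _; rewrite (prI1 _ mi (pr_increasing_atoms epsP)); last exact: measurable_number_below.
  by rewrite pr_number_below.
have mA (m : 'I_M) : true -> measurable (number_below eps t m `&` increasing_atoms eps).
  by move=> _; apply: measurableI => //; exact: measurable_number_below.
rewrite -(pr_sum_fin P mA); last first.
  by move=> m m' w _ _ [nm iw] [nm' _]; apply: ord_inj; exact: number_below_inj iw nm nm'.
apply: pr_mono.
- exact: (measurable_exists_fin mA).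
- exact: measurable_locally_finite_atoms.
- by move=> w [m _ H]; exists m.
Qed.

(** On the event that atom n lies below t, the number m of atoms below t exceeds n, and for each
    such m the conditional probability of missing the gaps is q. Letting t grow removes the
    restriction. *)
Lemma pr_misses_atoms n D q : places_below n D ->
  (forall m, (n < m)%N -> vsum (vhull S D) m K / 'C(K, m)%:R @[K --> \oo] --> q) ->
  pr P (misses_atoms D `&` increasing_atoms eps) = q.
Proof.
move=> Dn vq; set X := _ `&` _.
have mi := measurable_increasing_atoms eps.
have mX : measurable X by exact: measurable_misses_atoms Dn.
pose L t := [set w | eps n w < t].
have mL t : measurable (L t).
  apply: measurable_bool_set; apply: measurable_fun_ltr; first exact: measurable_funP.
  exact: measurable_cst.
have XL t : 0 < t -> pr P (X `&` L t) = q * pr P (L t).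
  move=> t0.
  pose B (m : nat) := number_below eps t m `&` increasing_atoms eps.
  have mB m : measurable (B m) by apply: measurableI => //; exact: measurable_number_below.
  pose W M := [set w | exists2 m : 'I_M, (n < m)%N & B m w].
  have mW M : measurable (W M).
    by apply: (measurable_exists_fin (Q := fun m : 'I_M => (n < m)%N) (A := fun m => B m)).
  have cW Y : measurable Y -> pr P (Y `&` W M) @[M --> \oo] --> pr P (Y `&` L t).
    move=> mY; apply: (pr_event_cvg (N := locally_finite_atoms t)).
    - by move=> M; exact: measurableI.
    - exact: measurableI.
    - exact: measurable_locally_finite_atoms.
    - exact: pr_locally_finite_atoms.
    move=> w [m [[nb1 nb2] iw]]; exists m.+1 => M mM; split.
      move=> [Yw [m' nm' [[h1 _] _]]]; split=> //; exact: h1.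
    move=> [Yw Lw]; split=> //; exists (Ordinal mM) => //=.
    rewrite ltnNge; apply/negP => mn; have := le_lt_trans (atoms_le iw mn) Lw.
    by rewrite ltNge nb2.
  have H : q * pr P (setT `&` W M) @[M --> \oo] --> q * pr P (setT `&` L t).
    by apply: cvgMr; exact: cW.
  rewrite setTI in H; apply: (cvg_unique _ (cW X mX)); first exact: Rhausdorff.
  apply: cvg_trans H; apply: near_eq_cvg; apply: nearW => M; rewrite setTI.
  have dB (m m' : 'I_M) w : (n < m)%N -> (n < m')%N -> B m w -> B m' w -> m = m'.
    by move=> _ _ [nm iw] [nm' _]; apply: ord_inj; exact: number_below_inj iw nm nm'.
  rewrite (pr_sum_fin _ (Q := fun m : 'I_M => (n < m)%N) (A := fun m => B m))//.
  rewrite (_ : X `&` W M = [set w | exists2 m : 'I_M, (n < m)%N & (X `&` B m) w]); last first.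
    by apply/seteqP; split=> w; [move=> [? [m ? ?]]|move=> [m ? [? ?]]]; [exists m|split=> //; exists m].
  rewrite (pr_sum_fin _ (Q := fun m : 'I_M => (n < m)%N) (A := fun m => X `&` B m)); last 2 first.
  - by move=> m _; exact: measurableI.
  - by move=> m m' w nm nm' [_ h] [_ h']; exact: dB h h'.
  rewrite mulr_sumr; apply: eq_bigr => m nm.
  have Dm : places_below m D.
    apply/allP => p /(allP Dn) /andP[-> /= h]; exact: ltn_trans nm.
  have -> : X `&` B m = X `&` number_below eps t m.
    by apply/seteqP; split=> w [[? ?]]; [move=> []|]; split.
  rewrite (pr_misses_number t0 Dm (vq m nm)) (prI1 _ mi (pr_increasing_atoms epsP)).
    by rewrite pr_number_below// mulrC.
  exact: measurable_number_below.
have cL Y : measurable Y -> pr P (Y `&` L k.+1%:R) @[k --> \oo] --> pr P Y.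
  move=> mY; apply: (pr_event_cvg (N := increasing_atoms eps)) => //.
  - by move=> k; exact: measurableI.
  - exact: pr_increasing_atoms epsP.
  move=> w iw; exists (Num.truncn (eps n w)) => k ek; split=> [[]//|Yw]; split=> //.
  by rewrite /L /= (lt_le_trans (truncnS_gt _))// ler_nat.
have H : q * pr P (setT `&` L k.+1%:R) @[k --> \oo] --> q * 1.
  by have H0 := cL setT measurableT; rewrite pr_setT in H0; exact: cvgMr.
rewrite mulr1 in H; apply: (cvg_unique _ (cL X mX)); first exact: Rhausdorff.
by apply: cvg_trans H; apply: near_eq_cvg; apply: nearW => k; rewrite setTI XL.
Qed.

End poisson_counts.

Section poisson_construction.
Context (R : realType) (C : forall n, probability (composition n) R).
Context dS (TS : measurableType dS) (PS : probability TS R).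
Variable S : {RV PS >-> closed_subset `[0%R : R, +oo[}.
Hypothesis ssS : self_similar S.
Hypothesis CS : derived_from C (@restrict01 R _ \o S : {RV PS >-> _}).
Context d (T : measurableType d) (P : probability T R).
Variables (rate : R) (S' : {RV P >-> closed_subset `[0%R : R, +oo[}).
Variables (eps : nat -> {RV P >-> R}) (X : forall n : nat, T -> composition n).
Hypotheses (rate0 : 0 < rate) (S'S : same_law S' S).
Hypothesis XC : poisson_construction rate S' eps X.

Lemma same_law_self_similar : self_similar S'.
Proof.
move=> c A mA; rewrite (S'S mA) (ssS c mA).
have mcA : measurable (scale c @^-1` A) by exact: measurable_funPTI.
by have := S'S mcA.
Qed.

Lemma same_law_vhull D : vhull S' D = vhull S D.
Proof.
apply/funext => a; rewrite /vhull /pr; congr fine; apply: S'S.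
by apply: measurable_misses_compact; exact: compact_bands.
Qed.

Lemma measurable_digit j b : measurable [set w | digit S' eps w j = b].
Proof.
case: j => [|j] /=.
  case: b; first by rewrite (_ : [set w | _] = setT)//; apply/seteqP; split.
  by rewrite (_ : [set w | _] = set0)//; apply/seteqP; split.
pose G := [set w | eps j w <= eps j.+1 w /\ misses `[eps j w, eps j.+1 w] (S' w)] `|`
  [set w | eps j.+1 w < eps j w].
have mG : measurable G.
  apply: measurableU; first by apply: measurable_misses_itv; exact: measurable_funP.
  by apply: measurable_bool_set; apply: measurable_fun_ltr; exact: measurable_funP.
have GE w : G w <-> misses `[eps j w, eps j.+1 w] (S' w).
  split=> [[[//]|h]|h].
    apply/seteqP; split=> // t [_]; rewrite /= in_itv /= => /andP[h1 h2].
    by have := le_lt_trans (le_trans h1 h2) h; rewrite ltxx.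
  by rewrite /G /=; have [h'|h'] := leP (eps j w) (eps j.+1 w); [left|right].
case: b.
  rewrite (_ : [set w | _] = ~` G); first exact: measurableC.
  apply/seteqP; split=> w /= H.
    by move=> /GE H'; move/asboolP : H; rewrite H' => -[].
  by apply/asboolP; apply: contrapT => /nonemptyPn H'; apply: H; exact/GE.
rewrite (_ : [set w | _] = G)//; apply/seteqP; split=> w /= H.
  by apply/GE; move/negbT/asboolPn : H => /nonemptyPn.
by apply/negbTE/asboolPn/nonemptyPn; apply/GE.
Qed.

Lemma measurable_poisson_composition n (A : set (composition n)) :
  measurable (X n @^-1` A).
Proof.
have [_ _ Xb] := XC.
apply: (measurable_factor (b := fun w => [ffun i : 'I_n => digit S' eps w i])).
- move=> x; rewrite (_ : [set w | _] =
     [set w | forall i : 'I_n, digit S' eps w i = x i]); last first.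
    apply/seteqP; split=> w /=; first by move=> <- i; rewrite ffunE.
    by move=> H; apply/ffunP => i; rewrite ffunE.
  apply: (measurable_forall (A := fun i : 'I_n => [set w | digit S' eps w i = x i])) => i.
  exact: measurable_digit.
- move=> w w' bww'; apply: composition_binary_inj; rewrite !Xb.
  apply/eq_in_map => i; rewrite mem_iota add0n /= => ni.
  by move/ffunP : bww' => /(_ (Ordinal ni)); rewrite !ffunE.
Qed.

Lemma poisson_unbroken n D w : places_below n D -> increasing_atoms eps w ->
  unbroken n D (X n w) <-> misses_atoms S' eps D w.
Proof.
move=> Dn iw; have [_ _ Xb] := XC.
have chain p (pD : p \in D) := @miss_gaps_chain R (cset (S' w)) (fun i => eps i w) p.1 p.2
  (proj1 (andP (allP Dn p pD))) (fun k l kl => atoms_lt iw (proj1 (andP kl))).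
have digitE p l : p \in D -> (p.1 < l <= p.2)%N ->
    ~~ nth false (binary (X n w)) l <-> cset (S' w) `&` `[eps l.-1 w, eps l w] = set0.
  move=> pD /andP[p1l lp2]; have /andP[_ p2n] := allP Dn p pD.
  rewrite Xb nth_mkseq ?(leq_ltn_trans lp2)//; case: l p1l {lp2} => // l _ /=.
  split; first by move=> /asboolPn/nonemptyPn.
  by move=> H; apply/asboolPn/nonemptyPn.
split=> [H|H].
  apply/(misses_atomsE _ Dn iw) => p pD; have /andP[p12 _] := allP Dn p pD.
  split; first by apply: atoms_le => //; exact: ltnW.
  by apply/chain => // l pl; exact: (digitE p l pD pl).1 (H p pD l pl).
move=> p pD l pl; apply: (digitE p l pD pl).2; apply: (chain p pD).1 pl.
by have [_] := (misses_atomsE S' Dn iw).1 H p pD.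
Qed.

Lemma poisson_construction_version : strong_right_version C P X.
Proof.
have [epsP Seps Xb] := XC.
have mi := measurable_increasing_atoms eps.
split.
- by move=> n _ A _; rewrite setTI; exact: measurable_poisson_composition.
- move=> n n0; apply: composition_rv_law; first exact: measurable_poisson_composition.
  move=> D Dn; have mX := measurable_poisson_composition (unbroken n D).
  rewrite !prE//; congr EFin.
  rewrite -(prI1 mX mi (pr_increasing_atoms epsP)).
  rewrite -(pr_misses_atoms rate0 epsP Seps same_law_self_similar Dn (q := pr (C n) (unbroken n D))).
    congr pr; apply/seteqP; split=> w [H iw]; split=> //.
      exact: (poisson_unbroken Dn iw).1.
    exact: (poisson_unbroken Dn iw).2.
  move=> m nm; rewrite same_law_vhull.
  have Dm : places_below m D.
    by apply/allP => p /(allP Dn) /andP[-> /= h]; exact: ltn_trans nm.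
  (* Right-consistency of C, itself a consequence of the sampling, makes the limit independent of
     the number m of atoms. *)
  rewrite -(consistent_unbroken_le (m := m) _ _ Dn) ?n0 ?(ltnW nm)//.
    exact: (derived_cells ssS CS (ltn_trans n0 nm) Dm).
  apply: unbroken_right_consistent => k E k0 Ek.
  exact: (derived_unbroken_last ssS CS k0 Ek).
- apply: aeW => w n n0; apply: composition_binary_inj.
  have /andP[Xgt /eqP Xsum] := compositionP (X n.+1 w).
  rewrite /= binary_delete_seq ?Xsum//.
  have sz : size (binary (X n.+1 w)) = n.+1 by exact: size_composition_binary.
  have := @remove_last_digit (binary (X n.+1 w)); rewrite sz /= => ->//.
  rewrite !Xb; apply: (@eq_from_nth _ false).
    by rewrite size_take !size_mkseq ltnSn.
  by move=> i; rewrite size_mkseq => ni; rewrite nth_take// !nth_mkseq// ltnS ltnW.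
Qed.

End poisson_construction.

Lemma eventually_forall_fin (I : finType) (Q : I -> nat -> Prop) :
  (forall i, exists K0, forall K, (K0 <= K)%N -> Q i K) ->
  exists K0, forall K, (K0 <= K)%N -> forall i, Q i K.
Proof.
move=> /boolp.choice[k Hk]; exists (\max_i k i)%N => K kK i; apply: Hk.
by apply: leq_trans kK; exact: leq_bigmax.
Qed.

Lemma cvg_bigprod (R : realType) (I : Type) (r : seq I) (f : I -> nat -> R) (l : I -> R) :
  (forall i, f i n @[n --> \oo] --> l i) ->
  \prod_(i <- r) f i n @[n --> \oo] --> \prod_(i <- r) l i.
Proof.
move=> fl; elim: r => [|i r IH].
  by rewrite big_nil; under eq_fun do rewrite big_nil; exact: cvg_cst.
rewrite big_cons; under eq_fun do rewrite big_cons.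
by apply: cvgM => //; exact: fl.
Qed.

Lemma half_expr_lt (R : realType) (e : R) : 0 < e ->
  exists K0, forall K, (K0 <= K)%N -> 2^-1 ^+ K < e.
Proof.
move=> e0; exists (Num.truncn e^-1).+1 => K eK; rewrite exprVn -[ltRHS]invrK.
rewrite ltf_pV2 ?posrE ?exprn_gt0 ?invr_gt0//.
rewrite (lt_le_trans (truncnS_gt _))// (@le_trans _ _ K%:R) ?ler_nat//.
by rewrite -natrX ler_nat ltnW// ltn_expl.
Qed.

(** * Independent uniform variables *)

Section unit_uniform.
Variable R : realType.

(** The uniform law on [0, 1], as a probability on the whole line, is the base space on which the
    bits, the uniform sequences and the Poisson atoms are constructed. *)
Definition unit_uniform (A : set R) : \bar R := uniform_prob (@ltr01 R) A.

Let unit_uniform0 : unit_uniform set0 = 0%E.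
Proof. exact: measure0. Qed.

Let unit_uniform_ge0 A : (0 <= unit_uniform A)%E.
Proof. exact: measure_ge0. Qed.

Let unit_uniform_sigma_additive : semi_sigma_additive unit_uniform.
Proof. exact: (@measure_semi_sigma_additive _ _ R (uniform_prob (@ltr01 R))). Qed.

HB.instance Definition _ := isMeasure.Build _ _ _ unit_uniform
  unit_uniform0 unit_uniform_ge0 unit_uniform_sigma_additive.

Let unit_uniform_setT : unit_uniform setT = 1%E.
Proof. exact: probability_setT. Qed.

HB.instance Definition _ :=
  Measure_isProbability.Build _ _ _ unit_uniform unit_uniform_setT.

End unit_uniform.

Lemma pr_uniform_itv (R : realType) (a b : R) : 0 <= a -> a <= b -> b <= 1 ->
  pr (@unit_uniform R) `[a, b[%classic = b - a.
Proof. by move=> a0 ab b1; exact: (congr1 fine (uniform_prob_itv a0 ab b1)). Qed.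

Section tree_bits.
Context (R : realType).
Variable p : seq bool -> R.
Hypotheses (p_ge0 : forall s, 0 <= p s) (p_nil : p [::] = 1).
Hypothesis p_rcons : forall s, p s = p (rcons s false) + p (rcons s true).
Local Notation unif := (@unit_uniform R).

(* The interval [ [left s, left s + p s[ ] is split according to the next bit. *)
Definition left_end (s : seq bool) : R :=
  \sum_(k < size s) if nth false s k then p (rcons (take k s) false) else 0.

(** Locates x in nested intervals of lengths [p s]. A consistent family of cylinder probabilities is
    thereby realised as the law of a bit sequence that is a function of one uniform number. *)
Fixpoint walk (x : R) (n : nat) : seq bool :=
  if n is m.+1 then
    let s := walk x m in rcons s (left_end s + p (rcons s false) <= x)
  else [::].

Definition walk_bit (n : nat) (x : R) : bool := nth false (walk x n.+1) n.

Lemma left_end_rcons s b :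
  left_end (rcons s b) = left_end s + (if b then p (rcons s false) else 0).
Proof.
rewrite /left_end size_rcons big_ord_recr /= nth_rcons ltnn eqxx; congr (_ + _).
  apply: eq_bigr => i _; rewrite nth_rcons ltn_ord -(cats1 s) takel_cat//.
  exact: ltnW.
by rewrite -(cats1 s) takel_cat// take_size.
Qed.

Lemma size_walk x n : size (walk x n) = n.
Proof. by elim: n => //= n IH; rewrite size_rcons IH. Qed.

Lemma walkE x n : walk x n = mkseq (walk_bit ^~ x) n.
Proof.
elim: n => // n IH; rewrite /mkseq -addn1 iotaD map_cat /= -/(mkseq _ n) -IH addn1 add0n.
by rewrite /walk_bit /= nth_rcons size_walk ltnn eqxx cats1.
Qed.

Lemma walk_interval x n s : 0 <= x < 1 ->
  walk x n = s <-> size s = n /\ left_end s <= x < left_end s + p s.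
Proof.
move=> x01; elim: n s => [|n IH] s.
  split=> [<-|[/size0nil ->//]].
  by rewrite /left_end big_ord0 add0r p_nil.
case/lastP: s => [|s b].
  by split=> [/(congr1 size)|[]//]; rewrite size_walk.
rewrite size_rcons left_end_rcons /=; split=> [/rcons_inj[ws bE]|].
  have [sn /andP[h1 h2]] := (IH s).1 ws; rewrite sn; split=> //.
  have ps := p_rcons s; move: bE; rewrite ws; case: b => bE; apply/andP; split; lra.
move=> [[sn] h]; have [h1 h2] : left_end s <= x /\ x < left_end s + p s.
  have := p_rcons s; have := p_ge0 (rcons s false); have := p_ge0 (rcons s true).
  by case: b h => /andP[]; lra.
have ws : walk x n = s by apply/IH; rewrite h1 h2.
rewrite ws; congr rcons; case: b h => /andP[]; first by move=> ->.
by move=> _; rewrite addr0 ltNge => /negbTE.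
Qed.

Lemma left_end_ge0 s : 0 <= left_end s.
Proof. by apply: sumr_ge0 => k _; case: ifP. Qed.

Lemma left_end_le1 s : left_end s + p s <= 1.
Proof.
elim/last_ind: s => [|s b IH].
  by rewrite /left_end big_ord0 add0r p_nil.
apply: le_trans IH; rewrite left_end_rcons [p s]p_rcons.
by case: b; have := p_ge0 (rcons s true); lra.
Qed.

Lemma measurable_walk n s : measurable [set x | walk x n = s].
Proof.
elim: n s => [|n IH] s.
  have [->|s0] := eqVneq s [::].
    by rewrite (_ : [set x | _] = setT)//; apply/seteqP; split.
  rewrite (_ : [set x | _] = set0)//; apply/seteqP; split=> // x /= E.
  by rewrite -E eqxx in s0.
case/lastP: s => [|s b].
  rewrite (_ : [set x | _] = set0)//; apply/seteqP; split=> // x /(congr1 size).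
  by rewrite size_walk.
rewrite (_ : [set x | _] = [set x | walk x n = s] `&`
    [set x | (left_end s + p (rcons s false) <= x) = b]).
  apply: measurableI => //; set c := left_end s + _.
  case: b.
    rewrite (_ : [set x | _] = `[c, +oo[%classic); first exact: measurable_itv.
    by apply/seteqP; split=> x; rewrite /= in_itv /= andbT.
  rewrite (_ : [set x | _] = `]-oo, c[%classic); first exact: measurable_itv.
  by apply/seteqP; split=> x; rewrite /= in_itv /= leNgt; case: (x < c).
apply/seteqP; split=> x /=; first by move=> /rcons_inj[-> <-].
by move=> [-> ->].
Qed.

Lemma measurable_walk_bit n b : measurable [set x | walk_bit n x = b].
Proof.
rewrite (_ : [set x | _] = [set x | exists2 t : n.+1.-tuple bool,
    nth false t n == b & walk x n.+1 = t]).
  apply: (measurable_exists_fin (Q := fun t : n.+1.-tuple bool => nth false t n == b)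
    (A := fun t => [set x | walk x n.+1 = t])) => t _.
  exact: measurable_walk.
apply/seteqP; split=> x; last by move=> [t /eqP tb wt]; rewrite /= /walk_bit wt.
move=> /= wb; exists (Tuple (introT eqP (size_walk x n.+1))) => //.
exact/eqP.
Qed.

Lemma pr_walk s : pr unif [set x | walk x (size s) = s] = p s.
Proof.
have h0 := left_end_ge0 s; have h1 := left_end_le1 s; have hp := p_ge0 s.
have m01 : measurable (`[0, 1[%classic : set R) by exact: measurable_itv.
have mw := measurable_walk (size s) s.
rewrite -(@prI1 _ _ R unif _ _ mw m01); last by rewrite pr_uniform_itv// subr0.
rewrite (_ : _ `&` _ = `[left_end s, left_end s + p s[%classic).
  by rewrite pr_uniform_itv// ?lerDl// addrAC subrr add0r.
apply/seteqP; split=> x; rewrite /= !in_itv /=.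
  by move=> [H x01]; have [_] := (walk_interval _ _ x01).1 H.
move=> H; have x01 : 0 <= x < 1 by move: H => /andP[]; lra.
by split=> //; apply/(walk_interval _ _ x01).
Qed.

Lemma pr_walk_bits n (f : {ffun 'I_n -> bool}) :
  pr unif [set x | forall k : 'I_n, walk_bit k x = f k] = p (fgraph f).
Proof.
have sz : size (fgraph f) = n by rewrite size_tuple card_ord.
rewrite -pr_walk sz; congr pr; apply/seteqP; split=> x /=; rewrite walkE.
  move=> H; apply: (@eq_from_nth _ false); first by rewrite size_mkseq sz.
  move=> i; rewrite size_mkseq => ni; rewrite nth_mkseq// (H (Ordinal ni)).
  by rewrite (nth_fgraph_ord false (Ordinal ni)).
move=> H k; have := congr1 (nth false ^~ k) H.
by rewrite nth_mkseq// nth_fgraph_ord.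
Qed.

End tree_bits.

(** * A sequence of uniform numbers from the bits of one *)

Section fair_bits.
Context (R : realType).
Local Notation unif := (@unit_uniform R).

Definition fair (s : seq bool) : R := 2^-1 ^+ size s.

Lemma fair_ge0 s : 0 <= fair s.
Proof. by rewrite exprn_ge0// invr_ge0. Qed.

Lemma fair_rcons s : fair s = fair (rcons s false) + fair (rcons s true).
Proof. by rewrite /fair !size_rcons exprS; set y := _ ^+ size s; lra. Qed.

Local Notation bit := (walk_bit fair).

Lemma measurable_fair_bit n b : measurable [set x | bit n x = b].
Proof. exact: measurable_walk_bit. Qed.

(** The event is the union of all patterns of the first M bits that extend g. Distributing the sum
    over the product leaves a factor 1/2 for each selected position and 1 for every other. *)
Lemma pr_fair_bits (I : finType) (phi : I -> nat) (g : {ffun I -> bool}) :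
  injective phi ->
  pr unif [set x | forall i, bit (phi i) x = g i] = 2^-1 ^+ #|I|.
Proof.
move=> phi_inj; pose M := (\max_i phi i).+1.
have phiM i : (phi i < M)%N by rewrite ltnS; exact: leq_bigmax.
pose B (k : 'I_M) : pred bool := fun b => [forall i, (phi i == k) ==> (b == g i)].
rewrite (_ : [set x | _] = [set x | exists2 f : {ffun 'I_M -> bool},
    f \in family B & forall k : 'I_M, bit k x = f k]); last first.
  apply/seteqP; split=> x /=.
    move=> H; exists [ffun k : 'I_M => bit k x]; last by move=> k; rewrite ffunE.
    apply/familyP => k; rewrite ffunE; apply/forallP => i; apply/implyP => /eqP <-.
    by rewrite H.
  move=> [f /familyP fB H] i; rewrite (H (Ordinal (phiM i))).
  by have /forallP/(_ i)/implyP/(_ (eqxx _))/eqP := fB (Ordinal (phiM i)).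
rewrite (pr_sum_fin unif (Q := fun f : {ffun 'I_M -> bool} => f \in family B)
    (A := fun f => [set x | forall k : 'I_M, bit k x = f k])); last 2 first.
- move=> f _; apply: (measurable_forall (A := fun k : 'I_M => [set x | bit k x = f k])) => k.
  exact: measurable_fair_bit.
- by move=> f f' x _ _ H H'; apply/ffunP => k; rewrite -H -H'.
rewrite (eq_bigr (fun f : {ffun 'I_M -> bool} => \prod_(k < M) (2^-1 : R))); last first.
  move=> f _; rewrite (pr_walk_bits fair_ge0 _ fair_rcons)//.
  by rewrite /fair size_tuple card_ord prodr_const card_ord.
rewrite -(bigA_distr_big_dep _ (fun (k : 'I_M) (b : bool) => 2^-1 : R)) /=.
rewrite -(card_imset _ (f := fun i => Ordinal (phiM i))); last first.
  by move=> i j /(congr1 val) /=; exact: phi_inj.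
rewrite -prodr_const [RHS]big_mkcond /=; apply: eq_bigr => k _; case: ifPn.
  move=> /imsetP[i _ ->]; rewrite (big_pred1 (g i))// => b; rewrite /B /=.
  apply/forallP/eqP => [/(_ i)|-> j]; first by rewrite eqxx => /eqP.
  by apply/implyP => /eqP/phi_inj ->.
move=> ki; rewrite (eq_bigl xpredT) => [|b].
  by rewrite big_bool /= -div1r -splitr.
apply/forallP => i; apply/implyP => /eqP ik; case/negP: ki.
by apply/imsetP; exists i => //; apply: ord_inj.
Qed.

Definition dyadic K (f : {ffun 'I_K -> bool}) : R := \sum_(j < K) (f j)%:R * 2^-1 ^+ j.+1.

Lemma measurable_bits (I : finType) (phi : I -> nat) (g : {ffun I -> bool}) :
  measurable [set x : R | forall i, bit (phi i) x = g i].
Proof.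
apply: (measurable_forall (A := fun i => [set x : R | bit (phi i) x = g i])) => i.
exact: measurable_fair_bit.
Qed.

(* The [i]-th row of a double array of fair bits, truncated at [K] and read as
   the binary expansion of a number. *)
Definition row_trunc (i K : nat) (x : R) : R :=
  \sum_(j < K) (bit (choice.pickle (i, nat_of_ord j)) x)%:R * 2^-1 ^+ j.+1.

Lemma row_truncE i K x (f : {ffun 'I_K -> bool}) :
  (forall j : 'I_K, bit (choice.pickle (i, nat_of_ord j)) x = f j) ->
  row_trunc i K x = dyadic f.
Proof. by move=> H; apply: eq_bigr => j _; rewrite H. Qed.

Lemma row_pickle_inj n K :
  injective (fun p : 'I_n * 'I_K => choice.pickle (nat_of_ord p.1, nat_of_ord p.2)).
Proof.
move=> [i j] [i' j'] /= /(pcan_inj choice.pickleK)[ii' jj'].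
by congr pair; exact: ord_inj.
Qed.

(** [choice.pickle] assigns disjoint sets of bit positions to the rows, so the truncated rows form a
    uniform array of bits and events on different rows multiply. *)
Lemma pr_rows n K (A : nat -> set R) :
  pr unif [set x | forall i : 'I_n, A i (row_trunc i K x)] =
  \prod_(i < n) \sum_(f : {ffun 'I_K -> bool} | `[< A i (dyadic f) >]) 2^-1 ^+ K.
Proof.
pose B (i : 'I_n) : pred {ffun 'I_K -> bool} := fun f => `[< A i (dyadic f) >].
pose E (G : {ffun 'I_n -> {ffun 'I_K -> bool}}) : set R :=
  [set x | forall p : 'I_n * 'I_K,
     bit (choice.pickle (nat_of_ord p.1, nat_of_ord p.2)) x = [ffun p : 'I_n * 'I_K => G p.1 p.2] p].
rewrite (_ : [set x | _] = [set x | exists2 G : {ffun 'I_n -> {ffun 'I_K -> bool}},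
    G \in family B & E G x]); last first.
  apply/seteqP; split=> x /=.
    move=> H; exists [ffun i : 'I_n => [ffun j : 'I_K =>
      bit (choice.pickle (nat_of_ord i, nat_of_ord j)) x]].
      apply/familyP => i; rewrite ffunE; apply/asboolP.
      by rewrite -(@row_truncE i K x)// => j; rewrite ffunE.
    by move=> [i j]; rewrite !ffunE.
  move=> [G /familyP GB H] i; rewrite (@row_truncE i K x (G i)); last first.
    by move=> j; rewrite (H (i, j)) ffunE.
  by have /asboolP := GB i.
rewrite (pr_sum_fin unif (Q := fun G : {ffun 'I_n -> {ffun 'I_K -> bool}} => G \in family B)
    (A := E)); last 2 first.
- by move=> G _; exact: measurable_bits.
- move=> G G' x _ _ H H'; apply/ffunP => i; apply/ffunP => j.
  by have := H (i, j); have := H' (i, j); rewrite !ffunE /= => -> ->.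
rewrite (bigA_distr_big_dep _ (fun (i : 'I_n) (f : {ffun 'I_K -> bool}) => 2^-1 ^+ K : R)).
apply: eq_bigr => G _; rewrite /E (@pr_fair_bits _ _ [ffun p : 'I_n * 'I_K => G p.1 p.2]); last first.
  exact: row_pickle_inj.
by rewrite card_prod !card_ord prodr_const card_ord -exprM mulnC.
Qed.

(** The same count as for a single row: a truncated row has the law of the truncated binary
    expansion of x itself. *)
Lemma pr_dyadic K (A : set R) :
  pr unif [set x | A (\sum_(j < K) (bit j x)%:R * 2^-1 ^+ j.+1)] =
  \sum_(f : {ffun 'I_K -> bool} | `[< A (dyadic f) >]) 2^-1 ^+ K.
Proof.
pose E (f : {ffun 'I_K -> bool}) : set R := [set x | forall j : 'I_K, bit j x = f j].
rewrite (_ : [set x | _] = [set x | exists2 f : {ffun 'I_K -> bool},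
    `[< A (dyadic f) >] & E f x]); last first.
  apply/seteqP; split=> x /=.
    move=> H; exists [ffun j : 'I_K => bit j x]; last by move=> j; rewrite ffunE.
    apply/asboolP; rewrite /dyadic; move: H; congr (A _); apply: eq_bigr => j _.
    by rewrite ffunE.
  move=> [f /asboolP Af H]; move: Af; congr (A _); apply: eq_bigr => j _.
  by rewrite H.
rewrite (pr_sum_fin unif (Q := fun f : {ffun 'I_K -> bool} => `[< A (dyadic f) >])
    (A := E)); last 2 first.
- by move=> f _; exact: measurable_bits.
- by move=> f f' x _ _ H H'; apply/ffunP => j; rewrite -H -H'.
apply: eq_bigr => f _; rewrite /E (@pr_fair_bits 'I_K (fun j => nat_of_ord j) f) ?card_ord//.
exact: ord_inj.
Qed.

Lemma fair_left_end x K : left_end fair (walk fair x K) =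
  \sum_(j < K) (bit j x)%:R * 2^-1 ^+ j.+1.
Proof.
elim: K => [|K IH]; first by rewrite /left_end !big_ord0.
rewrite big_ord_recr /= -IH left_end_rcons; congr (_ + _).
rewrite /walk_bit /= nth_rcons size_walk ltnn eqxx.
by case: ifP; rewrite ?mul0r// mul1r /fair size_rcons size_walk.
Qed.

Definition row (i : nat) (x : R) : R := limn (fun K => row_trunc i K x).

Lemma row_trunc_nondecreasing i x : nondecreasing_seq (fun K => row_trunc i K x).
Proof.
apply/nondecreasing_seqP => K; rewrite /row_trunc big_ord_recr /= lerDl.
by rewrite mulr_ge0// exprn_ge0// invr_ge0.
Qed.

Lemma row_trunc_le1 i K x : row_trunc i K x <= 1 - 2^-1 ^+ K.
Proof.
elim: K => [|K IH]; first by rewrite /row_trunc big_ord0 expr0 subrr.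
rewrite /row_trunc big_ord_recr /= -/(row_trunc i K x).
have y0 : 0 <= 2^-1 ^+ K :> R by rewrite exprn_ge0// invr_ge0.
by move: y0 IH; rewrite exprS; set y := _ ^+ K; case: (bit _ x); rewrite ?mul1r ?mul0r; lra.
Qed.

Lemma row_gt i x c : c < row i x <-> exists K0, forall K, (K0 <= K)%N -> c < row_trunc i K x.
Proof.
have cv : cvgn (fun K => row_trunc i K x).
  apply: nondecreasing_is_cvgn; first exact: row_trunc_nondecreasing.
  exists 1 => _ [K _ <-]; rewrite (le_trans (row_trunc_le1 i K x))//.
split=> [cr|[K0 H]].
  apply: contrapT => H; move: cr; rewrite ltNge => /negP; apply.
  apply: limr_le => //; apply: nearW => K; rewrite leNgt; apply/negP => cK.
  apply: H; exists K => L KL; apply: (lt_le_trans cK).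
  exact: row_trunc_nondecreasing.
apply: lt_le_trans (H K0 (leqnn _)) _.
by apply: nondecreasing_cvgn_le => //; exact: row_trunc_nondecreasing.
Qed.

Lemma measurable_row_trunc i K (A : set R) : measurable [set x | A (row_trunc i K x)].
Proof.
apply: (measurable_factor (b := fun x => [ffun j : 'I_K => bit (choice.pickle (i, nat_of_ord j)) x])).
- move=> f; rewrite (_ : [set x | _] =
     [set x | forall j : 'I_K, bit (choice.pickle (i, nat_of_ord j)) x = f j]).
    exact: measurable_bits.
  apply/seteqP; split=> w /=; first by move=> <- j; rewrite ffunE.
  by move=> H; apply/ffunP => j; rewrite ffunE.
- move=> x y xy; apply: eq_bigr => j _.
  by move/ffunP : xy => /(_ j); rewrite !ffunE => ->.
Qed.

Lemma measurable_row i : measurable_fun setT (row i).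
Proof.
apply: (measurability _ (RGenOInfty.measurableE R)) => // _ [_ [c ->] <-].
rewrite setTI (_ : _ @^-1` _ = [set x | exists K0, forall K, (K0 <= K)%N -> c < row_trunc i K x]).
  apply: (measurable_exists (A := fun K0 => [set x | forall K, (K0 <= K)%N -> c < row_trunc i K x])) => K0.
  apply: (measurable_forall (A := fun K => [set x | (K0 <= K)%N -> c < row_trunc i K x])) => K.
  exact: (@measurable_row_trunc i K (fun y => (K0 <= K)%N -> c < y)).
by apply/seteqP; split=> x; rewrite /= in_itv /= andbT; [move/row_gt|move=> H; apply/row_gt].
Qed.

(** A row is the nondecreasing limit of its truncations, so it lies in an open half-line exactly
    when all large truncations do, with no exceptional value. [setT] leaves a coordinate
    unconstrained. *)
Definition half_line (A : set R) := A = setT \/ exists c, A = `]c, +oo[%classic.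

Lemma row_half_line i x A : half_line A ->
  exists K0, forall K, (K0 <= K)%N -> A (row_trunc i K x) <-> A (row i x).
Proof.
move=> [->|[c ->]]; first by exists 0%N.
have [cr|cr] := boolP (c < row i x).
  have [K0 H] := (row_gt i x c).1 cr.
  by exists K0 => K /H; rewrite /= !in_itv /= !andbT cr.
exists 0%N => K _; rewrite /= !in_itv /= !andbT (negbTE cr); split=> // cK.
move/negP : cr; case; apply/row_gt; exists K => L KL.
by apply: (lt_le_trans cK); exact: row_trunc_nondecreasing.
Qed.

Lemma half_line_measurable A : half_line A -> measurable A.
Proof. by move=> [->//|[c ->]]; exact: measurable_itv. Qed.

Lemma measurable_rows n (A : nat -> set R) : (forall i, measurable (A i)) ->
  measurable [set x | forall i : 'I_n, A i (row i x)].
Proof.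
move=> mA; apply: (measurable_forall (A := fun i : 'I_n => [set x | A i (row i x)])) => i.
by rewrite -[X in measurable X]setTI; exact: measurable_row.
Qed.

(** Both sides are limits of the corresponding expressions for truncations, which are equal by
    [pr_rows] and [pr_dyadic]. *)
Lemma pr_rows_half_lines n (A : nat -> set R) : (forall i, half_line (A i)) ->
  pr unif [set x | forall i : 'I_n, A i (row i x)] = \prod_(i < n) pr unif (A i).
Proof.
move=> hA; have mA i := half_line_measurable (hA i).
have c1 : pr unif [set x | forall i : 'I_n, A i (row_trunc i K x)] @[K --> \oo] -->
    pr unif [set x | forall i : 'I_n, A i (row i x)].
  apply: (pr_event_cvg (N := setT)) => //.
  - move=> K; apply: (measurable_forall (A := fun i : 'I_n => [set x | A i (row_trunc i K x)])) => i.
    exact: measurable_row_trunc.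
  - exact: measurable_rows.
  - exact: pr_setT.
  move=> x _; have H (i : 'I_n) := row_half_line i x (hA i).
  have [K0 HK0] := eventually_forall_fin H.
  exists K0 => K /HK0 HK; split=> Hx i; exact/HK.
pose trunc K x := \sum_(j < K) (bit j x)%:R * 2^-1 ^+ j.+1 : R.
have c2 : \prod_(i < n) pr unif [set x | A i (trunc K x)] @[K --> \oo] -->
    \prod_(i < n) pr unif (A i).
  apply: cvg_bigprod => i.
  have m01 : measurable (`[0, 1[%classic : set R) by exact: measurable_itv.
  apply: (@pr_event_cvg _ _ R unif (fun K => [set x | A i (trunc K x)]) (A i)
    `[0, 1[%classic) => //.
  - move=> K; apply: (measurable_factor (b := fun x => [ffun j : 'I_K => bit j x])
      (X := trunc K)).
    + move=> f; rewrite (_ : [set x | _] = [set x | forall j : 'I_K, bit j x = f j]).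
        exact: (@measurable_bits _ (fun j : 'I_K => nat_of_ord j)).
      apply/seteqP; split=> w /=; first by move=> <- j; rewrite ffunE.
      by move=> H; apply/ffunP => j; rewrite ffunE.
    + move=> x y xy; apply: eq_bigr => j _.
      by move/ffunP : xy => /(_ j); rewrite !ffunE => ->.
  - by rewrite pr_uniform_itv// subr0.
  move=> x; rewrite /= in_itv /= => x01.
  have tx K : trunc K x <= x < trunc K x + 2^-1 ^+ K.
    rewrite /trunc -fair_left_end.
    have [_] := (walk_interval fair_ge0 (expr0 _) fair_rcons K (walk fair x K) x01).1 erefl.
    by rewrite /fair size_walk.
  case: (hA i) => [->|[c ->]]; first by exists 0%N.
  have [cx|xc] := ltP c x.
    have [|K0 HK0] := @half_expr_lt R (x - c); first by rewrite subr_gt0.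
    exists K0 => K /HK0; have := tx K; rewrite /= !in_itv /= !andbT cx => /andP[_ h1] h2.
    by split=> // _; lra.
  exists 0%N => K _; rewrite /= !in_itv /= !andbT [c < x]ltNge xc; split=> // h.
  by have := tx K; lra.
apply: (cvg_unique _ c1); first exact: Rhausdorff.
apply: cvg_trans c2; apply: near_eq_cvg; apply: nearW => K.
by rewrite pr_rows; apply: eq_bigr => i _; rewrite pr_dyadic.
Qed.

End fair_bits.

(** * Laws and independence tested on half-lines *)

Section half_line_laws.
Context d (T : measurableType d) (R : realType) (P : probability T R).

Lemma half_line_measure_unique (m1 m2 : {measure set R -> \bar R}) :
  (forall c, m1 `]c, +oo[%classic = m2 `]c, +oo[%classic) ->
  (m1 setT < +oo)%E ->
  forall A, measurable A -> m1 A = m2 A.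
Proof.
move=> H fin1 A mA.
apply: (measure_unique (@RGenOInfty.G R) (fun k : nat => `]- k%:R, +oo[%classic)) => //.
- exact: RGenOInfty.measurableE.
- move=> _ _ [a ->] [b ->]; exists (Num.max a b).
  by apply/seteqP; split=> x; rewrite /= !in_itv /= !andbT gt_max => /andP.
- by move=> k; exists (- k%:R).
- apply/seteqP; split=> // x _; exists (Num.truncn (- x)).+1 => //=.
  rewrite in_itv /= andbT ltrNl.
  have [x0|x0] := leP 0 (- x); first exact: truncnS_gt.
  by rewrite (lt_trans x0).
- by move=> _ [c ->]; exact: H.
- move=> k; apply: le_lt_trans fin1; apply: le_measure; rewrite ?inE//.
Qed.

Lemma product_rule_half_lines (U : {RV P >-> R}) (E : set T) (c : {nonneg R}) :
  measurable E ->
  (forall A, half_line A -> P (E `&` U @^-1` A) = (c%:num%:E * P (U @^-1` A))%E) ->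
  forall A, measurable A -> P (E `&` U @^-1` A) = (c%:num%:E * P (U @^-1` A))%E.
Proof.
move=> mE H A mA.
have mU : measurable_fun [set: T] U.
  by move=> _ Y mY; rewrite setTI; exact: measurable_funPTI.
pose m1 : {measure set R -> \bar R} :=
  measure_function_pushforward__canonical__measure_function_Measure (mrestr P mE) mU.
pose m2 : {measure set R -> \bar R} := mscale c (distribution P U).
have -> : P (E `&` U @^-1` A) = m1 A by rewrite /m1 /= /pushforward /mrestr setIC.
apply: (@half_line_measure_unique m1 m2) => //.
- move=> x; rewrite /m1 /m2 /= /pushforward /mrestr /mscale /= setIC.
  by apply: H; right; exists x.
- rewrite /m1 /= /pushforward /mrestr; rewrite preimage_setT setTI.
  by rewrite (le_lt_trans (probability_le1 _ _))// ltry.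
Qed.

(** The coordinates are released one at a time: with the other sets fixed, both sides are finite
    measures in the set of coordinate k that agree on half-lines, hence everywhere. *)
Lemma mutually_independent_half_lines (U : nat -> {RV P >-> R}) :
  (forall n (A : nat -> set R), (forall i, half_line (A i)) ->
    pr P [set w | forall i : 'I_n, A i (U i w)] = \prod_(i < n) pr P (U i @^-1` A i)) ->
  mutually_independent U.
Proof.
move=> H.
have mrect n (A : nat -> set R) : (forall i, measurable (A i)) ->
    measurable [set w | forall i : 'I_n, A i (U i w)].
  move=> mA; apply: (measurable_forall (A := fun i : 'I_n => [set w | A i (U i w)])) => i.
  exact: measurable_funPTI.
(* Arbitrary measurable sets are allowed in the coordinates below k, half-lines from k on. *)
have step k : forall n (A : nat -> set R), (forall i, measurable (A i)) ->
    (forall i, (k <= i)%N -> half_line (A i)) ->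
    pr P [set w | forall i : 'I_n, A i (U i w)] = \prod_(i < n) pr P (U i @^-1` A i).
  elim: k => [|k IH] n A mA hA; first by apply: H => i; exact: hA.
  pose A' (Y : set R) i := if i == k then Y else A i.
  have mA' Y : measurable Y -> forall i, measurable (A' Y i).
    by move=> mY i; rewrite /A'; case: ifP.
  have hA' Y : half_line Y -> forall i, (k <= i)%N -> half_line (A' Y i).
    move=> hY i ki; rewrite /A'; case: (eqVneq i k) => // ik; apply: hA.
    by rewrite ltn_neqAle eq_sym ik.
  have [nk|kn] := leqP n k.
    have AA' (i : 'I_n) : A i = A' setT i.
      by rewrite /A'; case: eqP => // ik; move: (ltn_ord i); rewrite ik ltnNge nk.
    rewrite (_ : [set w | _] = [set w | forall i : 'I_n, A' setT i (U i w)]); last first.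
      by apply/seteqP; split=> w /= Hw i; have := Hw i; rewrite AA'.
    rewrite IH//; first by apply: eq_bigr => i _; rewrite -AA'.
    - exact: mA'.
    - by apply: hA'; left.
  pose kO := Ordinal kn.
  pose E := [set w | forall i : 'I_n, A' setT i (U i w)].
  have mE : measurable E by apply: mrect; exact: mA'.
  have EI Y : E `&` U k @^-1` Y = [set w | forall i : 'I_n, A' Y i (U i w)].
    apply/seteqP; split=> w /=.
      move=> [Ew Yw] i; have := Ew i; rewrite /A'; case: eqP => [->//|//].
    move=> Hw; split; last by have := Hw kO; rewrite /A' /= eqxx.
    by move=> i; have := Hw i; rewrite /A'; case: eqP.
  have c0 : 0 <= \prod_(i < n | i != kO) pr P (U i @^-1` A i).
    by apply: prodr_ge0 => i _; exact: pr_ge0.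
  pose c := NngNum c0.
  have prodE Y : \prod_(i < n) pr P (U i @^-1` A' Y i) = c%:num * pr P (U k @^-1` Y).
    rewrite (bigD1 kO)//= mulrC (_ : A' Y k = Y); last by rewrite /A' eqxx.
    congr (_ * _).
    apply: eq_bigr => i ik; rewrite /A' (_ : (nat_of_ord i == k) = false)//.
    by apply/negbTE; move: ik; rewrite -val_eqE.
  have rule : forall Y, measurable Y ->
      P (E `&` U k @^-1` Y) = (c%:num%:E * P (U k @^-1` Y))%E.
    apply: product_rule_half_lines => // Y hY.
    have mY := half_line_measurable hY.
    rewrite EI !prE.
    - by rewrite -EFinM -prodE IH//; [exact: mA'|exact: hA'].
    - exact: measurable_funPTI.
    - by apply: mrect; exact: mA'.
  have AA' : A = A' (A k) by apply/funext => i; rewrite /A'; case: eqP => [->|].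
  apply: EFin_inj; rewrite -prE; last exact: mrect.
  rewrite {1}AA' -EI rule// prE; last exact: measurable_funPTI.
  by rewrite -EFinM -prodE -AA'.
move=> J A mA.
pose n := (\max_(j <- J) j).+1.
have Jn j : j \in J -> (j < n)%N by move=> jJ; rewrite ltnS; apply: leq_bigmax_seq.
pose A' i := if i \in J then A i else setT.
have mA' i : measurable (A' i) by rewrite /A'; case: ifP.
have -> : \bigcap_(i in [set` J]) (U i @^-1` A i) = [set w | forall i : 'I_n, A' i (U i w)].
  apply/seteqP; split=> w Hw.
    by move=> i; rewrite /A'; case: ifPn => // iJ; exact: Hw.
  by move=> j /= jJ; have := Hw (Ordinal (Jn j jJ)); rewrite /A' /= jJ.
rewrite prE; last exact: mrect.
pose A'' i := if (i < n)%N then A' i else setT.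
have A''E (i : 'I_n) : A'' i = A' i by rewrite /A'' ltn_ord.
have -> : [set w | forall i : 'I_n, A' i (U i w)] = [set w | forall i : 'I_n, A'' i (U i w)].
  by apply/seteqP; split=> w /= Hw i; have := Hw i; rewrite A''E.
rewrite (step n n A''); last 2 first.
- by move=> i; rewrite /A''; case: ifP.
- by move=> i ni; left; rewrite /A'' ltnNge ni.
rewrite (eq_bigr (fun i : 'I_n => if nat_of_ord i \in J then pr P (U i @^-1` A i) else 1)); last first.
  by move=> i _; rewrite A''E /A'; case: ifP; rewrite // preimage_setT pr_setT.
rewrite -(big_mkord xpredT (fun i => if i \in J then pr P (U i @^-1` A i) else 1)).
rewrite -big_mkcond -big_filter.
rewrite (perm_big (enum_fset J)); last first.
  apply: uniq_perm; [by rewrite filter_uniq// iota_uniq|exact: fset_uniq|].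
  move=> j; rewrite mem_filter mem_index_iota.
  by apply/andP/idP => [[]//|jJ]; split=> //; exact: Jn.
by rewrite -prodEFin; apply: eq_bigr => j _; rewrite prE//; exact: measurable_funPTI.
Qed.

End half_line_laws.

Lemma iid_uniforms (R : realType) : exists U : nat -> {RV (@unit_uniform R) >-> R},
  (forall i A, measurable A -> distribution (@unit_uniform R) (U i) A = uniform_prob (@ltr01 R) A) /\
  mutually_independent U.
Proof.
pose U i : {mfun R >-> R} :=
  HB.pack (@row R i) (isMeasurableFun.Build _ _ _ _ (@row R i) (@measurable_row R i)).
have U_law i A : measurable A ->
    distribution (@unit_uniform R) (U i) A = uniform_prob (@ltr01 R) A.
  move=> mA; apply: (@half_line_measure_unique _ (distribution (@unit_uniform R) (U i))
    (@unit_uniform R)) => //.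
    move=> c.
    pose B j : set R := if j == i then `]c, +oo[%classic else setT.
    have hB j : half_line (B j) by rewrite /B; case: ifP => _; [right; exists c|left].
    have := @pr_rows_half_lines R i.+1 B hB.
    rewrite big_ord_recr /= big1 ?mul1r; last first.
      by move=> j _; rewrite /B (ltn_eqF (ltn_ord j)) pr_setT.
    rewrite {2}/B eqxx (_ : [set x | _] = U i @^-1` `]c, +oo[%classic); last first.
      apply/seteqP; split=> x /=.
        by move=> /(_ ord_max); rewrite /B /= eqxx.
      by move=> Hx j; rewrite /B; case: eqP => // ->.
    move=> H; have := congr1 EFin H; rewrite -!prE//.
    exact: measurable_funPTI.
  by rewrite -ge0_fin_numE// fin_num_measure.
exists U; split=> //; apply: mutually_independent_half_lines => n A hA.
rewrite -[RHS]/(\prod_(i < n) pr (@unit_uniform R) (U i @^-1` A i)).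
rewrite (@pr_rows_half_lines R n A hA); apply: eq_bigr => i _.
by rewrite /pr; congr fine; apply/esym; apply: U_law; exact: half_line_measurable.
Qed.

(** * Independence on product spaces *)

Section independent_product.
Context d1 d2 (T1 : measurableType d1) (T2 : measurableType d2) (R : realType).
Variables (P1 : probability T1 R) (P2 : probability T2 R).
Local Notation P := (P1 \x P2)%E.

Lemma product_rectangle A B : measurable A -> measurable B ->
  P (fst @^-1` A `&` snd @^-1` B) = (P1 A * P2 B)%E.
Proof.
move=> mA mB; rewrite -product_measure1E//; congr (P _).
Qed.

Lemma product_fst A : measurable A -> P (fst @^-1` A) = P1 A.
Proof.
move=> mA; have := product_rectangle mA (@measurableT _ T2).
by rewrite preimage_setT setIT probability_setT mule1.
Qed.

Lemma product_snd B : measurable B -> P (snd @^-1` B) = P2 B.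
Proof.
move=> mB; have := product_rectangle (@measurableT _ T1) mB.
by rewrite preimage_setT setTI probability_setT mul1e.
Qed.

End independent_product.

Section independent_copies.
Context d1 d2 (T1 : measurableType d1) (T2 : measurableType d2) (R : realType).
Variables (P1 : probability T1 R) (P2 : probability T2 R).
Context dX dY (TX : measurableType dX) (TY : measurableType dY).
Variables (X : {RV P1 >-> TX}) (Y : nat -> {RV P2 >-> TY}).
Local Notation P := (P1 \x P2)%E.

(** The preimages under [snd] form a sigma-algebra containing the generators of [sigma_rvs Y'], so
    each of its events is such a preimage and meets an event of [X'] in a measurable rectangle. *)
Lemma independent_copies : exists (X' : {RV P >-> TX}) (Y' : nat -> {RV P >-> TY}),
  [/\ forall w, X' w = X w.1, forall i w, Y' i w = Y i w.2 & independent_of_seq X' Y'].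
Proof.
have mX : measurable_fun setT (X \o fst : T1 * T2 -> TX) by exact: measurableT_comp.
have mY i : measurable_fun setT (Y i \o snd : T1 * T2 -> TY) by exact: measurableT_comp.
pose X' : {mfun (T1 * T2)%type >-> TX} := HB.pack (X \o fst : T1 * T2 -> TX) (isMeasurableFun.Build _ _ _ _ (X \o fst : T1 * T2 -> TX) mX).
pose Y' i : {mfun (T1 * T2)%type >-> TY} := HB.pack (Y i \o snd : T1 * T2 -> TY) (isMeasurableFun.Build _ _ _ _ (Y i \o snd : T1 * T2 -> TY) (mY i)).
exists X', Y'; split=> // A B [A' mA' <-] sB.
rewrite setTI (_ : X' @^-1` A' = fst @^-1` (X @^-1` A'))//.
have [B' mB' ->] : exists2 B', measurable B' & B = snd @^-1` B'.
  apply: (@smallest_sub _ (sigma_algebra setT) _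
    [set Z | exists2 Z', measurable Z' & Z = snd @^-1` Z'] _ _ B sB); last first.
    move=> _ [i _ [Z mZ <-]]; exists (Y i @^-1` Z); first exact: measurable_funPTI.
    by rewrite setTI.
  split.
  - by exists set0 => //; rewrite preimage_set0.
  - move=> Z [Z' mZ' ->]; exists (~` Z'); first exact: measurableC.
    by rewrite setTD preimage_setC.
  - move=> F HF; have /boolp.choice[G HG] : forall i, exists B', measurable B' /\
        F i = snd @^-1` B' by move=> i; have [B' mB' ->] := HF i; exists B'.
    exists (\bigcup_i G i); first by apply: bigcupT_measurable => i; have [] := HG i.
    by rewrite preimage_bigcup; apply: eq_bigcupr => i _; have [] := HG i.
have mXA : measurable (X @^-1` A') by exact: measurable_funPTI.
transitivity (P1 (X @^-1` A') * P2 B')%E.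
  exact: (@product_rectangle _ _ _ _ R P1 P2 _ _ mXA mB').
by congr (_ * _)%E; apply/esym; [exact: product_fst|exact: product_snd].
Qed.

End independent_copies.

(** * Existence of Poisson processes *)

Section independence_of_past.
Context d (T : measurableType d) (R : realType) (P : probability T R).
Variable V : nat -> {RV P >-> R}.
Hypothesis Vindep : mutually_independent V.

Definition past_rectangles n : set (set T) :=
  [set E | exists2 A : nat -> set R, (forall i, measurable (A i)) &
    E = [set w | forall i : 'I_n, A i (V i w)]].

(** The sigma-algebra of the first n variables, given as a measurable space of its own so that the
    general measurability lemmas apply to it. *)
Definition past n : measurableType _ := g_sigma_algebraType (past_rectangles n).

Lemma past_rectangles_setI n : setI_closed (past_rectangles n).
Proof.
move=> _ _ [A mA ->] [B mB ->]; exists (fun i => A i `&` B i).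
  by move=> i; exact: measurableI.
by apply/seteqP; split=> w; [move=> [HA HB] i; split|move=> H; split=> i; have [] := H i].
Qed.

Lemma measurable_past_rv n i : (i < n)%N ->
  @measurable_fun _ _ (past n) R setT (V i).
Proof.
move=> ni _ Y mY; rewrite setTI; apply: sub_sigma_algebra.
exists (fun j => if j == i then Y else setT); first by move=> j; case: ifP.
apply/seteqP; split=> w.
  by move=> Yw j; case: eqP => // ->.
by move=> /(_ (Ordinal ni)) /=; rewrite eqxx.
Qed.

Lemma past_rectangle_rule n (A : nat -> set R) : (forall i, measurable (A i)) ->
  P [set w | forall i : 'I_n, A i (V i w)] = (\prod_(i < n) P (V i @^-1` A i))%E.
Proof.
move=> mA; have := Vindep [fset i | i in iota 0 n]%fset mA.
rewrite (_ : \bigcap_(i in _) _ = [set w | forall i : 'I_n, A i (V i w)]); last first.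
  apply/seteqP; split=> w H.
    by move=> i; apply: H; rewrite /= !inE /= mem_iota /=.
  move=> i /=; rewrite !inE /= mem_iota /= => ni.
  exact: (H (Ordinal ni)).
move=> ->; rewrite -(big_mkord xpredT (fun i => P (V i @^-1` A i))).
apply: perm_big; apply: uniq_perm; rewrite ?fset_uniq ?iota_uniq// => i.
by rewrite mem_index_iota !inE /= mem_iota.
Qed.

Lemma past_measurable n (E : set T) : measurable (E : set (past n)) ->
  measurable (E : set T).
Proof.
apply: smallest_sub; first exact: sigma_algebra_measurable.
move=> _ [A mA ->]; apply: (measurable_forall (A := fun i : 'I_n => [set w | A i (V i w)])) => i.
exact: measurable_funPTI.
Qed.

(** For fixed B the events E with the product rule form a Dynkin system; mutual independence puts
    the rectangles, a pi-system generating the past, into it. *)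
Lemma independent_of_past n (E : set T) (B : set R) :
  measurable (E : set (past n)) -> measurable B ->
  P (E `&` V n @^-1` B) = (P E * P (V n @^-1` B))%E.
Proof.
move=> mE mB; have mVB : measurable (V n @^-1` B) by exact: measurable_funPTI.
pose Q (F : set T) := P (F `&` V n @^-1` B) = (P F * P (V n @^-1` B))%E.
have QC (F : set T) : measurable F -> Q F -> Q (~` F).
  move=> mF; have mFB : measurable (F `&` V n @^-1` B) by exact: measurableI.
  have mFC := measurableC mF.
  rewrite /Q !prE//; last by exact: measurableI.
  move=> [QF]; congr EFin; rewrite pr_setC// mulrBl mul1r -QF.
  by rewrite (pr_split P mVB mF) [_ @^-1` _ `&` F]setIC addrAC subrr add0r setIC.
have QU (F : nat -> set T) : (forall k, measurable (F k)) -> trivIset setT F ->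
    (forall k, Q (F k)) -> Q (\bigcup_k F k).
  move=> mF tF QF; rewrite /Q setI_bigcupl measure_bigcup//=; last 2 first.
  + by move=> k _; exact: measurableI.
  + exact: trivIset_setIr.
  rewrite measure_bigcup// muleC (prE P mVB) -nneseriesZl; last by move=> *; exact: measure_ge0.
  by apply: eq_eseriesr => k _; rewrite QF muleC (prE P mVB).
apply: (@dynkin_induction _ (past n) (past_rectangles n) Q erefl (@past_rectangles_setI n) _ _ _ _ E mE).
- by rewrite /Q setTI probability_setT mul1e.
- move=> _ [A mA ->]; rewrite /Q.
  pose A' i := if i == n then B else A i.
  have A'E (i : 'I_n) : A' i = A i by rewrite /A' (ltn_eqF (ltn_ord i)).
  rewrite (_ : _ `&` _ = [set w | forall i : 'I_n.+1, A' i (V i w)]).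
    rewrite past_rectangle_rule; last by move=> i; rewrite /A'; case: ifP.
    rewrite big_ord_recr /= past_rectangle_rule//; congr (_ * _)%E.
      by apply: eq_bigr => i _; rewrite A'E.
    by rewrite /A' eqxx.
  apply/seteqP; split=> w.
    move=> [HA HB] i; rewrite /A'; case: eqP => [->//|/eqP ni].
    have ni' : (i < n)%N by rewrite ltn_neqAle ni -ltnS ltn_ord.
    exact: (HA (Ordinal ni')).
  move=> H; split; last by have := H ord_max; rewrite /A' /= eqxx.
  by move=> i; have := H (widen_ord (leqnSn n) i); rewrite /= A'E.
- by move=> F /past_measurable; exact: QC.
- move=> F mF tF QF; apply: QU => // k; exact: past_measurable.
Qed.

End independence_of_past.

(** * Multinomial counts of coloured points *)

Section points.
Context d (T : measurableType d) (R : realType) (P : probability T R).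
Variable V : nat -> {RV P >-> R}.
Hypothesis Vindep : mutually_independent V.
Context (J : finType) (c : R -> J) (b : J -> R).
Hypothesis mc : forall j, measurable [set y | c y = j].
Hypothesis Vc : forall i j, pr P (V i @^-1` [set y | c y = j]) = b j.

Definition color_count n w j : nat := \sum_(i < n) (c (V i w) == j).

Definition multinomial n (k : J -> nat) : R :=
  if (\sum_j k j)%N == n then n`!%:R * \prod_j (b j ^+ k j / (k j)`!%:R) else 0.

Lemma multinomialS n (k : J -> nat) :
  \sum_(j | (0 < k j)%N) multinomial n (fun j' => k j' - (j' == j))%N * b j =
  multinomial n.+1 k.
Proof.
have ksum j : (0 < k j)%N ->
    (\sum_j' (k j' - (j' == j)) = n)%N <-> (\sum_j' k j' = n.+1)%N.
  move=> kj; rewrite [X in X = n](bigD1 j)//= [X in X = n.+1](bigD1 j)//= eqxx.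
  rewrite (eq_bigr k) => [|j' /negbTE ->]; last by rewrite subn0.
  by rewrite -(prednK kj) subn1 /= addSn; split=> [->|[]].
rewrite /multinomial; case: ifPn => [/eqP kn|kn]; last first.
  apply: big1 => j kj; case: ifP => [/eqP/(ksum j kj) E|]; last by rewrite mul0r.
  by rewrite E eqxx in kn.
transitivity (\sum_j (k j)%:R * (n`!%:R * \prod_j (b j ^+ k j / (k j)`!%:R))).
  rewrite big_mkcond; apply: eq_bigr => j _; case: ifPn => [kj|]; last first.
    by rewrite lt0n negbK => /eqP ->; rewrite mul0r.
  rewrite (_ : (\sum_j' _)%N == n); last exact/eqP/(ksum j kj).
  rewrite (bigD1 j)//= [in RHS](bigD1 j)//= eqxx.
  rewrite (eq_bigr (fun j' => b j' ^+ k j' / (k j')`!%:R)); last first.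
    by move=> j' /negbTE ->; rewrite subn0.
  rewrite -(prednK kj) subn1 /= factS natrM exprSr; set X := \prod_(i | _) _.
  have f0 : (k j).-1`!%:R != 0 :> R by rewrite pnatr_eq0 -lt0n fact_gt0.
  by field; rewrite f0 /= addrC natr1 pnatr_eq0.
by rewrite -mulr_suml -natr_sum kn mulrA -natrM -factS.
Qed.

Lemma measurable_color_count n k :
  measurable ([set w | forall j, color_count n w j = k j] : set (past V n)).
Proof.
apply: (measurable_factor (b := fun w : past V n => [ffun i : 'I_n => c (V i w)])
  (X := fun w => color_count n w) [set f | forall j, f j = k j]).
- move=> x; rewrite [X in measurable X](_ : _ =
     [set w | forall i : 'I_n, c (V i w) = x i]); last first.
    apply/seteqP; split=> w /=; first by move=> <- i; rewrite ffunE.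
    by move=> H; apply/ffunP => i; rewrite ffunE.
  apply: (@measurable_forall _ (past V n) 'I_n (fun i => [set w | c (V i w) = x i])) => i.
  rewrite -[X in measurable X]setTI.
  exact: (@measurable_past_rv _ _ _ P V n i (ltn_ord i) measurableT _ (mc (x i))).
- move=> w w' ww'; apply/funext => j; apply: eq_bigr => i _.
  by move/ffunP : ww' => /(_ i); rewrite !ffunE => ->.
Qed.

Lemma pr_color_count n (k : J -> nat) :
  pr P [set w | forall j, color_count n w j = k j] = multinomial n k.
Proof.
elim: n k => [|n IH] k.
  rewrite /multinomial; case: ifPn => [|k0].
    rewrite sum_nat_eq0 => /forallP k0; rewrite fact0 mul1r big1; last first.
      by move=> j _; have /eqP -> := k0 j; rewrite fact0 expr0 divr1.
    rewrite (_ : [set w | _] = setT) ?pr_setT//; apply/seteqP; split=> w // _ j.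
    by rewrite /color_count big_ord0; have /eqP -> := k0 j.
  rewrite (_ : [set w | _] = set0) ?pr_set0//; apply/seteqP; split=> w // H.
  case/negP : k0; rewrite sum_nat_eq0; apply/forallP => j /=.
  by rewrite -H /color_count big_ord0.
pose E j := [set w | forall j', color_count n w j' = (k j' - (j' == j))%N].
have mE j := measurable_color_count (n := n) (fun j' => k j' - (j' == j))%N.
have mE' j : measurable (E j) := past_measurable (mE j).
have mVc j : measurable (V n @^-1` [set y | c y = j]) by exact: measurable_funPTI.
rewrite (_ : [set w | _] = [set w | exists2 j, (0 < k j)%N &
    (E j `&` V n @^-1` [set y | c y = j]) w]); last first.
  apply/seteqP; split=> w /=.
    move=> H; exists (c (V n w)); first by rewrite -H /color_count big_ord_recr /= eqxx addn1.
    split=> // j; rewrite -H /color_count [in RHS]big_ord_recr /= eq_sym.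
    by rewrite addnK.
  move=> [j kj [Ej cj]] j'; rewrite /color_count big_ord_recr /=.
  rewrite -/(color_count n w j') Ej cj [j == j']eq_sym; case: eqP => [->|_].
    by rewrite subnK.
  by rewrite subn0 addn0.
rewrite (pr_sum_fin P (Q := fun j => (0 < k j)%N)
  (A := fun j => E j `&` V n @^-1` [set y | c y = j])).
- rewrite -multinomialS; apply: eq_bigr => j _.
  rewrite -IH -(Vc n j) -/(E j); apply: EFin_inj; rewrite EFinM -!prE//.
    exact: (independent_of_past Vindep (mE j) (mc j)).
  exact: measurableI.
- by move=> j _; exact: measurableI.
- by move=> j j' w _ _ [_ /= <-] [_ /= <-].
Qed.

End points.

Section poisson_number.
Context (R : realType) (rate : R).
Hypothesis rate0 : 0 < rate.
Local Notation unif := (@unit_uniform R).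
Local Notation cumulative := (series (poisson_weight rate)).

(* The Poisson quantile function. *)
Definition poisson_number (v : R) : nat :=
  xget 0%N [set n | cumulative n <= v < cumulative n.+1].

Lemma cumulative_mono : nondecreasing_seq cumulative.
Proof.
apply/nondecreasing_seqP => n; rewrite seriesEord /= big_ord_recr /= lerDl.
exact: poisson_weight_ge0 (ltW rate0).
Qed.

Lemma cumulative_step v m n : cumulative n <= v < cumulative n.+1 ->
  cumulative m <= v < cumulative m.+1 -> m = n.
Proof.
move=> /andP[n1 n2] /andP[m1 m2]; apply/eqP; case: ltngtP => // mn.
  by have := le_lt_trans (le_trans (cumulative_mono mn) n1) m2; rewrite ltxx.
by have := le_lt_trans (le_trans (cumulative_mono mn) m1) n2; rewrite ltxx.
Qed.

Lemma poisson_numberE v n : cumulative n <= v < cumulative n.+1 ->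
  poisson_number v = n.
Proof.
move=> vn; rewrite /poisson_number; case: xgetP => [m _ vm|/(_ n)//].
exact: cumulative_step vn vm.
Qed.

Lemma cumulative0 : cumulative 0%N = 0.
Proof. by rewrite seriesEord /= big_ord0. Qed.

Lemma cumulative_le1 n : cumulative n <= 1.
Proof.
have H := @poisson_weight_sum R rate.
rewrite -(cvg_lim (@Rhausdorff R) H); apply: nondecreasing_cvgn_le.
  exact: cumulative_mono.
by apply/cvg_ex; exists 1.
Qed.

Lemma cumulative_cover v : 0 <= v < 1 -> exists n, cumulative n <= v < cumulative n.+1.
Proof.
move=> /andP[v0 v1].
have ex : exists n, v < cumulative n.
  have := cvgr_gt 1 (@poisson_weight_sum R rate) v v1.
  by move=> [n _ /(_ n (leqnn n))]; exists n.
exists (ex_minn ex).-1; case: ex_minnP => -[|n] vn nmin.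
  by rewrite cumulative0 ltNge v0 in vn.
by rewrite vn andbT leNgt; apply/negP => /nmin; rewrite ltnn.
Qed.

Lemma measurable_poisson_number n : measurable [set v | poisson_number v = n].
Proof.
pose I m := [set v : R | cumulative m <= v < cumulative m.+1].
have mI m : measurable (I m).
  rewrite (_ : I m = `[cumulative m, cumulative m.+1[%classic); first exact: measurable_itv.
  by apply/seteqP; split=> v; rewrite /= in_itv.
rewrite (_ : [set v | _] = I n `|` (if n == 0%N then ~` [set v | exists m, I m v] else set0)).
  apply: measurableU => //; case: ifP => // _; apply: measurableC.
  exact: (measurable_exists (A := I)).
apply/seteqP; split=> v /=.
  rewrite /poisson_number; case: xgetP => [m -> vm <-|none <-]; first by left.
  by right => /= -[m vm]; exact: (none m).
move=> [/poisson_numberE//|]; case: eqP => // -> none.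
rewrite /poisson_number; case: xgetP => // m _ vm; exfalso; apply: none.
by exists m.
Qed.

Lemma pr_poisson_number n : pr unif [set v | poisson_number v = n] = poisson_weight rate n.
Proof.
have m01 : measurable (`[0, 1[%classic : set R) by exact: measurable_itv.
have mN := measurable_poisson_number n.
rewrite -(@prI1 _ _ R unif _ _ mN m01); last by rewrite pr_uniform_itv// subr0.
rewrite (_ : _ `&` _ = `[cumulative n, cumulative n.+1[%classic).
  rewrite pr_uniform_itv//.
  - by rewrite seriesEord /= big_ord_recr /= addrAC subrr add0r.
  - by rewrite -cumulative0; exact: cumulative_mono.
  - exact: cumulative_mono.
  - exact: cumulative_le1.
apply/seteqP; split=> v; rewrite /= !in_itv /=.
  by move=> [vn /cumulative_cover[m mv]]; rewrite -vn (poisson_numberE mv).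
move=> vn; split; first exact: poisson_numberE.
move: vn => /andP[h1 h2]; rewrite (lt_le_trans h2 (cumulative_le1 _)) andbT.
by apply: le_trans h1; rewrite -cumulative0; exact: cumulative_mono.
Qed.

End poisson_number.

(** * A Poisson number of uniform points *)

Section poisson_block.
Context (R : realType) (rate : R).
Hypothesis rate0 : 0 < rate.
Local Notation unif := (@unit_uniform R).
Variable U : nat -> {RV unif >-> R}.
Hypothesis Uunif : forall i A, measurable A ->
  distribution unif (U i) A = uniform_prob (@ltr01 R) A.
Hypothesis Uindep : mutually_independent U.

(* [U 0] provides the number of points in a block, [U 1] their positions. *)
Definition block_number (u : R) : nat := poisson_number rate (U 0%N u).
Definition block_point (i : nat) (u : R) : R := U i (U 1%N u).

(** Each [U i] preserves the uniform law, so these variables may be composed: as i varies,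
    [U i (U 1 u)] is again a sequence of independent uniform numbers, and being a function of
    [U 1 u] it is independent of [U 0 u]. *)
Lemma pr_uniform_preimage i A : measurable A -> pr unif (U i @^-1` A) = pr unif A.
Proof. by move=> mA; rewrite /pr; congr fine; exact: Uunif. Qed.

Section colors.
Context (J : finType) (c : R -> J).
Hypothesis mc : forall j, measurable [set y | c y = j].

Definition block_count u j : nat := \sum_(i < block_number u) (c (block_point i u) == j).

Definition color_event n (k : J -> nat) : set R :=
  [set v | forall j, color_count U c n v j = k j].

Lemma block_countE k : [set u | forall j, block_count u j = k j] =
  U 0%N @^-1` [set v | poisson_number rate v = (\sum_j k j)%N] `&`
  U 1%N @^-1` color_event (\sum_j k j)%N k.
Proof.
apply/seteqP; split=> u /=.
  move=> H; have nE : block_number u = (\sum_j k j)%N.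
    rewrite (eq_bigr _ (fun j _ => esym (H j))) exchange_big /=.
    rewrite (eq_bigr (fun=> 1%N)) ?sum1_card ?card_ord// => i _.
    rewrite (bigD1 (c (block_point i u)))//= eqxx big1// => j /negbTE.
    by rewrite eq_sym => ->.
  by split=> // j; rewrite -H /block_count nE.
by move=> [nE H] j; rewrite -H /block_count /block_number nE.
Qed.

Lemma measurable_color_event n k : measurable (color_event n k).
Proof. apply: past_measurable; exact: measurable_color_count. Qed.

Lemma measurable_block_count k : measurable [set u | forall j, block_count u j = k j].
Proof.
rewrite block_countE; apply: measurableI; apply: measurable_funPTI.
  exact: measurable_poisson_number.
exact: measurable_color_event.
Qed.

(** Colouring a Poisson number of points gives independent Poisson counts: the n! of the multinomial
    law cancels that of the Poisson weight, and e^(-rate) splits into factors because the colour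
    probabilities sum to 1. *)
Lemma pr_block_count k :
  pr unif [set u | forall j, block_count u j = k j] =
  \prod_j poisson_weight (rate * pr unif [set y | c y = j]) (k j).
Proof.
set n := (\sum_j k j)%N; set b := fun j => pr unif [set y | c y = j].
pose A i := if i == 0%N then [set v | poisson_number rate v = n]
  else color_event n k.
have mA i : measurable (A i).
  rewrite /A; case: ifP => _; first exact: measurable_poisson_number.
  exact: measurable_color_event.
rewrite (_ : [set u | _] = [set w | forall i : 'I_2, A i (U i w)]); last first.
  rewrite block_countE; apply/seteqP; split=> w.
    by move=> [H0 H1] [[|[|]]]//.
  by move=> H; split; [exact: (H ord0)|exact: (H ord_max)].
have := past_rectangle_rule Uindep 2 mA.
rewrite big_ord_recl big_ord1 /= !prE//; last 3 first.
- exact: measurable_funPTI.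
- exact: measurable_funPTI.
- apply: (measurable_forall (A := fun i : 'I_2 => [set w | A i (U i w)])) => i.
  exact: measurable_funPTI.
move=> [->]; rewrite !pr_uniform_preimage// /A /= pr_poisson_number//.
rewrite (pr_color_count Uindep (b := b))//; last first.
  by move=> i j; rewrite pr_uniform_preimage.
rewrite /multinomial eqxx /poisson_weight.
have f0 : n`!%:R != 0 :> R by rewrite pnatr_eq0 -lt0n fact_gt0.
rewrite mulrA divfK//; set Y := \prod_j _.
have sumb : \sum_j b j = 1.
  rewrite -(@pr_setT _ _ _ unif) /b.
  rewrite -(pr_sum_fin unif (Q := xpredT) (A := fun j => [set y | c y = j]))//.
    by congr pr; apply/seteqP; split=> // y _; exists (c y).
  by move=> i j w _ _ /= <- <-.
have -> : expR (- rate) = \prod_j expR (- (rate * b j)).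
  by rewrite -expR_sum sumrN -mulr_sumr sumb mulr1.
rewrite (_ : rate ^+ n = \prod_j rate ^+ k j); last by rewrite prodrXr.
rewrite /Y -!big_split /=; apply: eq_bigr => j _.
by rewrite exprMn; ring.
Qed.

End colors.

Section hits.
Context (m : nat).
Implicit Types B : 'I_m -> set R.

Definition block_hits B u i : nat :=
  \sum_(l < block_number u) `[< B i (block_point l u) >].

(** Disjoint sets are turned into the values of a single colour; [None] stands for the complement of
    their union. *)
Definition set_color B (y : R) : option 'I_m := [pick i | `[< B i y >]].

Lemma set_color_Some B y i : trivIset setT B ->
  (set_color B y == Some i) = `[< B i y >].
Proof.
move=> tB; rewrite /set_color; case: pickP => [j /asboolP Bj|none].
  apply/eqP/asboolP => [[<-]//|Bi]; congr Some; apply: contrapT => ji.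
  have /trivIsetP/(_ j i Logic.I Logic.I) := tB; move/(_ (introN eqP ji)) => E.
  by have : (B j `&` B i) y by []; rewrite E.
by apply/eqP/asboolP => // /asboolP; rewrite none.
Qed.

Lemma measurable_set_color B j : (forall i, measurable (B i)) ->
  measurable [set y | set_color B y = j].
Proof.
move=> mB; apply: (measurable_factor (b := fun y => [ffun i => `[< B i y >]])
  (X := set_color B) [set j]).
- move=> x; rewrite (_ : [set w | _] = [set w | forall i, `[< B i w >] = x i]).
    apply: (measurable_forall (A := fun i => [set w | `[< B i w >] = x i])) => i.
    case: (x i).
      rewrite (_ : [set w | _] = B i)//.
      by apply/seteqP; split=> w /= /asboolP.
    rewrite (_ : [set w | _] = ~` B i); first exact: measurableC.
    apply/seteqP; split=> w /=; last by move=> /asboolPn/negbTE.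
    by move=> H; apply/asboolPn; rewrite H.
  apply/seteqP; split=> w /=; first by move=> <- i; rewrite ffunE.
  by move=> H; apply/ffunP => i; rewrite ffunE.
- move=> y y' yy'; apply: eq_pick => i.
  by move/ffunP : yy' => /(_ i); rewrite !ffunE.
Qed.

Lemma block_hits_color B u i : trivIset setT B ->
  block_hits B u i = block_count (set_color B) u (Some i).
Proof. by move=> tB; apply: eq_bigr => l _; rewrite set_color_Some. Qed.

Definition extend (k : 'I_m -> nat) n (j : option 'I_m) : nat :=
  if j is Some i then k i else n.

Lemma hits_event B k M : trivIset setT B ->
  [set u | (forall i, block_hits B u i = k i) /\ (block_count (set_color B) u None < M)%N] =
  [set u | exists2 n : 'I_M, true & forall j, block_count (set_color B) u j = extend k n j].
Proof.
move=> tB; apply/seteqP; split=> u /=.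
  move=> [H NM]; exists (Ordinal NM) => // -[i|//]; by rewrite -block_hits_color.
move=> [n _ H]; split; first by move=> i; rewrite block_hits_color// H.
by rewrite H /=.
Qed.

Lemma measurable_block_hits B k : (forall i, measurable (B i)) -> trivIset setT B ->
  measurable [set u | forall i, block_hits B u i = k i].
Proof.
move=> mB tB; have mc j := measurable_set_color j mB.
rewrite (_ : [set u | _] = [set u | exists n,
    forall j, block_count (set_color B) u j = extend k n j]).
  apply: (measurable_exists (A := fun n =>
    [set u | forall j, block_count (set_color B) u j = extend k n j])) => n.
  exact: measurable_block_count.
apply/seteqP; split=> u /=.
  move=> H; exists (block_count (set_color B) u None) => -[i|//].
  by rewrite -block_hits_color.
by move=> [n H] i; rewrite block_hits_color// H.
Qed.

(** Points outside all the sets have colour [None]. Their number is summed out: the partial sums of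
    its Poisson weights tend to 1. *)
Lemma pr_block_hits B k : (forall i, measurable (B i)) -> trivIset setT B ->
  pr unif [set u | forall i, block_hits B u i = k i] =
  \prod_i poisson_weight (rate * pr unif (B i)) (k i).
Proof.
move=> mB tB; have mc j := measurable_set_color j mB.
pose E M := [set u | (forall i, block_hits B u i = k i) /\
  (block_count (set_color B) u None < M)%N].
pose F n := [set u | forall j, block_count (set_color B) u j = extend k n j].
have mF n : measurable (F n) by exact: measurable_block_count.
have c1 : pr unif (E M) @[M --> \oo] --> pr unif [set u | forall i, block_hits B u i = k i].
  apply: (@pr_event_cvg _ _ R unif E _ setT) => //.
  - move=> M; rewrite /E hits_event//.
    exact: (measurable_exists_fin (Q := xpredT) (A := fun n : 'I_M => F n)).
  - exact: measurable_block_hits.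
  - exact: pr_setT.
  move=> u _; exists (block_count (set_color B) u None).+1 => M NM.
  by split=> [[]//|H]; split.
pose x := rate * pr unif [set y | set_color B y = None].
have c2 : (\prod_i poisson_weight (rate * pr unif (B i)) (k i)) *
    series (poisson_weight x) M @[M --> \oo] -->
    (\prod_i poisson_weight (rate * pr unif (B i)) (k i)) * 1.
  by apply: cvgMr; exact: poisson_weight_sum.
rewrite mulr1 in c2; apply: (cvg_unique _ c1); first exact: Rhausdorff.
apply: cvg_trans c2; apply: near_eq_cvg; apply: nearW => M.
rewrite /E hits_event// (pr_sum_fin unif (Q := xpredT) (A := fun n : 'I_M => F n))//; last first.
  by move=> n n' u _ _ Fn Fn'; apply: ord_inj; have /= <- := Fn None; have /= <- := Fn' None.
rewrite seriesEord /= mulr_sumr; apply: eq_bigr => n _.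
rewrite /F pr_block_count// (bigD1 None)//= mulrC; congr (_ * _).
rewrite (reindex_omap Some id) /=; last by case.
apply: eq_big => [i|i _]; first by rewrite eqxx.
congr (poisson_weight (rate * pr _ _) _); apply/seteqP; split=> y /=.
  by move=> Bi; apply/eqP; rewrite set_color_Some//; exact/asboolP.
by move=> /eqP; rewrite set_color_Some// => /asboolP.
Qed.

Section total.
Variable B : nat -> 'I_m -> set R.
Hypotheses (mB : forall k i, measurable (B k i)) (tB : forall k, trivIset setT (B k)).

Definition total_hits L w i : nat := \sum_(k < L) block_hits (B k) (U k w) i.

Definition hits_set k (h : 'I_m -> nat) : set R :=
  [set u | forall i, block_hits (B k) u i = h i].

Lemma measurable_hits_set k h : measurable (hits_set k h).
Proof. exact: measurable_block_hits. Qed.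

Lemma measurable_total_hits L (h : 'I_m -> nat) :
  measurable ([set w | forall i, total_hits L w i = h i] : set (past U L)).
Proof.
pose F (nu : {ffun 'I_L -> {ffun 'I_m -> nat}}) : set (past U L) :=
  [set w | forall k : 'I_L, hits_set k (nu k) (U k w)].
rewrite [X in measurable X](_ : _ = [set w | exists nu : {ffun 'I_L -> {ffun 'I_m -> nat}},
    ((forall i, \sum_(k < L) nu k i = h i)%N /\ F nu w)]); last first.
  apply/seteqP; split=> w /=.
    move=> H; exists [ffun k : 'I_L => [ffun i => block_hits (B k) (U k w) i]].
    split=> [i|k i]; last by rewrite !ffunE.
    by rewrite -H; apply: eq_bigr => k _; rewrite !ffunE.
  by move=> [nu [H Fnu]] i; rewrite -H; apply: eq_bigr => k _; rewrite Fnu.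
apply: (@measurable_exists _ (past U L) {ffun 'I_L -> {ffun 'I_m -> nat}}
  (fun nu => [set w | (forall i, \sum_(k < L) nu k i = h i)%N /\ F nu w])) => nu.
have [H|H] := pselect (forall i, (\sum_(k < L) nu k i = h i)%N); last first.
  rewrite [X in measurable X](_ : _ = set0)//; apply/seteqP; split=> w //=.
  by move=> [].
rewrite [X in measurable X](_ : _ = F nu); last by apply/seteqP; split=> w; [case|split].
apply: (@measurable_forall _ (past U L) 'I_L (fun k => [set w | hits_set k (nu k) (U k w)])) => k.
rewrite -[X in measurable X]setTI.
exact: (@measurable_past_rv _ _ _ unif U L k (ltn_ord k) measurableT _ (measurable_hits_set k (nu k))).
Qed.

(** The blocks are independent and Poisson weights convolve. The counts [nu] reached by the first L
    blocks are split off componentwise, and the sum over [nu] factors over the sets. *)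
Lemma pr_total_hits L (h : 'I_m -> nat) :
  pr unif [set w | forall i, total_hits L w i = h i] =
  \prod_i poisson_weight (rate * \sum_(k < L) pr unif (B k i)) (h i).
Proof.
elim: L h => [|L IH] h.
  rewrite (eq_bigr (fun i => if h i == 0%N then 1 else 0)); last first.
    move=> i _; rewrite big_ord0 mulr0 /poisson_weight oppr0 expR0 mulr1 expr0n.
    by case: (h i) => [|k] /=; rewrite ?fact0 ?divr1 ?mul0r.
  have [h0|/existsP[i hi]] := boolP [forall i, h i == 0%N].
    rewrite big1; last by move=> i _; rewrite (forallP h0 i).
    rewrite (_ : [set w | _] = setT) ?pr_setT//; apply/seteqP; split=> w // _ i.
    by rewrite /total_hits big_ord0 (eqP (forallP h0 i)).
  rewrite (bigD1 i)//= (negbTE hi) mul0r.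
  rewrite (_ : [set w | _] = set0) ?pr_set0//; apply/seteqP; split=> w // H.
  by move: hi; rewrite -H /total_hits big_ord0.
pose K := (\max_i h i).+1.
have hK i : (h i < K)%N by rewrite ltnS; exact: leq_bigmax.
pose Q i : pred 'I_K := fun j => (j <= h i)%N.
pose E (nu : {ffun 'I_m -> 'I_K}) := [set w | forall i, total_hits L w i = nu i].
have mE (nu : {ffun 'I_m -> 'I_K}) := measurable_total_hits (L := L) (fun i => nat_of_ord (nu i)).
have mE' nu : measurable (E nu) := past_measurable (mE nu).
pose H (nu : {ffun 'I_m -> 'I_K}) := hits_set L (fun i => h i - nu i)%N.
have mH nu : measurable (H nu) by exact: measurable_hits_set.
have mUH nu : measurable (U L @^-1` H nu) by exact: measurable_funPTI.
rewrite (_ : [set w | _] = [set w | exists2 nu : {ffun 'I_m -> 'I_K},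
    nu \in family Q & (E nu `&` U L @^-1` H nu) w]); last first.
  apply/seteqP; split=> w /=.
    move=> Hw; have le i : (total_hits L w i <= h i)%N.
      by rewrite -Hw /total_hits big_ord_recr /= leq_addr.
    exists [ffun i => Ordinal (leq_ltn_trans (le i) (hK i))].
      by apply/familyP => i; rewrite ffunE; exact: le.
    split=> i; rewrite ffunE //= -Hw /total_hits big_ord_recr /=.
    by rewrite addnC addnK.
  move=> [nu /familyP nuQ [Ew Hw]] i; rewrite /total_hits big_ord_recr /=.
  rewrite -/(total_hits L w i) Ew Hw subnKC//; exact: (nuQ i).
rewrite (pr_sum_fin unif (Q := fun nu : {ffun 'I_m -> 'I_K} => nu \in family Q)
    (A := fun nu => E nu `&` U L @^-1` H nu)); last 2 first.
- by move=> nu _; exact: measurableI.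
- move=> nu nu' w _ _ [Ew _] [Ew' _]; apply/ffunP => i; apply: ord_inj.
  by rewrite -Ew -Ew'.
pose a i := rate * \sum_(k < L) pr unif (B k i).
pose b i := rate * pr unif (B L i).
transitivity (\sum_(nu in family Q) \prod_i
    (poisson_weight (a i) (nu i) * poisson_weight (b i) (h i - nu i))).
  apply: eq_bigr => nu _; rewrite big_split /= -IH -pr_block_hits//.
  rewrite -(pr_uniform_preimage L (mH nu)); apply: EFin_inj.
  rewrite EFinM -(prE unif (mE' nu)) -(prE unif (mUH nu)).
  rewrite -(prE unif (measurableI _ _ (mE' nu) (mUH nu))).
  exact: (independent_of_past Uindep (mE nu) (mH nu)).
transitivity (\prod_i \sum_(j | Q i j)
    (poisson_weight (a i) j * poisson_weight (b i) (h i - j))).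
  by rewrite bigA_distr_big_dep.
apply: eq_bigr => i _; rewrite big_ord_recr mulrDr -/(a i) -/(b i) -poisson_weightD.
rewrite (big_ord_widen K (fun j => poisson_weight (a i) j * poisson_weight (b i) (h i - j)))//.
Qed.

End total.
End hits.
End poisson_block.

Section shifted_uniform.
Context (R : realType).
Local Notation mu := (@lebesgue_measure R).
Local Notation unif := (@unit_uniform R).

Lemma unit_uniform_shift (t : R) (A : set R) : measurable A ->
  unif [set y | A (t + y)] = mu (A `&` `[t, t + 1[%classic).
Proof.
move=> mA.
have mt : measurable_fun [set: R] (fun y : R => t + y).
  by apply: measurable_funD => //; exact: measurable_cst.
have mtc (c : R) : measurable ((fun y : R => t + y) @^-1` `]c, +oo[%classic).
  by rewrite -[X in measurable X]setTI; exact: mt.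
have mI : measurable (`[t, t + 1[%classic : set R) by exact: measurable_itv.
pose m1 : {measure set R -> \bar R} :=
  measure_function_pushforward__canonical__measure_function_Measure unif mt.
(* The measure [mu] is carried by the sigma-algebra generated by half-open intervals; pushed along
   the identity it becomes a measure for the same structure as [m1]. *)
have mid : measurable_fun setT (idfun : g_sigma_algebraType (@ocitv R) -> R).
  by move=> _ Y mY; rewrite setTI.
pose m2 : {measure set R -> \bar R} :=
  measure_function_pushforward__canonical__measure_function_Measure (mrestr mu mI) mid.
apply: (@half_line_measure_unique _ m1 m2) => // [c|]; last first.
  exact: (le_lt_trans (probability_le1 unif measurableT) (ltry _)).
rewrite /m1 /m2 /= /pushforward /mrestr /= /unit_uniform.
rewrite uniform_prob01; last exact: mtc.
have [ct|tc] := ltP c t.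
  rewrite (_ : _ `&` _ = `[0, 1]%classic); last first.
    by apply/seteqP; split=> y; rewrite /= !in_itv /= ?andbT; [case|move=> /andP[? ?]; split; lra].
  rewrite (_ : _ `&` `[t, _[%classic = `[t, t + 1[%classic); last first.
    by apply/seteqP; split=> y; rewrite /= !in_itv /= ?andbT; [case|move=> /andP[? ?]; split; lra].
  by rewrite !lebesgue_measure_itv /= !lte_fin ltr01 ltrDl ltr01 -!EFinB; congr EFin; lra.
have [ct1|tc1] := ltP c (t + 1).
  rewrite (_ : _ `&` _ = `]c - t, 1]%classic); last first.
    apply/seteqP; split=> y; rewrite /= !in_itv /= ?andbT.
      by move=> [? /andP[? ?]]; apply/andP; split; lra.
    by move=> /andP[? ?]; split; [lra|apply/andP; split; lra].
  rewrite (_ : _ `&` `[t, _[%classic = `]c, t + 1[%classic); last first.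
    apply/seteqP; split=> y; rewrite /= !in_itv /= ?andbT.
      by move=> [? /andP[? ?]]; apply/andP; split; lra.
    by move=> /andP[? ?]; split; [lra|apply/andP; split; lra].
  rewrite !lebesgue_measure_itv /= !lte_fin ct1 (_ : c - t < 1); last by lra.
  by rewrite -!EFinB; congr EFin; lra.
rewrite (_ : _ `&` _ = set0); last first.
  by apply/seteqP; split=> // y; rewrite /= !in_itv /= ?andbT => -[? /andP[? ?]]; lra.
rewrite (_ : _ `&` `[t, _[%classic = set0) ?measure0//.
by apply/seteqP; split=> // y; rewrite /= !in_itv /= ?andbT => -[? /andP[? ?]]; lra.
Qed.

Lemma sum_unit_uniform_shift (A : set R) L : measurable A ->
  \sum_(k < L) pr unif [set y | A (k%:R + y)] = fine (mu (A `&` `[0, L%:R[%classic)).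
Proof.
move=> mA.
have fin (a b : R) : a <= b -> (mu (A `&` `[a, b[%classic) < +oo)%E.
  move=> ab; apply: (@le_lt_trans _ _ (mu `[a, b[%classic)).
    by apply: le_measure; rewrite ?inE//; apply: measurableI => //; exact: measurable_itv.
  by rewrite lebesgue_measure_itv /=; case: ifP => _; rewrite ?ltry// -EFinB ltry.
elim: L => [|L IH].
  rewrite big_ord0 (_ : _ `&` _ = set0) ?measure0//.
  by apply/seteqP; split=> // y [_]; rewrite /= in_itv /= => /andP[? ?]; lra.
rewrite big_ord_recr /= IH.
rewrite (_ : pr _ _ = fine (mu (A `&` `[L%:R, L%:R + 1[%classic))); last first.
  exact: (congr1 fine (unit_uniform_shift _ mA)).
rewrite -fineD.
- congr fine; rewrite -measureU.
  + congr (mu _); rewrite -setIUr; congr (_ `&` _); apply/seteqP; split=> y.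
      by rewrite /= !in_itv /= -natr1 => -[] /andP[? ?]; apply/andP; split; have := ler0n R L; lra.
    rewrite /= !in_itv /= -natr1 => /andP[? ?].
    by have [yL|Ly] := ltP y L%:R; [left|right]; apply/andP; split; lra.
  + by apply: measurableI => //; exact: measurable_itv.
  + by apply: measurableI => //; exact: measurable_itv.
  + by apply/seteqP; split=> // y [[_ ] + [_]]; rewrite /= !in_itv /= => /andP[? ?] /andP[? ?]; lra.
- by rewrite ge0_fin_numE// fin.
- by rewrite ge0_fin_numE// fin// lerDl.
Qed.

Lemma fine_measure_cvg (A : set R) : measurable A -> A `<=` `[0, +oo[%classic ->
  (mu A < +oo)%E ->
  fine (mu (A `&` `[0, L%:R[%classic)) @[L --> \oo] --> fine (mu A).
Proof.
move=> mA A0 Afin.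
pose F L := A `&` `[0, L%:R[%classic.
have mF L : measurable (F L) by apply: measurableI => //; exact: measurable_itv.
have UF : \bigcup_L F L = A.
  apply/seteqP; split=> [y [L _ []]//|y Ay].
  exists (Num.truncn y).+1 => //; split=> //=; rewrite in_itv /= truncnS_gt.
  by have := A0 _ Ay; rewrite /= in_itv /= andbT => ->.
have := nondecreasing_cvg_mu (mu := mu) mF (bigcup_measurable (fun k _ => mF k)).
rewrite UF => H; apply/fine_cvg; rewrite fineK ?ge0_fin_numE//.
apply: H => n m nm; apply/subsetPset => y [Ay]; rewrite /= !in_itv /= => /andP[y0 yn].
by split=> //=; rewrite in_itv /= y0 (lt_le_trans yn)// ler_nat.
Qed.

Lemma poisson_weight_cvg (x : nat -> R) l k : x n @[n --> \oo] --> l ->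
  poisson_weight (x n) k @[n --> \oo] --> poisson_weight l k.
Proof.
move=> xl; rewrite /poisson_weight; apply: cvgM; last exact: cvg_cst.
apply: cvgM.
  elim: k => [|k IH]; first by under eq_fun do rewrite expr0; rewrite expr0; exact: cvg_cst.
  by under eq_fun do rewrite exprS; rewrite exprS; exact: cvgM.
apply: (cvg_comp _ _ (cvgN xl)); exact: continuous_expR.
Qed.

End shifted_uniform.

(** * Poisson atoms on the half-line *)

Section atoms.
Context (R : realType) (rate : R).
Hypothesis rate0 : 0 < rate.
Local Notation unif := (@unit_uniform R).
Variable U : nat -> {RV unif >-> R}.
Hypothesis Uunif : forall i A, measurable A ->
  distribution unif (U i) A = uniform_prob (@ltr01 R) A.
Hypothesis Uindep : mutually_independent U.

(** Block k is a Poisson number of uniform points of [k, k+1[, computed entirely from the single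
    number [U k w]; distinct blocks are therefore independent. *)
Definition block_points k (w : R) : seq R :=
  [seq k%:R + block_point U i (U k w) | i <- iota 0 (block_number rate U (U k w))].
Definition points w L : seq R := flatten [seq block_points k w | k <- iota 0 L].
Definition sorted_points w L : seq R := sort <=%R (points w L).

Definition generic_blocks : set R :=
  [set w | forall k n, good_points U n (U 1%N (U k w))].

Lemma measurable_generic_block k :
  measurable [set w | forall n, good_points U n (U 1%N (U k w))].
Proof.
rewrite [X in measurable X](_ : _ = U k @^-1` (U 1%N @^-1` [set v | forall n, good_points U n v]))//.
do 2!apply: measurable_funPTI.
apply: (measurable_forall (A := fun n => good_points U n)) => n.
exact: measurable_good_points.
Qed.

Lemma measurable_generic_blocks : measurable generic_blocks.
Proof.
apply: (measurable_forall (A := fun k => [set w | forall n, good_points U n (U 1%N (U k w))])) => k.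
exact: measurable_generic_block.
Qed.

Lemma pr_generic_blocks : pr unif generic_blocks = 1.
Proof.
apply: (@pr1_forall _ _ R unif nat (fun k => [set w | forall n, good_points U n (U 1%N (U k w))])).
  by move=> k; exact: measurable_generic_block.
move=> k.
have mG : measurable [set v | forall n, good_points U n v].
  apply: (measurable_forall (A := fun n => good_points U n)) => n.
  exact: measurable_good_points.
rewrite (_ : [set w | _] = U k @^-1` (U 1%N @^-1` [set v | forall n, good_points U n v]))//.
rewrite !pr_uniform_preimage//; last exact: measurable_funPTI.
apply: (pr1_forall (P := unif) (A := fun n => good_points U n)) => n.
  exact: measurable_good_points.
exact: pr_good_points.
Qed.

Section generic.
Variable w : R.
Hypothesis gw : generic_blocks w.

Lemma generic_point k i : 0 <= block_point U i (U k w) < 1.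
Proof. by have [] := gw k (ltnSn i) (ltnSn i). Qed.

Lemma generic_point_inj k : injective (fun i => block_point U i (U k w)).
Proof.
move=> i j; have [] := @gw k (maxn i j).+1 i j; rewrite ?ltnS ?leq_maxl ?leq_maxr//.
Qed.

Lemma block_points_itv k y : y \in block_points k w -> k%:R <= y < k%:R + 1.
Proof.
by move=> /mapP[i _ ->]; have := generic_point k i; lra.
Qed.

Lemma block_points_uniq k : uniq (block_points k w).
Proof.
rewrite map_inj_uniq ?iota_uniq// => i j /addrI; exact: generic_point_inj.
Qed.

Lemma pointsS L : points w L.+1 = points w L ++ block_points L w.
Proof. by rewrite /points -addn1 iotaD map_cat flatten_cat /= cats0 add0n. Qed.

Lemma points_itv L y : y \in points w L -> 0 <= y < L%:R.
Proof.
elim: L => [//|L IH]; rewrite pointsS mem_cat -natr1 => /orP[/IH|/block_points_itv].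
  by move=> ?; lra.
by have := ler0n R L; lra.
Qed.

Lemma points_uniq L : uniq (points w L).
Proof.
elim: L => [//|L IH]; rewrite pointsS cat_uniq IH block_points_uniq andbT /=.
apply/hasPn => y /block_points_itv yL; apply/negP => /points_itv; lra.
Qed.

Lemma sorted_pointsS L :
  sorted_points w L.+1 = sorted_points w L ++ sort <=%R (block_points L w).
Proof.
apply: (@sorted_eq _ (<=%R : rel R)).
- exact: le_trans.
- exact: le_anti.
- by apply: sort_sorted; exact: le_total.
- have := sort_sorted (@le_total _ R) (points w L).
  have := sort_sorted (@le_total _ R) (block_points L w).
  rewrite -/(sorted_points w L); case E : (sorted_points w L) => [//|x s] /= sb ps.
  rewrite cat_path ps /=; case E' : (sort _ _) sb => [//|y t] /= yt.
  rewrite yt andbT.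
  have xs : last x s \in points w L by rewrite -(mem_sort <=%R) -/(sorted_points w L) E mem_last.
  have yb : y \in block_points L w by rewrite -(mem_sort <=%R) E' mem_head.
  by have := points_itv xs; have := block_points_itv yb; lra.
- rewrite /sorted_points pointsS perm_sort perm_sym.
  by apply: perm_cat; rewrite perm_sort.
Qed.

Lemma size_points_mono L M : (L <= M)%N -> (size (points w L) <= size (points w M))%N.
Proof.
elim: M => [|M IH]; first by rewrite leqn0 => /eqP ->.
rewrite leq_eqVlt => /orP[/eqP ->//|/IH h]; rewrite pointsS size_cat.
by rewrite (leq_trans h)// leq_addr.
Qed.

Lemma nth_sorted_points L M j : (L <= M)%N -> (j < size (points w L))%N ->
  nth 0 (sorted_points w M) j = nth 0 (sorted_points w L) j.
Proof.
move=> + jL; elim: M => [|M IH]; first by rewrite leqn0 => /eqP ->.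
rewrite leq_eqVlt => /orP[/eqP ->//|]; rewrite ltnS => LM.
rewrite sorted_pointsS nth_cat size_sort (leq_trans jL) ?size_points_mono//.
exact: IH.
Qed.

End generic.

Definition hits (A : set R) w L : nat := count (fun y => `[< A y >]) (points w L).

Lemma hitsE (m : nat) (B : 'I_m -> set R) w L i :
  hits (B i) w L =
  total_hits rate U (fun k i => [set y | B i (k%:R + y)]) L w i.
Proof.
rewrite /hits /points count_flatten -map_comp sumnE big_map /total_hits.
rewrite -(big_mkord xpredT (fun k =>
  block_hits rate U (fun i => [set y | B i (k%:R + y)]) (U k w) i)).
rewrite /index_iota subn0; apply: eq_bigr => k _; rewrite /= count_map /block_hits.
rewrite -sum1_count -(big_mkord xpredT (fun l =>
  nat_of_bool `[< B i (k%:R + block_point U l (U k w)) >])) big_mkcond.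
rewrite /index_iota subn0.
by apply: eq_bigr => l _ /=; case: ifP.
Qed.

Section laws.
Context (m : nat) (B : 'I_m -> set R).
Hypotheses (mB : forall i, measurable (B i)) (tB : trivIset setT B).

Let mBk k i : measurable [set y : R | B i (k%:R + y)].
Proof.
have mt : measurable_fun [set: R] (fun y : R => k%:R + y).
  by apply: measurable_funD => //; exact: measurable_cst.
by rewrite -[X in measurable X]setTI; exact: mt.
Qed.

Let tBk k : trivIset setT (fun i => [set y : R | B i (k%:R + y)]).
Proof.
apply/trivIsetP => i j _ _ ij; apply/seteqP; split=> // y [Bi Bj].
have /trivIsetP/(_ i j Logic.I Logic.I ij) E := tB.
by have : (B i `&` B j) (k%:R + y) by []; rewrite E.
Qed.

Lemma measurable_hits L (h : 'I_m -> nat) : measurable [set w | forall i, hits (B i) w L = h i].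
Proof.
have := past_measurable (measurable_total_hits (U := U) rate0 mBk tBk (L := L) h).
by congr measurable; apply/seteqP; split=> w H i; have := H i; rewrite hitsE.
Qed.

Lemma pr_hits L (h : 'I_m -> nat) : pr unif [set w | forall i, hits (B i) w L = h i] =
  \prod_i poisson_weight (rate * fine (lebesgue_measure (B i `&` `[0, L%:R[%classic))) (h i).
Proof.
rewrite (_ : [set w | _] = [set w | forall i, total_hits rate U
    (fun k i => [set y | B i (k%:R + y)]) L w i = h i]); last first.
  by apply/seteqP; split=> w H i; have := H i; rewrite hitsE.
rewrite (pr_total_hits rate0 Uunif Uindep mBk tBk); apply: eq_bigr => i _; congr (poisson_weight (rate * _) _).
exact: sum_unit_uniform_shift.
Qed.

End laws.

Lemma measurable_hits1 A L n : measurable A -> measurable [set w | hits A w L = n].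
Proof.
move=> mA; have tA : trivIset setT (fun _ : 'I_1 => A).
  by apply/trivIsetP => i j _ _; rewrite !ord1.
rewrite (_ : [set w | _] = [set w | 'I_1 -> hits A w L = n]).
  exact: (measurable_hits (fun _ => mA) tA L (fun=> n)).
by apply/seteqP; split=> w H; [move=> _|exact: (H ord0)].
Qed.

Lemma hits_setT w L : hits setT w L = size (points w L).
Proof. by rewrite /hits (eq_count (a2 := xpredT)) ?count_predT// => y; apply/asboolP. Qed.

Lemma pr_size_points L n : pr unif [set w | size (points w L) = n] =
  poisson_weight (rate * L%:R) n.
Proof.
have tA : trivIset setT (fun _ : 'I_1 => [set: R]).
  by apply/trivIsetP => i j _ _; rewrite !ord1.
have := pr_hits (fun _ => measurableT) tA L (fun=> n).
rewrite big_ord1 setTI lebesgue_measure_itv /= lte_fin.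
rewrite (_ : fine _ = L%:R); last first.
  by case: ifP; rewrite ?oppr0 ?addr0// ltr0n lt0n => /negbFE/eqP ->.
move=> <-; congr (pr _ _); apply/seteqP; split=> w /=.
  by move=> <- i; rewrite hits_setT.
by move=> /(_ ord0); rewrite hits_setT.
Qed.

Lemma measurable_size_points L n : measurable [set w | size (points w L) = n].
Proof.
have := @measurable_hits1 setT L n measurableT.
by congr measurable; apply/seteqP; split=> w /=; rewrite hits_setT.
Qed.

Lemma measurable_size_points_le L n : measurable [set w | (size (points w L) <= n)%N].
Proof.
rewrite (_ : [set w | _] = [set w | exists2 i : 'I_n.+1, true & size (points w L) = i]).
  apply: (measurable_exists_fin (Q := xpredT) (A := fun i : 'I_n.+1 =>
    [set w | size (points w L) = i])) => i _.
  exact: measurable_size_points.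
apply/seteqP; split=> w /=; last by move=> [i _ ->]; rewrite -ltnS ltn_ord.
by rewrite -ltnS => h; exists (Ordinal h).
Qed.

Definition infinitely_many : set R := [set w | forall j, exists L, (j < size (points w L))%N].

Lemma measurable_infinitely_many : measurable infinitely_many.
Proof.
apply: (measurable_forall (A := fun j => [set w | exists L, (j < size (points w L))%N])) => j.
apply: (measurable_exists (A := fun L => [set w | (j < size (points w L))%N])) => L.
rewrite (_ : [set w | _] = ~` [set w | (size (points w L) <= j)%N]).
  by apply: measurableC; exact: measurable_size_points_le.
by apply/seteqP; split=> w /=; rewrite ltnNge => /negP.
Qed.

(** By [poisson_weight_le], each of the counts 0, ..., j over L unit blocks has probability at most
    (j+1) / (rate L), so at most j points occur with probability at most (j+1)^2 / (rate L), for
    every L. *)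
Lemma pr_infinitely_many : pr unif infinitely_many = 1.
Proof.
have mF j : measurable [set w | exists L, (j < size (points w L))%N].
  apply: (measurable_exists (A := fun L => [set w | (j < size (points w L))%N])) => L.
  rewrite (_ : [set w | _] = ~` [set w | (size (points w L) <= j)%N]).
    by apply: measurableC; exact: measurable_size_points_le.
  by apply/seteqP; split=> w /=; rewrite ltnNge => /negP.
apply: (@pr1_forall _ _ R unif nat (fun j => [set w | exists L, (j < size (points w L))%N])) => // j.
apply/eqP; rewrite eq_le pr_le1//= leNgt; apply/negP => lt1.
set F := [set w | _] in lt1.
have bound L : (0 < L)%N -> 1 - pr unif F <= (j.+1 ^ 2)%:R / rate / L%:R.
  move=> L0; rewrite -(pr_setC unif (mF j)).
  apply: (@le_trans _ _ (pr unif [set w | exists2 i : 'I_j.+1, true & size (points w L) = i])).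
    apply: pr_mono.
    - exact: measurableC (mF j).
    - apply: (measurable_exists_fin (Q := xpredT) (A := fun i : 'I_j.+1 =>
        [set w | size (points w L) = i])) => i _.
      exact: measurable_size_points.
    - move=> w /= H; have h : (size (points w L) < j.+1)%N.
        by rewrite ltnS leqNgt; apply/negP => h; apply: H; exists L.
      by exists (Ordinal h).
  rewrite (pr_sum_fin unif (Q := xpredT) (A := fun i : 'I_j.+1 => [set w | size (points w L) = i])).
  - apply: (@le_trans _ _ (\sum_(i < j.+1) j.+1%:R / (rate * L%:R))).
      apply: ler_sum => i _; rewrite pr_size_points.
      apply: le_trans (poisson_weight_le _ _) _; first by rewrite mulr_gt0// ltr0n.
      by rewrite ler_pM2r ?invr_gt0 ?mulr_gt0 ?ltr0n// ler_nat.
    rewrite sumr_const card_ord -[X in X <= _]mulr_natl mulrA -natrM -mulnn invfM mulrA.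
    by rewrite lexx.
  - by move=> i _; exact: measurable_size_points.
  - by move=> i i' w _ _ /= -> /ord_inj.
have e0 : 0 < 1 - pr unif F by rewrite subr_gt0.
set c : R := (j.+1 ^ 2)%:R / rate in bound.
have := bound (Num.truncn (c / (1 - pr unif F))).+1 isT.
rewrite ler_pdivlMr ?ltr0n// leNgt => /negP; apply.
by rewrite mulrC -ltr_pdivrMr//; exact: truncnS_gt.
Qed.

Definition first_reaching j w : set nat :=
  [set L | (j < size (points w L))%N /\ forall M, (M < L)%N -> (size (points w M) <= j)%N].

(* Junk value [0] off the event [infinitely_many], as [sorted_points w 0] is empty. *)
Definition atom (j : nat) (w : R) : R :=
  nth 0 (sorted_points w (xget 0%N (first_reaching j w))) j.

Lemma first_reaching_ex j w L : (j < size (points w L))%N ->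
  exists M, first_reaching j w M.
Proof.
move=> jL; have ex : exists L, (j < size (points w L))%N by exists L.
exists (ex_minn ex); case: ex_minnP => M jM Mmin; split=> // M' M'M.
by rewrite leqNgt; apply/negP => /Mmin; rewrite leqNgt M'M.
Qed.

Lemma first_reaching_unique j w L M : first_reaching j w L -> first_reaching j w M -> L = M.
Proof.
move=> [jL Lmin] [jM Mmin]; apply/eqP; case: ltngtP => // h.
  by have := Mmin _ h; rewrite leqNgt jL.
by have := Lmin _ h; rewrite leqNgt jM.
Qed.

(** Later blocks lie to the right of all earlier ones, so the j-th smallest point is final as soon
    as more than j points are present. *)
Lemma atom_nth w L j : generic_blocks w -> (j < size (points w L))%N ->
  atom j w = nth 0 (sorted_points w L) j.
Proof.
move=> gw jL; have [M HM] := first_reaching_ex jL.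
rewrite /atom; case: xgetP => [M' _ [jM' M'min]|/(_ M)//].
apply/esym/nth_sorted_points => //; rewrite leqNgt; apply/negP => /M'min.
by rewrite leqNgt jL.
Qed.

(** An order statistic is expressed through a count, whose events are known to be measurable. The
    second alternative is the default value 0 of [nth]. *)
Lemma nth_sorted_gt c L j w : c < nth 0 (sorted_points w L) j <->
  ((j < size (points w L))%N /\ (hits `]-oo, c] w L <= j)%N) \/
  ((size (points w L) <= j)%N /\ c < 0).
Proof.
have szs : size (sorted_points w L) = size (points w L) by rewrite size_sort.
have [jL|Lj] := ltnP j (size (points w L)); last first.
  rewrite nth_default ?szs//; split=> [c0|[[//]|[_ //]]].
  by right.
have hE : hits `]-oo, c] w L = count (fun y => y <= c) (sorted_points w L).
  rewrite /hits -(permP (permEl (perm_sort <=%R (points w L))) _).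
  by apply: eq_count => y; apply/asboolP/idP; rewrite /= in_itv.
have srt : sorted <=%R (sorted_points w L) by apply: sort_sorted; exact: le_total.
suff H : (c < nth 0 (sorted_points w L) j) = (hits `]-oo, c] w L <= j)%N.
  by rewrite H; split=> [h|[[]//|[]//]]; left.
rewrite hE; set s := sorted_points w L in srt *; rewrite -szs in jL.
rewrite -[s in count _ s](cat_take_drop j) count_cat.
apply/idP/idP => h.
  rewrite (_ : count _ (drop j s) = 0%N).
    by rewrite addn0 (leq_trans (count_size _ _))// size_take_min geq_minl.
  apply/eqP; rewrite -leqn0 leqNgt -has_count; apply/hasPn => y /(nthP 0)[i].
  rewrite size_drop nth_drop ltn_subRL => ij <-; rewrite -ltNge (lt_le_trans h)//.
  by apply: (sorted_leq_nth (@le_trans _ R) (@lexx _ R) 0 srt) => //; rewrite leq_addr.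
rewrite ltNge; apply/negP => h'; move: h; rewrite leqNgt => /negP; apply.
rewrite (_ : count _ (take j s) = j).
  rewrite (drop_nth 0)//= h' addnA addn1 ltnS leq_addr//.
rewrite -[RHS](size_takel (ltnW jL)); apply/eqP; rewrite -all_count.
apply/allP => y /(nthP 0)[i]; rewrite size_take_min leq_min => /andP[ij is_].
rewrite nth_take// => <-; apply: le_trans h'.
by apply: (sorted_leq_nth (@le_trans _ R) (@lexx _ R) 0 srt) => //; exact: ltnW.
Qed.

Lemma measurable_hits_le A L n : measurable A -> measurable [set w | (hits A w L <= n)%N].
Proof.
move=> mA; rewrite (_ : [set w | _] = [set w | exists2 i : 'I_n.+1, true & hits A w L = i]).
  apply: (measurable_exists_fin (Q := xpredT) (A := fun i : 'I_n.+1 =>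
    [set w | hits A w L = i])) => i _.
  exact: measurable_hits1.
apply/seteqP; split=> w /=; last by move=> [i _ ->]; rewrite -ltnS ltn_ord.
by rewrite -ltnS => h; exists (Ordinal h).
Qed.

Lemma measurable_size_points_gt L n : measurable [set w | (n < size (points w L))%N].
Proof.
rewrite (_ : [set w | _] = ~` [set w | (size (points w L) <= n)%N]).
  by apply: measurableC; exact: measurable_size_points_le.
by apply/seteqP; split=> w /=; rewrite ltnNge => /negP.
Qed.

Lemma measurable_first_reaching j L : measurable [set w | first_reaching j w L].
Proof.
apply: measurableI; first exact: measurable_size_points_gt.
apply: (measurable_forall (A := fun M => [set w | (M < L)%N -> (size (points w M) <= j)%N])) => M.
have [ML|ML] := boolP (M < L)%N.
  rewrite (_ : [set w | _] = [set w | (size (points w M) <= j)%N]).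
    exact: measurable_size_points_le.
  by apply/seteqP; split=> w /=; [apply|].
by rewrite (_ : [set w | _] = setT)//; apply/seteqP; split.
Qed.

Lemma measurable_atom j : measurable_fun setT (atom j).
Proof.
apply: (measurability _ (RGenOInfty.measurableE R)) => // _ [_ [c ->] <-].
rewrite setTI; pose G L := [set w | c < nth 0 (sorted_points w L) j].
have mG L : measurable (G L).
  rewrite (_ : G L = ([set w | (j < size (points w L))%N] `&`
      [set w | (hits `]-oo, c] w L <= j)%N]) `|`
    ([set w | (size (points w L) <= j)%N] `&` [set w | c < 0])).
    apply: measurableU; apply: measurableI.
    - exact: measurable_size_points_gt.
    - by apply: measurable_hits_le; exact: measurable_itv.
    - exact: measurable_size_points_le.
    - by have [c0|c0] := boolP (c < 0); [rewrite (_ : [set w | _] = setT)//|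
        rewrite (_ : [set w | _] = set0)//]; apply/seteqP; split.
  by apply/seteqP; split=> w /nth_sorted_gt.
rewrite (_ : _ @^-1` _ = [set w | exists L, first_reaching j w L /\ G L w] `|`
    (~` [set w | exists L, first_reaching j w L] `&` G 0%N)).
  apply: measurableU.
    apply: (measurable_exists (A := fun L => [set w | first_reaching j w L /\ G L w])) => L.
    by apply: measurableI => //; exact: measurable_first_reaching.
  apply: measurableI => //; apply: measurableC.
  apply: (measurable_exists (A := fun L => [set w | first_reaching j w L])) => L.
  exact: measurable_first_reaching.
apply/seteqP; split=> w /=; rewrite in_itv /= andbT /atom.
  case: xgetP => [L _ HL cL|none c0]; first by left; exists L.
  by right; split=> // -[L HL]; exact: (none L).
move=> [[L [HL cL]]|[none c0]].
  case: xgetP => [L' _ HL'|/(_ L)//]; by rewrite (first_reaching_unique HL' HL).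
case: xgetP => [L' _ HL'|//]; exfalso; apply: none; by exists L'.
Qed.

Section atom_paths.
Variable w : R.
Hypotheses (gw : generic_blocks w) (iw : infinitely_many w).

Lemma atom_ge0 j : 0 <= atom j w.
Proof.
have [L jL] := iw j; rewrite (atom_nth gw jL).
have : nth 0 (sorted_points w L) j \in sorted_points w L by rewrite mem_nth ?size_sort.
by rewrite mem_sort => /(points_itv gw) /andP[].
Qed.

Lemma atom_lt j : atom j w < atom j.+1 w.
Proof.
have [L jL] := iw j.+1.
rewrite (atom_nth gw jL) (atom_nth gw (ltnW jL)).
have srt : sorted <%R (sorted_points w L).
  rewrite lt_sorted_uniq_le sort_uniq (points_uniq gw) /=.
  by apply: sort_sorted; exact: le_total.
by apply: (sorted_ltn_nth (@lt_trans _ R) 0 srt) => //; rewrite inE size_sort// ltnW.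
Qed.

Lemma hits_atoms A L : hits A w L =
  count (fun j => `[< A (atom j w) >]) (iota 0 (size (points w L))).
Proof.
rewrite /hits -(permP (permEl (perm_sort <=%R (points w L))) _).
rewrite -/(sorted_points w L).
have -> : sorted_points w L = [seq atom j w | j <- iota 0 (size (points w L))].
  apply: (@eq_from_nth _ 0); first by rewrite size_sort size_map size_iota.
  move=> j; rewrite size_sort => jL.
  by rewrite (nth_map 0%N) ?size_iota// nth_iota// add0n (atom_nth gw jL).
by rewrite count_map.
Qed.

Lemma hits_mono A L M : (L <= M)%N -> (hits A w L <= hits A w M)%N.
Proof.
elim: M => [|M IH]; first by rewrite leqn0 => /eqP ->.
rewrite leq_eqVlt => /orP[/eqP ->//|/IH h]; rewrite {2}/hits pointsS count_cat.
by rewrite (leq_trans h)// leq_addr.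
Qed.

(** The counts over the first L blocks do not decrease with L. If one of them exceeds k, they stay
    above k; if none does and one equals k, then all further atoms avoid A and the cardinality is
    k. *)
Lemma hits_eventually A k : exists L0, forall L, (L0 <= L)%N ->
  hits A w L = k <-> ([set j | A (atom j w)] #= `I_k)%card.
Proof.
have [Ak|nAk] := pselect ([set j | A (atom j w)] #= `I_k)%card.
  have [n [An cn]] := (card_eq_countP _ _).1 Ak; have [L0 nL0] := iw n.
  exists L0 => L L0L; split=> // _.
  have nL : (n <= size (points w L))%N.
    by rewrite (leq_trans (ltnW nL0))// size_points_mono.
  rewrite hits_atoms -(subnKC nL) iotaD count_cat add0n cn.
  rewrite (_ : count _ (iota n _) = 0%N) ?addn0//.
  apply/eqP; rewrite -leqn0 leqNgt -has_count; apply/hasPn => j.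
  rewrite mem_iota => /andP[nj _]; apply/asboolPn => /An; by rewrite ltnNge nj.
have [[L0 kL0]|le_k] := pselect (exists L0, (k < hits A w L0)%N).
  exists L0 => L L0L; split=> // hk; move: kL0.
  by rewrite -hk ltnNge hits_mono.
have {}le_k L : (hits A w L <= k)%N by rewrite leqNgt; apply/negP => h; apply: le_k; exists L.
exists 0%N => L _; split=> // hk; exfalso; apply: nAk; apply/card_eq_countP.
exists (size (points w L)); rewrite -hits_atoms; split=> // j Aj.
rewrite ltnNge; apply/negP => Lj; have [M jM] := iw j.
have sLM : (size (points w L) <= size (points w M))%N by rewrite (leq_trans Lj)// ltnW.
have := le_k M; rewrite hits_atoms -(subnKC sLM) iotaD count_cat -hits_atoms add0n hk.
rewrite -[X in (_ <= X)%N]addn0 leq_add2l leqn0 -leqn0 leqNgt -has_count => /hasPn/(_ j).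
rewrite mem_iota Lj subnKC// jM => /(_ isT) /asboolPn; exact.
Qed.

End atom_paths.

(** The counts in the first L blocks agree with those of all atoms for large L, almost surely, while
    their Poisson parameters tend to the measures of the full sets. *)
Lemma poisson_atoms_exist : exists eps : nat -> {RV unif >-> R}, poisson_atoms rate eps.
Proof.
pose eps j : {mfun R >-> R} :=
  HB.pack (atom j) (isMeasurableFun.Build _ _ _ _ (atom j) (measurable_atom j)).
pose N := generic_blocks `&` infinitely_many.
have mN : measurable N.
  by apply: measurableI; [exact: measurable_generic_blocks|exact: measurable_infinitely_many].
have N1 : pr unif N = 1.
  by rewrite (prI1 measurable_generic_blocks measurable_infinitely_many pr_infinitely_many) pr_generic_blocks.
exists eps; split.
  exists (~` N); split; first exact: measurableC.
    by rewrite (prE unif (measurableC mN)) pr_setC// N1 subrr.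
  apply: subsetC => w [gw iw]; split; first exact: atom_ge0.
  by move=> j; exact: atom_lt.
move=> m B h HB tB.
have mB i : measurable (B i) by have [] := HB i.
pose E := [set w | forall i, ([set j | B i (eps j w)] #= `I_(h i))%card].
have mE : measurable E.
  apply: (measurable_forall (A := fun i => [set w | ([set j | B i (eps j w)] #= `I_(h i))%card])) => i.
  by apply: measurable_count => // j; exact: measurable_atom.
have c1 : pr unif [set w | forall i, hits (B i) w L = h i] @[L --> \oo] --> pr unif E.
  apply: (@pr_event_cvg _ _ R unif (fun L => [set w | forall i, hits (B i) w L = h i]) E N) => //.
    by move=> L; exact: measurable_hits.
  move=> w [gw iw].
  have [L0 HL0] := eventually_forall_fin (fun i => hits_eventually gw iw (B i) (h i)).
  by exists L0 => L /HL0 HL; split=> Hw i; apply/(HL i).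
have c2 : \prod_i poisson_weight (rate * fine (lebesgue_measure (B i `&` `[0, L%:R[%classic))) (h i)
    @[L --> \oo] --> \prod_i poisson_weight (rate * fine (lebesgue_measure (B i))) (h i).
  apply: cvg_bigprod => i; apply: poisson_weight_cvg; apply: cvgMr.
  by have [_ B0 Bfin] := HB i; exact: fine_measure_cvg.
rewrite -/E prE//.
have -> : pr unif E = \prod_i poisson_weight (rate * fine (lebesgue_measure (B i))) (h i).
  apply: (cvg_unique _ c1); first exact: Rhausdorff.
  apply: cvg_trans c2; apply: near_eq_cvg; apply: nearW => L.
  by rewrite pr_hits.
rewrite -prodEFin; apply: eq_bigr => i _; rewrite poisson_prob_weight//.
by rewrite mulr_ge0 ?fine_ge0// ltW.
Qed.

End atoms.

Lemma leading_zeros_binary (s : bitseq) : exists k (c : seq nat),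
  0%N \notin c /\ s = nseq k false ++ binary c.
Proof.
elim: s => [|[] s [k [c [c0 ->]]]]; first by exists 0%N, [::].
  by exists 0%N, (k.+1 :: c); rewrite inE.
by exists k.+1, c.
Qed.

Lemma mkseq_composition (b : nat -> bool) n : b 0%N ->
  exists c : composition n, binary c = mkseq b n.
Proof.
move=> b0; have [k [c [c0 E]]] := leading_zeros_binary (mkseq b n).
case: k E => [E|k E]; last first.
  by case: n E => // n /(congr1 (head false)) /=; rewrite b0.
have cn : is_composition n c.
  by rewrite /is_composition c0 /= -size_binary// -[binary c]/(nseq 0 false ++ binary c) -E size_mkseq.
by exists (Composition cn).
Qed.

Lemma poisson_construction_exists (R : realType) dS (TS : measurableType dS)
    (PS : probability TS R) (S : {RV PS >-> closed_subset `[0%R : R, +oo[}) (rate : R) :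
  0 < rate -> exists (d' : measure_display) (Omega' : measurableType d')
    (P' : probability Omega' R) (S' : {RV P' >-> closed_subset `[0%R : R, +oo[})
    (eps : nat -> {RV P' >-> R}) (X : forall n : nat, Omega' -> composition n),
    same_law S' S /\ poisson_construction rate S' eps X.
Proof.
move=> rate0; have [U [Uunif Uindep]] := iid_uniforms R.
have [eps [[N [mN N0 NS]] epsP]] := poisson_atoms_exist rate0 Uunif Uindep.
have [S' [eps' [S'E eps'E indep]]] := independent_copies S eps.
pose X n w := sval (cid (@mkseq_composition (digit S' eps' w) n isT)).
exists _, _, _, S', eps', X; split.
  move=> A mA; rewrite /distribution /pushforward.
  rewrite (_ : S' @^-1` A = fst @^-1` (S @^-1` A)); last first.
    by apply/seteqP; split=> w; rewrite /= S'E.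
  by apply: product_fst; exact: measurable_funPTI.
split=> //; last by move=> n w; exact: svalP (cid (@mkseq_composition (digit S' eps' w) n isT)).
split.
  exists (snd @^-1` N); split.
  - by rewrite -[X in measurable X]setTI; exact: measurable_snd.
  - by rewrite -N0; exact: product_snd.
  - move=> w /= H; apply: NS => /= H'; apply: H.
    by rewrite eps'E; case: H' => H0 H1; split=> // j; rewrite !eps'E.
move=> m B k HB tB; rewrite -(epsP m B k HB tB).
rewrite (_ : [set w | _] = snd @^-1` [set w | forall i, ([set j | B i (eps j w)] #= `I_(k i))%card]).
  apply: product_snd; apply: (measurable_forall (A := fun i =>
    [set w | ([set j | B i (eps j w)] #= `I_(k i))%card])) => i.
  apply: measurable_count; first by move=> j; exact: measurable_funP.
  by have [] := HB i.
apply/seteqP; split=> w /= H i; have := H i.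
  by under eq_set do rewrite eps'E.
by under [in X in _ -> X]eq_set do rewrite eps'E.
Qed.

(** * Dilation-invariant means *)

Section dilation_means.
Context (R : realType).
Implicit Types (F G : nat -> R) (ls : seq nat).

Definition dilation_mean N l F (c : nat) : R := N%:R^-1 * \sum_(e < N) F (c * l ^ e)%N.

Definition iterated_mean N ls F : nat -> R := foldr (dilation_mean N) F ls.

(* The dilations by [1], ..., [N] are averaged over exponents below [N], the
   starting point being divisible by every integer between [1] and [N]. *)
Definition mean_at F N : R := iterated_mean N (iota 1 N) F (N`! * 2 ^ N)%N.

Lemma dilation_mean_dilate N l k F c :
  dilation_mean N l (fun c => F (k * c)%N) c = dilation_mean N l F (k * c)%N.
Proof. by congr (_ * _); apply: eq_bigr => e _; rewrite mulnA. Qed.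

Lemma iterated_mean_dilate N ls k F c :
  iterated_mean N ls (fun c => F (k * c)%N) c = iterated_mean N ls F (k * c)%N.
Proof.
elim: ls c => [//|l ls IH] c /=.
by rewrite -dilation_mean_dilate; congr (_ * _); apply: eq_bigr => e _; rewrite IH.
Qed.

Lemma iterated_mean_le N ls F G c : {in ls, forall l, (0 < l)%N} ->
  (forall d, (0 < d)%N -> F (c * d)%N <= G (c * d)%N) ->
  iterated_mean N ls F c <= iterated_mean N ls G c.
Proof.
move=> + FG; suff H d : (0 < d)%N -> {in ls, forall l, (0 < l)%N} ->
    iterated_mean N ls F (c * d)%N <= iterated_mean N ls G (c * d)%N.
  by move=> ls0; have := H 1%N isT ls0; rewrite muln1.
elim: ls d => [|l ls IH] d d0 ls0; first exact: FG.
rewrite /= ler_wpM2l ?invr_ge0//; apply: ler_sum => e _.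
rewrite -mulnA; apply: IH.
  by rewrite muln_gt0 d0 expn_gt0 ls0 ?mem_head.
by move=> k kls; apply: ls0; rewrite inE kls orbT.
Qed.

Lemma dilation_meanD N l F G c :
  dilation_mean N l (fun c => F c + G c) c = dilation_mean N l F c + dilation_mean N l G c.
Proof. by rewrite /dilation_mean big_split mulrDr. Qed.

Lemma iterated_meanD N ls F G c :
  iterated_mean N ls (fun c => F c + G c) c = iterated_mean N ls F c + iterated_mean N ls G c.
Proof.
elim: ls c => [//|l ls IH] c /=; rewrite -dilation_meanD.
by congr (_ * _); apply: eq_bigr => e _; rewrite IH.
Qed.

Lemma iterated_meanZ N ls k F c :
  iterated_mean N ls (fun c => k * F c) c = k * iterated_mean N ls F c.
Proof.
elim: ls c => [//|l ls IH] c /=.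
rewrite /dilation_mean mulrCA; congr (_ * _); rewrite mulr_sumr.
by apply: eq_bigr => e _; rewrite IH.
Qed.

Lemma dilation_mean_cst N l k c : (0 < N)%N -> dilation_mean N l (fun=> k) c = k.
Proof.
move=> N0; rewrite /dilation_mean sumr_const card_ord -[k *+ N]mulr_natl mulrA.
by rewrite mulVf ?mul1r// pnatr_eq0 -lt0n.
Qed.

Lemma iterated_mean_cst N ls k c : (0 < N)%N -> iterated_mean N ls (fun=> k) c = k.
Proof.
move=> N0; elim: ls c => [//|l ls IH] c /=.
by rewrite -[RHS](dilation_mean_cst l k c N0); congr (_ * _); apply: eq_bigr => e _.
Qed.

Lemma iterated_mean_norm N ls F G k c : {in ls, forall l, (0 < l)%N} -> (0 < N)%N ->
  (forall d, (0 < d)%N -> `|F (c * d)%N - G (c * d)%N| <= k) ->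
  `|iterated_mean N ls F c - iterated_mean N ls G c| <= k.
Proof.
move=> ls0 N0 FG; rewrite ler_distl; apply/andP; split.
  rewrite lerBlDr -{1}(iterated_mean_cst ls k c N0) -iterated_meanD.
  by apply: iterated_mean_le => // d /FG; rewrite ler_distl; lra.
rewrite -{1}(iterated_mean_cst ls k c N0) -iterated_meanD.
by apply: iterated_mean_le => // d /FG; rewrite ler_distl; lra.
Qed.

Definition unital F := forall c, 0 <= F c <= 1.

Lemma iterated_mean_unital N ls F : (0 < N)%N -> {in ls, forall l, (0 < l)%N} ->
  unital F -> unital (iterated_mean N ls F).
Proof.
move=> N0 ls0 F01 c; apply/andP; split.
  rewrite -(iterated_mean_cst ls 0 c N0); apply: iterated_mean_le => // d _.
  by have /andP[] := F01 (c * d)%N.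
rewrite -[leRHS](iterated_mean_cst ls 1 c N0); apply: iterated_mean_le => // d _.
by have /andP[] := F01 (c * d)%N.
Qed.

(** In the mean over the powers of l, the sum of differences telescopes to its two end terms.
    Dilation commutes with the means over the other factors, and these, being averages, do not
    increase the bound. *)
Lemma iterated_mean_shift N ls l F c : {in ls, forall l, (0 < l)%N} -> (0 < N)%N ->
  l \in ls -> unital F ->
  `|iterated_mean N ls F (l * c)%N - iterated_mean N ls F c| <= N%:R^-1.
Proof.
move=> + N0 + F01; rewrite -iterated_mean_dilate.
elim: ls c => [//|k ls IH] c kls0.
have ls0 : {in ls, forall l, (0 < l)%N}.
  by move=> i ils; apply: kls0; rewrite inE ils orbT.
rewrite inE => /orP[/eqP ->|lls] /=; last first.
  apply: (@iterated_mean_norm N [:: k] (iterated_mean N ls (fun c => F (l * c)%N))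
    (iterated_mean N ls F)) => // [i|d _]; last exact: IH.
  by rewrite inE => /eqP ->; apply: kls0; rewrite mem_head.
set G := iterated_mean N ls F; have G01 : unital G by exact: iterated_mean_unital.
rewrite /dilation_mean -mulrBr normrM ger0_norm ?invr_ge0//.
rewrite -[leRHS]mulr1 ler_wpM2l ?invr_ge0//.
rewrite (eq_bigr (fun e : 'I_N => G (c * k ^ e.+1)%N)); last first.
  by move=> e _; rewrite iterated_mean_dilate expnS mulnCA.
rewrite -sumrB -(big_mkord xpredT (fun e => G (c * k ^ e.+1)%N - G (c * k ^ e)%N)).
rewrite telescope_sumr// ler_distl.
by have := G01 (c * k ^ N)%N; have := G01 (c * k ^ 0)%N; lra.
Qed.

Lemma iota1_gt0 N : {in iota 1 N, forall l, (0 < l)%N}.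
Proof. by move=> l; rewrite mem_iota => /andP[]. Qed.

Lemma mean_at_unital F N : unital F -> 0 <= mean_at F N.+1 <= 1.
Proof. by move=> F01; apply: iterated_mean_unital => //; exact: iota1_gt0. Qed.

(** Every scale visited is a multiple of N! 2^N, hence divisible by K and at least 2^N. Thus an
    inequality valid for large multiples of K is enough. *)
Lemma mean_at_le F G K N : (0 < K <= N)%N ->
  (forall c, (K %| c)%N -> (2 ^ N <= c)%N -> F c <= G c) -> mean_at F N <= mean_at G N.
Proof.
move=> /andP[K0 KN] FG; apply: iterated_mean_le; first exact: iota1_gt0.
move=> d d0; apply: FG.
  rewrite !dvdn_mulr// dvdn_fact// K0//.
by rewrite mulnAC -{1}[(2 ^ N)%N]mul1n leq_mul2r muln_gt0 fact_gt0 d0 orbT.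
Qed.

Section mean_limit.
Variable W : set_system nat.
Hypotheses (ultraW : UltraFilter W) (infW : \oo `<=` W).

Let properW : ProperFilter W.
Proof. exact: ultra_proper. Qed.
#[local] Existing Instance properW.

Definition mean_limit F : R := lim (mean_at F N @[N --> W]).

(** Compactness of [0, 1] gives a cluster point, and an ultrafilter converges to each of its cluster
    points. *)
Lemma ultra_cvg (x : nat -> R) : (\forall N \near \oo, 0 <= x N <= 1) ->
  exists l : R, x N @[N --> W] --> l.
Proof.
move=> x01; have W01 : (x @ W) `[0, 1]%classic.
  apply: infW; near=> N; rewrite /= in_itv /=; near: N; exact: x01.
have [l [_ lx]] := @segment_compact R 0 1 (x @ W) _ W01.
exists l => V Vl; have [//|WV] := in_ultra_setVsetC (x @^-1` V) ultraW.
have [y []] := lx (~` V) V WV Vl.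
by [].
Unshelve. all: by end_near. Qed.

Lemma mean_limit_cvg F : unital F -> mean_at F N @[N --> W] --> mean_limit F.
Proof.
move=> F01; have [l Fl] : exists l : R, mean_at F N @[N --> W] --> l.
  by apply: ultra_cvg; exists 1%N => // -[//|N] _; exact: mean_at_unital.
by rewrite /mean_limit (cvg_lim _ Fl)//; exact: Rhausdorff.
Qed.

Lemma mean_limit_le F G K N0 : (0 < K)%N -> unital F -> unital G ->
  (forall c, (K %| c)%N -> (N0 <= c)%N -> F c <= G c) ->
  mean_limit F <= mean_limit G.
Proof.
move=> K0 F01 G01 FG.
apply: (ler_cvg_to (mean_limit_cvg F01) (mean_limit_cvg G01)).
apply: infW; exists (maxn K N0) => // N /=; rewrite geq_max => /andP[KN N0N].
apply: (@mean_at_le _ _ K); first by rewrite K0.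
move=> c Kc Nc; apply: FG => //; rewrite (leq_trans N0N)// (leq_trans _ Nc)//.
by rewrite ltnW// ltn_expl.
Qed.

Lemma mean_limitD F G : unital F -> unital G -> unital (fun c => F c + G c) ->
  mean_limit (fun c => F c + G c) = mean_limit F + mean_limit G.
Proof.
move=> F01 G01 FG01.
apply: (cvg_unique _ (mean_limit_cvg FG01)); first exact: Rhausdorff.
have H := cvgD (mean_limit_cvg F01) (mean_limit_cvg G01).
apply: (cvg_trans _ (H _)); apply: near_eq_cvg; apply: nearW => N /=.
by rewrite /mean_at iterated_meanD.
Qed.

Lemma mean_limitZ k F : unital F -> unital (fun c => k * F c) ->
  mean_limit (fun c => k * F c) = k * mean_limit F.
Proof.
move=> F01 kF01.
apply: (cvg_unique _ (mean_limit_cvg kF01)); first exact: Rhausdorff.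
have H := cvgM (cvg_cst k) (mean_limit_cvg F01).
apply: (cvg_trans _ (H _ _)); apply: near_eq_cvg; apply: nearW => N /=.
by rewrite /mean_at iterated_meanZ.
Qed.

Lemma mean_limit_cst k : 0 <= k <= 1 -> mean_limit (fun=> k) = k.
Proof.
move=> k01; have kl := mean_limit_cvg (F := fun=> k) (fun=> k01).
apply: (cvg_unique _ kl); first exact: Rhausdorff.
have H : (fun _ : nat => k) @ W --> k by exact: cvg_cst.
apply: cvg_trans H; apply: near_eq_cvg; apply: infW; exists 1%N => // N N0.
by rewrite /mean_at iterated_mean_cst.
Qed.

Lemma mean_limit_dilate F l : (0 < l)%N -> unital F ->
  mean_limit (fun c => F (l * c)%N) = mean_limit F.
Proof.
move=> l0 F01; have lF01 : unital (fun c => F (l * c)%N) by move=> c; exact: F01.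
apply/eqP; rewrite -subr_eq0 -normr_le0.
have H := cvg_norm (cvgB (mean_limit_cvg lF01) (mean_limit_cvg F01)).
have c0 : (N%:R^-1 : R) @[N --> W] --> (0 : R).
  by apply: cvg_trans (@inv_nat_cvg0 R); exact: cvg_app.
apply: (ler_cvg_to (H _ _) c0).
apply: infW; exists l.+1 => // N /= lN.
change (`|mean_at (fun c => F (l * c)%N) N - mean_at F N| <= N%:R^-1).
rewrite /mean_at iterated_mean_dilate.
apply: iterated_mean_shift => //; first exact: iota1_gt0.
  by rewrite (leq_trans _ lN).
by rewrite mem_iota l0 add1n ltnS ltnW.
Qed.

End mean_limit.
End dilation_means.

Lemma binary_delete_last n (c : composition n.+1) :
  binary (delete_ball c ord_max) = take n (binary c).
Proof.
have /andP[cgt /eqP csum] := compositionP c.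
have sz : size (binary c) = n.+1 by exact: size_composition_binary.
rewrite /= binary_delete_seq ?csum//.
by have := @remove_last_digit (binary c); rewrite sz => ->.
Qed.

(** * The limiting closed set *)

Section digit_process.
Context (R : realType) (C : forall n, probability (composition n) R).
Hypothesis rC : right_consistent C.
Local Notation unif := (@unit_uniform R).

Definition digit_prob (s : seq bool) : R := pr (C (size s)) [set c | binary c = s].

Lemma digit_prob_ge0 s : 0 <= digit_prob s.
Proof. exact: pr_ge0. Qed.

Lemma digit_prob_nil : digit_prob [::] = 1.
Proof.
rewrite /digit_prob -(@pr_setT _ _ _ (C 0%N)); congr pr; apply/seteqP; split=> c // _.
by apply/size0nil; exact: size_composition_binary.
Qed.

Lemma digit_prob_rcons s : digit_prob s = digit_prob (rcons s false) + digit_prob (rcons s true).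
Proof.
rewrite /digit_prob !size_rcons -prU//; last first.
  apply/seteqP; split=> c // [/= -> /(congr1 (last false))]; rewrite !last_rcons.
  by [].
(* Consistency relates compositions of n and n + 1 for positive n only; for the empty sequence, both
   sides are 1 because the first digit is always one. *)
case: s => [|b s].
  transitivity (1 : R).
    exact: digit_prob_nil.
  rewrite -(@pr_setT _ _ _ (C 1%N)); congr pr; apply/seteqP; split=> c // _; right => /=.
  apply: (@eq_from_nth _ false); first exact: size_composition_binary.
  by move=> [|i]; rewrite size_composition_binary// nth_composition_binary0.
set n := size (b :: s); rewrite -((right_consistentP C).1 rC n)//; congr pr.
have takeE (c : composition n.+1) : binary c = rcons (take n (binary c)) (nth false (binary c) n).
  have sz : size (binary c) = n.+1 by exact: size_composition_binary.
  by move: sz; move: (binary c) => bc sz; rewrite -take_nth ?sz// -sz take_size.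
have tk b' : take n (rcons (b :: s) b') = b :: s by rewrite -cats1 take_size_cat.
apply/seteqP; split=> c /=; rewrite binary_delete_last.
  move=> H; have := takeE c; rewrite H.
  by case: (nth _ _ _); [right|left].
by move=> [] ->; exact: tk.
Qed.

Definition ball_digit (i : nat) (x : R) : bool := walk_bit digit_prob i x.

Lemma measurable_ball_digit i b : measurable [set x | ball_digit i x = b].
Proof. exact: measurable_walk_bit. Qed.

Lemma pr_ball_digits n (Q : {ffun 'I_n -> bool} -> Prop) :
  pr unif [set x | Q [ffun i : 'I_n => ball_digit i x]] =
  pr (C n) [set c | Q [ffun i : 'I_n => nth false (binary c) i]].
Proof.
pose q f := `[< Q f >].
rewrite (_ : [set x | _] = [set x | exists2 f : {ffun 'I_n -> bool}, q f &
    forall i : 'I_n, ball_digit i x = f i]); last first.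
  apply/seteqP; split=> x /=.
    by move=> H; exists [ffun i : 'I_n => ball_digit i x]; [exact/asboolP|move=> i; rewrite ffunE].
  move=> [f /asboolP Qf H]; rewrite (_ : [ffun i => _] = f)//.
  by apply/ffunP => i; rewrite ffunE H.
rewrite [in RHS](_ : [set c | _] = [set c | exists2 f : {ffun 'I_n -> bool}, q f &
    forall i : 'I_n, nth false (binary c) i = f i]); last first.
  apply/seteqP; split=> x /=.
    by move=> H; exists [ffun i : 'I_n => nth false (binary x) i]; [exact/asboolP|move=> i; rewrite ffunE].
  move=> [f /asboolP Qf H]; rewrite (_ : [ffun i => _] = f)//.
  by apply/ffunP => i; rewrite ffunE H.
rewrite (pr_sum_fin unif (Q := q)
    (A := fun f => [set x | forall i : 'I_n, ball_digit i x = f i])); last 2 first.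
- move=> f _; apply: (measurable_forall (A := fun i : 'I_n => [set x | ball_digit i x = f i])) => i.
  exact: measurable_ball_digit.
- by move=> f f' x _ _ H H'; apply/ffunP => i; rewrite -H -H'.
rewrite (pr_sum_fin (C n) (Q := q)
    (A := fun f => [set c | forall i : 'I_n, nth false (binary c) i = f i])); last 2 first.
- by [].
- by move=> f f' x _ _ H H'; apply/ffunP => i; rewrite -H -H'.
apply: eq_bigr => f _.
rewrite (pr_walk_bits digit_prob_ge0 digit_prob_nil digit_prob_rcons) /digit_prob.
have sz : size (fgraph f) = n by rewrite size_tuple card_ord.
move: (fgraph f : seq bool) sz (fun i : 'I_n => nth_fgraph_ord false i f) => s sz sE.
have {sE} : (fun i : 'I_n => f i) = (fun i : 'I_n => nth false s i) by apply/funext => i; rewrite sE.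
move=> fE; have {fE} fE i : f i = nth false s i by rewrite -[f i]/((fun i => f i) i) fE.
subst n; congr pr; apply/seteqP; split=> c /=.
  by move=> cs i; rewrite cs fE.
move=> H; apply: (@eq_from_nth _ false); first by rewrite size_composition_binary.
by move=> i; rewrite size_composition_binary => si; rewrite (H (Ordinal si)) fE.
Qed.

Lemma pr_ball_unbroken n D : places_below n D ->
  pr unif [set x | forall p, p \in D -> forall l, (p.1 < l <= p.2)%N -> ~~ ball_digit l x] =
  pr (C n) (unbroken n D).
Proof.
move=> Dn; have Dl p l : p \in D -> (p.1 < l <= p.2)%N -> (l < n)%N.
  by move=> /(allP Dn) /andP[_ p2n] /andP[_ lp]; exact: leq_ltn_trans p2n.
pose Q (f : {ffun 'I_n -> bool}) := forall p, p \in D -> forall l : 'I_n,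
  (p.1 < l <= p.2)%N -> ~~ f l.
have := pr_ball_digits Q; rewrite (_ : [set x | Q _] = [set x | forall p, p \in D ->
    forall l, (p.1 < l <= p.2)%N -> ~~ ball_digit l x]); last first.
  apply/seteqP; split=> x /= H p pD l pl; last by rewrite ffunE; exact: H pl.
  by have := H p pD (Ordinal (Dl p l pD pl)) pl; rewrite ffunE.
move=> ->; congr pr; apply/seteqP; split=> c /= H p pD l pl; last by rewrite ffunE; exact: H pl.
by have := H p pD (Ordinal (Dl p l pD pl)) pl; rewrite ffunE.
Qed.

(* The event that the rescaled set of box boundaries avoids [I]. *)
Definition scaled_miss (c : nat) (I : set R) : set R :=
  [set x | forall i : nat, I (i%:R / c%:R) -> ~~ ball_digit i x].

Lemma measurable_scaled_miss c I : measurable (scaled_miss c I).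
Proof.
apply: (measurable_forall (A := fun i : nat => [set x | I (i%:R / c%:R) -> ~~ ball_digit i x])) => i.
have [Ii|nIi] := pselect (I (i%:R / c%:R)).
  rewrite (_ : [set x | _] = [set x | ball_digit i x = false]).
    exact: measurable_ball_digit.
  by apply/seteqP; split=> x /=; [move=> /(_ Ii)/negbTE|move=> ->].
by rewrite (_ : [set x | _] = setT)//; apply/seteqP; split=> // x _ /nIi.
Qed.

Lemma scaled_miss_subset c I J : I `<=` J -> scaled_miss c J `<=` scaled_miss c I.
Proof. by move=> IJ x H i /IJ; exact: H. Qed.

Lemma scaled_miss_dilate l c I : (0 < l)%N ->
  scaled_miss (l * c) I = scaled_miss c [set t | I (t / l%:R)].
Proof.
move=> l0; apply/seteqP; split=> x H i /= Ii; apply: H => /=.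
  by rewrite natrM invfM [l%:R^-1 * _]mulrC mulrA.
by move: Ii; rewrite natrM invfM [l%:R^-1 * _]mulrC mulrA.
Qed.

Lemma pr_unital d (T : measurableType d) (P : probability T R) (E : nat -> set T) :
  (forall c, measurable (E c)) -> unital (fun c => pr P (E c)).
Proof. by move=> mE c; rewrite pr_ge0 pr_le1. Qed.

Section limit_set.
Variable W : set_system nat.
Hypotheses (ultraW : UltraFilter W) (infW : \oo `<=` W).

Definition limit_miss (I : set R) : R := mean_limit W (fun c => pr unif (scaled_miss c I)).

Lemma scaled_miss_unital I : unital (fun c => pr unif (scaled_miss c I)).
Proof. by apply: pr_unital => c; exact: measurable_scaled_miss. Qed.

Lemma limit_miss_subset I J : I `<=` J -> limit_miss J <= limit_miss I.
Proof.
move=> IJ; apply: (mean_limit_le ultraW infW (K := 1) (N0 := 0)) => //; try exact: scaled_miss_unital.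
move=> c _ _; apply: pr_mono; try exact: measurable_scaled_miss.
exact: scaled_miss_subset.
Qed.

Lemma limit_miss_dilate l I : (0 < l)%N -> limit_miss [set t | I (t / l%:R)] = limit_miss I.
Proof.
move=> l0; rewrite /limit_miss -[RHS](mean_limit_dilate ultraW infW l0); last exact: scaled_miss_unital.
by congr mean_limit; apply/funext => c; rewrite scaled_miss_dilate.
Qed.

Lemma limit_miss_rat (l l' : nat) I : (0 < l)%N -> (0 < l')%N ->
  limit_miss [set t | I (l%:R / l'%:R * t)] = limit_miss I.
Proof.
move=> l0 l'0; pose J := [set t | I (t * l%:R)].
have l0' : l%:R != 0 :> R by rewrite pnatr_eq0 -lt0n.
have H1 := limit_miss_dilate J l'0; have H2 := limit_miss_dilate J l0.
transitivity (limit_miss [set t | J (t / l'%:R)]).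
  by congr limit_miss; apply/seteqP; split=> t /=; rewrite /J /= mulrC mulrA mulrAC.
rewrite H1 -H2.
by congr limit_miss; apply/seteqP; split=> t /=; rewrite /J /= divfK.
Qed.

Definition rat_interval (k : nat) : set R :=
  if choice.unpickle k is Some pq then `]ratr pq.1, ratr pq.2 : R[%classic
  else set0.

Lemma open_rat_interval k : open (rat_interval k).
Proof.
by rewrite /rat_interval; case: choice.unpickle => [[p q]|]; [exact: interval_open|exact: open0].
Qed.

Lemma rat_interval_base (G : set R) t : open G -> G t ->
  exists k, rat_interval k t /\ rat_interval k `<=` G.
Proof.
move=> oG Gt; have /nbhs_ballP[e /= e0 He] : nbhs t G by exact: open_nbhs_nbhs.
have [p] := @rat_in_itvoo R (t - e) t ltac:(by rewrite ltrBlDr ltrDl).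
rewrite in_itv /= => /andP[p1 p2].
have [q] := @rat_in_itvoo R t (t + e) ltac:(by rewrite ltrDl).
rewrite in_itv /= => /andP[q1 q2].
exists (choice.pickle (p, q)); rewrite /rat_interval choice.pickleK /= in_itv /= p2 q1; split=> //.
move=> s; rewrite /= in_itv /= => /andP[s1 s2]; apply: He.
by rewrite /ball /= ltr_norml; apply/andP; split; lra.
Qed.

Definition scaled_hit (k c : nat) (x : R) : bool := ~~ `[< scaled_miss c (rat_interval k) x >].

Lemma measurable_scaled_hit k c b : measurable [set x | scaled_hit k c x = b].
Proof.
have m := measurable_scaled_miss c (rat_interval k).
case: b.
  rewrite (_ : [set x | _] = ~` scaled_miss c (rat_interval k)); first exact: measurableC.
  by apply/seteqP; split=> x /=; rewrite /scaled_hit => /asboolPn.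
rewrite (_ : [set x | _] = scaled_miss c (rat_interval k))//.
apply/seteqP; split=> x /=; rewrite /scaled_hit; first by move=> /negbFE/asboolP.
by move=> H; apply/negbTE; rewrite negbK; apply/asboolP.
Qed.

Definition hit_pattern (s : seq bool) (c : nat) : set R :=
  [set x | forall k : 'I_(size s), scaled_hit k c x = nth false s k].

Lemma measurable_hit_pattern s c : measurable (hit_pattern s c).
Proof.
apply: (measurable_forall (A := fun k : 'I_(size s) => [set x | scaled_hit k c x = nth false s k])) => k.
exact: measurable_scaled_hit.
Qed.

Lemma hit_pattern_unital s : unital (fun c => pr unif (hit_pattern s c)).
Proof. by apply: pr_unital => c; exact: measurable_hit_pattern. Qed.

(** Finite additivity of mean limits makes these numbers a consistent family of cylinder
    probabilities, which [walk_bit] realises as the law of a bit sequence. *)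
Definition hit_prob (s : seq bool) : R := mean_limit W (fun c => pr unif (hit_pattern s c)).

Lemma hit_prob_ge0 s : 0 <= hit_prob s.
Proof.
rewrite -(mean_limit_cst ultraW infW (k := 0)) ?lexx ?ler01//.
apply: (@mean_limit_le _ W ultraW infW (fun=> 0) _ 1 0); first by [].
- by move=> c; rewrite lexx ler01.
- exact: hit_pattern_unital.
- by move=> c _ _; exact: pr_ge0.
Qed.

Lemma hit_prob_nil : hit_prob [::] = 1.
Proof.
rewrite -[RHS](mean_limit_cst ultraW infW (k := 1)) ?lexx ?ler01//.
congr mean_limit; apply/funext => c; rewrite -(@pr_setT _ _ _ unif); congr pr.
by apply/seteqP; split=> x // _ [].
Qed.

Lemma hit_pattern_rcons s b c :
  hit_pattern (rcons s b) c = hit_pattern s c `&` [set x | scaled_hit (size s) c x = b].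
Proof.
apply/seteqP; split=> x.
  move=> H; split=> [k|/=].
    have ks : (k < size (rcons s b))%N by rewrite size_rcons ltnW// ltnS.
    by rewrite (H (Ordinal ks)) /= nth_rcons ltn_ord.
  have ks : (size s < size (rcons s b))%N by rewrite size_rcons.
  by rewrite (H (Ordinal ks)) /= nth_rcons ltnn eqxx.
move=> [H Hb] [k] /=; rewrite size_rcons => ks; rewrite nth_rcons.
move: ks; rewrite ltnS leq_eqVlt => /orP[/eqP ->|ks].
  by rewrite ltnn eqxx.
by rewrite ks; exact: (H (Ordinal ks)).
Qed.

Lemma hit_prob_rcons s : hit_prob s = hit_prob (rcons s false) + hit_prob (rcons s true).
Proof.
have E c : pr unif (hit_pattern s c) =
    pr unif (hit_pattern (rcons s false) c) + pr unif (hit_pattern (rcons s true) c).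
  rewrite -prU; last 3 first.
  - exact: measurable_hit_pattern.
  - exact: measurable_hit_pattern.
  - by rewrite !hit_pattern_rcons; apply/seteqP; split=> x //= [[_ ->] [_]].
  congr pr; rewrite !hit_pattern_rcons -setIUr; apply/seteqP; split=> x; last by case.
  by move=> H; split=> //=; case: (scaled_hit _ _ _); [right|left].
rewrite /hit_prob -(mean_limitD ultraW infW); try exact: hit_pattern_unital.
  by congr mean_limit; apply/funext => c; exact: E.
by move=> c; rewrite -E; exact: hit_pattern_unital.
Qed.

Definition limit_hit (k : nat) (x : R) : bool := walk_bit hit_prob k x.

Lemma measurable_limit_hit k b : measurable [set x | limit_hit k x = b].
Proof. exact: measurable_walk_bit. Qed.

Lemma mean_limit_sum (I : Type) (r : seq I) (F : I -> nat -> R) :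
  (forall i c, 0 <= F i c) -> (forall c, \sum_(i <- r) F i c <= 1) ->
  mean_limit W (fun c => \sum_(i <- r) F i c) = \sum_(i <- r) mean_limit W (F i).
Proof.
move=> F0; elim: r => [|i r IH] F1.
  rewrite big_nil -[RHS](mean_limit_cst ultraW infW (k := 0)) ?lexx ?ler01//.
  by congr mean_limit; apply/funext => c; rewrite big_nil.
have r0 c : 0 <= \sum_(j <- r) F j c by exact: sumr_ge0.
have F1' c : F i c + \sum_(j <- r) F j c <= 1 by have := F1 c; rewrite big_cons.
have F0i c := F0 i c.
rewrite big_cons -IH; last by move=> c; have := F1' c; have := F0i c; lra.
rewrite -(mean_limitD ultraW infW).
- by congr mean_limit; apply/funext => c; rewrite big_cons.
- by move=> c; have := F1' c; have := F0i c; have := r0 c; lra.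
- by move=> c; have := F1' c; have := F0i c; have := r0 c; lra.
- by move=> c; have := F1' c; have := F0i c; have := r0 c; lra.
Qed.

Lemma measurable_bit_event n (b : nat -> R -> bool) (Q : {ffun 'I_n -> bool} -> Prop) :
  (forall k c, measurable [set x : R | b k x = c]) ->
  measurable [set x : R | Q [ffun k : 'I_n => b k x]].
Proof.
move=> mb; apply: (measurable_factor (b := fun x => [ffun k : 'I_n => b k x])
  (X := fun x => [ffun k : 'I_n => b k x]) Q) => // f.
rewrite (_ : [set x | _] = [set x | forall k : 'I_n, b k x = f k]).
  exact: (measurable_forall (A := fun k : 'I_n => [set x : R | b k x = f k])).
apply/seteqP; split=> x /=; first by move=> <- k; rewrite ffunE.
by move=> H; apply/ffunP => k; rewrite ffunE.
Qed.

Lemma pr_limit_hits n (Q : {ffun 'I_n -> bool} -> Prop) :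
  pr unif [set x | Q [ffun k : 'I_n => limit_hit k x]] =
  mean_limit W (fun c => pr unif [set x | Q [ffun k : 'I_n => scaled_hit k c x]]).
Proof.
pose q f := `[< Q f >].
have QE (b : nat -> R -> bool) : (forall k c, measurable [set x : R | b k x = c]) ->
    pr unif [set x | Q [ffun k : 'I_n => b k x]] =
    \sum_(f : {ffun 'I_n -> bool} | q f) pr unif [set x | forall k : 'I_n, b k x = f k].
  move=> mb; rewrite (_ : [set x | _] = [set x | exists2 f : {ffun 'I_n -> bool}, q f &
      forall i : 'I_n, b i x = f i]); last first.
    apply/seteqP; split=> x /=.
      by move=> H; exists [ffun i : 'I_n => b i x]; [exact/asboolP|move=> i; rewrite ffunE].
    move=> [f /asboolP Qf H]; rewrite (_ : [ffun i => _] = f)//.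
    by apply/ffunP => i; rewrite ffunE H.
  rewrite (pr_sum_fin unif (Q := q) (A := fun f => [set x | forall i : 'I_n, b i x = f i]))//.
  - move=> f _; exact: (measurable_forall (A := fun i : 'I_n => [set x : R | b i x = f i])).
  - by move=> f f' x _ _ H H'; apply/ffunP => i; rewrite -H -H'.
rewrite QE; last exact: measurable_limit_hit.
have hE c (f : {ffun 'I_n -> bool}) : [set x | forall k : 'I_n, scaled_hit k c x = f k] =
    hit_pattern (fgraph f) c.
  have sz : size (fgraph f) = n by rewrite size_tuple card_ord.
  apply/seteqP; split=> x /= H.
    move=> [k kn] /=; have kn' : (k < n)%N by rewrite -[X in (k < X)%N]sz.
    by rewrite (H (Ordinal kn')) -(nth_fgraph_ord false).
  move=> k; have kn : (k < size (fgraph f))%N by rewrite sz.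
  by rewrite (H (Ordinal kn)) /= nth_fgraph_ord.
transitivity (mean_limit W (fun c => \sum_(f <- [seq f <- index_enum {ffun 'I_n -> bool} | q f])
    pr unif (hit_pattern (fgraph f) c))); last first.
  congr mean_limit; apply/funext => c; rewrite (QE (fun k x => scaled_hit k c x)).
    by rewrite big_filter; apply: eq_bigr => f _; rewrite hE.
  by move=> k b; exact: measurable_scaled_hit.
rewrite mean_limit_sum.
- rewrite big_filter; apply: eq_bigr => f _.
  by rewrite (pr_walk_bits hit_prob_ge0 hit_prob_nil hit_prob_rcons).
- by move=> f c; exact: pr_ge0.
- move=> c; rewrite big_filter (eq_bigr (fun f : {ffun 'I_n -> bool} =>
    pr unif [set x | forall k : 'I_n, scaled_hit k c x = f k])); last by move=> f _; rewrite hE.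
  rewrite -(QE (fun k x => scaled_hit k c x)); last by move=> k b; exact: measurable_scaled_hit.
  apply: pr_le1; apply: (measurable_bit_event (b := fun k x => scaled_hit k c x)) => k b.
  exact: measurable_scaled_hit.
Qed.

End limit_set.
End digit_process.

(** * The limiting random set and its self-similarity *)

Section limit_random_set.
Context (R : realType) (C : forall n, probability (composition n) R).
Local Notation unif := (@unit_uniform R).
Local Notation halfline := `[0%R : R, +oo[%classic.
Variable W : set_system nat.
Hypotheses (ultraW : UltraFilter W) (infW : \oo `<=` W).
Local Notation hit := (limit_hit C W).
Local Notation limit_miss := (limit_miss C W).

Lemma limit_set_subproof (x : R) :
  closed [set t : R | 0 <= t /\ forall k, ~~ hit k x -> ~ rat_interval k t] /\
  [set t : R | 0 <= t /\ forall k, ~~ hit k x -> ~ rat_interval k t] `<=` halfline.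
Proof.
split; last by move=> t [t0 _]; rewrite /= in_itv /= t0.
rewrite (_ : [set t | _] = `[0, +oo[%classic `&`
    \bigcap_(k in [set k | ~~ hit k x]) ~` rat_interval k).
  apply: closedI; first exact: interval_closed.
  by apply: closed_bigI => k _; apply: open_closedC; exact: open_rat_interval.
apply/seteqP; split=> t /=; rewrite in_itv /= andbT.
  by move=> [t0 H]; split=> // k /= hk; exact: H.
by move=> [t0 H]; split=> // k hk; exact: (H k hk).
Qed.

Definition limit_set (x : R) : closed_subset halfline := exist _ _ (limit_set_subproof x).

Definition covered (K : set R) n : set R :=
  [set x | K `&` halfline `<=` \bigcup_(k in [set k | (k < n)%N && ~~ hit k x]) rat_interval k].

Definition covers (K : set R) n (f : {ffun 'I_n -> bool}) : Prop :=
  K `&` halfline `<=` \bigcup_(k in [set k : 'I_n | ~~ f k]) rat_interval k.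

Lemma coversE (K : set R) n (b : nat -> R -> bool) x :
  covers K [ffun k : 'I_n => b k x] <->
  K `&` halfline `<=` \bigcup_(k in [set k | (k < n)%N && ~~ b k x]) rat_interval k.
Proof.
split=> H t /H [k /= kn kt].
  by exists k => //=; rewrite ltn_ord; move: kn; rewrite ffunE.
by move: kn => /andP[kn bk]; exists (Ordinal kn) => //=; rewrite ffunE.
Qed.

Lemma coveredE K n : covered K n = [set x | covers K [ffun k : 'I_n => hit k x]].
Proof. by apply/seteqP; split=> x /= /coversE. Qed.

Lemma measurable_covered K n : measurable (covered K n).
Proof.
rewrite coveredE; apply: measurable_bit_event => k b; exact: measurable_limit_hit.
Qed.

Lemma covered_mono K n m : (n <= m)%N -> covered K n `<=` covered K m.
Proof.
move=> nm x H t /H [k /= /andP[kn hk] kt]; exists k => //=.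
by rewrite (leq_trans kn nm).
Qed.

(** A compact set that is missed is covered by the unhit rational intervals, hence by finitely many
    of them. Missing it is thereby an increasing union of events on finitely many bits, whose
    probabilities are mean limits. *)
Lemma limit_set_missesE K x : compact K ->
  misses K (limit_set x) <-> exists n, covered K n x.
Proof.
move=> cK; split=> [SK|[n H]]; last first.
  apply/seteqP; split=> // t [[t0 St] Kt].
  have [|k /= /andP[_ hk] kt] := H t; first by split=> //=; rewrite in_itv /= t0.
  exact: (St k hk).
have cK' : compact (K `&` halfline).
  by apply: compact_closedI => //; exact: interval_closed.
move: cK'; rewrite compact_cover => /(_ nat [set k | ~~ hit k x] (@rat_interval R)).
case.
- by move=> k _; exact: open_rat_interval.
- move=> t [Kt t0]; apply: contrapT => nt.
  suff : (limit_set x `&` K) t by rewrite SK.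
  split=> //; split; first by move: t0; rewrite /= in_itv /= andbT.
  by move=> k hk kt; apply: nt; exists k.
move=> D' D'hit H; exists (\max_(k <- D') k).+1 => t /H [k /= kD kt]; exists k => //=.
rewrite ltnS leq_bigmax_seq//=; have := D'hit k kD; by rewrite inE.
Qed.

Lemma measurable_limit_set_misses K : compact K -> measurable [set x | misses K (limit_set x)].
Proof.
move=> cK; rewrite (_ : [set x | _] = [set x | exists n, covered K n x]).
  by apply: (measurable_exists (A := covered K)) => n; exact: measurable_covered.
by apply/seteqP; split=> x /= /(limit_set_missesE x cK).
Qed.

Lemma measurable_limit_set : measurable_fun setT limit_set.
Proof.
apply: (measurability (@hitting R halfline)) => //.
move=> _ [_ [K cK <-] <-]; rewrite setTI.
rewrite (_ : _ @^-1` _ = ~` [set x | misses K (limit_set x)]).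
  by apply: measurableC; exact: measurable_limit_set_misses.
apply/seteqP; split=> x /=.
  by move=> [t Ht] E; have : set0 t by rewrite -E.
by move=> H; apply: contrapT => /nonemptyPn.
Qed.

HB.instance Definition _ := isMeasurableFun.Build _ _ _ _ limit_set measurable_limit_set.

(* With [limit_miss_le_open], the two halves of the convergence in law, along
   the means, of the rescaled box boundaries to [limit_set]. *)
Lemma limit_set_misses_le K : compact K ->
  pr unif [set x | misses K (limit_set x)] <= limit_miss K.
Proof.
move=> cK; have cv : pr unif (covered K n) @[n --> \oo] -->
    pr unif [set x | misses K (limit_set x)].
  apply: (@pr_event_cvg _ _ R unif (covered K) _ setT) => //.
  - by move=> n; exact: measurable_covered.
  - exact: measurable_limit_set_misses.
  - exact: pr_setT.
  move=> x _; have [SK|SK] := pselect (misses K (limit_set x)).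
    have [n0 H] := (limit_set_missesE x cK).1 SK.
    by exists n0 => n n0n; split=> // _; exact: covered_mono H.
  exists 0%N => n _; split=> // H; exfalso; apply: SK.
  by apply/(limit_set_missesE x cK); exists n.
rewrite -(cvg_lim _ cv); last exact: Rhausdorff.
apply: limr_le; first by apply/cvg_ex; eexists; exact: cv.
apply: nearW => n; rewrite coveredE (pr_limit_hits C ultraW infW).
have mE c : measurable [set x : R | covers K [ffun k : 'I_n => scaled_hit C k c x]].
  apply: (measurable_bit_event (b := fun k x => scaled_hit C k c x)) => k b.
  exact: measurable_scaled_hit.
apply: (@mean_limit_le _ W ultraW infW _ _ 1 0) => //.
- by apply: pr_unital => c; exact: mE.
- exact: scaled_miss_unital.
move=> c _ _; apply: pr_mono => //; first exact: measurable_scaled_miss.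
(* At each scale c the unhit intervals contain no rescaled box boundary, so a set which they cover
   contains none either. *)
move=> x /(coversE K n (fun k x => scaled_hit C k c x) x) H i Ki.
have [|k /= /andP[_ hk] ki] := H (i%:R / c%:R).
  by split=> //=; rewrite in_itv /= andbT divr_ge0.
by move: hk; rewrite /scaled_hit negbK => /asboolP; apply.
Qed.

Lemma limit_miss_le_open G : open G ->
  limit_miss G <= pr unif [set x | misses G (limit_set x)].
Proof.
move=> oG.
(* An open set is the union of the rational intervals inside it; when none of these is hit, the
   limiting set misses G. *)
pose Q n (f : {ffun 'I_n -> bool}) := forall k : 'I_n, rat_interval k `<=` G -> ~~ f k.
pose F n := [set x | Q n [ffun k : 'I_n => hit k x]].
pose Finf := [set x | forall k, rat_interval k `<=` G -> ~~ hit k x].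
have mF n : measurable (F n).
  by apply: measurable_bit_event => k b; exact: measurable_limit_hit.
have mFinf : measurable Finf.
  apply: (measurable_forall (A := fun k => [set x | rat_interval k `<=` G -> ~~ hit k x])) => k.
  have [kG|kG] := pselect (rat_interval k `<=` G).
    rewrite (_ : [set x | _] = [set x | hit k x = false]); first exact: measurable_limit_hit.
    by apply/seteqP; split=> x /=; [move=> /(_ kG)/negbTE|move=> ->].
  by rewrite (_ : [set x | _] = setT)//; apply/seteqP; split=> // x _ /kG.
have mS : measurable [set x | misses G (limit_set x)].
  have := measurable_misses_open (D := halfline) oG.
  by move=> mG; rewrite -[X in measurable X]setTI; exact: measurable_limit_set.
apply: (@le_trans _ _ (pr unif Finf)); last first.
  apply: pr_mono => // x H; apply/seteqP; split=> // t [[t0 St] Gt].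
  have [k [kt kG]] := rat_interval_base oG Gt.
  exact: (St k (H k kG)).
have cv : pr unif (F n) @[n --> \oo] --> pr unif Finf.
  apply: (@pr_event_cvg _ _ R unif F Finf setT) => //; first exact: pr_setT.
  move=> x _; have [Fx|Fx] := pselect (Finf x).
    by exists 0%N => n _; split=> // _ k kG; rewrite ffunE; exact: Fx.
  have [k [kG hk]] : exists k, rat_interval k `<=` G /\ hit k x.
    apply: contrapT => H; apply: Fx => k kG; apply/negP => hk; apply: H.
    by exists k.
  exists k.+1 => n kn; split=> // H; have := H (Ordinal kn) kG.
  by rewrite ffunE /= hk.
rewrite -(cvg_lim _ cv); last exact: Rhausdorff.
apply: limr_ge; first by apply/cvg_ex; eexists; exact: cv.
apply: nearW => n; rewrite /F (pr_limit_hits C ultraW infW).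
have mE c : measurable [set x : R | Q n [ffun k : 'I_n => scaled_hit C k c x]].
  apply: (measurable_bit_event (b := fun k x => scaled_hit C k c x)) => k b.
  exact: measurable_scaled_hit.
apply: (@mean_limit_le _ W ultraW infW _ _ 1 0) => //.
- exact: scaled_miss_unital.
- by apply: pr_unital => c; exact: mE.
move=> c _ _; apply: pr_mono => //; first exact: measurable_scaled_miss.
move=> x H k kG; rewrite ffunE /scaled_hit negbK; apply/asboolP.
exact: scaled_miss_subset kG _ H.
Qed.

Definition thicken_closed (K : set R) (e : R) : set R := [set t | exists2 s, K s & `|t - s| <= e].
Definition thicken_open (K : set R) (e : R) : set R := [set t | exists2 s, K s & `|t - s| < e].

Lemma open_thicken K e : 0 < e -> open (thicken_open K e).
Proof.
move=> e0; rewrite (_ : thicken_open K e = \bigcup_(s in K) ball s e).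
  by apply: bigcup_open => s _; exact: ball_open.
by apply/seteqP; split=> t [s Ks]; exists s => //; rewrite /ball /= distrC.
Qed.

Lemma compact_thicken K e : compact K -> compact (thicken_closed K e).
Proof.
move=> cK.
rewrite (_ : thicken_closed K e = (fun p : R * R => p.1 + p.2) @` (K `*` `[- e, e]%classic)).
  apply: continuous_compact; last by apply: compact_setX => //; exact: segment_compact.
  apply: continuous_subspaceT => p; apply: cvgD; [exact: cvg_fst|exact: cvg_snd].
apply/seteqP; split=> t.
  move=> [s Ks ts]; exists (s, t - s); last by rewrite /= addrC subrK.
  by split=> //=; rewrite in_itv /= -ler_norml.
by move=> [[s r] [/= Ks]]; rewrite in_itv /= -ler_norml => re <-; exists s => //; rewrite addrAC subrr add0r.
Qed.

Lemma misses_thicken_cvg K : compact K ->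
  pr unif [set x | misses (thicken_closed K j.+1%:R^-1) (limit_set x)] @[j --> \oo] -->
  pr unif [set x | misses K (limit_set x)].
Proof.
move=> cK; have KT e : 0 < e -> K `<=` thicken_closed K e.
  by move=> e0 t Kt; exists t => //; rewrite subrr normr0 ltW.
apply: (@pr_event_cvg _ _ R unif (fun j => [set x | misses (thicken_closed K j.+1%:R^-1) (limit_set x)])
  [set x | misses K (limit_set x)] setT) => //.
- by move=> j; apply: measurable_limit_set_misses; exact: compact_thicken.
- exact: measurable_limit_set_misses.
- exact: pr_setT.
move=> x _; have [SK|SK] := pselect (misses K (limit_set x)); last first.
  exists 0%N => j _; split=> // H; exfalso; apply: SK; apply: misses_subset H.
  by apply: KT; rewrite invr_gt0 ltr0n.
have [e e0 He] := compact_closed_separated cK (@cset_closed _ _ (limit_set x)) SK.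
exists (Num.truncn e^-1) => j ej; split=> // _; apply/seteqP; split=> // t [St [s Ks ts]].
have := He s t Ks St; rewrite distrC => /le_trans/(_ ts); rewrite leNgt => /negP; apply.
rewrite -[ltRHS]invrK ltf_pV2 ?posrE ?invr_gt0 ?ltr0n//.
by rewrite (lt_le_trans (truncnS_gt _))// ler_nat.
Qed.

Lemma compact_dilate (a : R) K : 0 < a -> compact K -> compact [set t | K (t / a)].
Proof.
move=> a0 cK; rewrite (_ : [set t | _] = (fun s => a * s) @` K).
  by apply: continuous_compact => //; apply: continuous_subspaceT => s; exact: mulrl_continuous.
apply/seteqP; split=> t /=.
  by move=> Kt; exists (t / a) => //; rewrite mulrC divfK// gt_eqF.
by move=> [s Ks <-]; rewrite mulrC mulKf// gt_eqF.
Qed.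

(** Invariance is available for rational dilations only, and for [limit_miss]. The compact set is
    thickened by e, and a rational r close to 1/a then moves its dilate by a only within the open
    thickening. Applied to a and to its inverse, the inequality becomes an equality. *)
Lemma limit_set_dilate_le (a : R) K : 0 < a -> compact K ->
  pr unif [set x | misses K (limit_set x)] <=
  pr unif [set x | misses [set t | K (t / a)] (limit_set x)].
Proof.
move=> a0 cK; have cv := misses_thicken_cvg cK.
rewrite -(cvg_lim _ cv); last exact: Rhausdorff.
apply: limr_le; first by apply/cvg_ex; eexists; exact: cv.
apply: nearW => j; set e := j.+1%:R^-1; have e0 : 0 < e by rewrite invr_gt0 ltr0n.
have H1 := limit_set_misses_le (compact_thicken (e := e) cK); apply: (le_trans H1) => {H1}.
have [M [Mreal HM]] := compact_bounded cK.
have {}HM s : K s -> `|s| <= `|M| + 1.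
  by move=> Ks; apply: HM => //; rewrite (le_lt_trans (ler_norm _))// ltrDl.
set m := `|M| + 1 in HM; have m0 : 0 < m by rewrite ltr_wpDl.
(* The ratio r = l / l' exceeds 1/a by at most 1/l'. On a set bounded by m this moves points by at
   most a m / l', which is below e by the choice of l'. *)
pose l' := (Num.truncn (a * m / e)).+1; pose l := (Num.truncn (l'%:R / a)).+1.
have l'0 : 0 < l'%:R :> R by rewrite ltr0n.
pose r : R := l%:R / l'%:R.
apply: (@le_trans _ _ (limit_miss (thicken_open K e))).
  by apply: limit_miss_subset => // t [s Ks ts]; exists s => //; exact: ltW.
rewrite -(limit_miss_rat C ultraW infW (thicken_open K e) (ltn0Sn (Num.truncn (l'%:R / a)))
  (ltn0Sn (Num.truncn (a * m / e)))) -/l -/l' -/r.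
have oG : open [set t | thicken_open K e (r * t)].
  by have /continuousP := @mulrl_continuous R r; apply; exact: open_thicken.
apply: le_trans (limit_miss_le_open oG) _; apply: pr_mono.
- have := measurable_misses_open (D := halfline) oG => mG.
  by rewrite -[X in measurable X]setTI; exact: measurable_limit_set.
- by apply: measurable_limit_set_misses; exact: compact_dilate.
move=> x; apply: misses_subset => t /= Kt; exists (t / a) => //.
have r1 : 1 / a < r by rewrite /r ltr_pdivlMr// mul1r mulrC truncnS_gt.
have r2 : r <= 1 / a + 1 / l'%:R.
  rewrite /r ler_pdivrMr// mulrDl !mul1r mulVf ?gt_eqF// -natr1 lerD2r.
  have la0 : 0 <= l'%:R / a by rewrite divr_ge0// ltW.
  by rewrite [a^-1 * _]mulrC truncn_le.
rewrite (_ : r * t - t / a = (t / a) * (a * (r - 1 / a))); last first.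
  by have a0' : a != 0 := lt0r_neq0 a0; field.
rewrite normrM.
have ar0 : 0 < a * (r - 1 / a) by rewrite mulr_gt0// subr_gt0.
rewrite [X in _ * X]gtr0_norm//.
apply: (@le_lt_trans _ _ (m * (a / l'%:R))).
  apply: ler_pM => //; [exact: ltW|exact: HM|].
  by rewrite ler_wpM2l ?(ltW a0)// lerBlDl -[X in _ <= _ + X]mul1r.
rewrite mulrA ltr_pdivrMr// [m * a]mulrC.
have : a * m / e < l'%:R by exact: truncnS_gt.
by rewrite ltr_pdivrMr// [l'%:R * e]mulrC.
Qed.

Lemma limit_set_self_similar :
  self_similar (limit_set : {RV unif >-> closed_subset halfline}).
Proof.
move=> c; apply: closed_subset_law => K cK.
have c0 : 0 < c%:num by [].
have ci0 : 0 < c%:num^-1 by rewrite invr_gt0.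
pose K2 := [set t | K (c%:num * t)].
have K2E : [set t | K (t / c%:num^-1)] = K2.
  by apply/seteqP; split=> t; rewrite /K2 /= invrK mulrC.
have cK2 : compact K2 by rewrite -K2E; exact: compact_dilate.
have KE : [set t | K2 (t / c%:num)] = K.
  by apply/seteqP; split=> t; rewrite /K2 /= mulrC divfK// gt_eqF.
rewrite (_ : (scale c \o limit_set) @^-1` misses K = [set x | misses K2 (limit_set x)]); last first.
  by apply/seteqP; split=> x /misses_scale.
have H1 := limit_set_dilate_le ci0 cK; have H2 := limit_set_dilate_le c0 cK2.
rewrite K2E in H1; rewrite KE in H2.
rewrite (_ : limit_set @^-1` misses K = [set x | misses K (limit_set x)])//.
rewrite !prE; try exact: measurable_limit_set_misses.
by congr EFin; apply/eqP; rewrite eq_le H1 H2.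
Qed.

End limit_random_set.

(** * Subsamples *)

Section coarse_cells.
Context (n K h : nat).
Hypothesis h0 : (0 < h)%N.

Lemma coarse_subproof (b : 'I_(K * h)) : (b %/ h < K)%N.
Proof. by rewrite ltn_divLR. Qed.

Definition coarse (b : 'I_(K * h)) : 'I_K := Ordinal (coarse_subproof b).
Definition coarse_fun (g : {ffun 'I_n -> 'I_(K * h)}) : {ffun 'I_n -> 'I_K} :=
  [ffun i => coarse (g i)].

Lemma card_coarse k : #|[set b | coarse b == k]%SET| = h.
Proof.
have lt (i : 'I_h) : (k * h + i < K * h)%N.
  have : (k * h + i < k.+1 * h)%N by rewrite mulSn addnC ltn_add2r.
  by move=> /leq_trans; apply; rewrite leq_mul2r ltn_ord orbT.
rewrite -[RHS]card_ord -(card_imset _ (f := fun i : 'I_h => Ordinal (lt i))); last first.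
  by move=> i j /(congr1 val) /= /addnI; exact: ord_inj.
apply: eq_card => b; rewrite inE; apply/eqP/imsetP => [bk|[i _ ->]].
  exists (Ordinal (ltn_pmod b h0)) => //; apply: ord_inj => /=.
  by rewrite -bk /= -divn_eq.
by apply: ord_inj; rewrite /= divnMDl// divn_small ?addn0.
Qed.

Lemma card_coarse_fun (f : {ffun 'I_n -> 'I_K}) :
  #|[set g | coarse_fun g == f]%SET| = (h ^ n)%N.
Proof.
rewrite -sum1_card.
transitivity (\sum_(g in family (fun i => [pred b | coarse b == f i])) \prod_(i < n) 1)%N.
  apply: eq_big => [g|g _]; last by rewrite big1.
  rewrite inE; apply/eqP/familyP => [<- i|H]; first by rewrite inE ffunE.
  by apply/ffunP => i; rewrite ffunE; apply/eqP; exact: (H i).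
rewrite -(bigA_distr_big_dep _ (fun _ _ => 1%N)) /=.
rewrite (eq_bigr (fun=> h)) => [|i _]; first by rewrite prod_nat_const card_ord.
by rewrite -[RHS](card_coarse (f i)) -sum1_card; apply: eq_bigl => b; rewrite !inE.
Qed.

Lemma coarse_injective g : injective (coarse_fun g) -> injective g.
Proof. by move=> finj i j gij; apply: finj; rewrite !ffunE gij. Qed.

(** Division by h is nondecreasing, so when the coarse cells are distinct it commutes with
    ranking. *)
Lemma coarse_vals g l : injective (coarse_fun g) -> (l < n)%N ->
  nth 0%N (vals (coarse_fun g @: [set: 'I_n])%SET) l =
  (nth 0%N (vals (g @: [set: 'I_n])%SET) l %/ h)%N.
Proof.
move=> finj ln; have ginj := coarse_injective finj.
set G := (g @: _)%SET; set F := (coarse_fun g @: _)%SET.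
have szG : size (vals G) = n by rewrite size_vals card_imset// cardsT card_ord.
have memG k : k \in vals G -> exists i : 'I_n, k = g i.
  move=> kG; have kK := vals_lt kG; move: kG.
  rewrite -[k]/(nat_of_ord (Ordinal kK)) mem_vals => /imsetP[i _ ->].
  by exists i.
rewrite -[RHS](nth_map 0%N 0%N (fun b => b %/ h)%N) ?szG//; congr nth.
apply/esym/vals_unique.
  rewrite ltn_sorted_uniq_leq; apply/andP; split.
    rewrite map_inj_in_uniq; first exact: sorted_uniq ltn_trans ltnn _ (sorted_vals G).
    move=> _ _ /memG[i ->] /memG[j ->] gij.
    have : coarse_fun g i = coarse_fun g j by apply: ord_inj; rewrite !ffunE.
    by move=> /finj ->.
  apply: (homo_sorted (e := leq)); first by move=> a b ab; exact: leq_div2r.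
  by apply: sub_sorted (sorted_vals G) => a b /ltnW.
move=> k; apply/mapP/idP.
  move=> [b /memG[i ->] ->].
  rewrite -[(g i %/ h)%N]/(nat_of_ord (coarse (g i))) mem_vals.
  by apply/imsetP; exists i; rewrite ?ffunE.
move=> kF; have kK := vals_lt kF; move: kF.
rewrite -[k]/(nat_of_ord (Ordinal kK)) mem_vals => /imsetP[i _ kE].
exists (nat_of_ord (g i)); first by rewrite mem_vals; apply/imsetP; exists i.
by rewrite kE ffunE.
Qed.

(** An injection into the coarse cells has h^n refinements, and n! injections share each image. *)
Lemma sum_coarse (R : pzSemiRingType) (G : {set 'I_K} -> R) :
  \sum_(g : {ffun 'I_n -> 'I_(K * h)} | injectiveb (coarse_fun g))
    G (coarse_fun g @: [set: 'I_n])%SET =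
  (h ^ n)%:R * (n`!%:R * \sum_(A : {set 'I_K} | #|A| == n) G A).
Proof.
rewrite (partition_big coarse_fun (fun f => injectiveb f)) //=.
rewrite (eq_bigr (fun f : {ffun 'I_n -> 'I_K} => (h ^ n)%:R * G (f @: [set: 'I_n])%SET)).
  by rewrite -mulr_sumr sum_injective_image -[X in _ * X]mulr_natl.
move=> f finj; rewrite -(card_coarse_fun f) -sum1_card natr_sum mulr_suml.
apply: eq_big => [g|g /andP[_ /eqP ->]]; last by rewrite mul1r.
rewrite inE; apply/andP/eqP => [[_ /eqP]//|->]; by split.
Qed.

End coarse_cells.

(** * Subsamples between hulls and inner gaps *)

Section subsample_bounds.
Context (R : realType) (C : forall n, probability (composition n) R).
Hypotheses (uC : uniform_consistent C) (rC : right_consistent C).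
Local Notation unif := (@unit_uniform R).
Variables (n : nat) (D : seq (nat * nat)).
Hypotheses (n0 : (0 < n)%N) (Dn : places_below n D).
Local Notation q := (pr (C n) (unbroken n D)).
Local Notation place A := (nth 0%N (vals A)).

Section fixed_scale.
Variables (K h : nat).
Hypotheses (K0 : (0 < K)%N) (h0 : (0 < h)%N) (nKh : (n <= K * h)%N).
Local Notation c := (K * h)%N.

Let sampled (B : {set 'I_c}) : R := pr (C c) (unbroken c (map_places (place B) D)).

Let sum_sampled : \sum_(g : {ffun 'I_n -> 'I_c} | injectiveb g) sampled (g @: [set: 'I_n])%SET =
  n`!%:R * 'C(c, n)%:R * q.
Proof.
rewrite sum_injective_image /sampled (consistent_subsample uC _ Dn) ?n0//.
by rewrite -[LHS]mulr_natl mulrA.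
Qed.

Let sampledE (B : {set 'I_c}) : #|B| = n -> sampled B =
  pr unif [set x | forall p, p \in D -> forall l,
    (place B p.1 < l <= place B p.2)%N -> ~~ ball_digit C l x].
Proof.
move=> Bn; rewrite /sampled -(pr_ball_unbroken rC).
  congr pr; apply/seteqP; split=> x H p.
    by move=> pD l pl; apply: (H (place B p.1, place B p.2)) => //; apply/mapP; exists p.
  by move=> /mapP[p' p'D ->] l pl; exact: (H p').
apply/allP => _ /mapP[p pD ->] /=; have /andP[p12 p2n] := allP Dn p pD.
by rewrite nth_vals_mono ?Bn ?p12//= nth_vals_lt ?Bn.
Qed.

Let measurable_sampled (B : {set 'I_c}) :
  measurable [set x : R | forall p, p \in D -> forall l,
    (place B p.1 < l <= place B p.2)%N -> ~~ ball_digit C l x].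
Proof.
rewrite (_ : [set x | _] = [set x | forall pl : seq_sub D * nat,
    (place B (val pl.1).1 < pl.2 <= place B (val pl.1).2)%N -> ~~ ball_digit C pl.2 x]).
  apply: (measurable_forall (A := fun pl : seq_sub D * nat => [set x |
    (place B (val pl.1).1 < pl.2 <= place B (val pl.1).2)%N -> ~~ ball_digit C pl.2 x])) => -[p l].
  have [pl|pl] := boolP (place B (val p).1 < l <= place B (val p).2)%N.
    rewrite (_ : [set x | _] = [set x | ball_digit C l x = false]).
      exact: measurable_ball_digit.
    by apply/seteqP; split=> x /=; [move=> /(_ isT)/negbTE|move=> ->].
  rewrite (_ : [set x | _] = setT)//; by apply/seteqP; split.
apply/seteqP; split=> x H.
  by move=> [p l] /=; exact: (H _ (valP p)).
by move=> p pD l; exact: (H (SeqSub pD, l)).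
Qed.

Let cdiv : c%:R^-1 = K%:R^-1 * h%:R^-1 :> R.
Proof. by rewrite natrM invfM. Qed.

(** Place b lies in the coarse cell b / h. The places strictly after one sampled place and up to
    another, divided by c, therefore lie in the hull of their coarse cells. *)
Let hull_sampled (g : {ffun 'I_n -> 'I_c}) : injective (coarse_fun h0 g) ->
  pr unif (scaled_miss C c (hull K%:R^-1 (place (coarse_fun h0 g @: [set: 'I_n])%SET) D)) <=
  sampled (g @: [set: 'I_n])%SET.
Proof.
move=> finj; have ginj := coarse_injective finj.
rewrite sampledE; last by rewrite card_imset// cardsT card_ord.
apply: pr_mono; [exact: measurable_scaled_miss|exact: measurable_sampled|].
move=> x H p pD l /andP[bl lb]; apply: H; exists p => //.
have /andP[p12 p2n] := allP Dn p pD; have p1n := ltn_trans p12 p2n.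
rewrite !coarse_vals//; move: bl lb; set b1 := place _ p.1; set b2 := place _ p.2 => bl lb.
have K0' : 0 < K%:R^-1 :> R by rewrite invr_gt0 ltr0n.
have h0' : 0 < h%:R :> R by rewrite ltr0n.
rewrite cdiv [K%:R^-1 * _]mulrC mulrA !ler_pM2r// ler_pdivlMr// ler_pdivrMr// -!natrM !ler_nat.
apply/andP; split; first by rewrite (leq_trans (leq_trunc_div _ _))// ltnW.
by rewrite (leq_trans lb)// ltnW// ltn_ceil.
Qed.

Let sampled_inner (g : {ffun 'I_n -> 'I_c}) : injective (coarse_fun h0 g) ->
  sampled (g @: [set: 'I_n])%SET <=
  pr unif (scaled_miss C c (inner K%:R^-1 (place (coarse_fun h0 g @: [set: 'I_n])%SET) D)).
Proof.
move=> finj; have ginj := coarse_injective finj.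
rewrite sampledE; last by rewrite card_imset// cardsT card_ord.
apply: pr_mono; [exact: measurable_sampled|exact: measurable_scaled_miss|].
move=> x H l [p pD]; have /andP[p12 p2n] := allP Dn p pD; have p1n := ltn_trans p12 p2n.
rewrite !coarse_vals//; have := H p pD l.
set b1 := place _ p.1; set b2 := place _ p.2 => Hl.
have K0' : 0 < K%:R^-1 :> R by rewrite invr_gt0 ltr0n.
have h0' : 0 < h%:R :> R by rewrite ltr0n.
rewrite cdiv [K%:R^-1 * _]mulrC mulrA !ltr_pM2r// ltr_pdivlMr// ltr_pdivrMr// -!natrM !ltr_nat.
move=> /andP[h1 h2]; apply: Hl; apply/andP; split.
  by rewrite (leq_trans _ (ltnW h1))// ltn_ceil.
by rewrite (leq_trans (ltnW h2))// leq_trunc_div.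
Qed.

Let cn0 : 0 < c%:R ^+ n :> R.
Proof. by rewrite exprn_gt0// ltr0n muln_gt0 K0. Qed.

Let hn : (h ^ n)%:R = c%:R ^+ n / K%:R ^+ n :> R.
Proof.
rewrite natrM exprMn natrX mulrAC divff ?mul1r//.
by rewrite expf_neq0// pnatr_eq0 -lt0n.
Qed.

Let ffact_le : n`!%:R * 'C(c, n)%:R <= c%:R ^+ n :> R.
Proof.
rewrite -natrM mulnC bin_ffact -natrX ler_nat.
elim: n => [|m IH]; first by rewrite ffactn0.
by rewrite ffactnSr expnSr leq_mul// leq_subr.
Qed.

(** Injections into the c places that put two sampled places in one coarse cell are dropped; their
    contribution is nonnegative. *)
Lemma hull_sum_le :
  n`!%:R * K%:R^-1 ^+ n * \sum_(A : {set 'I_K} | #|A| == n)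
    pr unif (scaled_miss C c (hull K%:R^-1 (place A) D)) <= q.
Proof.
rewrite -(ler_pM2l cn0).
apply: (@le_trans _ _ (n`!%:R * 'C(c, n)%:R * q)); last by rewrite ler_wpM2r// pr_ge0.
rewrite -sum_sampled.
apply: (@le_trans _ _ (\sum_(g : {ffun 'I_n -> 'I_c} | injectiveb (coarse_fun h0 g))
    pr unif (scaled_miss C c (hull K%:R^-1 (place (coarse_fun h0 g @: [set: 'I_n])%SET) D)))).
  rewrite (sum_coarse n h0 (fun A => pr unif (scaled_miss C c (hull K%:R^-1 (place A) D)))).
  by rewrite hn exprVn le_eqVlt; apply/orP; left; apply/eqP; set X := \sum_(A | _) _; ring.
rewrite big_mkcond [leRHS]big_mkcond; apply: ler_sum => g _.
case: ifPn => [/injectiveP finj|_]; last by case: ifP => // _; exact: pr_ge0.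
rewrite (introT (injectiveP _) (coarse_injective finj)); exact: hull_sampled.
Qed.

(** Injections that put two sampled places in one coarse cell are kept with the trivial bound 1.
    Among all maps to the K cells, the fraction n! 'C(K, n) / K^n is injective, which explains the
    error term. *)
Lemma inner_sum_ge :
  q <= n`!%:R * K%:R^-1 ^+ n * \sum_(A : {set 'I_K} | #|A| == n)
    pr unif (scaled_miss C c (inner K%:R^-1 (place A) D)) +
  (1 - n`!%:R * 'C(K, n)%:R / K%:R ^+ n).
Proof.
have q1 : q <= 1 by exact: pr_le1.
set X := \sum_(A | _) _.
have cardK : \sum_(A : {set 'I_K} | #|A| == n) 1 = 'C(K, n)%:R :> R.
  by rewrite sumr_const -cardsE card_draws card_ord.
have cardc : \sum_(g : {ffun 'I_n -> 'I_c} | injectiveb g) 1 = n`!%:R * 'C(c, n)%:R :> R.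
  rewrite (sum_injective_image n (fun _ : {set 'I_c} => 1 : R)) sumr_const.
  by rewrite -cardsE card_draws card_ord -[LHS]mulr_natl.
have main : n`!%:R * 'C(c, n)%:R * q <= (h ^ n)%:R * (n`!%:R * X) +
    (n`!%:R * 'C(c, n)%:R - (h ^ n)%:R * (n`!%:R * 'C(K, n)%:R)).
  rewrite -sum_sampled -cardc -cardK.
  rewrite -(sum_coarse n h0 (fun A => pr unif (scaled_miss C c (inner K%:R^-1 (place A) D)))).
  rewrite -(sum_coarse n h0 (fun A : {set 'I_K} => 1 : R)).
  rewrite big_mkcond [in leRHS]big_mkcond /= [X in _ + (X - _)]big_mkcond /=.
  rewrite [X in _ + (_ - X)]big_mkcond /= -sumrB -big_split; apply: ler_sum => g _ /=.
  case: (injectiveP (coarse_fun h0 g)) => [finj|_].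
    rewrite (introT (injectiveP _) (coarse_injective finj)) subrr addr0.
    exact: sampled_inner.
  case: ifP => _; rewrite ?subr0 ?add0r//; exact: pr_le1.
rewrite -(ler_pM2l cn0); move: main ffact_le q1; rewrite hn exprVn.
have Kn0 : 0 < K%:R ^+ n :> R by rewrite exprn_gt0// ltr0n.
set y := c%:R ^+ n; set z := K%:R ^+ n in Kn0 *.
set a := n`!%:R * _; set b := n`!%:R * 'C(K, n)%:R => main ay q1.
(* As q is at most 1, replacing a = n! 'C(c, n) by y = c^n adds (y - a) q on the left and the larger
   y - a on the right. *)
have : (y - a) * (1 - q) >= 0 by rewrite mulr_ge0 ?subr_ge0.
rewrite (_ : y * (_ / z * X + _) = y / z * (n`!%:R * X) + (y - y / z * b)); last by ring.
lra.
Qed.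

End fixed_scale.
Section limit_bounds.
Variable W : set_system nat.
Hypotheses (ultraW : UltraFilter W) (infW : \oo `<=` W).
Variable K : nat.
Hypothesis K0 : (0 < K)%N.
Variable I : {set 'I_K} -> set R.

Let weight : R := n`!%:R * K%:R^-1 ^+ n.

Let weight0 : 0 <= weight.
Proof. by rewrite mulr_ge0// exprn_ge0// invr_ge0. Qed.

Let weight_sum_le1 (x : {set 'I_K} -> R) : (forall A, x A <= 1) ->
  weight * \sum_(A : {set 'I_K} | #|A| == n) x A <= 1.
Proof.
move=> x1; have Kn : 0 < K%:R ^+ n :> R by rewrite exprn_gt0// ltr0n.
apply: (@le_trans _ _ (weight * 'C(K, n)%:R)).
  rewrite ler_wpM2l// (_ : 'C(K, n)%:R = \sum_(A : {set 'I_K} | #|A| == n) 1).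
    exact: ler_sum.
  by rewrite sumr_const -cardsE card_draws card_ord.
rewrite /weight exprVn mulrAC ler_pdivrMr// mul1r -natrM mulnC bin_ffact -natrX ler_nat.
elim: n => [|m IH]; first by rewrite ffactn0.
by rewrite ffactnSr expnSr leq_mul// leq_subr.
Qed.

Let sum_miss c : R := weight * \sum_(A : {set 'I_K} | #|A| == n) pr unif (scaled_miss C c (I A)).

Let sum_miss_unital : unital sum_miss.
Proof.
move=> c; rewrite mulr_ge0//=; last by apply: sumr_ge0 => A _; exact: pr_ge0.
by apply: weight_sum_le1 => A; apply: pr_le1; exact: measurable_scaled_miss.
Qed.

Let weight_le1 (A : {set 'I_K}) : #|A| == n -> weight <= 1.
Proof.
move=> An; have := weight_sum_le1 (x := fun B => (B == A)%:R).
rewrite (bigD1 A)//= eqxx big1 ?addr0 ?mulr1; first by apply=> B; case: (B == A); rewrite ?ler01.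
by move=> B /andP[_ /negbTE ->].
Qed.

Let limit_sum_miss : weight * \sum_(A : {set 'I_K} | #|A| == n) limit_miss C W (I A) =
  mean_limit W sum_miss.
Proof.
rewrite mulr_sumr.
rewrite (eq_bigr (fun A => mean_limit W (fun c => weight * pr unif (scaled_miss C c (I A))))).
  rewrite -big_filter -(mean_limit_sum ultraW infW).
  - by congr mean_limit; apply/funext => c; rewrite big_filter -mulr_sumr.
  - by move=> A c; rewrite mulr_ge0// pr_ge0.
  - by move=> c; rewrite big_filter -mulr_sumr; have /andP[] := sum_miss_unital c.
move=> A An; rewrite (mean_limitZ ultraW infW)//; first exact: scaled_miss_unital.
move=> c; rewrite mulr_ge0 ?pr_ge0//= -[leRHS]mulr1; apply: ler_pM => //.
- exact: pr_ge0.
- exact: weight_le1 An.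
- by apply: pr_le1; exact: measurable_scaled_miss.
Qed.

Let multiple c : (K %| c)%N -> (n <= c)%N ->
  exists2 h, (0 < h)%N & (K * h = c)%N /\ (n <= K * h)%N.
Proof.
move=> Kc nc; have E : (K * (c %/ K) = c)%N by rewrite mulnC divnK.
exists (c %/ K)%N; last by rewrite E.
by rewrite divn_gt0// dvdn_leq// (leq_trans n0).
Qed.

Let q01 (k : R) : 0 <= k <= 1 -> unital (fun=> k).
Proof. by move=> k01 c. Qed.

Lemma limit_hull_sum_le :
  (forall A, I A = hull K%:R^-1 (place A) D) ->
  weight * \sum_(A : {set 'I_K} | #|A| == n) limit_miss C W (I A) <= q.
Proof.
move=> IE; have q1 : 0 <= q <= 1 by rewrite pr_ge0 pr_le1.
rewrite limit_sum_miss -[leRHS](mean_limit_cst ultraW infW q1).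
apply: (mean_limit_le ultraW infW (N0 := n) K0 sum_miss_unital (q01 q1)) => c Kc nc.
have [h h0 [<- nKh]] := multiple Kc nc.
have := hull_sum_le K0 h0 nKh; rewrite /sum_miss; under eq_bigr do rewrite -IE.
by [].
Qed.

Lemma limit_inner_sum_ge :
  (forall A, I A = inner K%:R^-1 (place A) D) ->
  q <= weight * \sum_(A : {set 'I_K} | #|A| == n) limit_miss C W (I A) +
    (1 - n`!%:R * 'C(K, n)%:R / K%:R ^+ n).
Proof.
move=> IE; rewrite limit_sum_miss -lerBlDr.
set r := 1 - _; have r0 : 0 <= r.
  by rewrite subr_ge0; have := weight_sum_le1 (x := fun=> 1) (fun=> lexx 1);
  rewrite sumr_const -cardsE card_draws card_ord /weight exprVn mulrAC.
have q0 : 0 <= q by exact: pr_ge0.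
have q1 : q <= 1 by exact: pr_le1.
(* Mean limits are handled for functions with values in [0, 1]; the constant q - r is one when it is
   nonnegative, and otherwise the bound is trivial. *)
have [qr|rq] := leP q r.
  apply: (@le_trans _ _ 0); first by rewrite subr_le0.
  rewrite -(mean_limit_cst ultraW infW (k := 0)) ?lexx ?ler01//.
  apply: (mean_limit_le ultraW infW (K := 1) (N0 := 0)) => //.
    by apply: q01; rewrite lexx ler01.
  by move=> c _ _; have /andP[] := sum_miss_unital c.
have qr1 : 0 <= q - r <= 1 by apply/andP; split; lra.
rewrite -[leLHS](mean_limit_cst ultraW infW qr1).
apply: (mean_limit_le ultraW infW (N0 := n) K0 (q01 qr1) sum_miss_unital) => c Kc nc.
have [h h0 [<- nKh]] := multiple Kc nc.
have := inner_sum_ge K0 h0 nKh; rewrite lerBlDr /sum_miss; under eq_bigr do rewrite -IE.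
by [].
Qed.

End limit_bounds.
End subsample_bounds.

(** * Sampling from the limiting set *)

Lemma measurable_misses_Ico (R : realType) (D : set R) (x y : R) :
  measurable (misses `[x, y[ : set (closed_subset D)).
Proof.
rewrite (_ : `[x, y[%classic = \bigcup_j `[x, y - j.+1%:R^-1]%classic).
  rewrite misses_bigcup; apply: bigcapT_measurable => j.
  by apply: measurable_misses_compact; exact: segment_compact.
apply/seteqP; split=> t /=; rewrite in_itv /=.
  move=> /andP[xt ty]; have ty0 : 0 < y - t by rewrite subr_gt0.
  exists (Num.truncn (y - t)^-1) => //=; rewrite in_itv /= xt /= lerBrDr -lerBrDl ltW//.
  by rewrite -[ltRHS]invrK ltf_pV2 ?posrE ?invr_gt0 ?ltr0n// truncnS_gt.
move=> [j _] /=; rewrite in_itv /= => /andP[-> /= ty].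
by rewrite (le_lt_trans ty)// ltrBlDr ltrDl invr_gt0 ltr0n.
Qed.

Lemma nat_ratio_between (R : realType) (x y : R) : 0 <= x -> x < y ->
  exists a b : nat, x < a%:R / b.+1%:R < y.
Proof.
move=> x0 xy; have yx : 0 < y - x by rewrite subr_gt0.
set b := Num.truncn (y - x)^-1; exists (Num.truncn (x * b.+1%:R)).+1, b.
have b0 : 0 < b.+1%:R :> R by rewrite ltr0n.
rewrite ltr_pdivlMr// truncnS_gt/= ltr_pdivrMr// -natr1.
have t1 : (Num.truncn (x * b.+1%:R))%:R <= x * b.+1%:R by rewrite truncn_le// mulr_ge0// ltW.
have : 1 < (y - x) * b.+1%:R.
  by rewrite -ltr_pdivrMl// mulr1 truncnS_gt.
by lra.
Qed.

(** * Sample points isolated on one side *)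

Section isolated_sample_points.
Context d (T : measurableType d) (R : realType) (P : probability T R).
Variables (Z : {RV P >-> closed_subset `[0%R : R, 1%R]}) (U : nat -> {RV P >-> R}).
Hypothesis sampleZU : uniform_sample Z U.

Lemma pr_cell_event i K (k : 'I_K) (H : set (closed_subset `[0%R : R, 1%R])) :
  measurable H ->
  pr P (Z @^-1` H `&` U i @^-1` cell K%:R^-1 k) = K%:R^-1 * pr P (Z @^-1` H).
Proof.
move=> mH; have [Uunif _ ZU] := sampleZU.
have mZ : measurable (Z @^-1` H) by exact: measurable_funPTI.
have mU : measurable (U i @^-1` cell K%:R^-1 k).
  by apply: measurable_funPTI; exact: cell_measurable.
have Uk : P (U i @^-1` cell K%:R^-1 k) = (K%:R^-1)%:E.
  by have := Uunif i _ (cell_measurable K%:R^-1 k); rewrite uniform_prob_cell.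
apply: EFin_inj; rewrite -prE//; last exact: measurableI.
rewrite EFinM -prE// -Uk muleC; apply: ZU; first by exists H => //; rewrite setTI.
apply: sub_sigma_algebra; exists i => //.
by exists (cell K%:R^-1 k); [exact: cell_measurable|rewrite setTI].
Qed.

(** At most one of the events [H k] occurs, so their probabilities sum to at most 1, and by
    independence each is multiplied by the probability 1/K of its cell. *)
Lemma pr_cells_disjoint i K (H : 'I_K -> set (closed_subset `[0%R : R, 1%R])) :
  (forall k, measurable (H k)) -> (forall k l F, H k F -> H l F -> k = l) ->
  pr P [set w | exists2 k, predT k & (Z @^-1` H k `&` U i @^-1` cell K%:R^-1 k) w]
    <= K%:R^-1.
Proof.
move=> mH dH; have mZ k : measurable (Z @^-1` H k) by exact: measurable_funPTI.
rewrite (pr_sum_fin P (Q := predT)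
  (A := fun k => Z @^-1` H k `&` U i @^-1` cell K%:R^-1 k)); last 2 first.
- move=> k _; apply: measurableI => //; apply: measurable_funPTI.
  exact: cell_measurable.
- by move=> k l w _ _ [kw _] [lw _]; exact: dH kw lw.
under eq_bigr do rewrite pr_cell_event//.
rewrite -mulr_sumr ler_piMr ?invr_ge0//.
rewrite -(pr_sum_fin P (Q := predT) (A := fun k => Z @^-1` H k)) => //.
- by apply: pr_le1; apply: (measurable_exists_fin (Q := predT)).
- by move=> k l w _ _; exact: dH.
Qed.

(* [F] hits the cell [k] but misses what separates this cell from the point
   [m] / [K], which lies to its right ([s]) or to its left.  At most one cell is
   lone, and a sample point lies in it with probability at most 1 / [K]: almost
   surely, no sample point is a point of [Z] isolated on one side. *)
Definition lone_cell K (m : nat) (s : bool) (k : 'I_K) :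
    set (closed_subset `[0%R : R, 1%R]) :=
  [set F | [/\ (k < m)%N = s, ~ misses (cell K%:R^-1 k) F &
    misses `[(if s then k.+1 else m)%:R * K%:R^-1, (if s then m else k)%:R * K%:R^-1[ F]].

Lemma measurable_lone_cell K m s (k : 'I_K) : measurable (lone_cell m s k).
Proof.
have [km|km] := eqVneq (k < m)%N s; last first.
  rewrite (_ : lone_cell m s k = set0)//.
  by apply/seteqP; split=> // F [kms _ _]; exfalso; move/eqP: km.
rewrite (_ : lone_cell m s k = ~` misses (cell K%:R^-1 k) `&`
  misses `[(if s then k.+1 else m)%:R * K%:R^-1, (if s then m else k)%:R * K%:R^-1[).
  apply: measurableI; last exact: measurable_misses_Ico.
  by apply: measurableC; exact: measurable_misses_Ico.
by apply/seteqP; split=> F; [case|move=> [? ?]; split].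
Qed.

Lemma lone_cell_inj K m s (k l : 'I_K) F : lone_cell m s k F -> lone_cell m s l F -> k = l.
Proof.
have K0' : 0 <= K%:R^-1 :> R by rewrite invr_ge0.
have le (a b : nat) : (a <= b)%N -> a%:R * K%:R^-1 <= b%:R * K%:R^-1 :> R.
  by move=> ab; rewrite ler_wpM2r// ler_nat.
wlog kl : k l / (k < l)%N.
  move=> H; have [kl|lk|/ord_inj //] := ltngtP k l; first exact: H.
  by move=> Fk Fl; apply/esym; exact: H.
case: s => -[km hk gk] [lm hl gl]; exfalso.
  apply: hl; apply: misses_subset gk => t; rewrite /cell /= !in_itv /= => /andP[t1 t2].
  by rewrite (le_trans (le _ _ kl) t1)/= (lt_le_trans t2)// le.
apply: hk; apply: misses_subset gl => t; rewrite /cell /= !in_itv /= => /andP[t1 t2].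
by rewrite (lt_le_trans t2 (le _ _ kl)) andbT (le_trans _ t1)// le// leqNgt km.
Qed.

(** The number a / (b+1) is a grid point of every grid with (b+1)(h+1) cells, so one rational
    separator is tested at arbitrarily small meshes. *)
Definition lone_point (x : nat * nat * nat * bool) : set T :=
  let: (i, a, b, s) := x in
  [set w | forall h : nat, exists2 k : 'I_(b.+1 * h.+1), predT k &
    (Z @^-1` lone_cell (a * h.+1) s k `&` U i @^-1` cell (b.+1 * h.+1)%:R^-1 k) w].

Lemma measurable_lone_point x : measurable (lone_point x).
Proof.
case: x => -[[i a] b] s; apply: measurable_forall => h.
apply: (measurable_exists_fin (Q := predT)) => k _; apply: measurableI.
  by apply: measurable_funPTI; exact: measurable_lone_cell.
by apply: measurable_funPTI; exact: cell_measurable.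
Qed.

Lemma pr_lone_point x : pr P (lone_point x) = 0.
Proof.
apply/eqP; rewrite eq_le pr_ge0 andbT leNgt; apply/negP => p0.
have mL := measurable_lone_point x.
case: x mL p0 => -[[i a] b] s mL p0; set p := pr P _ in p0.
pose h := Num.truncn p^-1.
have : p <= (b.+1 * h.+1)%:R^-1.
  apply: le_trans (pr_cells_disjoint i (H := lone_cell (K := b.+1 * h.+1) (a * h.+1) s) _ _).
  - apply: pr_mono => //; last by move=> w; exact.
    apply: (measurable_exists_fin (Q := predT)) => k _; apply: measurableI.
      by apply: measurable_funPTI; exact: measurable_lone_cell.
    by apply: measurable_funPTI; exact: cell_measurable.
  - by move=> k; exact: measurable_lone_cell.
  - by move=> k l F; exact: lone_cell_inj.
apply/negP; rewrite -ltNge -[ltRHS]invrK ltf_pV2 ?posrE ?invr_gt0 ?ltr0n//.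
by rewrite (lt_le_trans (truncnS_gt _))// ler_nat leq_pmull.
Qed.

Definition no_lone_point : set T := [set w | forall x, (~` lone_point x) w].

Lemma measurable_no_lone_point : measurable no_lone_point.
Proof.
by apply: measurable_forall => x; apply: measurableC; exact: measurable_lone_point.
Qed.

Lemma pr_no_lone_point : pr P no_lone_point = 1.
Proof.
apply: pr1_forall => x; first by apply: measurableC; exact: measurable_lone_point.
by rewrite pr_setC ?pr_lone_point ?subr0//; exact: measurable_lone_point.
Qed.

(** If Z had no point between the sample point and the rational, then in each of these grids the
    cell of the sample point would be lone. *)
Lemma no_lone_point_side w i (a b : nat) s : no_lone_point w -> 0 <= U i w < 1 ->
  cset (Z w) (U i w) -> (U i w < a%:R / b.+1%:R) = s -> a%:R / b.+1%:R != U i w ->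
  ~ (forall t, cset (Z w) t ->
      if s then ~ (U i w < t < a%:R / b.+1%:R) else ~ (a%:R / b.+1%:R <= t < U i w)).
Proof.
move=> nw /andP[u0 u1] Zu us qu H; apply: (nw (i, a, b, s)) => h.
set K := (b.+1 * h.+1)%N; have K0 : (0 < K)%N by rewrite muln_gt0.
have K0' : 0 < K%:R^-1 :> R by rewrite invr_gt0 ltr0n.
have kK : (Num.truncn (U i w / K%:R^-1) < K)%N.
  rewrite -(ltr_nat R) (@le_lt_trans _ _ (U i w / K%:R^-1))//.
    by rewrite truncn_le divr_ge0// ltW.
  by rewrite invrK -[ltRHS]mul1r ltr_pM2r ?ltr0n.
have := cell_truncn K0' u0; set k := Num.truncn _ => uk.
have qE : a%:R / b.+1%:R = (a * h.+1)%:R * K%:R^-1 :> R.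
  by rewrite /K !natrM invfM mulrACA divff ?pnatr_eq0// mulr1.
exists (Ordinal kK) => //; split=> //; split=> /=.
- rewrite -us qE; move: uk; rewrite /cell /= in_itv /= => /andP[k1 k2].
  apply/idP/idP => [km|uq].
    rewrite lt_neqAle; rewrite qE eq_sym in qu; rewrite qu /= (le_trans (ltW k2))//.
    by rewrite ler_pM2r// ler_nat.
  by have := le_lt_trans k1 uq; rewrite ltr_pM2r// ltr_nat.
- move=> Zk; suff : (cset (Z w) `&` cell K%:R^-1 k) (U i w) by rewrite Zk.
  by split.
apply/seteqP; split=> // t [Zt]; move: (H t Zt) uk; rewrite /cell /= !in_itv /= qE.
case: s {us H} => nt /andP[k1 k2] /andP[t1 t2]; apply: nt.
  by rewrite (lt_le_trans k2 t1).
by rewrite t1 (lt_le_trans t2 k1).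
Qed.

(** A point of Z in a closed gap but not in its interior is an endpoint, thus a sample point. With a
    rational placed inside the gap, Z would have no point between them, against
    [no_lone_point_side]. *)
Lemma sample_hits_open n D w : places_below n D -> good_points U n w ->
  no_lone_point w -> cset (Z w) `&` open_bands (ranked U n w) (ranked U n w) D = set0 ->
  cset (Z w) `&` gaps (ranked U n w) D = set0.
Proof.
move=> Dn gw nw ZD; apply/seteqP; split=> // t [Zt [p pD /andP[t1 t2]]].
have point l : (l < n)%N -> exists2 i, (i < n)%N & ranked U n w l = U i w.
  move=> ln; have : ranked U n w l \in sort <=%R [seq U i w | i <- iota 0 n].
    by rewrite mem_nth// size_sort size_map size_iota.
  by rewrite mem_sort => /mapP[i]; rewrite mem_iota => /andP[_ ni] ->; exists i.
have /andP[p12 p2] := allP Dn p pD.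
have [i ni iE] := point _ (ltn_trans p12 p2); have [j nj jE] := point _ p2.
have := ranked_lt Dn gw pD; rewrite iE jE => ij.
have miss s : cset (Z w) s -> ~ (U i w < s < U j w).
  move=> Zs h; have : (cset (Z w) `&` open_bands (ranked U n w) (ranked U n w) D) s.
    by split=> //; exists p => //; rewrite iE jE.
  by rewrite ZD.
rewrite iE in t1; rewrite jE in t2.
have [ui01 _] := gw i i ni ni; have [uj01 _] := gw j j nj nj.
have [a [b /andP[q1 q2]]] := nat_ratio_between (proj1 (andP ui01)) ij.
have [ti|ti] := eqVneq t (U i w).
  rewrite ti in Zt; apply: (no_lone_point_side nw ui01 Zt q1); first by rewrite gt_eqF.
  by move=> s Zs /andP[s1 s2]; apply: (miss s Zs); rewrite s1 (lt_trans s2 q2).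
have [tj|tj] := eqVneq t (U j w).
  rewrite tj in Zt; apply: (@no_lone_point_side w j a b false nw uj01 Zt).
  - by apply/negbTE; rewrite -leNgt ltW.
  - by rewrite lt_eqF.
  by move=> s Zs /andP[s1 s2]; apply: (miss s Zs); rewrite s2 (lt_le_trans q1 s1).
by apply: (miss t Zt); rewrite !lt_neqAle t1 t2 eq_sym ti tj.
Qed.

Lemma sample_inner_cvg n D : places_below n D ->
  (n`!%:R * K%:R^-1 ^+ n * \sum_(A : {set 'I_K} | #|A| == n)
    pr P (Z @^-1` misses (inner K%:R^-1 (nth 0%N (vals A)) D))) @[K --> \oo] -->
  pr P (sampled_unbroken Z U n D).
Proof.
move=> Dn; have [Uunif Uindep _] := sampleZU.
have mh e a : measurable (misses (D := `[0%R : R, 1%R]) (inner e a D)).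
  by apply: measurable_misses_open; exact: open_open_bands.
apply: (cells_cvg Uunif Uindep (V := fun K a => Z @^-1` misses (inner K%:R^-1 a D))
  (B := sampled_unbroken Z U n D)
  (v := fun K a => pr P (Z @^-1` misses (inner K%:R^-1 a D))) (G := no_lone_point)) => //.
- by move=> K a; exact: measurable_funPTI.
- exact: measurable_sampled_unbroken.
- exact: measurable_no_lone_point.
- exact: pr_no_lone_point.
- by move=> K f _ _; exact: pr_cells_misses.
move=> w gw nw; have su := sampled_unbrokenE Z Dn gw.
have [Bw|nBw] := pselect (sampled_unbroken Z U n D w).
  exists 1 => // K a K0 Ke ax; split=> // _.
  apply: subsetI_eq0 (su.1 Bw) => // t /(inner_sub_gaps Dn ax) [p pD /andP[t1 t2]].
  by exists p => //; rewrite !ltW.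
have /set0P[t [Zt tD]] : cset (Z w) `&` open_bands (ranked U n w) (ranked U n w) D != set0.
  by apply/eqP => /(sample_hits_open Dn gw nw) /su.2.
have [e e0 He] := hit_gaps_inner Dn Zt tD.
exists e => // K a K0 Ke ax; split=> // Vw; exfalso.
suff : (cset (Z w) `&` inner K%:R^-1 a D) t by rewrite Vw.
by split=> //; apply: He => //; rewrite invr_gt0 ltr0n.
Qed.

End isolated_sample_points.

Lemma uniform_sample_exists (R : realType) d0 (T0 : measurableType d0)
    (P0 : probability T0 R) (Z0 : {RV P0 >-> closed_subset `[0%R : R, 1%R]}) :
  exists (d : measure_display) (T : measurableType d) (P : probability T R)
    (Z : {RV P >-> closed_subset `[0%R : R, 1%R]}) (U : nat -> {RV P >-> R}),
    same_law Z Z0 /\ uniform_sample Z U.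
Proof.
have [U0 [Uunif Uindep]] := iid_uniforms R.
have [Z [U [ZE UE indep]]] := independent_copies Z0 U0.
exists _, _, _, Z, U; split.
  move=> A mA; rewrite /distribution /pushforward.
  rewrite (_ : Z @^-1` A = fst @^-1` (Z0 @^-1` A)); last first.
    by apply/seteqP; split=> w; rewrite /= ZE.
  by apply: product_fst; exact: measurable_funPTI.
have UpreE i A : U i @^-1` A = snd @^-1` (U0 i @^-1` A).
  by apply/seteqP; split=> w; rewrite /= UE.
split=> // [i A mA|J A mA].
  rewrite -(Uunif i A mA) /distribution /pushforward UpreE.
  by apply: product_snd; exact: measurable_funPTI.
have mU i : measurable (U0 i @^-1` A i) by exact: measurable_funPTI.
rewrite (_ : \bigcap_(i in _) _ = snd @^-1` (\bigcap_(i in [set` J]) (U0 i @^-1` A i))).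
  have mB : measurable (\bigcap_(i in [set` J]) (U0 i @^-1` A i)).
    by apply: fin_bigcap_measurable => //; exact: finite_fset.
  apply: (eq_trans (product_snd P0 (@unit_uniform R) mB)); rewrite Uindep//; apply: eq_bigr => i _; rewrite UpreE.
  by apply/esym/product_snd.
by apply/seteqP; split=> w /= H i Ji; have := H i Ji; rewrite /= UE.
Qed.

Section sample_limit_set.
Context (R : realType) (C : forall n, probability (composition n) R).
Hypotheses (uC : uniform_consistent C) (rC : right_consistent C).
Variable W : set_system nat.
Hypotheses (ultraW : UltraFilter W) (infW : \oo `<=` W).
Local Notation unif := (@unit_uniform R).
Let S : {RV unif >-> closed_subset `[0%R : R, +oo[} := limit_set C W.

Context d (T : measurableType d) (P : probability T R).
Variables (Z : {RV P >-> closed_subset `[0%R : R, 1%R]}) (U : nat -> {RV P >-> R}).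
Hypothesis ZS : same_law Z (@restrict01 R _ \o S : {RV unif >-> _}).
Hypothesis sampleZU : uniform_sample Z U.

Let pr_misses (I : set R) :
  measurable (misses I : set (closed_subset `[0%R : R, 1%R])) ->
  pr P (Z @^-1` misses I) = pr unif [set x | misses I (restrict01 (limit_set C W x))].
Proof. by move=> mI; rewrite /pr; congr fine; exact: (ZS mI). Qed.

(** At fixed K the inequality for compact sets passes from the hull average of [Z] to [limit_miss],
    then to q from below; the inequality for open sets bounds q by the inner average of [Z] up to an
    error that vanishes with K. Both averages tend to the sampled probability. *)
Lemma sample_limit_unbroken n D : (0 < n)%N -> places_below n D ->
  pr P (sampled_unbroken Z U n D) = pr (C n) (unbroken n D).
Proof.
move=> n0 Dn; apply/eqP; rewrite eq_le; apply/andP; split.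
  apply: (cvgr_to_le (sample_hull_cvg sampleZU Dn)); near=> K.
  have K0 : (0 < K)%N by near: K; exact: nbhs_infty_gt.
  apply: le_trans (limit_hull_sum_le uC rC n0 Dn ultraW infW K0 (fun=> erefl)).
  rewrite ler_wpM2l ?mulr_ge0 ?exprn_ge0 ?invr_ge0//; apply: ler_sum => A /eqP An.
  have cA := @compact_bands R (fun i => (nth 0%N (vals A) i)%:R * K%:R^-1)
    (fun i => (nth 0%N (vals A) i).+1%:R * K%:R^-1) D.
  apply: le_trans (limit_set_misses_le C ultraW infW cA).
  rewrite pr_misses; last exact: measurable_misses_compact.
  rewrite le_eqVlt; apply/orP; left; apply/eqP; congr (pr unif _).
  apply/seteqP; split=> x /= Hx; last by rewrite /misses /= -setIA; apply: subsetI_eq0 Hx => // t [].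
  apply/seteqP; split=> // t [St It].
  suff : (cset (restrict01 (limit_set C W x)) `&` hull K%:R^-1 (nth 0%N (vals A)) D) t by rewrite Hx.
  by do 2 split=> //; exact: hull_unit An Dn _ It.
have err0 : (1 - n`!%:R * 'C(K, n)%:R / K%:R ^+ n) @[K --> \oo] --> (0 : R).
  rewrite -[X in _ --> X](subrr 1); apply: cvgB; first exact: cvg_cst.
  by under eq_fun do rewrite -natrM mulnC bin_ffact; exact: ffact_ratio_cvg1.
have := cvgD (sample_inner_cvg sampleZU Dn) err0; rewrite addr0 => cv.
apply: (cvgr_to_ge (cv _)); near=> K.
have K0 : (0 < K)%N by near: K; exact: nbhs_infty_gt.
apply: le_trans (limit_inner_sum_ge uC rC n0 Dn ultraW infW K0 (fun=> erefl)) _.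
rewrite /= lerD2r ler_wpM2l ?mulr_ge0 ?exprn_ge0 ?invr_ge0//; apply: ler_sum => A _.
have oA := @open_open_bands R (fun i => (nth 0%N (vals A) i).+1%:R * K%:R^-1)
  (fun i => (nth 0%N (vals A) i)%:R * K%:R^-1) D.
apply: le_trans (limit_miss_le_open C ultraW infW oA) _.
rewrite pr_misses; last exact: measurable_misses_open.
apply: pr_mono.
- have mS := measurable_funPTI S (measurable_misses_open (D := `[0, +oo[) oA); exact: mS.
- have mS := measurable_funPTI (@restrict01 R _ \o S : {RV unif >-> _})
    (measurable_misses_open (D := `[0, 1]) oA); exact: mS.
by move=> x /=; rewrite /misses /= -setIA; apply: subsetI_eq0 => // t [].
Unshelve. all: by end_near. Qed.

Lemma sample_limit_law n : (0 < n)%N -> forall A,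
  pushforward P (fun w => sample_composition (cset (Z w)) n (fun i => U i w)) A = C n A.
Proof.
move=> n0; apply: composition_rv_law => [A|D Dn].
  by apply: measurable_sample => [|i]; exact: measurable_funP.
rewrite [LHS]prE; last exact: measurable_sampled_unbroken.
by rewrite [RHS]prE// sample_limit_unbroken.
Qed.

End sample_limit_set.

Lemma consistent_derived (R : realType) (C : forall n, probability (composition n) R) :
  uniform_consistent C -> right_consistent C ->
  exists (d : measure_display) (Omega : measurableType d)
    (P : probability Omega R) (S : {RV P >-> closed_subset `[0%R : R, +oo[}),
    self_similar S /\ derived_from C (@restrict01 R _ \o S : {RV P >-> _}).
Proof.
move=> uC rC; have [W [ultraW infW]] := ultraFilterLemma (@eventually_filter).
pose S : {RV @unit_uniform R >-> closed_subset `[0%R : R, +oo[} := limit_set C W.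
exists _, _, (@unit_uniform R), S; split; first exact: limit_set_self_similar.
have [d [T [P [Z [U [ZS sampleZU]]]]]] :=
  uniform_sample_exists (@restrict01 R _ \o S : {RV @unit_uniform R >-> _}).
exists d, T, P, Z, U; split=> // n n0.
exact: (sample_limit_law uC rC ultraW infW ZS sampleZU n0).
Qed.

Theorem theorem2 (R : realType) (C : forall n : nat, probability (composition n) R) :
  ((uniform_consistent C /\ right_consistent C) <->
   (exists (d : measure_display) (Omega : measurableType d)
      (P : probability Omega R) (S : {RV P >-> closed_subset `[0%R : R, +oo[}),
      self_similar S /\
      derived_from C (@restrict01 R _ \o S : {RV P >-> _})))
  /\
  (forall (d : measure_display) (Omega : measurableType d)
     (P : probability Omega R) (S : {RV P >-> closed_subset `[0%R : R, +oo[}),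
     self_similar S ->
     derived_from C (@restrict01 R _ \o S : {RV P >-> _}) ->
     forall rate : R, 0 < rate ->
     (exists (d' : measure_display) (Omega' : measurableType d')
        (P' : probability Omega' R)
        (S' : {RV P' >-> closed_subset `[0%R : R, +oo[})
        (eps : nat -> {RV P' >-> R}) (X : forall n : nat, Omega' -> composition n),
        same_law S' S /\ poisson_construction rate S' eps X)
     /\
     (forall (d' : measure_display) (Omega' : measurableType d')
        (P' : probability Omega' R)
        (S' : {RV P' >-> closed_subset `[0%R : R, +oo[})
        (eps : nat -> {RV P' >-> R}) (X : forall n : nat, Omega' -> composition n),
        same_law S' S -> poisson_construction rate S' eps X ->
        strong_right_version C P' X)).
Proof.
split.
  split=> [[uC rC]|[d [T [P [S [ssS CS]]]]]]; first exact: consistent_derived.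
  split.
    by apply: unbroken_uniform_consistent => n D; exact: (derived_unbroken_remove ssS CS).
  by apply: unbroken_right_consistent => n D; exact: (derived_unbroken_last ssS CS).
move=> d T P S ssS CS rate rate0; split; first exact: poisson_construction_exists.
move=> d' T' P' S' eps X; exact: poisson_construction_version.
Qed.
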